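(* For any positive integer $k$, there exist compactly supported stationary Euler flows on $\mathbb{R}^2$ of class $C^k(\mathbb{R}^2)$ that are not locally radial.
   Context: A stationary Euler flow on $\mathbb{R}^2$ is a vector field $v:\mathbb{R}^2\to\mathbb{R}^2$ such that, for some pressure function $p$, one has $v\cdot\nabla v+\nabla p=0$ and $\operatorname{div} v=0$ in $\mathbb{R}^2$. Writing $v=\nabla^\perp\psi:=(\partial_{x_2}\psi,-\partial_{x_1}\psi)$ in terms of a stream function $\psi$, the flow is called locally radial if the stream function is a linear combination of radially symmetric functions (each radial about its own center, possibly at distinct points) with pairwise disjoint compact supports; equivalently, the set where $v\neq 0$ is a countable union of pairwise disjoint disks and annuli, and on each of them $\psi$ is radially symmetric with respect to its center. *)

(* Defs.v *)
From Stdlib Require Import Reals.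
From Coquelicot Require Import Coquelicot.
Open Scope R_scope.

Definition d1 (f : R -> R -> R) : R -> R -> R :=
  fun x y => Derive (fun t => f t y) x.
Definition d2 (f : R -> R -> R) : R -> R -> R :=
  fun x y => Derive (fun t => f x t) y.

Definition cont2 (f : R -> R -> R) : Prop :=
  forall x y : R, continuous (fun p : R * R => f (fst p) (snd p)) (x, y).

Fixpoint Ck (k : nat) (f : R -> R -> R) : Prop :=
  match k with
  | O => cont2 f
  | S n => cont2 f /\
           (forall x y, ex_derive (fun t => f t y) x /\ ex_derive (fun t => f x t) y) /\
           Ck n (d1 f) /\ Ck n (d2 f)
  end.

Definition vCk (k : nat) (v1 v2 : R -> R -> R) : Prop := Ck k v1 /\ Ck k v2.

Definition compactly_supported (v1 v2 : R -> R -> R) : Prop :=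
  exists M : R, forall x y, x ^ 2 + y ^ 2 > M ^ 2 -> v1 x y = 0 /\ v2 x y = 0.

Definition stationary_euler (v1 v2 : R -> R -> R) : Prop :=
  (forall x y, d1 v1 x y + d2 v2 x y = 0) /\
  exists p : R -> R -> R, Ck 1 p /\
    forall x y,
      v1 x y * d1 v1 x y + v2 x y * d2 v1 x y + d1 p x y = 0 /\
      v1 x y * d1 v2 x y + v2 x y * d2 v2 x y + d2 p x y = 0.

Definition dist2 (a b x y : R) : R := sqrt ((x - a) ^ 2 + (y - b) ^ 2).

Definition region (isdisk : bool) (a b r Rad x y : R) : Prop :=
  if isdisk then dist2 a b x y < Rad else r < dist2 a b x y < Rad.

(* Locally radial flow: v = grad^perp psi = (d2 psi, - d1 psi) for a stream
   function psi, and the set {v <> 0} is a countable (possibly finite or empty,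
   selected by [used]) union of pairwise disjoint open disks / annuli, on each
   of which psi is radially symmetric w.r.t. the centre of that disk/annulus. *)
Definition locally_radial (v1 v2 : R -> R -> R) : Prop :=
  exists psi : R -> R -> R,
    (forall x y, ex_derive (fun t => psi t y) x /\ ex_derive (fun t => psi x t) y /\
                 v1 x y = d2 psi x y /\ v2 x y = - d1 psi x y) /\
    exists (used : nat -> Prop) (isdisk : nat -> bool) (a b r Rad : nat -> R),
      (forall n, used n -> 0 <= r n < Rad n) /\
      (forall n m x y, used n -> used m -> n <> m ->
         region (isdisk n) (a n) (b n) (r n) (Rad n) x y ->
         region (isdisk m) (a m) (b m) (r m) (Rad m) x y -> False) /\
      (forall x y, (v1 x y <> 0 \/ v2 x y <> 0) <->
         exists n, used n /\ region (isdisk n) (a n) (b n) (r n) (Rad n) x y) /\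
      (forall n x y x' y', used n ->
         region (isdisk n) (a n) (b n) (r n) (Rad n) x y ->
         region (isdisk n) (a n) (b n) (r n) (Rad n) x' y' ->
         dist2 (a n) (b n) x y = dist2 (a n) (b n) x' y' ->
         psi x y = psi x' y').

(* Main.v *)
(* The flow is an annular vortex with 2-fold symmetry, described in log-polar coordinates (t, th). Its
   streamlines are the curves t = T(s, th), s in (-1/2, 1/2), exp(2 T) = exp(-2 s) (1 + 2 al(s) psi(s, th)),
   and its stream function is u = v0(s) + be(s) psi(s, th) with be vanishing near both ends of the
   interval. The Laplacian of u is -1 where be <> 0 and depends on the label s alone elsewhere, so it
   always has the form F0(s) with F0 grad(u) = grad(H); Euler's equation then holds with the pressure
   H - |v|^2/2.
   The unknowns psi, Y (with psi_s = -Y + N) and the nonlinear terms N, M are double power series in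
   eps exp(2 i th) and eps exp(-2 i th), starting with psi = 2 eps cos(2 th) + O(eps^2). Each coefficient
   solves a linear problem on (-1/2, 1/2) whose weight degenerates at both ends: a Volterra iteration
   at one end, Sturm comparison to be uniform in the frequency, and gluing at s = 0. This problem is
   resonant for the frequency 2 only, and a parameter lam of the profile, itself a power series,
   absorbs the solvability condition. A majorant argument gives convergence for small eps.
   Each derivative costs a factor 1/D, D = 1/4 - s^2, while the velocity carries a factor D^N, so the
   extension by zero is C^k for large N.
   Were the flow locally radial, the streamline s = -9/20 would lie in a single disk or annulus; both
   axes being axes of symmetry, its centre would be the origin, and psi would not depend on th there. *)
Require Import Defs.
From Stdlib Require Import Reals Lra Lia Psatz ClassicalEpsilon FunctionalExtensionality.
From Coquelicot Require Import Coquelicot.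
(* Coquelicot has its own [d1] and [d2]. *)
Import Defs.
Open Scope R_scope.

(** Near the circle [s = 0] the radial base flow has stream function [ln r / 2 - r^2 / 4], up to a
    constant: its Laplacian is -1, and its speed vanishes at [r = 1]. The stream function cannot
    label streamlines there, but a constant vorticity puts no condition on the level sets. Elsewhere
    in the annulus the speed has no zero, and a vorticity depending on the label alone is
    admissible. The coefficient [al] interpolates between the two descriptions, and [be] measures
    what the displacement of the label does not carry. To first order [p psi] is the perturbation of
    the stream function at a fixed point of the plane. In the middle [p = cosh (2 s)], and
    [cosh (2 s) cos (2 th)] is harmonic; the profile is built so that a constant [psi] solves the
    linear problem of frequency 2 on the whole interval, and this is the direction of bifurcation.
    Labels turn the free boundary of the support into a fixed interval. The linear problem recovers
    the one angular derivative that the nonlinear terms contain, so the recursion on coefficients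
    closes without loss. Frequency 0 alone has a negative zero-order coefficient; its solvability is
    a property of the profile, proved by explicit bounds. *)

Ltac triang := eapply Rle_trans; [apply Rabs_triang|].

(** * Calculus on an open interval: comparison, antiderivatives based at an end, series *)

Lemma cont_of_derive (f : R -> R) (x l : R) : is_derive f x l -> continuous f x.
Proof. intros H. apply (ex_derive_continuous (V:=R_NormedModule)). now exists l. Qed.

Lemma continuous_Rplus (f g : R -> R) x :
  continuous f x -> continuous g x -> continuous (fun t => f t + g t) x.
Proof. intros. now apply (continuous_plus (V:=R_NormedModule) f g). Qed.
Lemma continuous_Rminus (f g : R -> R) x :
  continuous f x -> continuous g x -> continuous (fun t => f t - g t) x.
Proof. intros. now apply (continuous_minus (V:=R_NormedModule) f g). Qed.
Lemma continuous_Ropp (f : R -> R) x : continuous f x -> continuous (fun t => - f t) x.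
Proof. intros. now apply (continuous_opp (V:=R_NormedModule) f). Qed.
Lemma continuous_Rmult (f g : R -> R) x :
  continuous f x -> continuous g x -> continuous (fun t => f t * g t) x.
Proof. intros. now apply (continuous_mult (K:=R_AbsRing) f g). Qed.

Lemma derive_eq (f : R -> R) (x l l' : R) : is_derive f x l -> l = l' -> is_derive f x l'.
Proof. now intros H <-. Qed.
Lemma derive_plus (f g : R -> R) (x a b : R) :
  is_derive f x a -> is_derive g x b -> is_derive (fun t => f t + g t) x (a + b).
Proof. intros. now apply (is_derive_plus (K:=R_AbsRing) f g). Qed.
Lemma derive_minus (f g : R -> R) (x a b : R) :
  is_derive f x a -> is_derive g x b -> is_derive (fun t => f t - g t) x (a - b).
Proof. intros. now apply (is_derive_minus (K:=R_AbsRing) f g). Qed.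
Lemma derive_opp (f : R -> R) (x a : R) : is_derive f x a -> is_derive (fun t => - f t) x (- a).
Proof. intros. now apply (is_derive_opp (K:=R_AbsRing) f). Qed.
Lemma derive_mult (f g : R -> R) (x a b : R) :
  is_derive f x a -> is_derive g x b -> is_derive (fun t => f t * g t) x (a * g x + f x * b).
Proof. intros. apply (is_derive_mult (K:=R_AbsRing) f g); auto. intros; apply Rmult_comm. Qed.
Lemma derive_scal (f : R -> R) (x a k : R) :
  is_derive f x a -> is_derive (fun t => k * f t) x (k * a).
Proof. intros. now apply is_derive_scal. Qed.
Lemma derive_inv (f : R -> R) (x a : R) :
  is_derive f x a -> f x <> 0 -> is_derive (fun t => / f t) x (- a / f x ^ 2).
Proof. intros. now apply is_derive_inv. Qed.
Lemma derive_comp (f g : R -> R) (x a b : R) :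
  is_derive f (g x) a -> is_derive g x b -> is_derive (fun t => f (g t)) x (a * b).
Proof. intros. rewrite Rmult_comm. now apply (is_derive_comp f g). Qed.
Lemma derive_pow (f : R -> R) (x a : R) n :
  is_derive f x a -> is_derive (fun t => f t ^ n) x (INR n * a * f x ^ pred n).
Proof. intros. now apply is_derive_pow. Qed.
Lemma derive_cst (c x : R) : is_derive (fun _ : R => c) x 0.
Proof. exact (is_derive_const c x). Qed.
Lemma derive_id (x : R) : is_derive (fun t : R => t) x 1.
Proof. exact (is_derive_id x). Qed.
Lemma derive_exp x : is_derive exp x (exp x).
Proof. apply is_derive_Reals, derivable_pt_lim_exp. Qed.
Lemma derive_cosh x : is_derive cosh x (sinh x).
Proof. apply is_derive_Reals, derivable_pt_lim_cosh. Qed.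
Lemma derive_sinh x : is_derive sinh x (cosh x).
Proof. apply is_derive_Reals, derivable_pt_lim_sinh. Qed.
Lemma derive_exp_comp (f : R -> R) x a : is_derive f x a -> is_derive (fun t => exp (f t)) x (exp (f x) * a).
Proof. apply (derive_comp exp f), derive_exp. Qed.

Create HintDb deriv.
#[export] Hint Extern 2 (_ < _) => lra : deriv.
#[export] Hint Extern 2 (_ <= _) => lra : deriv.
#[export] Hint Resolve derive_exp derive_cosh derive_sinh is_derive_cos is_derive_sin : deriv.
Ltac derive_rec := first [ lazymatch goal with
  | |- is_derive (fun _ => ?c) _ _ => apply derive_cst
  | |- is_derive (fun t => t) _ _ => apply derive_id
  | |- is_derive (fun t => @?f t + @?g t) _ _ => apply (derive_plus f g); derive_rec
  | |- is_derive (fun t => @?f t - @?g t) _ _ => apply (derive_minus f g); derive_rec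
  | |- is_derive (fun t => - @?f t) _ _ => apply (derive_opp f); derive_rec
  | |- is_derive (fun t => @?f t * @?g t) _ _ =>
    lazymatch f with fun _ => ?k => apply (derive_scal g) | _ => apply (derive_mult f g) end; derive_rec
  | |- is_derive (fun t => @?f t ^ _) _ _ => apply (derive_pow f); derive_rec
  | |- is_derive (fun t => exp (@?f t)) _ _ => apply (derive_exp_comp f); derive_rec
  | |- is_derive (fun t => / @?f t) _ _ => apply (derive_inv f); [derive_rec|cbv beta; lra]
  end
  | match goal with |- is_derive (fun t => ?f t) ?x ?l => change (is_derive f x l); solve [eauto 4 with deriv] end
  | solve [eauto 4 with deriv] ].
Ltac derive := eapply derive_eq; [derive_rec|cbv beta].

Lemma continuous_Rinv (f : R -> R) x :
  continuous f x -> f x <> 0 -> continuous (fun t => / f t) x.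
Proof.
  intros H H0. apply continuity_pt_filterlim. apply continuity_pt_inv; auto. now apply continuity_pt_filterlim.
Qed.

Lemma locally_itv (a b x : R) : a < x < b -> locally x (fun y => a < y < b).
Proof.
  intros H. assert (Hd : 0 < Rmin (x - a) (b - x)) by (apply Rmin_glb_lt; lra).
  exists (mkposreal _ Hd). intros y Hy.
  unfold ball in Hy; simpl in Hy; unfold AbsRing_ball, abs, minus, plus, opp in Hy; simpl in Hy.
  apply Rabs_def2 in Hy. pose proof (Rmin_l (x-a) (b-x)). pose proof (Rmin_r (x-a) (b-x)). lra.
Qed.

Lemma mvt (f f' : R -> R) (a b : R) :
  a < b -> (forall x, a <= x <= b -> is_derive f x (f' x)) ->
  exists c, a < c < b /\ f b - f a = f' c * (b - a).
Proof.
  intros Hab H. destruct (MVT_cor2 f f' a b Hab) as [c [Hc1 Hc2]].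
  - intros c Hc. apply is_derive_Reals. now apply H.
  - exists c. split; auto.
Qed.

Lemma eq_of_derive_zero (f : R -> R) x y : (forall z, Rmin x y <= z <= Rmax x y -> is_derive f z 0) -> f x = f y.
Proof.
  assert (A : forall u v, u < v -> (forall z, u <= z <= v -> is_derive f z 0) -> f u = f v).
  { intros u v Huv H. destruct (mvt f (fun _ => 0) u v Huv H) as [c [_ E]]. lra. }
  intros H. destruct (Rtotal_order x y) as [h|[->|h]]; auto.
  - apply A; auto. intros z Hz. apply H. rewrite Rmin_left, Rmax_right; lra.
  - symmetry. apply A; auto. intros z Hz. apply H. rewrite Rmin_right, Rmax_left; lra.
Qed.

Lemma mono_of_derive (f f' : R -> R) (a b : R) :
  (forall x, a < x < b -> is_derive f x (f' x)) ->
  (forall x, a < x < b -> 0 <= f' x) ->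
  forall x y, a < x -> x <= y -> y < b -> f x <= f y.
Proof.
  intros H Hp x y Hx Hxy Hy. destruct (Req_dec x y) as [->|Hne]; [lra|].
  destruct (mvt f f' x y) as [c [Hc1 Hc2]]; [lra| |].
  - intros z Hz. apply H; lra.
  - assert (0 <= f' c) by (apply Hp; lra). assert (0 <= f' c * (y - x)) by (apply Rmult_le_pos; lra). lra.
Qed.

Lemma lip_of_derive (f f' : R -> R) (a b B : R) :
  (forall x, a < x < b -> is_derive f x (f' x)) ->
  (forall x, a < x < b -> Rabs (f' x) <= B) ->
  forall x y, a < x < b -> a < y < b -> Rabs (f y - f x) <= B * Rabs (y - x).
Proof.
  intros H Hp. assert (G : forall x y, a < x < b -> a < y < b -> x < y -> Rabs (f y - f x) <= B * Rabs (y - x)).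
  { intros x y Hx Hy Hxy. destruct (mvt f f' x y) as [c [Hc1 Hc2]]; [lra| |].
    - intros z Hz. apply H; lra.
    - rewrite Hc2, Rabs_mult. apply Rmult_le_compat_r; [apply Rabs_pos|]. apply Hp; lra. }
  intros x y Hx Hy. destruct (Rtotal_order x y) as [h|[h|h]].
  - now apply G.
  - subst. unfold Rminus. rewrite !Rplus_opp_r, Rabs_R0. lra.
  - rewrite Rabs_minus_sym, (Rabs_minus_sym y x). now apply G.
Qed.

Lemma cmp_of_derive (f f' g g' : R -> R) (a b : R) :
  (forall x, a < x < b -> is_derive f x (f' x)) ->
  (forall x, a < x < b -> is_derive g x (g' x)) ->
  (forall x, a < x < b -> Rabs (f' x) <= g' x) ->
  forall x y, a < x -> x <= y -> y < b -> Rabs (f y - f x) <= g y - g x.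
Proof.
  intros Hf Hg H x y Hx Hxy Hy. assert (H1 : (fun t => g t - f t) x <= (fun t => g t - f t) y).
  { apply (mono_of_derive (fun t => g t - f t) (fun t => g' t - f' t) a b); auto.
    - intros z Hz. apply derive_minus; auto.
    - intros z Hz. specialize (H z Hz). apply Rabs_le_between in H. lra. }
  assert (H2 : (fun t => g t + f t) x <= (fun t => g t + f t) y).
  { apply (mono_of_derive (fun t => g t + f t) (fun t => g' t + f' t) a b); auto.
    - intros z Hz. apply derive_plus; auto.
    - intros z Hz. specialize (H z Hz). apply Rabs_le_between in H. lra. }
  simpl in *. apply Rabs_le. lra.
Qed.

(* The antiderivative vanishing at an endpoint at which the integrand need not have a limit. *)
Lemma antiderivative_left (f : R -> R) (a b B : R) :
  a < b -> (forall x, a < x < b -> continuous f x) ->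
  (forall x, a < x < b -> Rabs (f x) <= B) ->
  exists F : R -> R, (forall x, a < x < b -> is_derive F x (f x)) /\
    (forall x, a < x < b -> Rabs (F x) <= B * (x - a)).
Proof.
  intros Hab Hc Hb. set (c := (a + b) / 2). set (G := fun x => RInt f c x). assert (HB : 0 <= B).
  { apply Rle_trans with (Rabs (f c)); [apply Rabs_pos|]. apply Hb. unfold c; lra. }
  assert (HG : forall x, a < x < b -> is_derive G x (f x)).
  { intros x Hx. apply (is_derive_RInt f G c x).
    - apply (filter_imp (fun y => a < y < b)); [|now apply locally_itv].
      intros y Hy. apply (RInt_correct f c y). apply ex_RInt_continuous.
      intros z Hz. apply Hc. unfold Rmin, Rmax in Hz. destruct (Rle_dec c y); unfold c in *; lra.
    - now apply Hc. }
  assert (HL : forall x y, a < x < b -> a < y < b -> Rabs (G y - G x) <= B * Rabs (y - x)).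
  { intros; eapply lip_of_derive; eauto. }
  (* The primitive [G] based at the midpoint is Lipschitz with constant [B], hence Cauchy along a
     sequence tending to [a]; subtracting its limit moves the base point to the end. *)
  set (u := fun n : nat => a + (b - a) / (INR n + 2)). assert (Hu : forall n, a < u n < b).
  { intros n. unfold u. pose proof (pos_INR n).
    assert (0 < (b - a) / (INR n + 2)) by (apply Rdiv_lt_0_compat; lra). assert ((b - a) / (INR n + 2) < b - a).
    { apply Rlt_div_l; [lra|]. nra. }
    lra. }
  assert (Hul : is_lim_seq u a).
  { unfold u. replace (Finite a) with (Rbar_plus a (Rbar_mult (b - a) 0)) by (simpl; f_equal; ring).
    apply is_lim_seq_plus'. apply is_lim_seq_const.
    unfold Rdiv. replace (Finite ((b-a)*0)) with (Rbar_mult (b-a) 0) by reflexivity.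
    apply (is_lim_seq_scal_l (fun n => / (INR n + 2)) (b - a) 0).
    apply is_lim_seq_ext with (fun n => / INR (n + 2)).
    { intros n. now rewrite plus_INR. }
    apply (is_lim_seq_incr_n (fun n => / INR n) 2). replace (Finite 0) with (Rbar_inv p_infty) by reflexivity.
    apply is_lim_seq_inv; [apply is_lim_seq_INR|discriminate]. }
  assert (Hex : ex_finite_lim_seq (fun n => G (u n))).
  { apply ex_lim_seq_cauchy_corr. intros eps. assert (Hcau : ex_lim_seq_cauchy u).
    { apply ex_lim_seq_cauchy_corr. now exists a. }
    assert (He : 0 < eps / (B + 1)) by (apply Rdiv_lt_0_compat; [apply cond_pos|lra]).
    destruct (Hcau (mkposreal _ He)) as [N HN]. exists N. intros n m Hn Hm.
    eapply Rle_lt_trans; [apply HL; apply Hu|]. specialize (HN n m Hn Hm). simpl in HN.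
    apply Rle_lt_trans with ((B + 1) * Rabs (u n - u m)).
    { apply Rmult_le_compat_r; [apply Rabs_pos|lra]. }
    replace (pos eps) with ((B + 1) * (eps / (B + 1))) by (field; lra). apply Rmult_lt_compat_l; lra. }
  destruct Hex as [l Hl]. exists (fun x => G x - l). split.
  - intros x Hx. eapply derive_eq.
    + apply derive_minus; [now apply HG|apply is_derive_const].
    + unfold zero; simpl. ring.
  - intros x Hx. assert (Hlim : is_lim_seq (fun n => Rabs (G x - G (u n))) (Rabs (G x - l))).
    { apply (is_lim_seq_abs (fun n => G x - G (u n)) (G x - l)).
      apply is_lim_seq_minus'; auto. apply is_lim_seq_const. }
    assert (Hlim2 : is_lim_seq (fun n => B * Rabs (x - u n)) (B * Rabs (x - a))).
    { apply (is_lim_seq_scal_l _ B (Rabs (x - a))). apply (is_lim_seq_abs (fun n => x - u n) (x - a)).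
      apply is_lim_seq_minus'; auto. apply is_lim_seq_const. }
    assert (Hle := is_lim_seq_le _ _ _ _ (fun n => HL (u n) x (Hu n) Hx) Hlim Hlim2).
    simpl in Hle. rewrite (Rabs_right (x - a)) in Hle; lra.
Qed.

(** The comparison starts from a point [y] close to [a], where [F y] is already small by the a
    priori bound; [g] may therefore fail to have a limit at [a], as long as it is nonnegative. *)
Lemma antiderivative_left_bound (F f g g' : R -> R) (a b B : R) :
  (forall x, a < x < b -> is_derive F x (f x)) ->
  (forall x, a < x < b -> Rabs (F x) <= B * (x - a)) ->
  forall s, a < s < b ->
  (forall x, a < x <= s -> is_derive g x (g' x)) ->
  (forall x, a < x <= s -> 0 <= g x) ->
  (forall x, a < x <= s -> Rabs (f x) <= g' x) ->
  Rabs (F s) <= g s.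
Proof.
  intros HF HB s Hs Hg Hg0 Hfg. apply Rnot_lt_le. intros Hlt. assert (HB0 : 0 <= B).
  { specialize (HB s Hs). pose proof (Rabs_pos (F s)).
    destruct (Rle_dec 0 B); auto. exfalso. assert (B * (s - a) < 0) by nra. lra. }
  set (e := Rabs (F s) - g s). set (y := a + Rmin ((s - a) / 2) (e / (2 * (B + 1)))).
  assert (He : 0 < e) by (unfold e; lra). assert (He2 : 0 < e / (2 * (B + 1))) by (apply Rdiv_lt_0_compat; lra).
  assert (Hy : a < y < s).
  { unfold y. pose proof (Rmin_l ((s - a) / 2) (e / (2 * (B + 1)))).
    assert (0 < Rmin ((s - a) / 2) (e / (2 * (B + 1)))) by (apply Rmin_glb_lt; lra). lra. }
  assert (Hcmp : Rabs (F s - F y) <= g s - g y).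
  { destruct (mvt (fun t => g t - F t) (fun t => g' t - f t) y s) as [c1 [H1 H2]]; [lra| |].
    { intros z Hz. apply derive_minus; [apply Hg|apply HF]; lra. }
    destruct (mvt (fun t => g t + F t) (fun t => g' t + f t) y s) as [c2 [H3 H4]]; [lra| |].
    { intros z Hz. apply derive_plus; [apply Hg|apply HF]; lra. }
    assert (A1 := Hfg c1 ltac:(lra)). assert (A2 := Hfg c2 ltac:(lra)).
    apply Rabs_le_between in A1. apply Rabs_le_between in A2.
    assert (0 <= (g' c1 - f c1) * (s - y)) by (apply Rmult_le_pos; lra).
    assert (0 <= (g' c2 + f c2) * (s - y)) by (apply Rmult_le_pos; lra). apply Rabs_le. lra. }
  assert (H0 : 0 <= g y) by (apply Hg0; lra). assert (Hy2 : Rabs (F y) <= B * (y - a)) by (apply HB; lra).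
  assert (H3 : y - a <= e / (2 * (B + 1))).
  { unfold y. pose proof (Rmin_r ((s - a) / 2) (e / (2 * (B + 1)))). lra. }
  assert (H4 : B * (y - a) <= e / 2).
  { apply Rle_trans with ((B + 1) * (e / (2 * (B + 1)))).
    - apply Rmult_le_compat; lra.
    - right. field. lra. }
  assert (H5 : Rabs (F s) <= Rabs (F s - F y) + Rabs (F y)).
  { replace (F s) with ((F s - F y) + F y) at 1 by ring. apply Rabs_triang. }
  unfold e in *. lra.
Qed.

Lemma derive_glue (f g : R -> R) (x l : R) :
  is_derive f x l -> is_derive g x l -> f x = g x ->
  is_derive (fun t => if Rle_dec t x then f t else g t) x l.
Proof.
  intros Hf Hg E. apply is_derive_Reals in Hf. apply is_derive_Reals in Hg.
  apply is_derive_Reals. intros eps He. destruct (Hf eps He) as [d1 H1]. destruct (Hg eps He) as [d2 H2].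
  assert (Hd : 0 < Rmin d1 d2) by (apply Rmin_glb_lt; apply cond_pos).
  exists (mkposreal _ Hd). intros h Hh0 Hh. simpl in Hh.
  assert (Rabs h < d1) by (eapply Rlt_le_trans; [apply Hh|apply Rmin_l]).
  assert (Rabs h < d2) by (eapply Rlt_le_trans; [apply Hh|apply Rmin_r]).
  destruct (Rle_dec x x) as [_|n]; [|lra]. destruct (Rle_dec (x + h) x).
  - now apply H1.
  - rewrite E. now apply H2.
Qed.

Lemma ex_series_dom (a M : nat -> R) :
  (forall k, Rabs (a k) <= M k) -> ex_series M -> ex_series a.
Proof. intros H. exact (ex_series_le (V:=R_CompleteNormedModule) a M H). Qed.

Lemma Series_dom (a M : nat -> R) :
  (forall k, Rabs (a k) <= M k) -> ex_series M -> Rabs (Series a) <= Series M.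
Proof.
  intros H HM. eapply Rle_trans; [apply Series_Rabs|].
  - apply ex_series_dom with M; auto. intros k. now rewrite Rabs_Rabsolu.
  - apply Series_le; auto. intros k. split; [apply Rabs_pos|apply H].
Qed.

(** By the mean value theorem the tail of the difference quotients is bounded by the tail of [M],
    and so is the tail of the derivatives; together they stay below [eps / 2], and the head is a
    finite sum. *)
Lemma derive_Series (f f' : nat -> R -> R) (M : nat -> R) (a b : R) :
  (forall k x, a < x < b -> is_derive (f k) x (f' k x)) ->
  (forall k x, a < x < b -> Rabs (f' k x) <= M k) ->
  (forall x, a < x < b -> ex_series (fun k => f k x)) ->
  ex_series M ->
  forall x, a < x < b ->
  is_derive (fun y => Series (fun k => f k y)) x (Series (fun k => f' k x)).
Proof.
  intros Hd HM Hs HMs x Hx. assert (HM0 : forall k, 0 <= M k).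
  { intros k. eapply Rle_trans; [apply Rabs_pos|apply (HM k x Hx)]. }
  assert (Hs' : forall y, a < y < b -> ex_series (fun k => f' k y)).
  { intros y Hy. apply ex_series_dom with M; auto. }
  apply is_derive_Reals. intros eps He.
  assert (Htail : exists N : nat, Series (fun k => M (S N + k)%nat) < eps / 4).
  { assert (L : is_lim_seq (sum_n M) (Series M)) by exact (Series_correct _ HMs).
    assert (He4 : 0 < eps / 4) by lra. apply is_lim_seq_spec in L. destruct (L (mkposreal _ He4)) as [N HN].
    exists N. specialize (HN N (le_n N)). simpl in HN.
    assert (E := Series_incr_n M (S N) ltac:(lia) HMs). simpl pred in E. rewrite sum_n_Reals in HN.
    apply Rabs_def2 in HN. lra. }
  destruct Htail as [N HN].
  assert (Hfin : forall N, is_derive (fun y => sum_f_R0 (fun k => f k y) N) x (sum_f_R0 (fun k => f' k x) N)).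
  { intros n. induction n as [|n IH]; simpl; [now apply Hd|]. apply derive_plus; auto. }
  assert (H1 := Hfin N). apply is_derive_Reals in H1. assert (He2 : 0 < eps / 2) by lra.
  destruct (H1 (eps/2) He2) as [d Hdd]. destruct (locally_itv a b x Hx) as [d2 Hd2].
  assert (Hm : 0 < Rmin d d2) by (apply Rmin_glb_lt; apply cond_pos).
  exists (mkposreal _ Hm). intros h Hh0 Hh. simpl in Hh.
  assert (Hh1 : Rabs h < d) by (eapply Rlt_le_trans; [apply Hh|apply Rmin_l]).
  assert (Hh2 : Rabs h < d2) by (eapply Rlt_le_trans; [apply Hh|apply Rmin_r]). assert (Hxh : a < x + h < b).
  { apply Hd2. unfold ball; simpl; unfold AbsRing_ball, abs, minus, plus, opp; simpl.
    replace (x + h + - x) with h by ring. auto. }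
  rewrite (Series_incr_n (fun k => f k (x + h)) (S N)); [|lia|auto].
  rewrite (Series_incr_n (fun k => f k x) (S N)); [|lia|auto].
  rewrite (Series_incr_n (fun k => f' k x) (S N)); [|lia|auto]. simpl pred.
  specialize (Hdd h Hh0 Hh1). simpl in Hdd.
  set (A := (sum_f_R0 (fun k => f k (x + h)) N - sum_f_R0 (fun k => f k x) N) / h) in *.
  set (B := sum_f_R0 (fun k => f' k x) N) in *. set (T1 := Series (fun k => f (S N + k)%nat (x + h))).
  set (T2 := Series (fun k => f (S N + k)%nat x)). set (T3 := Series (fun k => f' (S N + k)%nat x)).
  set (TM := Series (fun k => M (S N + k)%nat)) in *.
  assert (HMt : ex_series (fun k => M (S N + k)%nat)) by now apply ex_series_incr_n.
  assert (X1 : Rabs (T1 - T2) <= TM * Rabs h).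
  { unfold T1, T2. rewrite <- Series_minus.
    2: now apply (ex_series_incr_n (fun k => f k (x+h))); auto.
    2: now apply (ex_series_incr_n (fun k => f k x)); auto. unfold TM. rewrite <- Series_scal_r.
    apply Series_dom; [|now apply (ex_series_scal_r (Rabs h) (fun n => M (S N + n)%nat))].
    intros k. replace h with (x + h - x) at 2 by ring. apply (lip_of_derive _ (f' (S N + k)%nat) a b); auto. }
  assert (X2 : Rabs T3 <= TM).
  { unfold T3, TM. apply Series_dom; auto. }
  replace ((sum_f_R0 (fun k => f k (x + h)) N + T1 - (sum_f_R0 (fun k => f k x) N + T2)) / h - (B + T3))
    with ((A - B) + ((T1 - T2) / h - T3)) by (unfold A; field; auto).
  eapply Rle_lt_trans; [apply Rabs_triang|]. assert (X3 : Rabs ((T1 - T2) / h) <= TM).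
  { rewrite Rabs_div; auto. apply Rle_div_l; auto. now apply Rabs_pos_lt. }
  assert (X4 : Rabs ((T1 - T2) / h - T3) <= TM + TM).
  { triang. rewrite Rabs_Ropp. lra. }
  lra.
Qed.

Lemma antiderivative_left_bound_const (F f : R -> R) (a b B c : R) :
  (forall x, a < x < b -> is_derive F x (f x)) ->
  (forall x, a < x < b -> Rabs (F x) <= B * (x - a)) ->
  forall s, a < s < b -> 0 <= c ->
  (forall x, a < x <= s -> Rabs (f x) <= c) ->
  Rabs (F s) <= c * (s - a).
Proof.
  intros HF HB s Hs Hc Hf.
  apply (antiderivative_left_bound F f (fun t => c * (t - a)) (fun _ => c) a b B); auto.
  - intros t Ht. eapply derive_eq.
    + apply derive_scal, derive_minus; [apply derive_id|apply derive_cst].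
    + unfold one, zero; simpl. ring.
  - intros t Ht. apply Rmult_le_pos; lra.
Qed.

Lemma Rmult_shrink (X Y t : R) : 0 <= X -> X <= Y -> 0 <= t <= 1 -> X * t <= Y.
Proof. intros. nra. Qed.

Lemma le_div_intro (a b c : R) : 0 < c -> a * c <= b -> a <= b / c.
Proof. intros Hc H. now apply Rle_div_r. Qed.
Lemma div_le_intro (a b c : R) : 0 < c -> a <= b * c -> a / c <= b.
Proof. intros Hc H. now apply Rle_div_l. Qed.

Lemma cmp_of_derive_closed (f f' g g' : R -> R) (x y : R) : x <= y ->
  (forall t, x <= t <= y -> is_derive f t (f' t)) ->
  (forall t, x <= t <= y -> is_derive g t (g' t)) ->
  (forall t, x <= t <= y -> Rabs (f' t) <= g' t) ->
  Rabs (f y - f x) <= g y - g x.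
Proof.
  intros Hxy Hf Hg H. destruct (Req_dec x y) as [->|Hne].
  { unfold Rminus. rewrite !Rplus_opp_r, Rabs_R0. lra. }
  destruct (mvt (fun t => g t - f t) (fun t => g' t - f' t) x y) as [c1 [H1 H2]]; [lra| |].
  { intros z Hz. apply derive_minus; auto. }
  destruct (mvt (fun t => g t + f t) (fun t => g' t + f' t) x y) as [c2 [H3 H4]]; [lra| |].
  { intros z Hz. apply derive_plus; auto. }
  assert (A1 := H c1 ltac:(lra)). assert (A2 := H c2 ltac:(lra)).
  apply Rabs_le_between in A1. apply Rabs_le_between in A2.
  assert (0 <= (g' c1 - f' c1) * (y - x)) by (apply Rmult_le_pos; lra).
  assert (0 <= (g' c2 + f' c2) * (y - x)) by (apply Rmult_le_pos; lra). apply Rabs_le. lra.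
Qed.

Definition In1 (s : R) : Prop := - (1/2) < s < 1/2.
#[export] Hint Extern 2 (In1 _) => unfold In1; lra : deriv.

(** Such an [F] is nondecreasing and tends to 0 at [a]. *)
Lemma antiderivative_left_nonneg (F f : R -> R) (a b B : R) :
  (forall x, a < x < b -> is_derive F x (f x)) ->
  (forall x, a < x < b -> Rabs (F x) <= B * (x - a)) ->
  (forall x, a < x < b -> 0 <= f x) ->
  forall s, a < s < b -> 0 <= F s.
Proof.
  intros HF HB Hf s Hs. apply Rnot_lt_le. intros Hlt. assert (HB0 : 0 < B).
  { specialize (HB s Hs). assert (0 < Rabs (F s)) by (apply Rabs_pos_lt; lra).
    destruct (Rlt_dec 0 B); auto. exfalso. assert (B * (s - a) <= 0) by nra. lra. }
  set (y := a + Rmin ((s - a) / 2) (- F s / (2 * B))).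
  assert (He2 : 0 < - F s / (2 * B)) by (apply Rdiv_lt_0_compat; lra). assert (Hy : a < y < s).
  { unfold y. pose proof (Rmin_l ((s - a) / 2) (- F s / (2 * B))).
    assert (0 < Rmin ((s - a) / 2) (- F s / (2 * B))) by (apply Rmin_glb_lt; lra). lra. }
  assert (F y <= F s) by (apply (mono_of_derive F f a b); auto; lra).
  assert (H2 : Rabs (F y) <= B * (y - a)) by (apply HB; lra). assert (H3 : B * (y - a) <= - F s / 2).
  { replace (- F s / 2) with (B * (- F s / (2 * B))) by (field; lra). apply Rmult_le_compat_l; [lra|]. unfold y.
    pose proof (Rmin_r ((s - a) / 2) (- F s / (2 * B))). lra. }
  apply Rabs_le_between in H2. lra.
Qed.

(** This is [tanh u <= u] cleared of its denominator. *)
Lemma sinh_le_mul_cosh u : 0 <= u -> exp u - exp (- u) <= u * (exp u + exp (- u)).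
Proof.
  intros Hu. destruct (Req_dec u 0) as [->|Hn]; [rewrite Ropp_0; lra|].
  set (f := fun u => u * (exp u + exp (- u)) - (exp u - exp (- u))).
  assert (Hd : forall x, is_derive f x (x * (exp x - exp (- x)))).
  { intros x. unfold f. auto_derive; auto. ring. }
  destruct (mvt f (fun x => x * (exp x - exp (- x))) 0 u) as [c [Hc1 Hc2]]; [lra|auto|].
  assert (exp (- c) <= exp c) by (left; apply exp_increasing; lra).
  assert (0 <= c * (exp c - exp (- c)) * (u - 0)) by (apply Rmult_le_pos; [apply Rmult_le_pos|]; lra).
  unfold f in Hc2. rewrite Ropp_0, exp_0 in Hc2. lra.
Qed.

Definition full_sol (h : R -> R) (k : R) (f1 F psi Y : R -> R) : Prop :=
  (forall s, In1 s -> is_derive psi s (- Y s + f1 s)) /\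
  (forall s, In1 s -> is_derive Y s (- 2 * h s * Y s - k * psi s + F s)).

(** The integer [i] stands for the angular frequency [2 i], for which [k = 4 i^2 - 4]. The source
    [f4] comes with an angular derivative, whence its factor [2 i]; the bound on [psi] wins back one
    power of the frequency. Only the resonant [i = 1] may use the multiplier [lam]. *)
Definition sol_spec (h b : R -> R) (C : R) (i : nat) (B : R) (f1 G f4 : R -> R) (r : R * ((R -> R) * (R -> R))) : Prop :=
  let lam := fst r in let psi := fst (snd r) in let Y := snd (snd r) in
  full_sol h (4 * INR i ^ 2 - 4) f1 (fun s => G s + 2 * INR i * f4 s + lam * b s) psi Y /\
  Rabs lam <= C * B /\ (i <> 1%nat -> lam = 0) /\
  (forall s, In1 s -> (1 + 2 * INR i) * Rabs (psi s) <= C * B) /\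
  (forall s, In1 s -> Rabs (Y s) <= C * B).

Definition solvable (h b : R -> R) (C : R) : Prop := forall (i : nat) B f1 G f4, 0 <= B ->
  (forall s, In1 s -> continuous f1 s) -> (forall s, In1 s -> continuous G s) ->
  (forall s, In1 s -> continuous f4 s) ->
  (forall s, In1 s -> Rabs (f1 s) <= B) -> (forall s, In1 s -> Rabs (G s) <= B / (1/4 - s ^ 2)) ->
  (forall s, In1 s -> Rabs (f4 s) <= B) ->
  exists r, sol_spec h b C i B f1 G f4 r.

Section Linear.
Variables (p h : R -> R) (x0 Ch : R).
Hypothesis p_pos : forall s, - (1/2) < s < 1/2 -> 0 < p s.
Hypothesis p_der : forall s, - (1/2) < s < 1/2 -> is_derive p s (h s * p s).
Hypothesis x0_pos : 0 < x0.
Hypothesis Ch_pos : 0 < Ch.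
Hypothesis h_near : forall s, - (1/2) < s <= - (1/2) + x0 -> 1 / (s + 1/2) <= h s.
Hypothesis h_bound : forall s, - (1/2) < s < 1/4 -> Rabs (h s) <= Ch / (s + 1/2).

Notation I := In1.
(** The left half is continued past 0 so that derivatives at the gluing point are two-sided. *)
Let J (s : R) := - (1/2) < s < 1/4.

Definition left_sol (k : R) (f1 F psi Y : R -> R) : Prop :=
  (forall s, J s -> is_derive psi s (- Y s + f1 s)) /\
  (forall s, J s -> is_derive Y s (- 2 * h s * Y s - k * psi s + F s)).

Lemma J_I s : J s -> I s.
Proof. unfold I, J; lra. Qed.
(** The logarithmic derivative of [p^2 / (s + 1/2)] is [2 h - 1 / (s + 1/2)], positive within [x0]
    of the end and at least [- M] beyond. Multiplication by [exp (M s)] makes the function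
    nondecreasing, at the price of [exp M] on an interval shorter than 1. *)
Lemma p_quasimonotone : exists C, 1 <= C /\ forall y s, - (1/2) < y -> y <= s -> s < 1/4 ->
  p y ^ 2 / (y + 1/2) <= C * (p s ^ 2 / (s + 1/2)).
Proof.
  set (M := (2 * Ch + 1) / x0). assert (HM : 0 < M) by (unfold M; apply Rdiv_lt_0_compat; lra).
  exists (exp M). split.
  { rewrite <- exp_0. left. now apply exp_increasing. }
  intros y s Hy Hys Hs. set (q := fun s => p s ^ 2 * / (s + 1/2) * exp (M * s)). assert (Hm : q y <= q s).
  { apply (mono_of_derive q (fun s => (2 * h s - 1 / (s + 1/2) + M) * q s) (-(1/2)) (1/4)); auto.
    - intros x Hx. unfold q. derive. simpl. field. lra.
    - intros x Hx. apply Rmult_le_pos.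
      + destruct (Rle_dec x (-(1/2) + x0)).
        * assert (1 / (x + 1/2) <= h x) by (apply h_near; lra).
          assert (0 < 1 / (x + 1/2)) by (apply Rdiv_lt_0_compat; lra). lra.
        * assert (H1 : Rabs (h x) <= Ch / (x + 1/2)) by (apply h_bound; lra).
          assert (H2 : (2 * Ch + 1) / (x + 1/2) <= M).
          { unfold M. apply Rmult_le_compat_l; [lra|]. apply Rinv_le_contravar; lra. }
          apply Rabs_le_between in H1.
          assert ((2 * Ch + 1) / (x + 1/2) = 2 * (Ch / (x + 1/2)) + 1 / (x + 1/2)) by (field; lra). lra.
      + unfold q. assert (0 < p x) by (apply p_pos; lra). apply Rmult_le_pos; [apply Rmult_le_pos|].
        * apply pow_le; lra.
        * left. apply Rinv_0_lt_compat; lra.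
        * left. apply exp_pos. }
  unfold q in Hm. assert (E1 : 0 < exp (M * y)) by apply exp_pos.
  assert (H1 : p y ^ 2 / (y + 1/2) <= p s ^ 2 / (s + 1/2) * (exp (M * s) * / exp (M * y))).
  { apply Rmult_le_reg_r with (exp (M * y)); auto.
    replace (p s ^ 2 / (s + 1/2) * (exp (M * s) * / exp (M * y)) * exp (M * y))
      with (p s ^ 2 * / (s + 1/2) * exp (M * s)) by (field; lra). exact Hm. }
  eapply Rle_trans; [exact H1|]. rewrite Rmult_comm. apply Rmult_le_compat_r.
  - assert (0 < p s) by (apply p_pos; lra). apply Rmult_le_pos; [apply pow_le; lra|].
    left; apply Rinv_0_lt_compat; lra.
  - rewrite <- exp_Ropp, <- exp_plus. destruct (Req_dec (M * s + - (M * y)) M) as [->|Hn]; [lra|].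
    left. apply exp_increasing. nra.
Qed.

Let C2 := proj1_sig (constructive_indefinite_description _ p_quasimonotone).
Lemma C2_ge1 : 1 <= C2.
Proof. unfold C2. destruct constructive_indefinite_description as [C [H ?]]; simpl; auto. Qed.
Lemma C2_spec : forall y s, - (1/2) < y -> y <= s -> s < 1/4 ->
  p y ^ 2 / (y + 1/2) <= C2 * (p s ^ 2 / (s + 1/2)).
Proof. unfold C2. destruct constructive_indefinite_description as [C [? H]]; simpl; auto. Qed.
Lemma p2_pos s : - (1/2) < s < 1/2 -> 0 < p s ^ 2.
Proof. intros. apply pow_lt; auto. Qed.
Lemma C2_spec' : forall y s, - (1/2) < y -> y <= s -> s < 1/4 -> p y ^ 2 <= C2 * p s ^ 2.
Proof.
  intros y s Hy Hys Hs. assert (H := C2_spec y s Hy Hys Hs). assert (0 < p s ^ 2) by (apply p2_pos; lra).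
  apply Rle_trans with (C2 * (p s ^ 2 / (s + 1/2)) * (y + 1/2)).
  - apply Rmult_le_reg_r with (/ (y + 1/2)); [apply Rinv_0_lt_compat; lra|].
    replace (C2 * (p s ^ 2 / (s + 1/2)) * (y + 1/2) * / (y + 1/2)) with (C2 * (p s ^ 2 / (s + 1/2))) by (field; lra).
    exact H.
  - replace (C2 * (p s ^ 2 / (s + 1/2)) * (y + 1/2)) with (C2 * p s ^ 2 * ((y + 1/2) / (s + 1/2))) by (field; lra).
    rewrite <- (Rmult_1_r (C2 * p s ^ 2)) at 2. apply Rmult_le_compat_l.
    + pose proof C2_ge1. nra.
    + apply div_le_intro; lra.
Qed.

Lemma p2_der s : - (1/2) < s < 1/2 -> is_derive (fun t => p t ^ 2) s (2 * h s * p s ^ 2).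
Proof.
  intros. derive. simpl. ring.
Qed.
Lemma p2_cont s : - (1/2) < s < 1/2 -> continuous (fun t => p t ^ 2) s.
Proof. intros. eapply cont_of_derive, p2_der; auto. Qed.

(** Quasi-monotonicity carries the bound from the compact part [[0, 1/4]] to the end. The vanishing
    of [p^2] removes the boundary terms of the Wronskian identities below. *)
Lemma p2_linear_bound : exists A, 0 < A /\ forall s, J s -> 0 < p s ^ 2 <= A * (s + 1/2).
Proof.
  pose proof C2_ge1 as HC.
    destruct (continuity_ab_maj (fun t => p t ^ 2) 0 (1/4)) as [Mx [HMx _]]; [lra| |].
  { intros c Hc. apply continuity_pt_filterlim. eapply cont_of_derive, derive_pow, p_der. lra. }
  assert (HA : 0 <= p Mx ^ 2) by apply pow2_ge_0. exists (C2 * (2 * p Mx ^ 2) + 1). split; [nra|].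
  intros s Hs. split; [now apply p2_pos, J_I|]. unfold J in Hs.
  assert (Q : forall s, 0 <= s < 1/4 -> p s ^ 2 / (s + 1/2) <= 2 * p Mx ^ 2).
  { intros z Hz. assert (p z ^ 2 <= p Mx ^ 2) by (apply HMx; lra). assert (0 <= p z ^ 2) by apply pow2_ge_0.
    apply div_le_intro; [lra|]. nra. }
  assert (Q2 : p s ^ 2 / (s + 1/2) <= C2 * (2 * p Mx ^ 2)).
  { destruct (Rle_dec s 0).
    - eapply Rle_trans; [apply (C2_spec s 0); lra|]. apply Rmult_le_compat_l; [lra|]. apply Q; lra.
    - eapply Rle_trans; [apply Q; lra|]. nra. }
  replace (p s ^ 2) with (p s ^ 2 / (s + 1/2) * (s + 1/2)) by (field; lra). apply Rmult_le_compat_r; lra.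
Qed.

(* [p^2 y] is the antiderivative of [p^2 G] vanishing at the left end. *)
Lemma first_order_left (G : R -> R) (B : R) : 0 <= B ->
  (forall s, - (1/2) < s < 1/4 -> continuous G s) ->
  (forall s, - (1/2) < s < 1/4 -> Rabs (G s) <= B / (s + 1/2)) ->
  exists y : R -> R,
    (forall s, - (1/2) < s < 1/4 -> is_derive y s (- 2 * h s * y s + G s)) /\
    (forall s A, - (1/2) < s < 1/4 ->
       (forall t, - (1/2) < t <= s -> Rabs (G t) <= A / (t + 1/2)) -> Rabs (y s) <= C2 * A) /\
    ((forall s, - (1/2) < s < 1/4 -> 0 <= G s) -> forall s, - (1/2) < s < 1/4 -> 0 <= y s).
Proof.
  intros HB0 Gc GB.
  (* Quasi-monotonicity replaces the weight at [t] by its value at [s]; integrating over the length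
     [s + 1/2] then cancels the singular factor of the source. *)
  assert (Hb0 : forall A t s, 0 <= A -> - (1/2) < t -> t <= s -> s < 1/4 -> Rabs (G t) <= A / (t + 1/2) ->
      Rabs (p t ^ 2 * G t) <= A * (C2 * (p s ^ 2 / (s + 1/2)))).
  { intros A t s HA Ht Hts Hs HG. rewrite Rabs_mult.
    assert (0 < p t ^ 2) by (apply p2_pos; lra). rewrite (Rabs_right (p t ^ 2)) by lra.
    apply Rle_trans with (p t ^ 2 * (A / (t + 1/2))).
    - apply Rmult_le_compat_l; lra.
    - replace (p t ^ 2 * (A / (t + 1/2))) with (A * (p t ^ 2 / (t + 1/2))) by (field; lra).
      apply Rmult_le_compat_l; auto. now apply C2_spec. }
  assert (Hcont : forall s, - (1/2) < s < 1/4 -> continuous (fun t => p t ^ 2 * G t) s).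
  { intros s Hs. apply continuous_Rmult; [apply p2_cont; lra|auto]. }
  assert (H14 : exists B1, forall s, - (1/2) < s < 1/4 -> Rabs (p s ^ 2 * G s) <= B1).
  { destruct p2_linear_bound as [W [W0 HW]]. exists (B * W). intros s Hs. destruct (HW s Hs).
    rewrite Rabs_mult, (Rabs_right (p s ^ 2)) by lra. apply Rle_trans with (W * (s + 1/2) * (B / (s + 1/2))).
    - apply Rmult_le_compat; auto; [lra|apply Rabs_pos].
    - right. field. lra. }
  destruct H14 as [B1 HB1].
  destruct (antiderivative_left (fun t => p t ^ 2 * G t) (-(1/2)) (1/4) B1) as [Z [HZ1 HZ2]]; auto; [lra|].
  exists (fun s => Z s * / p s ^ 2). split; [|split].
  - intros s Hs. assert (0 < p s) by (apply p_pos; lra). eapply derive_eq.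
    + apply derive_mult; [now apply HZ1|]. apply derive_inv; [apply p2_der; lra|]. apply pow_nonzero; lra.
    + cbv beta. field. lra.
  - intros s A Hs HA. assert (HA0 : 0 <= A).
    { assert (H := HA s ltac:(lra)). pose proof (Rabs_pos (G s)). assert (0 <= A / (s + 1/2)) by lra.
      replace A with (A / (s + 1/2) * (s + 1/2)) by (field; lra). apply Rmult_le_pos; lra. }
    assert (0 < p s ^ 2) by (apply p2_pos; lra). rewrite Rabs_mult, (Rabs_right (/ p s ^ 2)).
    2: left; apply Rinv_0_lt_compat; lra. pose proof C2_ge1. set (c := A * (C2 * (p s ^ 2 / (s + 1/2)))).
    assert (K0 : 0 <= c).
    { apply Rmult_le_pos; auto. apply Rmult_le_pos; [lra|]. left. apply Rdiv_lt_0_compat; lra. }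
    assert (HZs : Rabs (Z s) <= c * (s - - (1/2))).
    { apply (antiderivative_left_bound_const Z (fun t => p t ^ 2 * G t) _ (1/4) B1); auto.
      intros t Ht. apply Hb0; auto; try lra. }
    apply div_le_intro; [lra|]. replace (C2 * A * p s ^ 2) with (c * (s - - (1/2))); auto. unfold c. field. lra.
  - intros HG s Hs. assert (0 < p s ^ 2) by (apply p2_pos; lra).
    apply Rmult_le_pos; [|left; apply Rinv_0_lt_compat; lra].
    apply (antiderivative_left_nonneg Z (fun t => p t ^ 2 * G t) (-(1/2)) (1/4) B1); auto.
    intros x Hx. apply Rmult_le_pos; [apply pow2_ge_0|auto].
Qed.

Section Picard.
Variable k : R.
(** With [M > 2 C2 |k|], one double integration halves the norm weighted by the exponential [w],
    whatever the size of [k]. *)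
Let M := 2 * C2 * Rabs k + 1.
Let w (s : R) := exp (M * (s + 1/2)).

Lemma M_ge1 : 1 <= M.
Proof. unfold M. pose proof C2_ge1. pose proof (Rabs_pos k). nra. Qed.
Lemma w_mono y s : y <= s -> w y <= w s.
Proof.
  intros. unfold w. pose proof M_ge1. destruct (Req_dec y s) as [->|Hn]; [lra|]. left; apply exp_increasing.
  apply Rmult_lt_compat_l; lra.
Qed.
Lemma w_pos s : 0 < w s.
Proof. apply exp_pos. Qed.
Lemma w_le s : J s -> w s <= exp M.
Proof.
  intros [H1 H2]. unfold w. pose proof M_ge1. left; apply exp_increasing.
  rewrite <- (Rmult_1_r M) at 2. apply Rmult_lt_compat_l; lra.
Qed.
Lemma w_ge1 s : J s -> 1 <= w s.
Proof.
  intros [H1 H2]. unfold w. pose proof M_ge1.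
  apply Rle_trans with (exp 0); [rewrite exp_0; lra|]. left; apply exp_increasing. apply Rmult_lt_0_compat; lra.
Qed.
Lemma w_der s : is_derive w s (M * w s).
Proof. unfold w. derive. ring. Qed.

(** One step [u -> v] of the iteration: [v' = y] and [(p^2 y)' = k p^2 u], with [v] and [p^2 y]
    vanishing at the left end. The fourth clause is the contraction, the fifth the linear vanishing
    of [v], the last the positivity used for homogeneous solutions. *)
Definition picard_spec (A : R) (u : R -> R) (vy : (R -> R) * (R -> R)) : Prop :=
  let v := fst vy in let y := snd vy in
  (forall s, J s -> is_derive v s (y s)) /\
  (forall s, J s -> is_derive y s (- 2 * h s * y s + k * u s)) /\
  (forall s, J s -> Rabs (y s) <= A * M * w s) /\
  (forall s, J s -> Rabs (v s) <= A / 2 * w s) /\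
  (forall s, J s -> Rabs (v s) <= A * M * exp M * (s + 1/2)) /\
  (0 <= k -> (forall s, J s -> 0 <= u s) -> forall s, J s -> 0 <= y s /\ 0 <= v s).

Lemma picard_step (A : R) (u : R -> R) : 0 <= A ->
  (forall s, J s -> continuous u s) ->
  (forall s, J s -> Rabs (u s) <= A * w s) ->
  exists vy, picard_spec A u vy.
Proof.
  intros HA Hc Hb. pose proof C2_ge1 as HC2. pose proof M_ge1 as HM1. pose proof (Rabs_pos k) as Hk.
  assert (HG : forall s, J s -> Rabs (k * u s) <= Rabs k * A * w s).
  { intros s Hs. rewrite Rabs_mult, Rmult_assoc. apply Rmult_le_compat_l; auto. }
  assert (HkA : 0 <= Rabs k * A) by (apply Rmult_le_pos; auto).
  destruct (first_order_left (fun s => k * u s) (Rabs k * A * exp M)) as [y [Hy1 [Hy2 Hy3]]].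
  - pose proof (exp_pos M). nra.
  - intros s Hs. apply continuous_Rmult; [apply continuous_const|auto].
  - intros s Hs. eapply Rle_trans; [apply HG; auto|].
    pose proof (w_le s Hs). pose proof (w_pos s). apply le_div_intro; [lra|].
    unfold J in *. assert (0 <= Rabs k * A * w s) by (apply Rmult_le_pos; lra).
    assert (Rabs k * A * w s <= Rabs k * A * exp M) by (apply Rmult_le_compat_l; auto).
    apply Rmult_shrink; [assumption|assumption|lra].
  - assert (Hyb : forall s, J s -> Rabs (y s) <= C2 * (Rabs k * A) * w s).
    { intros s Hs. replace (C2 * (Rabs k * A) * w s) with (C2 * (Rabs k * A * w s)) by ring.
      apply Hy2; auto. intros t Ht. assert (Ht' : J t) by (unfold J in *; lra).
      eapply Rle_trans; [apply HG; auto|]. pose proof (w_mono t s ltac:(lra)). pose proof (w_pos t).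
      unfold J in *. apply le_div_intro; [lra|]. assert (0 <= Rabs k * A * w t) by (apply Rmult_le_pos; lra).
      assert (Rabs k * A * w t <= Rabs k * A * w s) by (apply Rmult_le_compat_l; auto).
      apply Rmult_shrink; [assumption|assumption|lra]. }
    assert (HCM : C2 * Rabs k <= M / 2) by (unfold M; lra).
    assert (Hyb2 : forall s, J s -> Rabs (y s) <= A / 2 * (M * w s)).
    { intros s Hs. eapply Rle_trans; [now apply Hyb|]. pose proof (w_pos s).
      replace (C2 * (Rabs k * A) * w s) with (A * w s * (C2 * Rabs k)) by ring.
      replace (A / 2 * (M * w s)) with (A * w s * (M / 2)) by field.
      apply Rmult_le_compat_l; auto. apply Rmult_le_pos; lra. }
    assert (Hyb3 : forall s, J s -> Rabs (y s) <= A * M * exp M).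
    { intros s Hs. eapply Rle_trans; [now apply Hyb2|]. pose proof (w_le s Hs). pose proof (w_pos s).
      assert (0 <= A * M) by (apply Rmult_le_pos; lra).
      apply Rle_trans with (A * M * w s); [|now apply Rmult_le_compat_l].
      replace (A / 2 * (M * w s)) with (A * M * w s / 2) by field.
      assert (0 <= A * M * w s) by (apply Rmult_le_pos; lra). lra. }
    destruct (antiderivative_left y (-(1/2)) (1/4) (A * M * exp M)) as [v [Hv1 Hv2]].
    { lra. }
    { intros s Hs. eapply cont_of_derive, Hy1; auto. }
    { exact Hyb3. }
    exists (v, y). unfold picard_spec; simpl. split; [|split; [|split; [|split; [|split]]]]; auto.
    + intros s Hs. eapply Rle_trans; [now apply Hyb2|]. pose proof (w_pos s).
      assert (0 <= A * M * w s) by (apply Rmult_le_pos; [apply Rmult_le_pos|]; lra).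
      replace (A / 2 * (M * w s)) with (A * M * w s / 2) by field. lra.
    + intros s Hs.
      apply (antiderivative_left_bound v y (fun t => A / 2 * w t) (fun t => A / 2 * (M * w t)) (-(1/2)) (1/4) (A * M * exp M)); auto.
      * intros t Ht. apply derive_scal, w_der.
      * intros t Ht. pose proof (w_pos t). nra.
      * intros t Ht. apply Hyb2. unfold J in *; lra.
    + intros s Hs. replace (s + 1/2) with (s - - (1/2)) by ring. now apply Hv2.
    + intros H0k Hu s Hs. assert (Hy0 : forall s, J s -> 0 <= y s).
      { apply Hy3. intros t Ht. apply Rmult_le_pos; auto. }
      split; [now apply Hy0|]. apply (antiderivative_left_nonneg v y (-(1/2)) (1/4) (A * M * exp M)); auto.
Qed.

Section Iterates.
Variables (u0 : R -> R) (A0 : R).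
Hypothesis A0_pos : 0 <= A0.
Hypothesis u0_cont : forall s, J s -> continuous u0 s.
Hypothesis u0_bound : forall s, J s -> Rabs (u0 s) <= A0 * w s.

Fixpoint picard (n : nat) : (R -> R) * (R -> R) :=
  match n with
  | O => (u0, fun _ => 0)
  | S n => epsilon (inhabits (u0, u0)) (picard_spec (A0 / 2 ^ n) (fst (picard n)))
  end.

Lemma picard_ok n :
  (forall s, J s -> continuous (fst (picard n)) s) /\
  (forall s, J s -> Rabs (fst (picard n) s) <= A0 / 2 ^ n * w s) /\
  picard_spec (A0 / 2 ^ n) (fst (picard n)) (picard (S n)).
Proof.
  induction n as [|n [IH1 [IH2 IH3]]].
  - split; [|split]; auto.
    + simpl. intros s Hs. replace (A0 / 1) with A0 by field. auto.
    + simpl. apply (epsilon_spec (inhabits (u0, u0))). apply picard_step.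
      * lra.
      * auto.
      * intros; replace (A0 / 1) with A0 by field. auto.
  - assert (Hp : 0 < 2 ^ S n) by (apply pow_lt; lra).
    assert (HA : 0 <= A0 / 2 ^ S n) by (apply le_div_intro; lra).
    assert (H1 : forall s, J s -> continuous (fst (picard (S n))) s).
    { intros s Hs. eapply cont_of_derive. apply (proj1 IH3); auto. }
    assert (H2 : forall s, J s -> Rabs (fst (picard (S n)) s) <= A0 / 2 ^ S n * w s).
    { intros s Hs. destruct IH3 as [_ [_ [_ [G _]]]].
      replace (A0 / 2 ^ S n) with (A0 / 2 ^ n / 2); [now apply G|]. simpl. field. apply pow_nonzero; lra. }
    split; [|split]; auto. simpl. apply (epsilon_spec (inhabits (u0, u0))). now apply picard_step.
Qed.
End Iterates.
End Picard.

(** The solution is the sum of the Picard iterates started from the exact solution for [k = 0] with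
    value [c0] at the left end. The constant obtained grows exponentially in [k], so it serves for
    fixed frequencies and for qualitative facts. *)
Lemma volterra (k : R) : exists C, 0 < C /\ forall c0 B f1 F, 0 <= B ->
  (forall s, J s -> continuous f1 s) -> (forall s, J s -> continuous F s) ->
  (forall s, J s -> Rabs (f1 s) <= B) -> (forall s, J s -> Rabs (F s) <= B / (s + 1/2)) ->
  exists psi Y : R -> R, left_sol k f1 F psi Y /\
    (forall s, J s -> Rabs (psi s) <= C * (Rabs c0 + B)) /\
    (forall s, J s -> Rabs (Y s) <= C * (Rabs c0 + B)) /\
    (forall s, J s -> Rabs (psi s - c0) <= C * (Rabs c0 + B) * (s + 1/2)) /\
    (0 <= k -> 0 <= c0 -> (forall s, J s -> f1 s = 0) -> (forall s, J s -> F s = 0) ->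
     forall s, J s -> c0 <= psi s /\ Y s <= 0).
Proof.
  pose proof C2_ge1 as HC2. pose proof (M_ge1 k) as HM1. set (M := 2 * C2 * Rabs k + 1) in *.
  set (L := (1 + C2) * (1 + 2 * M * exp M)). assert (HL : 0 < L).
  { unfold L. pose proof (exp_pos M). apply Rmult_lt_0_compat; nra. }
  exists (C2 + 1 + 2 * L * exp M + 2 * L). assert (HeM := exp_pos M).
  assert (HeM1 : 1 <= exp M). { rewrite <- exp_0. left. apply exp_increasing. lra. }
  split. { nra. }
  intros c0 B f1 F HB f1c Fc f1b Fb. destruct (first_order_left F B HB Fc Fb) as [Y0 [HY1 [HY2 HY3]]].
  assert (HY0 : forall s, J s -> Rabs (Y0 s) <= C2 * B).
  { intros s Hs. apply HY2; auto. intros t Ht. apply Fb. unfold J in *; lra. }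
  assert (Hb0 : forall s, J s -> Rabs (f1 s - Y0 s) <= (1 + C2) * B).
  { intros s Hs. replace (f1 s - Y0 s) with (f1 s + - Y0 s) by ring. triang. rewrite Rabs_Ropp.
    specialize (f1b s Hs). specialize (HY0 s Hs). lra. }
  destruct (antiderivative_left (fun s => f1 s - Y0 s) (-(1/2)) (1/4) ((1 + C2) * B)) as [U [HU1 HU2]].
  { lra. }
  { intros s Hs. apply continuous_Rminus; auto. eapply cont_of_derive, HY1; auto. }
  { exact Hb0. }
  set (u0 := fun s => c0 + U s). set (A0 := Rabs c0 + (1 + C2) * B). pose proof (Rabs_pos c0) as Hc0.
  assert (HA0 : 0 <= A0) by (unfold A0; nra).
  assert (HA0b : A0 <= (1 + C2) * (Rabs c0 + B)) by (unfold A0; nra).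
  assert (u0d : forall s, J s -> is_derive u0 s (f1 s - Y0 s)).
  { intros s Hs. unfold u0. derive. unfold zero; simpl; ring. }
  assert (u0b : forall s, J s -> Rabs (u0 s) <= A0 * exp (M * (s + 1/2))).
  { intros s Hs. pose proof (w_ge1 k s Hs) as Hw. fold M in Hw. unfold u0. triang.
    assert (Rabs (U s) <= (1 + C2) * B).
    { eapply Rle_trans; [now apply HU2|]. unfold J in Hs. assert (0 <= (1 + C2) * B) by nra. nra. }
    unfold A0 in *. nra. }
  pose proof (picard_ok k u0 A0 HA0 (fun s Hs => cont_of_derive _ _ _ (u0d s Hs)) u0b) as HP.
  set (v := fun n s => fst (picard k u0 A0 (S n)) s). set (y := fun n s => snd (picard k u0 A0 (S n)) s).
  fold M in HP. assert (Hv : forall n s, J s -> is_derive (v n) s (y n s)).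
  { intros n s Hs. destruct (HP n) as [_ [_ [G _]]]. now apply G. }
  assert (Hy0 : forall s, J s -> is_derive (y O) s (- 2 * h s * y O s + k * u0 s)).
  { intros s Hs. destruct (HP O) as [_ [_ [_ [G _]]]]. now apply G. }
  assert (HyS : forall n s, J s -> is_derive (y (S n)) s (- 2 * h s * y (S n) s + k * v n s)).
  { intros n s Hs. destruct (HP (S n)) as [_ [_ [_ [G _]]]]. now apply G. }
  assert (Hw : forall s, J s -> exp (M * (s + 1/2)) <= exp M) by exact (w_le k).
  assert (Hw0 : forall s, 0 < exp (M * (s + 1/2))) by (intros; apply exp_pos).
  assert (HA2 : forall n, 0 <= A0 * (1/2) ^ n).
  { intros n. apply Rmult_le_pos; auto. apply pow_le; lra. }
  assert (E2 : forall n, A0 / 2 ^ n = A0 * (1/2) ^ n).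
  { intros n. unfold Rdiv at 2. rewrite Rmult_1_l, pow_inv. reflexivity. }
  assert (Hyb : forall n s, J s -> Rabs (y n s) <= A0 * M * exp M * (1/2) ^ n).
  { intros n s Hs. destruct (HP n) as [_ [_ [_ [_ [G _]]]]]. eapply Rle_trans; [now apply G|].
    fold M. rewrite E2. specialize (Hw s Hs). specialize (Hw0 s). specialize (HA2 n).
    replace (A0 * M * exp M * (1 / 2) ^ n) with (A0 * (1/2)^n * M * exp M) by ring.
    apply Rmult_le_compat_l; auto. apply Rmult_le_pos; lra. }
  assert (Hvb : forall n s, J s -> Rabs (v n s) <= A0 * exp M * (1/2) ^ n).
  { intros n s Hs. destruct (HP n) as [_ [_ [_ [_ [_ [G _]]]]]]. eapply Rle_trans; [now apply G|].
    rewrite E2. specialize (Hw s Hs). specialize (Hw0 s). specialize (HA2 n). fold M.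
    replace (A0 * exp M * (1 / 2) ^ n) with (A0 * (1/2)^n * exp M) by ring. apply Rmult_le_compat; lra. }
  assert (Hvb2 : forall n s, J s -> Rabs (v n s) <= A0 * M * exp M * (s + 1/2) * (1/2) ^ n).
  { intros n s Hs. destruct (HP n) as [_ [_ [_ [_ [_ [_ [G _]]]]]]]. eapply Rle_trans; [now apply G|].
    rewrite E2. fold M. right. ring. }
  assert (Hgeo : forall c, ex_series (fun n => c * (1/2) ^ n)).
  { intros c. apply (ex_series_scal (K:=R_AbsRing) c (fun n => (1/2)^n)). apply ex_series_geom. rewrite Rabs_right; lra. }
  assert (Hgeo2 : forall c, Series (fun n => c * (1/2) ^ n) = 2 * c).
  { intros c. rewrite Series_scal_l, Series_geom; [field|rewrite Rabs_right; lra]. }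
  assert (Sv : forall s, J s -> ex_series (fun n => v n s)).
  { intros s Hs. eapply ex_series_dom; [intros n; now apply Hvb|apply Hgeo]. }
  assert (Sy : forall s, J s -> ex_series (fun n => y n s)).
  { intros s Hs. eapply ex_series_dom; [intros n; now apply Hyb|apply Hgeo]. }
  set (V := fun s => Series (fun n => v n s)). set (W := fun s => Series (fun n => y n s)).
  assert (HV : forall s, J s -> is_derive V s (W s)).
  { intros s Hs. unfold V, W. apply (derive_Series v y (fun n => A0 * M * exp M * (1/2)^n) (-(1/2)) (1/4)); auto. }
  assert (HW : forall s, J s -> is_derive W s (- 2 * h s * W s + k * (u0 s + V s))).
  (* [h] is unbounded at the left end, so the derivatives are dominated on [(a, 1/4)] only. The
     source of the iterate [n] is the iterate [n - 1], with [u0] in front, whence the match on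
     [n]. *)
  { intros s Hs. set (a := (s - 1/2) / 2). assert (Ha : - (1/2) < a < s) by (unfold a, J in *; lra).
    set (z := fun n s => - 2 * h s * y n s + k * (match n with O => u0 s | S n => v n s end)).
    assert (Hz : forall n t, J t -> is_derive (y n) t (z n t)) by (intros [|n] t Ht; [now apply Hy0|now apply HyS]).
    assert (Ez : Series (fun n => z n s) = - 2 * h s * W s + k * (u0 s + V s)).
    { assert (X : ex_series (fun n => match n with O => u0 s | S n => v n s end)).
      { apply ex_series_incr_1. now apply Sv. }
      unfold z. rewrite Series_plus.
      - rewrite !Series_scal_l. f_equal. f_equal. rewrite Series_incr_1; auto.
      - apply (ex_series_scal (K:=R_AbsRing) (-2 * h s) (fun n => y n s)). now apply Sy.
      - now apply (ex_series_scal (K:=R_AbsRing) k (fun n => match n with O => u0 s | S n => v n s end)). }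
    rewrite <- Ez. unfold W. set (Hh := Ch / (a + 1/2)).
    assert (HHh : forall t, a < t < 1/4 -> Rabs (h t) <= Hh).
    { intros t Ht. eapply Rle_trans; [apply h_bound; lra|]. unfold Hh.
      apply Rmult_le_compat_l; [lra|]. apply Rinv_le_contravar; lra. }
    apply (derive_Series y z (fun n => (2 * Hh * (A0 * M * exp M) + Rabs k * (2 * A0 * exp M)) * (1/2)^n) a (1/4)); auto.
    - intros n t Ht. apply Hz. unfold J in *; lra.
    - intros n t Ht. assert (Jt : J t) by (unfold J in *; lra). unfold z. triang.
      rewrite Rmult_plus_distr_r. apply Rplus_le_compat.
      + rewrite !Rabs_mult, (Rabs_left (-2)) by lra. replace (- (-2)) with 2 by ring.
        replace (2 * Hh * (A0 * M * exp M) * (1 / 2) ^ n) with (2 * Hh * (A0 * M * exp M * (1 / 2) ^ n)) by ring.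
        apply Rmult_le_compat; auto.
        * apply Rmult_le_pos; [lra|apply Rabs_pos].
        * apply Rabs_pos.
        * specialize (HHh t Ht). lra.
      + rewrite Rabs_mult, Rmult_assoc. apply Rmult_le_compat_l; [apply Rabs_pos|]. destruct n as [|n].
        * eapply Rle_trans; [now apply u0b|]. specialize (Hw t Jt). specialize (Hw0 t). simpl.
          apply Rle_trans with (A0 * exp M); [apply Rmult_le_compat_l; lra|]. nra.
        * eapply Rle_trans; [now apply Hvb|]. simpl. right. field.
    - intros t Ht. apply Sy. unfold J in *; lra.
    - unfold J in *; lra. }
  assert (HVb : forall s, J s -> Rabs (V s) <= 2 * (A0 * exp M)).
  { intros s Hs. rewrite <- Hgeo2. apply Series_dom; auto. }
  assert (HVb2 : forall s, J s -> Rabs (V s) <= 2 * (A0 * M * exp M * (s + 1/2))).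
  { intros s Hs. rewrite <- Hgeo2. apply Series_dom; auto. }
  assert (HWb : forall s, J s -> Rabs (W s) <= 2 * (A0 * M * exp M)).
  { intros s Hs. rewrite <- Hgeo2. apply Series_dom; auto. }
  assert (HcB : 0 <= Rabs c0 + B) by lra. assert (HAL : A0 + 2 * (A0 * M * exp M) <= L * (Rabs c0 + B)).
  { unfold L. replace (A0 + 2 * (A0 * M * exp M)) with (A0 * (1 + 2 * M * exp M)) by ring.
    replace ((1 + C2) * (1 + 2 * M * exp M) * (Rabs c0 + B)) with ((1 + C2) * (Rabs c0 + B) * (1 + 2 * M * exp M)) by ring.
    apply Rmult_le_compat_r; auto. nra. }
  assert (HALp : 0 <= L * (Rabs c0 + B)) by nra.
  assert (HALp2 : 0 <= L * exp M * (Rabs c0 + B)) by (apply Rmult_le_pos; nra).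
  assert (HAM : A0 * exp M <= A0 * M * exp M).
  { rewrite (Rmult_comm A0 M), Rmult_assoc. assert (0 <= A0 * exp M) by nra. nra. }
  assert (HAM2 : A0 <= A0 * exp M) by nra. exists (fun s => u0 s + V s), (fun s => Y0 s - W s).
  split; [split; intros s Hs; derive; ring|split; [|split; [|split]]].
  - intros s Hs. triang. assert (Q1 : Rabs (u0 s) <= A0 * exp M).
    { eapply Rle_trans; [now apply u0b|]. apply Rmult_le_compat_l; auto. }
    specialize (HVb s Hs). assert (0 <= (C2 + 1) * (Rabs c0 + B)) by nra.
    replace ((C2 + 1 + 2 * L * exp M + 2 * L) * (Rabs c0 + B)) with ((C2 + 1) * (Rabs c0 + B) + 2 * (L * exp M * (Rabs c0 + B)) + 2 * (L * (Rabs c0 + B))) by ring.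
    lra.
  - intros s Hs. replace (Y0 s - W s) with (Y0 s + - W s) by ring. triang. rewrite Rabs_Ropp.
    specialize (HWb s Hs). specialize (HY0 s Hs).
    replace ((C2 + 1 + 2 * L * exp M + 2 * L) * (Rabs c0 + B)) with ((C2 + 1) * (Rabs c0 + B) + 2 * (L * exp M * (Rabs c0 + B)) + 2 * (L * (Rabs c0 + B))) by ring.
    assert (C2 * B <= (C2 + 1) * (Rabs c0 + B)) by nra. lra.
  - intros s Hs. replace (u0 s + V s - c0) with (U s + V s) by (unfold u0; ring). triang.
    assert (Q1 := HU2 s Hs). specialize (HVb2 s Hs). unfold J in Hs.
    assert (Q2 : (1 + C2) * B * (s - - (1/2)) <= (C2 + 1) * (Rabs c0 + B) * (s + 1/2)).
    { replace (s - - (1/2)) with (s + 1/2) by ring. apply Rmult_le_compat_r; [lra|]. nra. }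
    assert (Q3 : 2 * (A0 * M * exp M * (s + 1/2)) <= L * (Rabs c0 + B) * (s + 1/2)).
    { replace (2 * (A0 * M * exp M * (s + 1/2))) with (2 * (A0 * M * exp M) * (s + 1/2)) by ring.
      apply Rmult_le_compat_r; lra. }
    assert (0 <= L * exp M * (Rabs c0 + B) * (s + 1/2)) by (apply Rmult_le_pos; lra).
    assert (0 <= L * (Rabs c0 + B) * (s + 1/2)) by (apply Rmult_le_pos; lra).
    replace ((C2 + 1 + 2 * L * exp M + 2 * L) * (Rabs c0 + B) * (s + 1/2)) with ((C2 + 1) * (Rabs c0 + B) * (s + 1/2) + 2 * (L * exp M * (Rabs c0 + B) * (s + 1/2)) + 2 * (L * (Rabs c0 + B) * (s + 1/2))) by ring.
    lra.
  - intros Hk Hc Hf HF0 s Hs. assert (Y00 : forall s, J s -> Y0 s = 0).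
    { intros t Ht. assert (Rabs (Y0 t) <= C2 * 0).
      { apply HY2; auto. intros t' Ht'. rewrite HF0 by (unfold J in *; lra). rewrite Rabs_R0. unfold Rdiv; lra. }
      rewrite Rmult_0_r in H. pose proof (Rabs_pos (Y0 t)). apply Rabs_eq_0. lra. }
    assert (U00 : forall s, J s -> U s = 0).
    { intros t Ht. assert (Rabs (U t) <= 0 * (t - - (1/2))).
      { apply (antiderivative_left_bound_const U (fun s => f1 s - Y0 s) _ (1/4) ((1 + C2) * B)); auto; [lra|].
        intros t' Ht'. rewrite Hf, Y00 by (unfold J in *; lra). rewrite Rminus_0_r, Rabs_R0. lra. }
      rewrite Rmult_0_l in H. pose proof (Rabs_pos (U t)). apply Rabs_eq_0. lra. }
    assert (HPos : forall n s, J s -> 0 <= fst (picard k u0 A0 n) s).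
    { induction n as [|n IH]; intros t Ht.
      - simpl. unfold u0. rewrite U00 by auto. lra.
      - destruct (HP n) as [_ [_ [_ [_ [_ [_ [_ G]]]]]]]. now apply G. }
    assert (HPos2 : forall n s, J s -> 0 <= y n s).
    { intros n t Ht. destruct (HP n) as [_ [_ [_ [_ [_ [_ [_ G]]]]]]]. apply G; auto. }
    assert (SP : forall a : nat -> R, (forall n, 0 <= a n) -> ex_series a -> 0 <= Series a).
    { intros a Ha Hex. replace 0 with (Series (fun n => 0 * a n)) by (rewrite Series_scal_l; ring).
      apply Series_le; auto. intros n. specialize (Ha n). lra. }
    split.
    + unfold u0. rewrite U00 by auto. assert (0 <= V s) by (apply SP; auto; intros n; now apply (HPos (S n))). lra.
    + rewrite Y00 by auto. assert (0 <= W s) by (apply SP; auto). lra.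
Qed.

Variable b : R -> R.
Hypothesis h_odd : forall s, - (1/2) < s < 1/2 -> h (- s) = - h s.
Hypothesis b_cont : forall s, - (1/2) < s < 1/2 -> continuous b s.
Hypothesis b_nonneg : forall s, - (1/2) < s < 1/2 -> 0 <= b s <= 1.
Hypothesis b_even : forall s, - (1/2) < s < 1/2 -> b (- s) = b s.
Hypothesis b_pos : forall s, - (1/2) < s < - (2/5) -> 0 < b s.

Definition bounded_left (psi Y : R -> R) : Prop :=
  exists A, forall s, J s -> Rabs (psi s) <= A /\ Rabs (Y s) <= A.

(** Nondegeneracy at frequency 0, where [k = -4]: the solution regular at the left end, normalised
    to 1 there, satisfies neither a Dirichlet nor a Neumann condition at the centre. *)
Hypothesis zero_mode : forall psi Y, left_sol (-4) (fun _ => 0) (fun _ => 0) psi Y ->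
  bounded_left psi Y -> (exists A, forall s, J s -> Rabs (psi s - 1) <= A * (s + 1/2)) ->
  psi 0 <> 0 /\ Y 0 <> 0.

Lemma left_sol_lin k f1 F psi Y f1' F' psi' Y' c :
  left_sol k f1 F psi Y -> left_sol k f1' F' psi' Y' ->
  left_sol k (fun s => f1 s + c * f1' s) (fun s => F s + c * F' s)
    (fun s => psi s + c * psi' s) (fun s => Y s + c * Y' s).
Proof.
  intros [H1 H2] [H3 H4]. split; intros s Hs.
  - derive. ring.
  - derive. ring.
Qed.

(** The right half is described in the reflected variable. Since [h] is odd, [psi (- s)] and
    [- Y (- s)] solve the same system with sources [- f1 (- s)] and [F (- s)]; hence [e] is 1 for
    [psi] and -1 for [Y]. *)
Definition glued (psil psir : R -> R) (e : R) : R -> R :=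
  fun s => if Rle_dec s 0 then psil s else e * psir (- s).

Lemma derive_glued (u v v' g : R -> R) (e : R) :
  (forall s, - (1/2) < s <= 0 -> is_derive u s (g s)) -> (forall s, - (1/2) < s <= 0 -> is_derive v s (v' s)) ->
  (forall s, 0 <= s < 1/2 -> - (e * v' (- s)) = g s) -> u 0 = e * v 0 ->
  forall s, I s -> is_derive (glued u v e) s (g s).
Proof.
  intros Hu Hv He E s [H1 H2]. assert (R0 : forall s, 0 <= s < 1/2 -> is_derive (fun s => e * v (- s)) s (g s)).
  { intros r Hr. rewrite <- He by auto. eapply derive_eq; [apply derive_scal, (derive_comp v (fun s => - s));
      [apply Hv; lra|apply derive_opp, derive_id]|]. ring. }
  destruct (Rtotal_order s 0) as [h0|[->|h0]].
  - apply (is_derive_ext_loc u); [|apply Hu; lra].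
    apply (filter_imp (fun y => s - 1 < y < 0)); [|apply locally_itv; lra].
    intros r Hr. unfold glued. destruct (Rle_dec r 0); lra.
  - apply (derive_glue u (fun s => e * v (- s))); [apply Hu; lra|apply R0; lra|now rewrite Ropp_0].
  - apply (is_derive_ext_loc (fun s => e * v (- s))); [|apply R0; lra].
    apply (filter_imp (fun y => 0 < y < s + 1)); [|apply locally_itv; lra].
    intros r Hr. unfold glued. destruct (Rle_dec r 0); lra.
Qed.

Lemma glue_solutions k f1 F pl Yl pr Yr :
  left_sol k f1 F pl Yl -> left_sol k (fun s => - f1 (- s)) (fun s => F (- s)) pr Yr ->
  pl 0 = pr 0 -> Yl 0 = - Yr 0 ->
  full_sol h k f1 F (glued pl pr 1) (glued Yl Yr (-1)).
Proof.
  intros [L1 L2] [R1 R2] E1 E2. split; intros s Hs.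
  - apply (derive_glued _ _ (fun s => - Yr s + - f1 (- s)) (fun s => - glued Yl Yr (-1) s + f1 s)); auto; try lra; clear s Hs; intros s Hs.
    + unfold glued. destruct (Rle_dec s 0); [apply L1; unfold J|]; lra.
    + apply R1. unfold J; lra.
    + unfold glued. rewrite Ropp_involutive. destruct (Rle_dec s 0); [|ring].
      replace s with 0 by lra. rewrite Ropp_0, E2. ring.
  - apply (derive_glued _ _ (fun s => - 2 * h s * Yr s - k * pr s + F (- s)) (fun s => - 2 * h s * glued Yl Yr (-1) s - k * glued pl pr 1 s + F s)); auto; try lra; clear s Hs; intros s Hs.
    + unfold glued. destruct (Rle_dec s 0); [apply L2; unfold J|]; lra.
    + apply R2. unfold J; lra.
    + unfold glued. rewrite Ropp_involutive, h_odd by lra. destruct (Rle_dec s 0); [|ring].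
      replace s with 0 by lra. rewrite Ropp_0, E2, E1. ring.
Qed.

Lemma glued_bound (u v : R -> R) (e A : R) : Rabs e = 1 ->
  (forall s, - (1/2) < s <= 0 -> Rabs (u s) <= A) ->
  (forall s, - (1/2) < s <= 0 -> Rabs (v s) <= A) ->
  forall s, I s -> Rabs (glued u v e s) <= A.
Proof.
  intros He Hu Hv s Hs. unfold I in Hs. unfold glued. destruct (Rle_dec s 0).
  - apply Hu; lra.
  - rewrite Rabs_mult, He, Rmult_1_l. apply Hv; lra.
Qed.

Lemma homogeneous_left (k : R) : exists psi Y, left_sol k (fun _ => 0) (fun _ => 0) psi Y /\
  bounded_left psi Y /\ (exists A, forall s, J s -> Rabs (psi s - 1) <= A * (s + 1/2)) /\
  (0 <= k -> forall s, J s -> 1 <= psi s /\ Y s <= 0).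
Proof.
  destruct (volterra k) as [C [HC H]].
  destruct (H 1 0 (fun _ => 0) (fun _ => 0)) as [psi [Y [Q1 [Q2 [Q3 [Q4 Q5]]]]]]; try lra.
  - intros; apply continuous_const.
  - intros; apply continuous_const.
  - intros; rewrite Rabs_R0; lra.
  - intros; rewrite Rabs_R0. unfold Rdiv; lra.
  - exists psi, Y. split; auto. split; [|split].
    + exists (C * (Rabs 1 + 0)). intros s Hs. split; auto.
    + now exists (C * (Rabs 1 + 0)).
    + intros Hk. apply Q5; auto. lra.
Qed.

(** * High frequencies: Sturm comparison and bounds uniform in the frequency *)

Lemma h_lower : forall s, J s -> - (Ch / x0) <= h s.
Proof.
  intros s Hs. unfold J in Hs. assert (0 < Ch / x0) by (apply Rdiv_lt_0_compat; lra).
  destruct (Rle_dec s (-(1/2) + x0)).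
  - assert (1 / (s + 1/2) <= h s) by (apply h_near; lra).
    assert (0 < 1 / (s + 1/2)) by (apply Rdiv_lt_0_compat; lra). lra.
  - assert (H1 : Rabs (h s) <= Ch / (s + 1/2)) by (apply h_bound; lra). assert (H2 : Ch / (s + 1/2) <= Ch / x0).
    { apply Rmult_le_compat_l; [lra|]. apply Rinv_le_contravar; lra. }
    apply Rabs_le_between in H1. lra.
Qed.

(* Sturm comparison: [p^2 (- Y g - psi g')] vanishes at the left end and is nondecreasing. *)
Lemma sturm_compare k psi Y g g' g'' :
  left_sol k (fun _ => 0) (fun _ => 0) psi Y -> bounded_left psi Y ->
  (forall s, J s -> is_derive g s (g' s)) -> (forall s, J s -> is_derive g' s (g'' s)) ->
  (exists A, forall s, J s -> Rabs (g s) <= A /\ Rabs (g' s) <= A) ->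
  (forall s, J s -> 0 <= psi s * (k * g s - g'' s - 2 * h s * g' s)) ->
  forall s, J s -> 0 <= - Y s * g s - psi s * g' s.
Proof.
  intros [E1 E2] [A HA] G1 G2 [A' HA'] Hs s Js. destruct p2_linear_bound as [P [HP0 HP]].
  set (W := fun s => p s ^ 2 * (- Y s * g s - psi s * g' s)).
  assert (A0 : 0 <= A) by (eapply Rle_trans; [apply Rabs_pos|apply (HA 0); unfold J; lra]).
  assert (A0' : 0 <= A') by (eapply Rle_trans; [apply Rabs_pos|apply (HA' 0); unfold J; lra]).
  assert (H : 0 <= W s).
  { apply (antiderivative_left_nonneg W (fun s => p s ^ 2 * (psi s * (k * g s - g'' s - 2 * h s * g' s))) (-(1/2)) (1/4) (P * (2 * A * A'))); auto.
    - intros t Ht. unfold W. eapply derive_eq.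
      + apply derive_mult; [apply p2_der, J_I, Ht|].
        apply derive_minus; apply derive_mult; [apply derive_opp, E2|apply G1|apply E1|apply G2]; auto.
      + cbv beta. ring.
    - intros t Ht. unfold W. destruct (HP t Ht). destruct (HA t Ht). destruct (HA' t Ht).
      rewrite Rabs_mult, Rabs_right by lra.
      replace (P * (2 * A * A') * (t - - (1/2))) with (P * (t + 1/2) * (2 * A * A')) by ring.
      apply Rmult_le_compat; try lra; [apply Rabs_pos|].
      replace (- Y t * g t - psi t * g' t) with (- (Y t * g t + psi t * g' t)) by ring.
      rewrite Rabs_Ropp. triang. rewrite !Rabs_mult.
      assert (Rabs (Y t) * Rabs (g t) <= A * A') by (apply Rmult_le_compat; auto; apply Rabs_pos).
      assert (Rabs (psi t) * Rabs (g' t) <= A * A') by (apply Rmult_le_compat; auto; apply Rabs_pos). lra.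
    - intros t Ht. apply Rmult_le_pos; [apply pow2_ge_0|auto]. }
  unfold W in H. destruct (HP s Js) as [H0 _]. apply Rmult_le_reg_l with (p s ^ 2); lra.
Qed.

Definition high_left (k : R) (psi Y : R -> R) : Prop :=
  left_sol k (fun _ => 0) (fun _ => 0) psi Y /\ bounded_left psi Y /\
  (forall s, J s -> 1 <= psi s /\ Y s <= 0).

Lemma high_left_growth : exists kap, 0 < kap <= 1 /\ forall nu psi Y, 3 <= nu ->
  high_left (nu ^ 2) psi Y ->
  (forall y s, J y -> J s -> y <= s -> psi y <= 2 * exp (- (kap * nu) * (s - y)) * psi s) /\
  kap * nu * psi 0 <= - Y 0.
Proof.
  set (q := / (1 + 2 * Ch)). assert (Hq : 0 < q < 1).
  { unfold q. split; [apply Rinv_0_lt_compat; lra|]. rewrite <- Rinv_1. apply Rinv_lt_contravar; lra. }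
  assert (Hq2 : q ^ 2 * (1 + 2 * Ch) <= 1).
  { replace (q ^ 2 * (1 + 2 * Ch)) with q; [lra|]. unfold q. field. lra. }
  set (t0 := (exp (3 * q / 2) - exp (- (3 * q / 2))) / (exp (3 * q / 2) + exp (- (3 * q / 2)))).
  assert (Hee : exp (- (3 * q / 2)) < exp (3 * q / 2)) by (apply exp_increasing; lra).
  pose proof (exp_pos (- (3 * q / 2))) as Hep. assert (Ht0 : 0 < t0 < 1).
  { unfold t0. split; [apply Rdiv_lt_0_compat; lra|]. apply Rlt_div_l; lra. }
  exists (q * t0). split; [nra|]. intros nu psi Y Hnu [HL [HB HP]]. set (c := q * nu).
  assert (Hc : 0 < c) by (unfold c; nra). set (g := fun s => exp (c * (s + 1/2)) + exp (- c * (s + 1/2))).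
  set (g' := fun s => c * (exp (c * (s + 1/2)) - exp (- c * (s + 1/2)))). set (g'' := fun s => c ^ 2 * g s).
  assert (G1 : forall s, is_derive g s (g' s)).
  { intros s. unfold g, g'. derive. ring. }
  assert (G2 : forall s, is_derive g' s (g'' s)).
  { intros s. unfold g'', g, g'. derive. ring. }
  assert (Gp : forall s, 0 < g s) by (intros s; unfold g; pose proof (exp_pos (c * (s + 1/2))); pose proof (exp_pos (- c * (s + 1/2))); lra).
  assert (Gm : forall s, J s -> exp (- c * (s + 1/2)) <= exp (c * (s + 1/2)) <= exp c).
  { intros s Hs. unfold J in Hs. split; left; apply exp_increasing; nra. }
  assert (SC : forall s, J s -> 0 <= - Y s * g s - psi s * g' s).
  { apply (sturm_compare (nu ^ 2) psi Y g g' g''); auto.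
    - exists (2 * (1 + c) * exp c). intros s Hs. specialize (Gm s Hs). pose proof (exp_pos (- c * (s + 1/2))).
      split.
      + rewrite Rabs_right by (apply Rle_ge; left; apply Gp). unfold g. nra.
      + unfold g'. rewrite Rabs_right by (apply Rle_ge, Rmult_le_pos; lra). nra.
    - intros s Hs. apply Rmult_le_pos; [destruct (HP s Hs); lra|]. unfold g''. unfold J in Hs.
      assert (X1 : Rabs (h s) * (s + 1/2) <= Ch).
      { pose proof (h_bound s Hs). apply Rle_div_r; lra. }
      assert (X2 : g' s <= c ^ 2 * (s + 1/2) * g s).
      { unfold g', g. replace (c ^ 2 * (s + 1/2) * (exp (c * (s + 1/2)) + exp (- c * (s + 1/2))))
          with (c * (c * (s + 1/2) * (exp (c * (s + 1/2)) + exp (- (c * (s + 1/2)))))).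
        2:{ replace (- (c * (s + 1/2))) with (- c * (s + 1/2)) by ring. ring. }
        apply Rmult_le_compat_l; [lra|]. replace (- c * (s + 1/2)) with (- (c * (s + 1/2))) by ring.
        apply sinh_le_mul_cosh. nra. }
      assert (X3 : 0 <= g' s). { unfold g'. destruct (Gm s Hs). nra. }
      assert (X4 : h s * g' s <= Ch * c ^ 2 * g s).
      { apply Rle_trans with (Rabs (h s) * (c ^ 2 * (s + 1/2) * g s)).
        - apply Rle_trans with (Rabs (h s) * g' s).
          + apply Rmult_le_compat_r; auto. apply Rle_abs.
          + apply Rmult_le_compat_l; auto. apply Rabs_pos.
        - replace (Rabs (h s) * (c ^ 2 * (s + 1/2) * g s)) with (Rabs (h s) * (s + 1/2) * (c ^ 2 * g s)) by ring.
          replace (Ch * c ^ 2 * g s) with (Ch * (c ^ 2 * g s)) by ring.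
          apply Rmult_le_compat_r; auto. specialize (Gp s). nra. }
      assert (X5 : c ^ 2 * (1 + 2 * Ch) <= nu ^ 2).
      { unfold c. replace ((q * nu) ^ 2 * (1 + 2 * Ch)) with (q ^ 2 * (1 + 2 * Ch) * nu ^ 2) by ring.
        assert (0 <= nu ^ 2) by apply pow2_ge_0. nra. }
      specialize (Gp s). assert (c ^ 2 * (1 + 2 * Ch) * g s <= nu ^ 2 * g s) by (apply Rmult_le_compat_r; lra).
      nra. }
  split.
  - intros y s Jy Js Hys. assert (Mono : psi y * / g y <= psi s * / g s).
    { apply (mono_of_derive (fun s => psi s * / g s) (fun s => (- Y s * g s - psi s * g' s) / g s ^ 2) (-(1/2)) (1/4)); try (unfold J in *; lra).
      - intros x Hx. specialize (Gp x). eapply derive_eq.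
        + apply derive_mult; [apply (proj1 HL); auto|]. apply derive_inv; [apply G1|lra].
        + cbv beta. field. lra.
      - intros x Hx. apply Rmult_le_pos; [now apply SC|]. left. apply Rinv_0_lt_compat, pow_lt, Gp. }
    assert (P1 : psi y <= psi s * (g y / g s)).
    { specialize (Gp y) as Gy. specialize (Gp s) as Gs. apply Rmult_le_compat_r with (r := g y) in Mono; [|lra].
      replace (psi y * / g y * g y) with (psi y) in Mono by (field; lra).
      eapply Rle_trans; [exact Mono|]. right. field. lra. }
    eapply Rle_trans; [exact P1|]. rewrite Rmult_comm. apply Rmult_le_compat_r; [destruct (HP s Js); lra|].
    apply div_le_intro; [apply Gp|]. destruct (Gm y Jy) as [Gy _].
    apply Rle_trans with (2 * exp (c * (y + 1/2))); [unfold g; lra|].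
    apply Rle_trans with (2 * exp (- (q * t0 * nu) * (s - y)) * exp (c * (s + 1/2))).
    + rewrite Rmult_assoc, <- exp_plus. apply Rmult_le_compat_l; [lra|].
      assert (c * (y + 1/2) <= - (q * t0 * nu) * (s - y) + c * (s + 1/2)).
      { unfold c. assert (0 <= q * nu * (s - y) * (1 - t0)).
        { apply Rmult_le_pos; [apply Rmult_le_pos|]; nra. } nra. }
      destruct (Req_dec (c * (y + 1/2)) (- (q * t0 * nu) * (s - y) + c * (s + 1/2))) as [->|]; [lra|].
      left; apply exp_increasing; lra.
    + apply Rmult_le_compat_l; [pose proof (exp_pos (- (q * t0 * nu) * (s - y))); lra|].
      unfold g. pose proof (exp_pos (- c * (s + 1/2))). lra.
  - assert (J0 : J 0) by (unfold J; lra). specialize (SC 0 J0). specialize (Gp 0).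
    assert (X : q * t0 * nu * g 0 <= g' 0).
    { unfold g', g, c. replace (q * t0 * nu) with (q * nu * t0) by ring. rewrite Rmult_assoc.
      apply Rmult_le_compat_l; [nra|]. rewrite Rplus_0_l.
      set (u := q * nu * (1/2)). replace (- (q * nu) * (1/2)) with (- u) by (unfold u; ring).
      assert (Hu : 3 * q / 2 <= u) by (unfold u; nra). assert (E1 : exp (3 * q / 2) <= exp u).
      { destruct (Req_dec (3 * q / 2) u) as [->|]; [lra|]. left; apply exp_increasing; lra. }
      assert (E2 : exp (- u) <= exp (- (3 * q / 2))).
      { destruct (Req_dec (3 * q / 2) u) as [->|]; [lra|]. left; apply exp_increasing; lra. }
      apply Rmult_le_reg_r with (exp (3 * q / 2) + exp (- (3 * q / 2))); [lra|].
      unfold t0. replace ((exp (3 * q / 2) - exp (- (3 * q / 2))) / (exp (3 * q / 2) + exp (- (3 * q / 2))) * (exp u + exp (- u)) * (exp (3 * q / 2) + exp (- (3 * q / 2))))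
        with ((exp (3 * q / 2) - exp (- (3 * q / 2))) * (exp u + exp (- u))) by (field; lra).
      pose proof (exp_pos (-u)). nra. }
    destruct (HP 0 J0) as [HP0 _]. apply Rmult_le_reg_r with (g 0); auto. nra.
Qed.

(** Comparison in the opposite direction, whence the minus sign in [g], with an exponential of rate
    [nu + 2 Ch / x0]; here the lower bound of [h] decides. *)
Lemma high_left_slope : exists CA, 0 < CA /\ forall nu psi Y, 3 <= nu ->
  high_left (nu ^ 2) psi Y -> forall s, J s -> - Y s <= CA * nu * psi s.
Proof.
  set (H0 := Ch / x0). assert (HH : 0 < H0) by (unfold H0; apply Rdiv_lt_0_compat; lra).
  exists (1 + H0). split; [lra|]. intros nu psi Y Hnu [HL [HB HP]] s Js. set (c := nu + 2 * H0).
  set (g := fun s => -1 * exp (c * (s + 1/2))). set (g' := fun s => - c * exp (c * (s + 1/2))).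
  assert (G1 : forall s, is_derive g s (g' s)).
  { intros t. unfold g, g'. derive. ring. }
  assert (G2 : forall s, is_derive g' s (- c ^ 2 * exp (c * (s + 1/2)))).
  { intros t. unfold g'. derive. ring. }
  assert (SC : 0 <= - Y s * g s - psi s * g' s).
  { apply (sturm_compare (nu ^ 2) psi Y g g' (fun s => - c ^ 2 * exp (c * (s + 1/2)))); auto.
    - exists ((1 + c) * exp c). intros t Ht. unfold J in Ht.
      assert (exp (c * (t + 1/2)) <= exp c) by (left; apply exp_increasing; unfold c; nra).
      pose proof (exp_pos (c * (t + 1/2))). unfold g, g', c in *.
      rewrite !Rabs_mult, Rabs_Ropp, (Rabs_right (exp _)), (Rabs_left (-1)), (Rabs_right (nu + 2 * H0)) by lra.
      split; nra.
    - intros t Ht. destruct (HP t Ht). apply Rmult_le_pos; [lra|]. unfold g, g'.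
      pose proof (exp_pos (c * (t + 1/2))) as E. assert (X := h_lower t Ht). fold H0 in X.
      replace (nu ^ 2 * (-1 * exp (c * (t + 1 / 2))) - - c ^ 2 * exp (c * (t + 1 / 2)) - 2 * h t * (- c * exp (c * (t + 1 / 2))))
        with (exp (c * (t + 1/2)) * (c ^ 2 + 2 * h t * c - nu ^ 2)) by ring.
      apply Rmult_le_pos; [lra|]. unfold c. nra. }
  unfold g, g' in SC. pose proof (exp_pos (c * (s + 1/2))) as E. destruct (HP s Js).
  assert (X : - Y s <= c * psi s).
  { apply Rmult_le_reg_r with (exp (c * (s + 1/2))); auto. nra. }
  eapply Rle_trans; [exact X|]. apply Rmult_le_compat_r; [lra|]. unfold c. nra.
Qed.

(** The quantity is a Wronskian: multiplied by [p^2] it has derivative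
    [p^2 (psiL (G + N f4) - YL f1)]. The sources cost a factor [nu], through [N] and through
    [|YL| <= CA nu psiL], but [psiL] decays to the left of [s] at rate [kap nu], and the integral of
    [nu exp (- kap nu (s - y))] is bounded. This is where uniformity in the frequency is won. *)
Lemma high_left_flux : exists C, 0 < C /\ forall nu N psiL YL, 3 <= nu -> 0 <= N <= 2 * nu ->
  high_left (nu ^ 2) psiL YL ->
  forall B f1 G f4 psi Y, 0 <= B ->
  left_sol (nu ^ 2) f1 (fun s => G s + N * f4 s) psi Y -> bounded_left psi Y ->
  (forall s, J s -> Rabs (f1 s) <= B) -> (forall s, J s -> Rabs (G s) <= B / (s + 1/2)) ->
  (forall s, J s -> Rabs (f4 s) <= B) ->
  forall s, J s -> Rabs (psiL s * Y s - YL s * psi s) <= C * B * psiL s.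
Proof.
  destruct high_left_growth as [kap [Hkap HG]]. destruct high_left_slope as [CA [HCA HS]].
  pose proof C2_ge1 as HC2. destruct p2_linear_bound as [P [HP0 HP]].
  exists (2 * C2 * (1 + (2 + CA) / kap)). split.
  { assert (0 < (2 + CA) / kap) by (apply Rdiv_lt_0_compat; lra). nra. }
  intros nu N psiL YL Hnu HN HL B f1 G f4 psi Y HB [E1 E2] [A HA] Hf1 HGb Hf4 s Js.
  destruct (HG nu psiL YL Hnu HL) as [Hdec _]. specialize (HS nu psiL YL Hnu HL).
  destruct HL as [[L1 L2] [[AL HAL] Hpos]]. set (W := fun s => p s ^ 2 * (psiL s * Y s - YL s * psi s)).
  set (W' := fun s => p s ^ 2 * (psiL s * (G s + N * f4 s) - YL s * f1 s)).
  assert (HW : forall t, J t -> is_derive W t (W' t)).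
  { intros t Ht. unfold W, W'. eapply derive_eq.
    - apply derive_mult; [apply p2_der, J_I, Ht|].
      apply derive_minus; apply derive_mult; [apply L1|apply E2|apply L2|apply E1]; auto.
    - cbv beta. ring. }
  assert (A0 : 0 <= A) by (eapply Rle_trans; [apply Rabs_pos|apply (HA 0); unfold J; lra]).
  assert (AL0 : 0 <= AL) by (eapply Rle_trans; [apply Rabs_pos|apply (HAL 0); unfold J; lra]).
  assert (HWb : forall t, J t -> Rabs (W t) <= P * (2 * A * AL) * (t - - (1/2))).
  { intros t Ht. unfold W. destruct (HP t Ht). destruct (HA t Ht). destruct (HAL t Ht).
    rewrite Rabs_mult, Rabs_right by lra.
    replace (P * (2 * A * AL) * (t - - (1/2))) with (P * (t + 1/2) * (2 * A * AL)) by ring.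
    apply Rmult_le_compat; try lra; [apply Rabs_pos|].
    replace (psiL t * Y t - YL t * psi t) with (psiL t * Y t + - (YL t * psi t)) by ring.
    triang. rewrite Rabs_Ropp, !Rabs_mult.
    assert (Rabs (psiL t) * Rabs (Y t) <= AL * A) by (apply Rmult_le_compat; auto; apply Rabs_pos).
    assert (Rabs (YL t) * Rabs (psi t) <= AL * A) by (apply Rmult_le_compat; auto; apply Rabs_pos). lra. }
  set (c := kap * nu). assert (Hc : 0 < c) by (unfold c; nra).
  destruct (HP s Js) as [Hps _]. destruct (Hpos s Js) as [HLs _]. set (K := 2 * C2 * p s ^ 2 * psiL s).
  assert (HK : 0 < K) by (unfold K; apply Rmult_lt_0_compat; nra).
  set (Q := (N + CA * nu) * B). assert (HQ : 0 <= Q) by (unfold Q; apply Rmult_le_pos; nra). unfold J in Js.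
  (* A primitive of the majorant: the linear part accounts for [G], the exponential part for the
     terms of size [nu B]. *)
  set (g := fun y => K * (B / (s + 1/2) * (y + 1/2) + Q / c * exp (- c * (s - y)))).
  set (g' := fun y => K * (B / (s + 1/2) + Q * exp (- c * (s - y)))).
  assert (HBs : 0 <= B / (s + 1/2)) by (apply le_div_intro; lra).
  assert (HQc : 0 <= Q / c) by (apply le_div_intro; lra). assert (HWs : Rabs (W s) <= g s).
  { apply (antiderivative_left_bound W W' g g' (-(1/2)) (1/4) (P * (2 * A * AL))); auto.
    - intros t Ht. unfold g, g'. auto_derive; auto. replace (- c * (s + - t)) with (- c * (s - t)) by ring. field. lra.
    - intros t Ht. unfold g. apply Rmult_le_pos; [lra|]. apply Rplus_le_le_0_compat.
      + apply Rmult_le_pos; lra.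
      + apply Rmult_le_pos; auto. left; apply exp_pos.
    - intros t Ht. assert (Jt : J t) by (unfold J; lra).
      unfold W', g'. destruct (HP t Jt) as [Hpt _]. destruct (Hpos t Jt) as [HLt HYt].
      rewrite Rabs_mult, (Rabs_right (p t ^ 2)) by lra. assert (HYa : Rabs (YL t) <= CA * nu * psiL t).
      { rewrite Rabs_left1 by lra. now apply HS. }
      assert (X1 : Rabs (psiL t * (G t + N * f4 t) - YL t * f1 t) <= psiL t * (B / (t + 1/2)) + psiL t * Q).
      { replace (psiL t * (G t + N * f4 t) - YL t * f1 t) with (psiL t * G t + (psiL t * (N * f4 t) + - (YL t * f1 t))) by ring.
        triang. apply Rplus_le_compat.
        - rewrite Rabs_mult, (Rabs_right (psiL t)) by lra. apply Rmult_le_compat_l; [lra|now apply HGb].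
        - triang. unfold Q.
          replace (psiL t * ((N + CA * nu) * B)) with (psiL t * (N * B) + CA * nu * psiL t * B) by ring.
          apply Rplus_le_compat.
          + rewrite Rabs_mult, (Rabs_right (psiL t)) by lra. apply Rmult_le_compat_l; [lra|].
            rewrite Rabs_mult, (Rabs_right N) by lra. apply Rmult_le_compat_l; [lra|now apply Hf4].
          + rewrite Rabs_Ropp, Rabs_mult. apply Rmult_le_compat; auto; apply Rabs_pos. }
      assert (Hd := Hdec t s Jt Js ltac:(lra)). fold c in Hd.
      assert (Hx := C2_spec t s ltac:(lra) ltac:(lra) ltac:(lra)). assert (Hx2 := C2_spec' t s ltac:(lra) ltac:(lra) ltac:(lra)).
      pose proof (exp_pos (- c * (s - t))) as Ep. assert (Ep1 : exp (- c * (s - t)) <= 1).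
      { rewrite <- exp_0. destruct (Req_dec t s) as [->|]; [rewrite Rminus_diag, Rmult_0_r; lra|].
        left; apply exp_increasing. nra. }
      assert (Hd1 : psiL t <= 2 * psiL s).
      { eapply Rle_trans; [exact Hd|]. apply Rmult_le_compat_r; lra. }
      apply Rle_trans with (p t ^ 2 * (psiL t * (B / (t + 1/2)) + psiL t * Q)).
      { apply Rmult_le_compat_l; lra. }
      assert (Y1 : p t ^ 2 * (psiL t * (B / (t + 1/2))) <= K * (B / (s + 1/2))).
      { replace (p t ^ 2 * (psiL t * (B / (t + 1/2)))) with (p t ^ 2 / (t + 1/2) * psiL t * B) by (field; lra).
        replace (K * (B / (s + 1/2))) with (C2 * (p s ^ 2 / (s + 1/2)) * (2 * psiL s) * B) by (unfold K; field; lra).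
        apply Rmult_le_compat_r; auto. apply Rmult_le_compat; auto; try lra. apply le_div_intro; lra. }
      assert (Y2 : p t ^ 2 * (psiL t * Q) <= K * (Q * exp (- c * (s - t)))).
      { replace (p t ^ 2 * (psiL t * Q)) with (p t ^ 2 * psiL t * Q) by ring.
        replace (K * (Q * exp (- c * (s - t)))) with (C2 * p s ^ 2 * (2 * exp (- c * (s - t)) * psiL s) * Q) by (unfold K; ring).
        apply Rmult_le_compat_r; auto. apply Rmult_le_compat; lra. }
      lra. }
  unfold W in HWs. rewrite Rabs_mult, (Rabs_right (p s ^ 2)) in HWs by lra.
  apply Rmult_le_reg_l with (p s ^ 2); auto. eapply Rle_trans; [exact HWs|].
  unfold g. rewrite Rminus_diag, Rmult_0_r, exp_0. replace (B / (s + 1/2) * (s + 1/2)) with B by (field; lra).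
  assert (Qb : Q / c <= (2 + CA) / kap * B).
  { apply div_le_intro; auto. unfold Q, c.
    replace ((2 + CA) / kap * B * (kap * nu)) with ((2 + CA) * nu * B) by (field; lra).
    apply Rmult_le_compat_r; auto. nra. }
  replace (p s ^ 2 * (2 * C2 * (1 + (2 + CA) / kap) * B * psiL s)) with (K * (B + (2 + CA) / kap * B)) by (unfold K; ring).
  apply Rmult_le_compat_l; lra.
Qed.

(** A half interval leaves one free parameter, the value [v] at the centre. [A = - YL 0 / psiL 0] is
    its Dirichlet-to-Neumann coefficient, at least of size [nu], and [z] is the value of [Y] at 0
    for [v = 0]. The Wronskian controls the derivative of [psi / psiL]; integrating it from [s] to 0
    bounds [psi] with a gain of [nu]. *)
Lemma half_high : exists C c, 0 < C /\ 0 < c /\ forall nu N, 3 <= nu -> 0 <= N <= 2 * nu ->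
  exists A, c * nu <= A /\ forall B f1 G f4, 0 <= B ->
  (forall s, J s -> continuous f1 s) -> (forall s, J s -> continuous G s) ->
  (forall s, J s -> continuous f4 s) ->
  (forall s, J s -> Rabs (f1 s) <= B) -> (forall s, J s -> Rabs (G s) <= B / (s + 1/2)) ->
  (forall s, J s -> Rabs (f4 s) <= B) ->
  exists z, Rabs z <= C * B /\ forall v, exists psi Y,
    left_sol (nu ^ 2) f1 (fun s => G s + N * f4 s) psi Y /\ psi 0 = v /\ Y 0 = z - A * v /\
    (forall s, - (1/2) < s <= 0 -> nu * Rabs (psi s) <= C * (B + nu * Rabs v)) /\
    (forall s, - (1/2) < s <= 0 -> Rabs (Y s) <= C * (B + nu * Rabs v)).
Proof.
  destruct high_left_growth as [kap [Hkap HG]]. destruct high_left_slope as [CA [HCA HS]].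
  destruct high_left_flux as [C [HC HF]]. set (C1 := 2 + 2 * (C + 1) / kap).
  assert (HC1 : 2 < C1). { unfold C1. assert (0 < 2 * (C + 1) / kap) by (apply Rdiv_lt_0_compat; lra). lra. }
  exists (C + C1 + CA * C1), kap. split; [nra|split; [lra|]]. intros nu N Hnu HN.
  destruct (homogeneous_left (nu ^ 2)) as [psiL [YL [HL1 [HL2 [_ HL3]]]]].
  assert (HL : high_left (nu ^ 2) psiL YL).
  { split; [auto|split; auto]. apply HL3. apply pow2_ge_0. }
  destruct (HG nu psiL YL Hnu HL) as [Hdec Hslope0]. specialize (HS nu psiL YL Hnu HL).
  assert (J0 : J 0) by (unfold J; lra).
  assert (Hpos : forall s, J s -> 1 <= psiL s) by (intros s Hs; apply HL; auto).
  assert (Hneg : forall s, J s -> YL s <= 0) by (intros s Hs; apply HL; auto). pose proof (Hpos 0 J0) as P0.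
  exists (- YL 0 / psiL 0). split.
  { apply le_div_intro; lra. }
  intros B f1 G f4 HB Hc1 HcG Hc4 Hb1 HbG Hb4. set (F := fun s => G s + N * f4 s).
  (* The constant [CV] depends on [nu]; it gives existence and boundedness, while the uniform bounds
     come from the Wronskian. *)
  assert (HNB : 0 <= N * B) by (apply Rmult_le_pos; lra). destruct (volterra (nu ^ 2)) as [CV [HCV HV]].
  destruct (HV 0 (B + N * B) f1 F) as [psiP [YP [SP [BP1 [BP2 _]]]]].
  { lra. }
  { auto. }
  { intros s Hs. apply continuous_Rplus; auto. apply continuous_Rmult; auto. apply continuous_const. }
  { intros s Hs. specialize (Hb1 s Hs). lra. }
  { intros s Hs. unfold F. triang.
    replace ((B + N * B) / (s + 1/2)) with (B / (s + 1/2) + N * B / (s + 1/2)) by (field; unfold J in Hs; lra).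
    apply Rplus_le_compat; [auto|]. rewrite Rabs_mult, (Rabs_right N) by lra.
    unfold J in Hs. apply le_div_intro; [lra|].
    assert (N * Rabs (f4 s) <= N * B) by (apply Rmult_le_compat_l; [lra|apply Hb4; auto]).
    assert (0 <= N * Rabs (f4 s)) by (apply Rmult_le_pos; [lra|apply Rabs_pos]). apply Rmult_shrink; lra. }
  set (z := (psiL 0 * YP 0 - YL 0 * psiP 0) / psiL 0). exists z.
  assert (bl : forall c, bounded_left (fun s => psiP s + c * psiL s) (fun s => YP s + c * YL s)).
  { intros c. destruct HL2 as [AL HAL].
    exists (CV * (Rabs 0 + (B + N * B)) + Rabs c * AL). intros s Hs. destruct (HAL s Hs).
    split; (triang); apply Rplus_le_compat; auto;
      rewrite Rabs_mult; apply Rmult_le_compat_l; auto; apply Rabs_pos. }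
  assert (solc : forall c, left_sol (nu ^ 2) f1 F (fun s => psiP s + c * psiL s) (fun s => YP s + c * YL s)).
  { intros c. assert (X := left_sol_lin _ _ _ _ _ _ _ _ _ c SP HL1). destruct X as [X1 X2]. split; intros s Hs.
    - derive. ring.
    - derive. ring. }
  assert (flux : forall c s, J s -> Rabs (psiL s * (YP s + c * YL s) - YL s * (psiP s + c * psiL s)) <= C * B * psiL s).
  { intros c. apply (HF nu N psiL YL Hnu HN HL B f1 G f4 (fun s => psiP s + c * psiL s) (fun s => YP s + c * YL s)); auto. }
  assert (Hz : Rabs z <= C * B).
  { unfold z. rewrite Rabs_div by lra. rewrite (Rabs_right (psiL 0)) by lra.
    apply div_le_intro; [lra|]. specialize (flux 0 0 J0).
    replace (psiL 0 * YP 0 - YL 0 * psiP 0) with (psiL 0 * (YP 0 + 0 * YL 0) - YL 0 * (psiP 0 + 0 * psiL 0)) by ring. auto. }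
  split. { assert (0 <= (C1 + CA * C1) * B) by (apply Rmult_le_pos; nra). lra. }
  intros v. set (c := (v - psiP 0) / psiL 0). exists (fun s => psiP s + c * psiL s), (fun s => YP s + c * YL s).
  split; [apply solc|]. assert (Ev : psiP 0 + c * psiL 0 = v) by (unfold c; field; lra).
  split; [exact Ev|]. split; [unfold c, z; field; lra|].
  set (psi := fun s => psiP s + c * psiL s) in *. set (Y := fun s => YP s + c * YL s) in *.
  assert (Hpsi : forall s, - (1/2) < s <= 0 -> nu * Rabs (psi s) <= C1 * (B + nu * Rabs v)).
  { intros s Hs. assert (Js : J s) by (unfold J; lra).
    set (kn := kap * nu). assert (Hkn : 0 < kn) by (unfold kn; nra). set (K := 2 * (C + 1) * B / psiL s).
    specialize (Hpos s Js) as Ps.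
    assert (Q : Rabs (psi 0 * / psiL 0 - psi s * / psiL s) <= - (K / kn * exp (- kn * (0 - s))) - - (K / kn * exp (- kn * (s - s)))).
    { apply (cmp_of_derive_closed (fun y => psi y * / psiL y) (fun y => (f1 y - (psiL y * Y y - YL y * psi y) / psiL y) / psiL y)
         (fun y => - (K / kn * exp (- kn * (y - s)))) (fun y => K * exp (- kn * (y - s)))); try lra.
      - intros y Hy. assert (Jy : J y) by (unfold J; lra). assert (Py : 1 <= psiL y) by (apply HL; auto).
        eapply derive_eq.
        + apply derive_mult; [apply (proj1 (solc c)); auto|]. apply derive_inv; [apply (proj1 HL1); auto|lra].
        + cbv beta. fold (Y y). fold (psi y). field. lra.
      - intros y Hy. auto_derive; auto. replace (y + - s) with (y - s) by ring. field. lra.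
      - intros y Hy. assert (Jy : J y) by (unfold J; lra). assert (Py : 1 <= psiL y) by (apply HL; auto).
        rewrite Rabs_div, (Rabs_right (psiL y)) by lra. apply div_le_intro; [lra|].
        assert (X : Rabs (f1 y - (psiL y * Y y - YL y * psi y) / psiL y) <= (C + 1) * B).
        { unfold Rminus at 1. triang. rewrite Rabs_Ropp, Rabs_div, (Rabs_right (psiL y)) by lra.
          assert (Rabs (psiL y * Y y - YL y * psi y) / psiL y <= C * B).
          { apply div_le_intro; [lra|]. now apply flux. }
          specialize (Hb1 y Jy). lra. }
        eapply Rle_trans; [exact X|]. assert (D := Hdec s y Js Jy ltac:(lra)). fold kn in D.
        replace (K * exp (- kn * (y - s)) * psiL y) with ((C + 1) * B * (2 * exp (- kn * (y - s)) * psiL y / psiL s)) by (unfold K; field; lra).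
        rewrite <- (Rmult_1_r ((C + 1) * B)) at 1. apply Rmult_le_compat_l; [nra|]. apply le_div_intro; lra. }
    rewrite Rminus_diag, Rmult_0_r, exp_0 in Q. assert (HK : 0 <= K) by (unfold K; apply le_div_intro; nra).
    assert (HKn : 0 <= K / kn) by (apply le_div_intro; lra). pose proof (exp_pos (- kn * (0 - s))) as E0.
    assert (Q2 : Rabs (psi 0 * / psiL 0 - psi s * / psiL s) <= K / kn) by nra.
    assert (D0 := Hdec s 0 Js J0 ltac:(lra)). fold kn in D0. assert (E01 : exp (- kn * (0 - s)) <= 1).
    { rewrite <- exp_0. destruct (Req_dec s 0) as [->|]; [rewrite Rminus_diag, Rmult_0_r; lra|].
      left; apply exp_increasing. nra. }
    assert (D1 : psiL s <= 2 * psiL 0).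
    { eapply Rle_trans; [exact D0|]. apply Rmult_le_compat_r; lra. }
    assert (Q3 : Rabs (psi s) <= 2 * Rabs v + psiL s * (K / kn)).
    { replace (psi s) with (psi 0 * (psiL s / psiL 0) + - (psiL s * (psi 0 * / psiL 0 - psi s * / psiL s))) by (field; lra).
      triang. apply Rplus_le_compat.
      - assert (psi 0 = v) by exact Ev. rewrite H, Rabs_mult, (Rmult_comm 2). apply Rmult_le_compat_l; [apply Rabs_pos|].
        rewrite Rabs_right; [apply div_le_intro; lra|]. apply Rle_ge, le_div_intro; lra.
      - rewrite Rabs_Ropp, Rabs_mult, (Rabs_right (psiL s)) by lra. apply Rmult_le_compat_l; lra. }
    replace (psiL s * (K / kn)) with (2 * (C + 1) / kap * B / nu) in Q3 by (unfold K, kn; field; lra).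
    apply Rle_trans with (nu * (2 * Rabs v + 2 * (C + 1) / kap * B / nu)).
    { apply Rmult_le_compat_l; lra. }
    replace (nu * (2 * Rabs v + 2 * (C + 1) / kap * B / nu)) with (2 * (nu * Rabs v) + 2 * (C + 1) / kap * B) by (field; lra).
    assert (0 <= nu * Rabs v) by (apply Rmult_le_pos; [lra|apply Rabs_pos]).
    unfold C1. assert (0 <= 2 * (C + 1) / kap) by (apply le_div_intro; lra).
    assert (0 <= 2 * (C + 1) / kap * (nu * Rabs v)) by (apply Rmult_le_pos; lra). lra. }
  assert (Hv0 : 0 <= B + nu * Rabs v).
  { assert (0 <= nu * Rabs v) by (apply Rmult_le_pos; [lra|apply Rabs_pos]). lra. }
  split.
  - intros s Hs. eapply Rle_trans; [exact (Hpsi s Hs)|]. apply Rmult_le_compat_r; auto. nra.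
  - intros s Hs. assert (Js : J s) by (unfold J; lra). specialize (Hpos s Js) as Ps.
    assert (Fl : Rabs (psiL s * Y s - YL s * psi s) <= C * B * psiL s) by exact (flux c s Js).
    change (Rabs (Y s) <= (C + C1 + CA * C1) * (B + nu * Rabs v)).
    replace (Y s) with ((psiL s * Y s - YL s * psi s) / psiL s + YL s / psiL s * psi s) by (field; lra). triang.
    rewrite (Rabs_mult (YL s / psiL s)), !Rabs_div, (Rabs_right (psiL s)) by lra.
    assert (X1 : Rabs (psiL s * Y s - YL s * psi s) / psiL s <= C * B) by (apply div_le_intro; lra).
    assert (X2 : Rabs (YL s) / psiL s <= CA * nu).
    { apply div_le_intro; [lra|]. rewrite Rabs_left1 by (apply Hneg; auto). now apply HS. }
    assert (X3 : Rabs (YL s) / psiL s * Rabs (psi s) <= CA * (C1 * (B + nu * Rabs v))).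
    { apply Rle_trans with (CA * nu * Rabs (psi s)).
      - apply Rmult_le_compat_r; [apply Rabs_pos|auto].
      - rewrite Rmult_assoc. apply Rmult_le_compat_l; [lra|]. now apply Hpsi. }
    assert (0 <= C1 * (B + nu * Rabs v)) by (apply Rmult_le_pos; lra). assert (C * B <= C * (B + nu * Rabs v)).
    { apply Rmult_le_compat_l; [lra|]. assert (0 <= nu * Rabs v) by (apply Rmult_le_pos; [lra|apply Rabs_pos]). lra. }
    lra.
Qed.

Lemma weight_left s : J s -> forall B G, 0 <= B -> Rabs G <= B / (1/4 - s ^ 2) -> Rabs G <= 4 * B / (s + 1/2).
Proof.
  unfold J. intros Hs B G HB H. eapply Rle_trans; [exact H|]. assert (0 < 1/4 - s ^ 2) by nra.
  apply div_le_intro; auto. replace (4 * B / (s + 1/2) * (1/4 - s ^ 2)) with (B * (4 * (1/2 - s))) by (field; lra).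
  nra.
Qed.

Lemma cont_neg (f : R -> R) : (forall s, I s -> continuous f s) -> forall s, J s -> continuous (fun s => f (- s)) s.
Proof.
  intros H s Hs. apply (continuous_comp (fun s => - s) f).
  - apply continuous_Ropp, continuous_id.
  - apply H. unfold I, J in *; lra.
Qed.

(** Both halves have the same [A], since the homogeneous problem is invariant under reflection.
    Matching [Y] at 0 reads [zl - A v = - (zr - A v)], so [v = (zl + zr) / (2 A)], and [A >= c nu]
    bounds [nu |v|] by the data. *)
Lemma solve_high : exists C, 0 < C /\ forall nu N, 3 <= nu -> 0 <= N <= 2 * nu ->
  forall B f1 G f4, 0 <= B ->
  (forall s, I s -> continuous f1 s) -> (forall s, I s -> continuous G s) ->
  (forall s, I s -> continuous f4 s) ->
  (forall s, I s -> Rabs (f1 s) <= B) -> (forall s, I s -> Rabs (G s) <= B / (1/4 - s ^ 2)) ->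
  (forall s, I s -> Rabs (f4 s) <= B) ->
  exists psi Y, full_sol h (nu ^ 2) f1 (fun s => G s + N * f4 s) psi Y /\
    (forall s, I s -> nu * Rabs (psi s) <= C * B) /\ (forall s, I s -> Rabs (Y s) <= C * B).
Proof.
  destruct half_high as [C [c [HC [Hc H]]]]. set (C' := 4 * C * (1 + C / c)).
  assert (HCc : 0 < C / c) by (apply Rdiv_lt_0_compat; lra). exists C'. split; [unfold C'; nra|].
  intros nu N Hnu HN B f1 G f4 HB c1 cG c4 b1 bG b4. destruct (H nu N Hnu HN) as [A [HA HH]].
  destruct (HH (4 * B) f1 G f4) as [zl [Hzl HL]]; try lra.
  { intros; apply c1, J_I; auto. } { intros; apply cG, J_I; auto. } { intros; apply c4, J_I; auto. }
  { intros s Hs. specialize (b1 s (J_I s Hs)). lra. }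
  { intros s Hs. apply weight_left; auto. apply bG, J_I; auto. }
  { intros s Hs. specialize (b4 s (J_I s Hs)). lra. }
  assert (In : forall s, J s -> I (- s)) by (unfold I, J; intros; lra).
  destruct (HH (4 * B) (fun s => - f1 (- s)) (fun s => G (- s)) (fun s => f4 (- s))) as [zr [Hzr HR]]; try lra.
  { intros; apply continuous_Ropp, cont_neg; auto. } { intros; apply cont_neg; auto. } { intros; apply cont_neg; auto. }
  { intros s Hs. rewrite Rabs_Ropp. specialize (b1 (-s) (In s Hs)). lra. }
  { intros s Hs. apply weight_left; auto. specialize (bG (-s) (In s Hs)). now replace ((- s) ^ 2) with (s ^ 2) in bG by ring. }
  { intros s Hs. specialize (b4 (-s) (In s Hs)). lra. }
  assert (HA0 : 0 < A) by nra. set (v := (zl + zr) / (2 * A)). assert (Hv : nu * Rabs v <= 4 * C / c * B).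
  { unfold v. rewrite Rabs_div, (Rabs_right (2 * A)) by lra.
    replace (nu * (Rabs (zl + zr) / (2 * A))) with (nu * Rabs (zl + zr) / (2 * A)) by (field; lra).
    apply div_le_intro; [lra|]. assert (Rabs (zl + zr) <= 8 * C * B) by (triang; lra).
    apply Rle_trans with (nu * (8 * C * B)); [apply Rmult_le_compat_l; lra|].
    replace (nu * (8 * C * B)) with (4 * C / c * B * (2 * (c * nu))) by (field; lra).
    apply Rmult_le_compat_l; [|lra]. apply Rmult_le_pos; auto. apply le_div_intro; lra. }
  destruct (HL v) as [pl [Yl [SL [El1 [El2 [Bl1 Bl2]]]]]].
  destruct (HR v) as [pr [Yr [SR [Er1 [Er2 [Br1 Br2]]]]]].
  destruct (glue_solutions (nu ^ 2) f1 (fun s => G s + N * f4 s) pl Yl pr Yr SL SR) as [S1 S2].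
  { congruence. } { rewrite El2, Er2. unfold v. field. lra. }
  assert (HCB : C * (4 * B + nu * Rabs v) <= C' * B).
  { unfold C'. apply Rle_trans with (C * (4 * B + 4 * C / c * B)); [apply Rmult_le_compat_l; lra|].
    right. field. lra. }
  exists (glued pl pr 1), (glued Yl Yr (-1)). split; [split; auto|]. split.
  - intros s Hs. rewrite Rmult_comm. apply Rle_div_r; [lra|].
    apply (glued_bound pl pr 1); auto; [apply Rabs_R1| |]; intros t Ht; apply le_div_intro; try lra; rewrite Rmult_comm.
    + specialize (Bl1 t Ht). lra.
    + specialize (Br1 t Ht). lra.
  - intros s Hs. apply (glued_bound Yl Yr (-1)); auto.
    + rewrite Rabs_left; lra.
    + intros t Ht. specialize (Bl2 t Ht). lra.
    + intros t Ht. specialize (Br2 t Ht). lra.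
Qed.

(** * The frequencies 0 and 2, and the solver for all frequencies *)

Definition source (on : R -> Prop) (B : R) (f1 G : R -> R) : Prop := forall s, on s ->
  continuous f1 s /\ continuous G s /\ Rabs (f1 s) <= B /\ Rabs (G s) <= B / (1/4 - s ^ 2).

Lemma source_halves B f1 G : source I B f1 G ->
  source J B f1 G /\ source J B (fun s => - f1 (- s)) (fun s => G (- s)).
Proof.
  intros H. split; intros s Hs; [apply H, J_I, Hs|]. destruct (H (- s)) as [_ [_ [H3 H4]]]; [unfold I, J in *; lra|].
  split; [|split; [|split]].
  - apply continuous_Ropp, cont_neg; auto. intros; now apply H.
  - apply cont_neg; auto. intros; now apply H.
  - now rewrite Rabs_Ropp.
  - now replace ((- s) ^ 2) with (s ^ 2) in H4 by ring.
Qed.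

Lemma left_data k : exists C, 0 < C /\ forall B f1 G, 0 <= B -> source J B f1 G ->
  exists psi Y, left_sol k f1 G psi Y /\ (forall s, J s -> Rabs (psi s) <= C * B) /\
    (forall s, J s -> Rabs (Y s) <= C * B).
Proof.
  destruct (volterra k) as [C [HC H]]. exists (4 * C). split; [lra|]. intros B f1 G HB S.
  destruct (H 0 (4 * B) f1 G) as [psi [Y [Q1 [Q2 [Q3 _]]]]]; try lra; try (intros s Hs; destruct (S s Hs) as [X1 [X2 [X3 X4]]]).
  - exact X1.
  - exact X2.
  - lra.
  - apply weight_left; auto.
  - exists psi, Y. rewrite Rabs_R0 in Q2, Q3. split; auto.
    split; intros s Hs; [specialize (Q2 s Hs)|specialize (Q3 s Hs)]; lra.
Qed.

(** Multiples [cl] and [cr] of the regular homogeneous solution are added to the two halves. The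
    jump of [psi] at 0 fixes [cl - cr] and that of [Y] fixes [cl + cr], because [psiL 0] and [YL 0]
    are nonzero. *)
Lemma solve_zero : exists C, 0 < C /\
  forall B f1 G, 0 <= B -> source I B f1 G ->
  exists psi Y, full_sol h (-4) f1 G psi Y /\
    (forall s, I s -> Rabs (psi s) <= C * B) /\ (forall s, I s -> Rabs (Y s) <= C * B).
Proof.
  destruct (left_data (-4)) as [C [HC HD]]. destruct (homogeneous_left (-4)) as [psiL [YL [L1 [L2 [L3 _]]]]].
  destruct (zero_mode psiL YL L1 L2 L3) as [N1 N2]. destruct L2 as [AL HAL].
  assert (AL0 : 0 <= AL) by (eapply Rle_trans; [apply Rabs_pos|apply (HAL 0); unfold J; lra]).
  set (m1 := C / Rabs (psiL 0)). set (m2 := C / Rabs (YL 0)).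
  assert (P1 : 0 < Rabs (psiL 0)) by (now apply Rabs_pos_lt).
  assert (P2 : 0 < Rabs (YL 0)) by (now apply Rabs_pos_lt).
  assert (M1 : 0 < m1) by (apply Rdiv_lt_0_compat; lra). assert (M2 : 0 < m2) by (apply Rdiv_lt_0_compat; lra).
  exists (C + (m1 + m2) * AL). split; [nra|].
  intros B f1 G HB S. apply source_halves in S. destruct S as [S1 S2].
  destruct (HD B _ _ HB S1) as [pl [Yl [SL [Bl1 Bl2]]]]. destruct (HD B _ _ HB S2) as [pr [Yr [SR [Br1 Br2]]]].
  clear S1 S2. set (d := (pr 0 - pl 0) / psiL 0). set (e := - (Yl 0 + Yr 0) / YL 0).
  set (cl := (d + e) / 2). set (cr := (e - d) / 2). assert (J0 : J 0) by (unfold J; lra).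
  assert (Hd : Rabs d <= 2 * m1 * B).
  { unfold d. rewrite Rabs_div by auto. apply div_le_intro; auto. unfold m1.
    replace (2 * (C / Rabs (psiL 0)) * B * Rabs (psiL 0)) with (2 * C * B) by (field; lra).
    unfold Rminus. triang. rewrite Rabs_Ropp. specialize (Bl1 0 J0). specialize (Br1 0 J0). lra. }
  assert (He : Rabs e <= 2 * m2 * B).
  { unfold e. rewrite Rabs_div by auto. apply div_le_intro; auto. unfold m2.
    replace (2 * (C / Rabs (YL 0)) * B * Rabs (YL 0)) with (2 * C * B) by (field; lra).
    rewrite Rabs_Ropp. triang. specialize (Bl2 0 J0). specialize (Br2 0 J0). lra. }
  assert (Hcl : Rabs cl <= (m1 + m2) * B).
  { unfold cl. rewrite Rabs_div, (Rabs_right 2) by lra. apply div_le_intro; [lra|]. triang. lra. }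
  assert (Hcr : Rabs cr <= (m1 + m2) * B).
  { unfold cr. rewrite Rabs_div, (Rabs_right 2) by lra. apply div_le_intro; [lra|].
    unfold Rminus. triang. rewrite Rabs_Ropp. lra. }
  assert (Sol : forall f F p' Y' c, left_sol (-4) f F p' Y' -> left_sol (-4) f F (fun s => p' s + c * psiL s) (fun s => Y' s + c * YL s)).
  { intros f F p' Y' c' S. destruct (left_sol_lin _ _ _ _ _ _ _ _ _ c' S L1) as [X1 X2]. split; intros s Hs.
    - derive. ring.
    - derive. ring. }
  destruct (glue_solutions (-4) f1 G _ _ _ _ (Sol _ _ _ _ cl SL) (Sol _ _ _ _ cr SR)) as [S1 S2].
  { unfold cl, cr, d. field. auto. } { unfold cl, cr, e. field. auto. }
  assert (Bd : forall (u uL : R -> R) c, (forall s, J s -> Rabs (u s) <= C * B) -> (forall s, J s -> Rabs (uL s) <= AL) ->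
     Rabs c <= (m1 + m2) * B -> forall s, - (1/2) < s <= 0 -> Rabs (u s + c * uL s) <= (C + (m1 + m2) * AL) * B).
  { intros u uL c' Hu HuL Hc' s Hs. assert (Js : J s) by (unfold J; lra). triang. rewrite Rabs_mult.
    specialize (Hu s Js). specialize (HuL s Js).
    assert (Rabs c' * Rabs (uL s) <= (m1 + m2) * B * AL) by (apply Rmult_le_compat; auto; apply Rabs_pos). lra. }
  eexists _, _. split; [split; [exact S1|exact S2]|]. split.
  - apply glued_bound; [apply Rabs_R1| |]; apply Bd; auto; intros; apply HAL; auto.
  - apply glued_bound; [rewrite Rabs_left; lra| |]; apply Bd; auto; intros; apply HAL; auto.
Qed.

(** For [k = 0] the regular homogeneous solution is [psi = 1], [Y = 0]. Constants match the values
    of [psi], normalised to 0 at the centre, but cannot match the fluxes. The multiple [lam b] does: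
    the flux [yb 0] that [b] generates on a half interval is positive, as [b >= 0] and [b > 0] near
    the end. *)
Lemma solve_resonant : exists C, 0 < C /\
  forall B f1 G, 0 <= B -> source I B f1 G ->
  exists lam psi Y, full_sol h 0 f1 (fun s => G s + lam * b s) psi Y /\ Rabs lam <= C * B /\
    (forall s, I s -> Rabs (psi s) <= C * B) /\ (forall s, I s -> Rabs (Y s) <= C * B).
Proof.
  destruct (first_order_left b 1) as [yb [Y1 [Y2 Y3]]]; [lra| | |].
  { intros; apply b_cont; lra. }
  { intros s Hs. destruct (b_nonneg s ltac:(lra)). rewrite Rabs_right by lra. apply le_div_intro; [lra|]. nra. }
  assert (J0 : J 0) by (unfold J; lra).
  assert (Yb0 : forall s, J s -> 0 <= yb s) by (apply Y3; intros; apply b_nonneg; lra). assert (YbP : 0 < yb 0).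
  { set (W := fun s => p s ^ 2 * yb s). assert (HW : forall s, J s -> is_derive W s (p s ^ 2 * b s)).
    { intros s Hs. unfold W. eapply derive_eq.
      - apply derive_mult; [apply p2_der, J_I; auto|now apply Y1].
      - cbv beta. ring. }
    assert (H1 : W (-(9/20)) <= W 0).
    { apply (mono_of_derive W (fun s => p s ^ 2 * b s) (-(1/2)) (1/4)); auto; try lra.
      intros x Hx. apply Rmult_le_pos; [apply pow2_ge_0|]. apply b_nonneg; lra. }
    destruct (mvt W (fun s => p s ^ 2 * b s) (-(19/40)) (-(9/20))) as [c [Hc1 Hc2]]; [lra| |].
    { intros x Hx. apply HW. unfold J; lra. }
    assert (0 < p c ^ 2 * b c).
    { apply Rmult_lt_0_compat; [apply pow_lt, p_pos; lra|apply b_pos; lra]. }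
    assert (0 <= W (-(19/40))).
    { unfold W. apply Rmult_le_pos; [apply pow2_ge_0|]. apply Yb0. unfold J; lra. }
    assert (0 < W 0) by nra. unfold W in *. assert (0 < p 0 ^ 2) by (apply pow_lt, p_pos; lra).
    apply Rmult_lt_reg_l with (p 0 ^ 2); lra. }
  destruct (left_data 0) as [C [HC HD]]. set (m := C / (2 * yb 0)).
  assert (HyB : exists K, 0 < K /\ forall B, 0 <= B -> forall f1 G, source J B f1 G ->
    exists psi Y, left_sol 0 f1 G psi Y /\ psi 0 = 0 /\ (forall s, J s -> Rabs (psi s) <= K * B) /\
    (forall s, J s -> Rabs (Y s) <= K * B)).
  { exists (2 * C). split; [lra|]. intros B HB f1 G S. destruct (HD B f1 G HB S) as [psi [Y [[S1 S2] [B1 B2]]]].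
    exists (fun s => psi s - psi 0), Y. split; [split|].
    - intros s Hs. derive. unfold zero; simpl; ring.
    - intros s Hs. derive. ring.
    - split; [ring|]. split; intros s Hs.
      + unfold Rminus. triang. rewrite Rabs_Ropp. assert (X1 := B1 s Hs). assert (X2 := B1 0 J0). lra.
      + specialize (B2 s Hs). pose proof (Rabs_pos (Y s)). lra. }
  destruct HyB as [K [HK HH]].
  destruct (HH 1 ltac:(lra) (fun _ => 0) b) as [pb [Yb [[Sb1 Sb2] [Zb [Bb1 Bb2]]]]].
  { intros s Hs. unfold J in Hs. destruct (b_nonneg s ltac:(lra)). rewrite Rabs_R0, Rabs_right by lra.
    split; [apply continuous_const|split; [apply b_cont|split; [|apply le_div_intro]]]; nra. }
  (* [p^2 (Yb - yb)] is constant and vanishes at the left end *)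
  assert (EY : Yb 0 = yb 0).
  { destruct p2_linear_bound as [P [HP0 HP]]. destruct (first_order_left (fun _ => 0) 0) as [y0 _]; try lra.
    { intros; apply continuous_const. } { intros; rewrite Rabs_R0; unfold Rdiv; lra. }
    set (W := fun s => p s ^ 2 * (Yb s - yb s)). assert (HW : forall s, J s -> is_derive W s 0).
    { intros s Hs. unfold W. eapply derive_eq.
      - apply derive_mult; [apply p2_der, J_I; auto|apply derive_minus; [now apply Sb2|now apply Y1]].
      - cbv beta. ring. }
    assert (Bound : exists Ky, forall s, J s -> Rabs (yb s) <= Ky).
    { eexists. intros s Hs. apply (Y2 s 1 Hs). intros t Ht. unfold J in Hs. destruct (b_nonneg t ltac:(lra)).
      rewrite Rabs_right by lra. apply le_div_intro; [lra|]. nra. }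
    destruct Bound as [Ky HKy].
    assert (HKy0 : 0 <= Ky) by (eapply Rle_trans; [apply Rabs_pos|apply (HKy 0 J0)]).
    assert (X : Rabs (W 0) <= 0 * (0 - - (1/2))).
    { apply (antiderivative_left_bound_const W (fun _ => 0) _ (1/4) (P * (K * 1 + Ky))); auto; try lra.
      - intros s Hs. unfold W. destruct (HP s Hs). rewrite Rabs_mult, Rabs_right by lra.
        replace (P * (K * 1 + Ky) * (s - - (1/2))) with (P * (s + 1/2) * (K * 1 + Ky)) by ring.
        apply Rmult_le_compat; try lra; [apply Rabs_pos|]. unfold Rminus. triang. rewrite Rabs_Ropp.
        specialize (Bb2 s Hs). specialize (HKy s Hs). lra.
      - intros; rewrite Rabs_R0; lra. }
    assert (W0 : W 0 = 0). { apply Rabs_eq_0. pose proof (Rabs_pos (W 0)). lra. }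
    unfold W in W0. assert (0 < p 0 ^ 2) by (apply pow_lt, p_pos; lra). nra. }
  set (m' := K / yb 0). assert (Hm : 0 < m') by (apply Rdiv_lt_0_compat; lra).
  exists (K + m' * K + m'). split; [nra|]. intros B f1 G HB S. apply source_halves in S. destruct S as [S1 S2].
  destruct (HH B HB _ _ S1) as [pl [Yl [SL [Zl [Bl1 Bl2]]]]]. destruct (HH B HB _ _ S2) as [pr [Yr [SR [Zr [Br1 Br2]]]]].
  clear S1 S2. set (lam := - (Yl 0 + Yr 0) / (2 * yb 0)). assert (Hlam : Rabs lam <= m' * B).
  { unfold lam. rewrite Rabs_div, (Rabs_right (2 * yb 0)), Rabs_Ropp by lra. apply div_le_intro; [lra|]. unfold m'.
    replace (K / yb 0 * B * (2 * yb 0)) with (2 * (K * B)) by (field; lra).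
    triang. specialize (Bl2 0 J0). specialize (Br2 0 J0). lra. }
  assert (Sol : forall f F p' Y', left_sol 0 f F p' Y' -> left_sol 0 f (fun s => F s + lam * b s) (fun s => p' s + lam * pb s) (fun s => Y' s + lam * Yb s)).
  { intros f F p' Y' S. destruct (left_sol_lin _ _ _ _ _ _ _ _ _ lam S (conj Sb1 Sb2)) as [X1 X2]. split; intros s Hs.
    - derive. ring.
    - derive. ring. }
  assert (SR' : left_sol 0 (fun s => - f1 (- s)) (fun s => (fun s => G s + lam * b s) (- s)) (fun s => pr s + lam * pb s) (fun s => Yr s + lam * Yb s)).
  { destruct (Sol _ _ _ _ SR) as [X1 X2]. split; auto. intros s Hs. derive.
    rewrite b_even by (now apply J_I). ring. }
  destruct (glue_solutions 0 f1 _ _ _ _ _ (Sol _ _ _ _ SL) SR') as [S1 S2].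
  { rewrite Zl, Zr. reflexivity. } { rewrite EY. unfold lam. field. lra. }
  assert (Bd : forall (u uL : R -> R), (forall s, J s -> Rabs (u s) <= K * B) -> (forall s, J s -> Rabs (uL s) <= K * 1) ->
     forall s, - (1/2) < s <= 0 -> Rabs (u s + lam * uL s) <= (K + m' * K + m') * B).
  { intros u uL Hu HuL s Hs. assert (Js : J s) by (unfold J; lra). triang. rewrite Rabs_mult.
    specialize (Hu s Js). specialize (HuL s Js).
    assert (Rabs lam * Rabs (uL s) <= m' * B * (K * 1)) by (apply Rmult_le_compat; auto; apply Rabs_pos).
    assert (0 <= m' * B) by (apply Rmult_le_pos; lra). lra. }
  exists lam. eexists _, _. split; [split; [exact S1|exact S2]|].
  assert (0 <= m' * B) by (apply Rmult_le_pos; lra). assert (0 <= (K + m' * K) * B) by (apply Rmult_le_pos; nra).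
  split; [lra|]. split.
  - apply glued_bound; [apply Rabs_R1| |]; apply Bd; auto.
  - apply glued_bound; [rewrite Rabs_left; lra| |]; apply Bd; auto.
Qed.

(** For [i >= 2] one has [k = nu^2 >= 12], so [nu >= 3], and both [2 i] and [1 + 2 i] are at most
    [2 nu]; [i = 0] gives [k = -4] and [i = 1] the resonant [k = 0]. *)
Lemma linear_solver : exists C, 0 < C /\ solvable h b C.
Proof.
  destruct solve_high as [C1 [H1 S1]]. destruct solve_zero as [c2 [H2 S2]].
  destruct solve_resonant as [C3 [H3 S3]]. exists (2 * C1 + c2 + 6 * C3). split; [lra|].
  intros [|[|i]] B f1 G f4 HB c1 cG c4 b1 bG b4;
    assert (0 <= c2 * B /\ 0 <= C1 * B /\ 0 <= C3 * B) by (split; [|split]; apply Rmult_le_pos; lra).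
  - destruct (S2 B f1 G) as [psi [Y [[E1 E2] [B1 B2]]]]; auto. { intros s Hs. auto. }
    exists (0, (psi, Y)). unfold sol_spec; simpl fst; simpl snd. split; [split; auto|].
    + intros s Hs. derive. simpl. ring.
    + rewrite Rabs_R0. split; [nra|]. split; [auto|]. split; intros s Hs.
      * specialize (B1 s Hs). simpl. lra.
      * specialize (B2 s Hs). lra.
  - destruct (S3 (2 * B) f1 (fun s => G s + 2 * f4 s)) as [lam [psi [Y [[E1 E2] [B0 [B1 B2]]]]]]; auto; try lra.
    { intros s Hs. specialize (b1 s Hs). split; [auto|]. split; [|split; [lra|]].
      { apply continuous_Rplus; auto. apply continuous_Rmult; auto. apply continuous_const. }
      triang. rewrite Rabs_mult, (Rabs_right 2) by lra.
      specialize (bG s Hs). specialize (b4 s Hs). unfold I in Hs. assert (0 < 1/4 - s ^ 2 <= 1/4) by nra.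
      assert (2 * B <= B / (1/4 - s ^ 2)) by (apply le_div_intro; nra).
      replace (2 * B / (1/4 - s ^ 2)) with (B / (1/4 - s ^ 2) + B / (1/4 - s ^ 2)) by (field; lra). lra. }
    exists (lam, (psi, Y)). unfold sol_spec; simpl fst; simpl snd. split; [split; auto|].
    + intros s Hs. derive. simpl. ring.
    + split; [nra|]. split; [congruence|]. split; intros s Hs.
      * specialize (B1 s Hs). simpl. lra.
      * specialize (B2 s Hs). lra.
  - set (n := INR (S (S i))). assert (Hn : 2 <= n). { unfold n. rewrite !S_INR. pose proof (pos_INR i). lra. }
    set (nu := sqrt (4 * n ^ 2 - 4)). assert (Hp : 12 <= 4 * n ^ 2 - 4) by nra.
    assert (Hnu2 : nu ^ 2 = 4 * n ^ 2 - 4) by (unfold nu; rewrite <- Rsqr_pow2; apply Rsqr_sqrt; lra).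
    assert (Hnu0 : 0 <= nu) by apply sqrt_pos. assert (Hnu : 3 <= nu) by nra.
    assert (HN : 0 <= 2 * n <= 2 * nu) by nra. assert (HN2 : 1 + 2 * n <= 2 * nu) by nra.
    destruct (S1 nu (2 * n) Hnu HN B f1 G f4) as [psi [Y [[E1 E2] [B1 B2]]]]; auto.
    exists (0, (psi, Y)). unfold sol_spec; simpl fst; simpl snd. split; [split; auto|].
    + intros s Hs. derive. fold n. rewrite <- Hnu2. ring.
    + rewrite Rabs_R0. split; [nra|]. split; [auto|]. split; intros s Hs.
      * specialize (B1 s Hs). fold n. pose proof (Rabs_pos (psi s)).
        assert ((1 + 2 * n) * Rabs (psi s) <= 2 * nu * Rabs (psi s)) by (apply Rmult_le_compat_r; lra). lra.
      * specialize (B2 s Hs). lra.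
Qed.

End Linear.

(** * Double power series and their majorants *)

Lemma sum_swap (f : nat -> nat -> R) n m :
  sum_f_R0 (fun a => sum_f_R0 (fun b => f a b) m) n = sum_f_R0 (fun b => sum_f_R0 (fun a => f a b) n) m.
Proof.
  induction n as [|n IH]; simpl; auto. rewrite IH, <- sum_plus. reflexivity.
Qed.

Lemma sum_rev (f : nat -> R) n : sum_f_R0 (fun a => f (n - a)%nat) n = sum_f_R0 f n.
Proof.
  induction n as [|n IH]; auto. rewrite decomp_sum by lia. simpl pred.
  rewrite (sum_eq (fun i => f (S n - S i)%nat) (fun a => f (n - a)%nat)) by (intros; f_equal; lia).
  rewrite IH. simpl. replace (S n - 0)%nat with (S n) by lia. ring.
Qed.

Lemma sum_abs_le (f g : nat -> R) n : (forall i, (i <= n)%nat -> Rabs (f i) <= g i) ->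
  Rabs (sum_f_R0 f n) <= sum_f_R0 g n.
Proof.
  intros H. eapply Rle_trans; [apply Rsum_abs|]. now apply sum_Rle.
Qed.

Lemma sum_mult_r (f : nat -> R) c n : sum_f_R0 f n * c = sum_f_R0 (fun i => f i * c) n.
Proof. induction n as [|n IH]; simpl; auto. rewrite <- IH. ring. Qed.

(* The weights are stable under convolution up to a constant ([qw_conv]), so that [bd] is stable under products. *)
Definition qw (j : nat) : R := / (INR j + 1) ^ 2.

Lemma qw_pos j : 0 < qw j.
Proof. unfold qw. apply Rinv_0_lt_compat, pow_lt. pose proof (pos_INR j). lra. Qed.
Lemma qw_le1 j : qw j <= 1.
Proof.
  unfold qw. rewrite <- Rinv_1. apply Rinv_le_contravar; [lra|]. pose proof (pos_INR j). nra.
Qed.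
Lemma qw_decr j : qw (S j) <= qw j.
Proof.
  unfold qw. rewrite S_INR. pose proof (pos_INR j). apply Rinv_le_contravar; [apply pow_lt; lra|].
  apply pow_incr. lra.
Qed.

Lemma sum_qw j : sum_f_R0 qw j <= 2 - / (INR j + 1).
Proof.
  induction j as [|j IH].
  - unfold qw. simpl. rewrite Rplus_0_l, !Rmult_1_l. lra.
  - simpl sum_f_R0. unfold qw at 2. rewrite S_INR. pose proof (pos_INR j).
    assert (/ (INR j + 1 + 1) ^ 2 <= / (INR j + 1) - / (INR j + 1 + 1)).
    { replace (/ (INR j + 1) - / (INR j + 1 + 1)) with (/ ((INR j + 1) * (INR j + 1 + 1))) by (field; lra).
      apply Rinv_le_contravar; [nra|]. simpl. nra. }
    lra.
Qed.

(** With [u + v = j + 2], [1 / (u v)^2 = (1/u + 1/v)^2 / (u + v)^2]: one factor has the size of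
    [qw j] and the other is summable. *)
Lemma qw_conv j : sum_f_R0 (fun a => qw a * qw (j - a)) j <= 16 * qw j.
Proof.
  pose proof (pos_INR j) as Hj.
  apply Rle_trans with (sum_f_R0 (fun a => (qw a + qw (j - a)%nat) * (2 * qw j)) j).
  - apply sum_Rle. intros a Ha. unfold qw.
    rewrite minus_INR by auto. assert (0 <= INR a <= INR j) by (split; [apply pos_INR|now apply le_INR]).
    set (u := INR a + 1). set (v := INR j - INR a + 1).
    assert (Hu : 1 <= u) by (unfold u; lra). assert (Hv : 1 <= v) by (unfold v; lra).
    replace (INR j) with (u + v - 2) by (unfold u, v; ring).
    apply Rle_trans with (2 * (/ u ^ 2 + / v ^ 2) * / (u + v) ^ 2).
    + replace (/ u ^ 2 * / v ^ 2) with ((/ u + / v) ^ 2 * / (u + v) ^ 2) by (field; lra).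
      apply Rmult_le_compat_r; [left; apply Rinv_0_lt_compat, pow_lt; lra|].
      replace (/ u ^ 2) with ((/ u) ^ 2) by (field; lra). replace (/ v ^ 2) with ((/ v) ^ 2) by (field; lra).
      pose proof (pow2_ge_0 (/ u - / v)). nra.
    + assert (0 < / u ^ 2) by (apply Rinv_0_lt_compat, pow_lt; lra).
      assert (0 < / v ^ 2) by (apply Rinv_0_lt_compat, pow_lt; lra).
      assert (/ (u + v) ^ 2 <= / (u + v - 2 + 1) ^ 2).
      { apply Rinv_le_contravar; [apply pow_lt; lra|]. apply pow_incr; lra. }
      assert (0 < / (u + v) ^ 2) by (apply Rinv_0_lt_compat, pow_lt; lra). nra.
  - rewrite <- sum_mult_r. rewrite sum_plus, (sum_rev qw).
    assert (X := sum_qw j). assert (0 < / (INR j + 1)) by (apply Rinv_0_lt_compat; lra).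
    pose proof (qw_pos j). nra.
Qed.

(* [f j l s] is the coefficient of [(eps exp(2 i th))^j (eps exp(-2 i th))^l], and [dth] is [-i] times the
   derivative in [th]. [zc] drops the constant term, [zo] the terms of order at most one. *)
Definition arr := nat -> nat -> R -> R.

Definition zc (f : arr) : arr := fun j l s => match j, l with O, O => 0 | _, _ => f j l s end.
Definition mul (f g : arr) : arr := fun j l s =>
  sum_f_R0 (fun a => sum_f_R0 (fun b => f a b s * g (j - a)%nat (l - b)%nat s) l) j.
Definition mulz (f g : arr) : arr := mul (zc f) (zc g).
Definition zo (f : arr) : arr := fun j l s => if Nat.leb (j + l) 1 then 0 else f j l s.
Definition dth (f : arr) : arr := fun j l s => 2 * (INR j - INR l) * f j l s.

Definition eqlow (n : nat) (f g : arr) : Prop := forall j l, (j + l < n)%nat -> f j l = g j l.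

Lemma zc_nz (f : arr) j l s : (j + l <> 0)%nat -> zc f j l s = f j l s.
Proof. unfold zc. destruct j, l; simpl; auto; lia. Qed.
Lemma zc_z (f : arr) s : zc f 0%nat 0%nat s = 0.
Proof. reflexivity. Qed.

(** Neither factor has a constant term, so a coefficient of total order [n] involves only
    coefficients of lower order; this makes the recursion well founded. *)
Lemma mulz_local n f f' g g' : eqlow n f f' -> eqlow n g g' -> eqlow (S n) (mulz f g) (mulz f' g').
Proof.
  intros Hf Hg j l Hjl. unfold mulz, mul. extensionality s.
  apply sum_eq. intros a Ha. apply sum_eq. intros b Hb. destruct (Nat.eq_dec (a + b) 0) as [E|E].
  { replace a with 0%nat by lia. replace b with 0%nat by lia. rewrite !zc_z. ring. }
  destruct (Nat.eq_dec ((j - a) + (l - b)) 0) as [E'|E'].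
  { replace (j - a)%nat with 0%nat by lia. replace (l - b)%nat with 0%nat by lia. rewrite !zc_z. ring. }
  rewrite !zc_nz by auto. rewrite Hf, Hg by lia. reflexivity.
Qed.

(** The second factor starts at order 2, so the first enters only up to two orders below; this
    leaves room for the index shift in [lamd]. *)
Lemma mulzo_local n f f' g g' : eqlow (pred n) f f' -> eqlow n g g' ->
  (forall s, f 0%nat 0%nat s = 0) -> (forall s, f' 0%nat 0%nat s = 0) -> eqlow (S n) (mul f (zo g)) (mul f' (zo g')).
Proof.
  intros Hf Hg Z Z' j l Hjl. unfold mul. extensionality s. apply sum_eq. intros a Ha. apply sum_eq. intros b Hb.
  destruct (Nat.eq_dec (a + b) 0) as [E|E].
  { replace a with 0%nat by lia. replace b with 0%nat by lia. rewrite Z, Z'. ring. }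
  unfold zo. destruct (Nat.leb_spec (j - a + (l - b)) 1); [ring|]. rewrite Hf, Hg by lia. reflexivity.
Qed.

Lemma mulz_first f g j l s : (j + l <= 1)%nat -> mulz f g j l s = 0.
Proof.
  intros H. unfold mulz, mul. rewrite (sum_eq _ (fun _ => 0)); [rewrite sum_cte; ring|].
  intros a Ha. rewrite (sum_eq _ (fun _ => 0)); [rewrite sum_cte; ring|].
  intros b Hb. destruct (Nat.eq_dec (a + b) 0) as [E|E].
  { replace a with 0%nat by lia. replace b with 0%nat by lia. rewrite !zc_z. ring. }
  replace (j - a)%nat with 0%nat by lia. replace (l - b)%nat with 0%nat by lia. rewrite !zc_z. ring.
Qed.

Lemma mulzo_first f g j l s : (j + l <= 1)%nat -> mul f (zo g) j l s = 0.
Proof.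
  intros H. unfold mul. rewrite (sum_eq _ (fun _ => 0)); [rewrite sum_cte; ring|].
  intros a Ha. rewrite (sum_eq _ (fun _ => 0)); [rewrite sum_cte; ring|].
  intros b Hb. unfold zo. destruct (Nat.leb_spec (j - a + (l - b)) 1); [ring|lia].
Qed.

(** For real coefficients this is parity in [th]: [e = 1] makes the sum real and even, [e = -1]
    purely imaginary and odd. *)
Definition sym (e : R) (f : arr) : Prop := forall j l s, f l j s = e * f j l s.

Lemma mul_sym e e' f g : sym e f -> sym e' g -> sym (e * e') (mul f g).
Proof.
  intros Hf Hg j l s. unfold mul. rewrite sum_swap, scal_sum.
  apply sum_eq. intros b Hb. rewrite (Rmult_comm _ (e * e')), scal_sum. apply sum_eq. intros a Ha.
  rewrite Hf, Hg. ring.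
Qed.
Lemma zc_sym e f : sym e f -> sym e (zc f).
Proof. intros H j l s. unfold zc. destruct j, l; try apply H. ring. Qed.
Lemma zo_sym e f : sym e f -> sym e (zo f).
Proof. intros H j l s. unfold zo. rewrite Nat.add_comm. destruct (Nat.leb (j + l) 1); [ring|apply H]. Qed.
Lemma mulz_sym e e' f g : sym e f -> sym e' g -> sym (e * e') (mulz f g).
Proof. intros. apply mul_sym; now apply zc_sym. Qed.

Section Bounds.
Variable K : R.
Hypothesis K_pos : 1 <= K.
Definition wt (j l : nat) : R := K ^ (j + l) * (qw j * qw l).
Lemma wt_pos j l : 0 < wt j l.
Proof.
  unfold wt. pose proof (qw_pos j). pose proof (qw_pos l). apply Rmult_lt_0_compat; [apply pow_lt; lra|nra].
Qed.

Definition bd (r : R) (n : nat) (f : arr) : Prop :=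
  forall j l, (j + l < n)%nat -> forall s, - (1/2) < s < 1/2 -> Rabs (f j l s) <= r * wt j l.

Lemma bd_mono r r' n f : bd r n f -> r <= r' -> bd r' n f.
Proof.
  intros H Hr j l Hjl s Hs. eapply Rle_trans; [now apply H|]. apply Rmult_le_compat_r; auto. left; apply wt_pos.
Qed.
Lemma bd_add r r' n f g : bd r n f -> bd r' n g -> bd (r + r') n (fun j l s => f j l s + g j l s).
Proof.
  intros Hf Hg j l Hjl s Hs. triang. specialize (Hf j l Hjl s Hs). specialize (Hg j l Hjl s Hs). lra.
Qed.
Lemma bd_sub r r' n f g : bd r n f -> bd r' n g -> bd (r + r') n (fun j l s => f j l s - g j l s).
Proof.
  intros Hf Hg j l Hjl s Hs. unfold Rminus. triang. rewrite Rabs_Ropp.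
  specialize (Hf j l Hjl s Hs). specialize (Hg j l Hjl s Hs). lra.
Qed.
Lemma bd_coef M r n f (c : R -> R) : (forall s, - (1/2) < s < 1/2 -> Rabs (c s) <= M) ->
  bd r n f -> bd (M * r) n (fun j l s => c s * f j l s).
Proof.
  intros Hc Hf j l Hjl s Hs. rewrite Rabs_mult, Rmult_assoc. apply Rmult_le_compat; auto; apply Rabs_pos.
Qed.
Lemma bd_mul r r' j l s f g : 0 <= r -> 0 <= r' ->
  (forall a b, (a <= j)%nat -> (b <= l)%nat ->
     Rabs (f a b s * g (j - a)%nat (l - b)%nat s) <= r * wt a b * (r' * wt (j - a) (l - b))) ->
  Rabs (mul f g j l s) <= 256 * r * r' * wt j l.
Proof.
  intros Hr Hr' H. unfold mul.
  apply Rle_trans with (sum_f_R0 (fun a => sum_f_R0 (fun b => r * wt a b * (r' * wt (j - a) (l - b))) l) j).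
  { apply sum_abs_le. intros a Ha. apply sum_abs_le. intros b Hb. now apply H. }
  assert (E : sum_f_R0 (fun a => sum_f_R0 (fun b => r * wt a b * (r' * wt (j - a) (l - b))) l) j
    = sum_f_R0 (fun b => qw b * qw (l - b)) l * sum_f_R0 (fun a => qw a * qw (j - a)) j * (r * r' * K ^ (j + l))).
  { rewrite (Rmult_comm (sum_f_R0 (fun b => qw b * qw (l - b)) l)), !sum_mult_r. apply sum_eq. intros a Ha.
    rewrite (Rmult_comm _ (sum_f_R0 (fun b => qw b * qw (l - b)) l)), !sum_mult_r. apply sum_eq. intros b Hb.
    unfold wt. replace (K ^ (j + l)) with (K ^ (a + b) * K ^ (j - a + (l - b))).
    - ring.
    - rewrite <- pow_add. f_equal. lia. }
  rewrite E. unfold wt. assert (A1 := qw_conv l). assert (A2 := qw_conv j).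
  assert (P : forall m, 0 <= sum_f_R0 (fun b => qw b * qw (m - b)) m).
  { intros m. apply cond_pos_sum. intros n. pose proof (qw_pos n). pose proof (qw_pos (m - n)). nra. }
  assert (A3 := P l). assert (A4 := P j). assert (0 <= r * r' * K ^ (j + l)).
  { apply Rmult_le_pos; [nra|]. apply pow_le; lra. }
  replace (256 * r * r' * (K ^ (j + l) * (qw j * qw l))) with (16 * qw l * (16 * qw j) * (r * r' * K ^ (j + l))) by ring.
  apply Rmult_le_compat_r; auto. apply Rmult_le_compat; auto.
Qed.
Lemma bd_mulz r r' n f g : bd r n f -> bd r' n g -> 0 <= r -> 0 <= r' -> bd (256 * r * r') (S n) (mulz f g).
Proof.
  intros Hf Hg Hr Hr' j l Hjl s Hs. apply bd_mul; auto. intros a b Ha Hb.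
  assert (P : 0 <= r * wt a b * (r' * wt (j - a) (l - b))).
  { pose proof (wt_pos a b). pose proof (wt_pos (j - a) (l - b)). apply Rmult_le_pos; nra. }
  destruct (Nat.eq_dec (a + b) 0) as [E|E].
  { replace a with 0%nat by lia. replace b with 0%nat by lia. rewrite zc_z, Rmult_0_l, Rabs_R0.
    replace a with 0%nat in P by lia. now replace b with 0%nat in P by lia. }
  destruct (Nat.eq_dec ((j - a) + (l - b)) 0) as [E'|E'].
  { replace (j - a)%nat with 0%nat in * by lia. replace (l - b)%nat with 0%nat in * by lia. now rewrite zc_z, Rmult_0_r, Rabs_R0. }
  rewrite !zc_nz by auto. rewrite Rabs_mult. apply Rmult_le_compat; try apply Rabs_pos; [apply Hf|apply Hg]; auto; lia.
Qed.
End Bounds.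

Ltac pos := repeat (first [apply Rmult_le_pos | apply pow2_ge_0 | apply pow_le]); lra.

Definition absdiff (j l : nat) : nat := ((j - l) + (l - j))%nat.
Lemma absdiff_sym j l : absdiff j l = absdiff l j.
Proof. unfold absdiff; lia. Qed.
Lemma absdiff_INR j l : INR (absdiff j l) = Rabs (INR j - INR l).
Proof.
  unfold absdiff. destruct (Nat.le_ge_cases j l) as [H|H].
  - replace ((j - l) + (l - j))%nat with (l - j)%nat by lia. rewrite minus_INR by auto.
    apply le_INR in H. rewrite Rabs_left1; lra.
  - replace ((j - l) + (l - j))%nat with (j - l)%nat by lia. rewrite minus_INR by auto.
    apply le_INR in H. rewrite Rabs_right; lra.
Qed.

(** * The nonlinear system as a recursion on the order of the coefficients *)

(** [ps] and [yy] are the unknowns [psi] and [Y], [nn] and [mm] the nonlinear terms; [la] keeps the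
    multipliers returned by the solver at the resonant places [(j + 1, j)]. *)
Record state := mkstate { ps : arr; yy : arr; nn : arr; mm : arr; la : arr }.

Section Formal.
Variables (al al' mu nu ah sc b h : R -> R) (M0 Cs : R).
Notation I := In1.
Definition coef_ok (c : R -> R) : Prop :=
  (forall s, I s -> continuous c s) /\ (forall s, I s -> Rabs (c s) <= M0).
Hypothesis M0_ge1 : 1 <= M0.
Hypothesis Cs_pos : 0 < Cs.
Hypothesis al_ok : coef_ok al.
Hypothesis al'_ok : coef_ok al'.
Hypothesis mu_ok : coef_ok mu.
Hypothesis nu_ok : coef_ok nu.
Hypothesis ah_ok : coef_ok ah.
Hypothesis sc_ok : coef_ok sc.
Hypothesis b_ok : coef_ok b.
Hypothesis h_cont : forall s, I s -> continuous h s.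
Hypothesis h_bound : forall s, I s -> Rabs (h s) <= M0 / (1/4 - s ^ 2).

Hypothesis solver : solvable h b Cs.

(** A choice by [epsilon] depends on its arguments alone, so equal data receive the same solution;
    locality and symmetry of the recursion rest on this. *)
Definition SOL i B f1 G f4 : R * ((R -> R) * (R -> R)) :=
  epsilon (inhabits (0, (f1, f1))) (sol_spec h b Cs i B f1 G f4).

(** The equation for [N] is [N (1 + Qm) (1 + Rm) = Bq], solved as [N = Bq - N QRm], whose right-hand
    side has no linear term. The terms in [dth] carry the opposite of the sign they have for true
    angular derivatives, since [dth] is [-i] times the derivative and occurs squared. *)
Definition S1 (z : state) : arr := fun j l s => yy z j l s + (2 * ah s - mu s) * ps z j l s.
Definition S2 (z : state) : arr := fun j l s => al' s * ps z j l s - al s * yy z j l s.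
Definition Qm (z : state) : arr := fun j l s => (2 * al s) * ps z j l s.
Definition Rm (z : state) : arr := fun j l s =>
  (al s * mu s + 2 * al s * (1 - ah s)) * ps z j l s - al s * yy z j l s.
Definition QRm (z : state) : arr := fun j l s => Qm z j l s + Rm z j l s + mulz (Qm z) (Rm z) j l s.
Definition Bq (z : state) : arr := fun j l s =>
  mulz (S1 z) (S2 z) j l s + mulz (Qm z) (mulz (S1 z) (S2 z)) j l s
  + (al s * mulz (dth (ps z)) (dth (ps z)) j l s
     + (al s * nu s) * mulz (ps z) (mulz (dth (ps z)) (dth (ps z))) j l s).
Definition newN (z : state) : arr := fun j l s => Bq z j l s - mulz (nn z) (QRm z) j l s.
Definition newM (z : state) : arr := fun j l s =>
  (2 * al s - nu s) * mulz (ps z) (dth (ps z)) j l s - mulz (Qm z) (mm z) j l s.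
(* [lam] is a power series in [eps^2], carried by the diagonal; its coefficient at [(j, j)] is what makes
   the resonant equation at [(j + 1, j)] solvable. *)
Definition lamd (z : state) : arr := fun j l s => if Nat.eqb j l then la z (S j) l s else 0.
(** The coefficient of [lam] in the equation for [Y]: the parameter changes [h] into [h + lam sc]
    and the zero-order coefficient 4 into [4 + 2 lam b]. *)
Definition Xa (z : state) : arr := fun j l s =>
  (-2 * sc s) * yy z j l s + (2 * b s) * ps z j l s + sc s * nn z j l s.
(** Only the terms of order at least 2 of [Xa] enter here; its first-order terms [2 b] are the ones
    that the solver multiplies by its own unknown [lam]. *)
Definition newG (z : state) : arr := fun j l s => h s * newN z j l s + mul (lamd z) (zo (Xa z)) j l s.
(** The solver knows the frequency as [|j - l|], while [dth] produces [2 (j - l)]; the sign is moved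
    into the source. *)
Definition sgnM (z : state) : arr := fun j l s => if Nat.leb l j then newM z j l s else - newM z j l s.

Section Recursion.
Variables (K cB : R).
Definition sol_at (z : state) (j l : nat) : R * ((R -> R) * (R -> R)) :=
  SOL (absdiff j l) (cB * wt K j l) (newN z j l) (newG z j l) (sgnM z j l).

(** Order 1 is prescribed, as the kernel of the resonant problem; from order 2 on the solver
    decides. Half of its multiplier is stored, because the equation contains [2 b lam]. *)
Definition Phi (z : state) : state := mkstate
  (fun j l => match (j + l)%nat with O => fun _ => 0 | 1%nat => fun _ => 1 | _ => fst (snd (sol_at z j l)) end)
  (fun j l => match (j + l)%nat with O => fun _ => 0 | 1%nat => fun _ => 0 | _ => snd (snd (sol_at z j l)) end)
  (newN z) (newM z)
  (fun j l => if Nat.leb (j + l) 1 then fun _ => 0 else fun _ => if Nat.eqb j (S l) then fst (sol_at z j l) / 2 else 0).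

Definition steq n (z z' : state) : Prop :=
  eqlow n (ps z) (ps z') /\ eqlow n (yy z) (yy z') /\ eqlow n (nn z) (nn z') /\
  eqlow n (mm z) (mm z') /\ eqlow n (la z) (la z').
Definition la0 (z : state) : Prop := forall s, la z 1%nat 0%nat s = 0.

Lemma eqlow_ptw n (f g f' g' : arr) (op : R -> R -> R -> R) :
  eqlow n f f' -> eqlow n g g' ->
  eqlow n (fun j l s => op s (f j l s) (g j l s)) (fun j l s => op s (f' j l s) (g' j l s)).
Proof. intros H H' j l Hjl. now rewrite H, H'. Qed.
Lemma eqlow_weak n f g : eqlow (S n) f g -> eqlow n f g.
Proof. intros H j l Hjl. apply H. lia. Qed.
Lemma eqlow_dth n f g : eqlow n f g -> eqlow n (dth f) (dth g).
Proof. intros H j l Hjl. unfold dth. now rewrite H. Qed.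

Lemma S1_local n z z' : steq n z z' -> eqlow n (S1 z) (S1 z').
Proof. intros [H1 [H2 _]]. exact (eqlow_ptw n _ _ _ _ (fun s y x => y + (2 * ah s - mu s) * x) H2 H1). Qed.
Lemma S2_local n z z' : steq n z z' -> eqlow n (S2 z) (S2 z').
Proof. intros [H1 [H2 _]]. exact (eqlow_ptw n _ _ _ _ (fun s y x => al' s * x - al s * y) H2 H1). Qed.
Lemma Qm_local n z z' : steq n z z' -> eqlow n (Qm z) (Qm z').
Proof. intros [H1 [H2 _]]. exact (eqlow_ptw n _ _ _ _ (fun s y x => (2 * al s) * x) H2 H1). Qed.
Lemma Rm_local n z z' : steq n z z' -> eqlow n (Rm z) (Rm z').
Proof. intros [H1 [H2 _]]. exact (eqlow_ptw n _ _ _ _ (fun s y x => (al s * mu s + 2 * al s * (1 - ah s)) * x - al s * y) H2 H1). Qed.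
Lemma QRm_local n z z' : steq n z z' -> eqlow n (QRm z) (QRm z').
Proof.
  intros H. apply (eqlow_ptw n (fun j l s => Qm z j l s + Rm z j l s) _ (fun j l s => Qm z' j l s + Rm z' j l s) _ (fun s x y => x + y)).
  - exact (eqlow_ptw n _ _ _ _ (fun s x y => x + y) (Qm_local n z z' H) (Rm_local n z z' H)).
  - apply eqlow_weak, mulz_local; [now apply Qm_local|now apply Rm_local].
Qed.

Lemma newN_local n z z' : steq n z z' -> eqlow (S n) (newN z) (newN z').
Proof.
  intros H j l Hjl. unfold newN, Bq. extensionality s.
  assert (E1 := mulz_local n _ _ _ _ (S1_local n z z' H) (S2_local n z z' H)). rewrite (E1 j l Hjl).
  rewrite (mulz_local n _ _ _ _ (Qm_local n z z' H) (eqlow_weak _ _ _ E1) j l Hjl).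
  destruct H as [H1 H2]. assert (H0 := conj H1 H2 : steq n z z').
  assert (E2 := mulz_local n _ _ _ _ (eqlow_dth _ _ _ H1) (eqlow_dth _ _ _ H1)). rewrite (E2 j l Hjl).
  rewrite (mulz_local n _ _ _ _ H1 (eqlow_weak _ _ _ E2) j l Hjl). destruct H2 as [_ [H3 _]].
  rewrite (mulz_local n _ _ _ _ H3 (QRm_local n z z' H0) j l Hjl). reflexivity.
Qed.
Lemma newM_local n z z' : steq n z z' -> eqlow (S n) (newM z) (newM z').
Proof.
  intros H j l Hjl. unfold newM. extensionality s.
  assert (E := Qm_local n z z' H). destruct H as [H1 [H2 [H3 [H4 H5]]]].
  rewrite (mulz_local n _ _ _ _ H1 (eqlow_dth _ _ _ H1) j l Hjl).
  rewrite (mulz_local n _ _ _ _ E H4 j l Hjl). reflexivity.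
Qed.
Lemma lamd00 z s : la0 z -> lamd z 0%nat 0%nat s = 0.
Proof. intros H. apply H. Qed.
Lemma newG_local n z z' : la0 z -> la0 z' -> steq n z z' -> eqlow (S n) (newG z) (newG z').
Proof.
  intros L L' H j l Hjl. unfold newG. extensionality s. rewrite (newN_local n z z' H j l Hjl). f_equal.
  apply (f_equal (fun f => f s)). apply (mulzo_local n); auto.
  - intros j' l' H'. unfold lamd. extensionality t. destruct (Nat.eqb_spec j' l'); auto.
    destruct H as [_ [_ [_ [_ H5]]]]. rewrite H5; auto. lia.
  - destruct H as [H1 [H2 [H3 _]]]. intros j' l' H'. unfold Xa. rewrite H1, H2, H3; auto.
Qed.

Lemma Phi_la0 z : la0 (Phi z).
Proof. intros s. reflexivity. Qed.

(** One application of [Phi] settles one more order, so the iterates from zero stabilise order by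
    order. *)
Lemma Phi_local n z z' : la0 z -> la0 z' -> steq n z z' -> steq (S n) (Phi z) (Phi z').
Proof.
  intros L L' H. assert (E1 := newN_local n z z' H). assert (E2 := newM_local n z z' H).
  assert (E3 := newG_local n z z' L L' H).
  assert (ES : forall j l, (j + l < S n)%nat -> sol_at z j l = sol_at z' j l).
  { intros j l Hjl. unfold sol_at. rewrite (E1 j l Hjl), (E3 j l Hjl).
    f_equal. unfold sgnM. rewrite (E2 j l Hjl). reflexivity. }
  split; [|split; [|split; [|split]]]; auto; intros j l Hjl; simpl; now rewrite ES.
Qed.

Definition z0 : state := mkstate (fun _ _ _ => 0) (fun _ _ _ => 0) (fun _ _ _ => 0) (fun _ _ _ => 0) (fun _ _ _ => 0).
Definition Zn (n : nat) : state := Nat.iter n Phi z0.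
Lemma Zn_la0 n : la0 (Zn n).
Proof. destruct n; [intros s; reflexivity|apply Phi_la0]. Qed.
Lemma Zn_stable n : steq n (Zn n) (Zn (S n)).
Proof.
  induction n as [|n IH].
  - split; [|split; [|split; [|split]]]; intros j l H; lia.
  - apply (Phi_local n (Zn n) (Zn (S n))); auto; apply Zn_la0.
Qed.
Lemma Zn_stable' n m : (n <= m)%nat -> steq n (Zn n) (Zn m).
Proof.
  induction 1 as [|m Hm IH].
  - split; [|split; [|split; [|split]]]; intros j l H; auto.
  - assert (X := Zn_stable m). unfold steq in *. destruct IH as [A1 [A2 [A3 [A4 A5]]]].
    destruct X as [B1 [B2 [B3 [B4 B5]]]]. split; [|split; [|split; [|split]]]; intros j l H.
    + rewrite A1, B1; auto; lia. + rewrite A2, B2; auto; lia. + rewrite A3, B3; auto; lia.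
    + rewrite A4, B4; auto; lia. + rewrite A5, B5; auto; lia.
Qed.

(** Each coefficient is read off an iterate at which its order [j + l] is already final. *)
Definition Zf : state := mkstate
  (fun j l => ps (Zn (S (j + l))) j l) (fun j l => yy (Zn (S (j + l))) j l) (fun j l => nn (Zn (S (j + l))) j l)
  (fun j l => mm (Zn (S (j + l))) j l) (fun j l => la (Zn (S (j + l))) j l).

Lemma Zf_steq n : steq n Zf (Zn n).
Proof.
  split; [|split; [|split; [|split]]]; intros j l H; simpl;
  destruct (Zn_stable' (S (j + l)) n H) as [A1 [A2 [A3 [A4 A5]]]].
  - apply A1; lia. - apply A2; lia. - apply A3; lia. - apply A4; lia. - apply A5; lia.
Qed.
Lemma Zf_la0 : la0 Zf.
Proof. intros s. reflexivity. Qed.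

Lemma Zf_fix : ps Zf = ps (Phi Zf) /\ yy Zf = yy (Phi Zf) /\ nn Zf = nn (Phi Zf) /\
  mm Zf = mm (Phi Zf) /\ la Zf = la (Phi Zf).
Proof.
  assert (H : forall n, steq (S n) Zf (Phi Zf)).
  { intros n. assert (X := Phi_local n Zf (Zn n) Zf_la0 (Zn_la0 n) (Zf_steq n)).
    assert (Y := Zf_steq (S n)). change (Zn (S n)) with (Phi (Zn n)) in Y.
    destruct X as [A1 [A2 [A3 [A4 A5]]]]. destruct Y as [B1 [B2 [B3 [B4 B5]]]].
    split; [|split; [|split; [|split]]]; intros j l Hjl.
    - rewrite A1, B1; auto. - rewrite A2, B2; auto. - rewrite A3, B3; auto.
    - rewrite A4, B4; auto. - rewrite A5, B5; auto. }
  split; [|split; [|split; [|split]]]; extensionality j; extensionality l;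
   destruct (H (j + l)%nat) as [A1 [A2 [A3 [A4 A5]]]]; auto.
Qed.

Definition state_sym (z : state) : Prop := sym 1 (ps z) /\ sym 1 (yy z) /\ sym 1 (nn z) /\ sym (-1) (mm z).

Lemma sym_eq e e' f : sym e f -> e = e' -> sym e' f.
Proof. now intros H <-. Qed.
Lemma dth_sym f : sym 1 f -> sym (-1) (dth f).
Proof. intros H j l s. unfold dth. rewrite H. ring. Qed.

Lemma newN_sym z : state_sym z -> sym 1 (newN z).
Proof.
  intros [H1 [H2 [H3 H4]]]. assert (E1 : sym 1 (S1 z)) by (intros j l s; unfold S1; rewrite H1, H2; ring).
  assert (E2 : sym 1 (S2 z)) by (intros j l s; unfold S2; rewrite H1, H2; ring).
  assert (E3 : sym 1 (Qm z)) by (intros j l s; unfold Qm; rewrite H1; ring).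
  assert (E4 : sym 1 (Rm z)) by (intros j l s; unfold Rm; rewrite H1, H2; ring).
  assert (F1 := sym_eq _ 1 _ (mulz_sym _ _ _ _ E1 E2) ltac:(ring)).
  assert (F2 := sym_eq _ 1 _ (mulz_sym _ _ _ _ E3 F1) ltac:(ring)).
  assert (F3 := sym_eq _ 1 _ (mulz_sym _ _ _ _ (dth_sym _ H1) (dth_sym _ H1)) ltac:(ring)).
  assert (F4 := sym_eq _ 1 _ (mulz_sym _ _ _ _ H1 F3) ltac:(ring)).
  assert (F5 := sym_eq _ 1 _ (mulz_sym _ _ _ _ E3 E4) ltac:(ring)).
  assert (E5 : sym 1 (QRm z)) by (intros j l s; unfold QRm; rewrite E3, E4, F5; ring).
  assert (F6 := sym_eq _ 1 _ (mulz_sym _ _ _ _ H3 E5) ltac:(ring)).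
  intros j l s. unfold newN, Bq. rewrite F1, F2, F3, F4, F6. ring.
Qed.
Lemma newM_sym z : state_sym z -> sym (-1) (newM z).
Proof.
  intros [H1 [H2 [H3 H4]]]. assert (E3 : sym 1 (Qm z)) by (intros j l s; unfold Qm; rewrite H1; ring).
  assert (F1 := sym_eq _ (-1) _ (mulz_sym _ _ _ _ H1 (dth_sym _ H1)) ltac:(ring)).
  assert (F2 := sym_eq _ (-1) _ (mulz_sym _ _ _ _ E3 H4) ltac:(ring)).
  intros j l s. unfold newM. rewrite F1, F2. ring.
Qed.
Lemma lamd_sym z : sym 1 (lamd z).
Proof. intros j l s. unfold lamd. destruct (Nat.eqb_spec l j); subst; [rewrite Nat.eqb_refl; ring|]. destruct (Nat.eqb_spec j l); [lia|ring]. Qed.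
Lemma newG_sym z : state_sym z -> sym 1 (newG z).
Proof.
  intros H. assert (E := newN_sym z H). destruct H as [H1 [H2 [H3 H4]]].
  assert (X : sym 1 (Xa z)) by (intros j l s; unfold Xa; rewrite H1, H2, H3; ring).
  assert (F := sym_eq _ 1 _ (mul_sym _ _ _ _ (lamd_sym z) (zo_sym _ _ X)) ltac:(ring)).
  intros j l s. unfold newG. rewrite E, F. ring.
Qed.
Lemma wt_sym k j l : wt k j l = wt k l j.
Proof. unfold wt. rewrite Nat.add_comm. ring. Qed.

(** The data at [(l, j)] and [(j, l)] are equal functions, so [epsilon] returns the same solution;
    this takes the place of uniqueness for the linear problem. *)
Lemma sol_at_sym z : state_sym z -> forall j l, sol_at z l j = sol_at z j l.
Proof.
  intros H j l. unfold sol_at. rewrite (absdiff_sym l j), (wt_sym K l j). f_equal.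
  - extensionality s. rewrite (newN_sym z H). ring.
  - extensionality s. rewrite (newG_sym z H). ring.
  - extensionality s. unfold sgnM. rewrite (newM_sym z H j l).
    destruct (Nat.leb_spec j l); destruct (Nat.leb_spec l j); try lia; try ring.
    replace j with l in * by lia. assert (X := newM_sym z H l l s). lra.
Qed.

Lemma Phi_sym z : state_sym z -> state_sym (Phi z).
Proof.
  intros H. split; [|split; [|split]].
  - intros j l s. simpl. rewrite (Nat.add_comm l j), (sol_at_sym z H). destruct (j + l)%nat as [|[|]]; ring.
  - intros j l s. simpl. rewrite (Nat.add_comm l j), (sol_at_sym z H). destruct (j + l)%nat as [|[|]]; ring.
  - now apply newN_sym.
  - now apply newM_sym.
Qed.
Lemma Zn_sym n : state_sym (Zn n).
Proof.
  induction n; [|now apply Phi_sym]. split; [|split; [|split]]; intros j l s; simpl; ring.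
Qed.
Lemma Zf_sym : state_sym Zf.
Proof.
  split; [|split; [|split]]; intros j l s; unfold Zf; cbn [ps yy nn mm]; rewrite (Nat.add_comm l j);
    destruct (Zn_sym (S (j + l))) as [A1 [A2 [A3 A4]]]; auto.
Qed.

Definition arr_cont n (f : arr) : Prop := forall j l, (j + l < n)%nat -> forall s, I s -> continuous (f j l) s.

Lemma sum_continuous (f : nat -> R -> R) n s : (forall a, (a <= n)%nat -> continuous (f a) s) ->
  continuous (fun s => sum_f_R0 (fun a => f a s) n) s.
Proof.
  induction n as [|n IH]; intros H; simpl.
  - now apply H.
  - apply continuous_Rplus; [apply IH; intros; apply H; lia|apply H; lia].
Qed.
Lemma mulz_cont n f g : arr_cont n f -> arr_cont n g -> arr_cont (S n) (mulz f g).
Proof.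
  intros Hf Hg j l Hjl s Hs. unfold mulz, mul.
  apply (sum_continuous (fun a s => sum_f_R0 (fun b => zc f a b s * zc g (j - a)%nat (l - b)%nat s) l)). intros a Ha.
  apply (sum_continuous (fun b s => zc f a b s * zc g (j - a)%nat (l - b)%nat s)). intros c Hc.
  destruct (Nat.eq_dec (a + c) 0) as [E|E].
  { replace a with 0%nat by lia. replace c with 0%nat by lia.
    apply (continuous_ext (fun _ => 0)); [intros; rewrite zc_z; symmetry; apply Rmult_0_l|apply continuous_const]. }
  destruct (Nat.eq_dec ((j - a) + (l - c)) 0) as [E'|E'].
  { replace (j - a)%nat with 0%nat by lia. replace (l - c)%nat with 0%nat by lia.
    apply (continuous_ext (fun _ => 0)); [intros; rewrite zc_z; symmetry; apply Rmult_0_r|apply continuous_const]. }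
  apply (continuous_ext (fun s => f a c s * g (j - a)%nat (l - c)%nat s)); [intros; now rewrite !zc_nz|].
  apply continuous_Rmult; [apply Hf|apply Hg]; auto; lia.
Qed.
Lemma mulzo_cont n f g : arr_cont (pred n) f -> arr_cont n g -> (forall s, f 0%nat 0%nat s = 0) -> arr_cont (S n) (mul f (zo g)).
Proof.
  intros Hf Hg Z j l Hjl s Hs. unfold mul.
  apply (sum_continuous (fun a s => sum_f_R0 (fun b => f a b s * zo g (j - a)%nat (l - b)%nat s) l)). intros a Ha.
  apply (sum_continuous (fun b s => f a b s * zo g (j - a)%nat (l - b)%nat s)). intros c Hc.
  destruct (Nat.eq_dec (a + c) 0) as [E|E].
  { replace a with 0%nat by lia. replace c with 0%nat by lia.
    apply (continuous_ext (fun _ => 0)); [intros; rewrite Z; symmetry; apply Rmult_0_l|apply continuous_const]. }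
  unfold zo. destruct (Nat.leb_spec (j - a + (l - c)) 1).
  - apply (continuous_ext (fun _ => 0)); [intros; symmetry; apply Rmult_0_r|apply continuous_const].
  - apply continuous_Rmult; [apply Hf|apply Hg]; auto; lia.
Qed.
Lemma arr_cont_coef n f (c : R -> R) : (forall s, I s -> continuous c s) -> arr_cont n f -> arr_cont n (fun j l s => c s * f j l s).
Proof. intros Hc Hf j l Hjl s Hs. apply continuous_Rmult; [auto|apply Hf; auto]. Qed.
Lemma arr_cont_add n f g : arr_cont n f -> arr_cont n g -> arr_cont n (fun j l s => f j l s + g j l s).
Proof. intros Hf Hg j l Hjl s Hs. apply continuous_Rplus; [apply Hf|apply Hg]; auto. Qed.
Lemma arr_cont_sub n f g : arr_cont n f -> arr_cont n g -> arr_cont n (fun j l s => f j l s - g j l s).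
Proof. intros Hf Hg j l Hjl s Hs. apply continuous_Rminus; [apply Hf|apply Hg]; auto. Qed.
Lemma arr_cont_weak n f : arr_cont (S n) f -> arr_cont n f.
Proof. intros H j l Hjl. apply H. lia. Qed.
Lemma arr_cont_dth n f : arr_cont n f -> arr_cont n (dth f).
Proof. intros H j l Hjl s Hs. unfold dth. apply continuous_Rmult; [apply continuous_const|now apply H]. Qed.

Lemma coef_lin a1 a2 c d : coef_ok c -> coef_ok d ->
  (forall s, I s -> continuous (fun s => a1 * c s + a2 * d s) s) /\
  (forall s, I s -> Rabs (a1 * c s + a2 * d s) <= (Rabs a1 + Rabs a2) * M0).
Proof.
  intros [Hc Hcb] [Hd Hdb]. split; intros s Hs.
  - apply continuous_Rplus; apply continuous_Rmult; auto; apply continuous_const.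
  - triang. rewrite !Rabs_mult, Rmult_plus_distr_r.
    apply Rplus_le_compat; apply Rmult_le_compat_l; auto; apply Rabs_pos.
Qed.
Lemma coef_mul c d : coef_ok c -> coef_ok d ->
  (forall s, I s -> continuous (fun s => c s * d s) s) /\
  (forall s, I s -> Rabs (c s * d s) <= M0 * M0).
Proof.
  intros [Hc Hcb] [Hd Hdb]. split; intros s Hs.
  - apply continuous_Rmult; auto.
  - rewrite Rabs_mult. apply Rmult_le_compat; auto; apply Rabs_pos.
Qed.

(** * Majorant estimate: geometric growth of the coefficients *)

Section Majorant.
Variables (rho A cF : R).
Hypothesis rho_pos : 0 < rho <= 1.
(** A large [K] makes the weighted size [rho] of the first-order terms small: the prescribed
    coefficients of [dth psi] have absolute value 2, and the weight at order 1 is [K / 4 = 2 / rho].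
    From order 2 on, everything is kept below [A rho^2]. *)
Hypothesis K_def : K = 8 / rho.
Hypothesis cB_def : cB = cF * rho ^ 2.
(** [cF rho^2] bounds all sources of the linear problems: [newN], then [(1/4 - s^2) h newN] with its
    factor [M0], then [newM], and 1 for the cubic contribution of [lam]. [A] adds the constant of
    the solver. *)
Hypothesis cF_def : cF = (M0 + 1) * (2000000 * M0 ^ 3) + 1 + 1000 * M0.
Hypothesis A_def : A = (Cs + 1) * cF.
Hypothesis rho_small : 100000000 * A ^ 2 * M0 ^ 3 * rho <= 1.

Lemma M0_pow3 : 1 <= M0 ^ 3 /\ M0 <= M0 ^ 3 /\ M0 ^ 2 <= M0 ^ 3.
Proof. assert (1 <= M0 ^ 2) by nra. split; [|split]; nra. Qed.
Lemma cF_big : 2000000 * M0 ^ 3 <= cF /\ 1 <= cF /\ cF <= A.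
Proof.
  destruct M0_pow3. rewrite A_def. assert (H1 : 2000000 * M0 ^ 3 <= cF) by (rewrite cF_def; nra).
  split; [auto|]. split; nra.
Qed.
Lemma A_big : 1 <= A.
Proof. destruct cF_big as [? [? ?]]. lra. Qed.
Lemma small1 : 1000000 * A * M0 ^ 3 * rho <= 1 /\ 100000 * A ^ 2 * M0 * rho <= 1 /\ A * rho <= 1.
Proof.
  pose proof A_big. destruct M0_pow3 as [H1 [H2 H3]]. assert (HA : A <= A ^ 2) by nra.
  assert (E1 : A * M0 ^ 3 <= A ^ 2 * M0 ^ 3) by (apply Rmult_le_compat_r; lra).
  assert (E2 : A ^ 2 * M0 <= A ^ 2 * M0 ^ 3) by (apply Rmult_le_compat_l; nra).
  assert (E3 : A * 1 <= A * M0 ^ 3) by (apply Rmult_le_compat_l; lra).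
  assert (F1 : A * M0 ^ 3 * rho <= A ^ 2 * M0 ^ 3 * rho) by (apply Rmult_le_compat_r; lra).
  assert (F2 : A ^ 2 * M0 * rho <= A ^ 2 * M0 ^ 3 * rho) by (apply Rmult_le_compat_r; lra).
  assert (F3 : A * 1 * rho <= A * M0 ^ 3 * rho) by (apply Rmult_le_compat_r; lra).
  assert (0 <= A ^ 2 * M0 ^ 3 * rho) by (apply Rmult_le_pos; nra). split; [|split]; nra.
Qed.
Lemma K_ge1 : 1 <= K.
Proof. rewrite K_def. apply le_div_intro; lra. Qed.

Definition inv n (z : state) : Prop :=
  (arr_cont n (ps z) /\ arr_cont n (yy z) /\ arr_cont n (nn z) /\ arr_cont n (mm z)) /\
  (bd K rho n (ps z) /\ bd K rho n (dth (ps z)) /\ bd K rho n (yy z) /\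
   bd K (A * rho ^ 2) n (nn z) /\ bd K (A * rho ^ 2) n (mm z)) /\
  (bd K (A * rho ^ 2) n (zo (ps z)) /\ bd K (A * rho ^ 2) n (zo (yy z)) /\ bd K (A * rho ^ 2) n (la z)).

Lemma A_rho2 : A * rho ^ 2 <= rho.
Proof. destruct small1 as [_ [_ H]]. nra. Qed.
Lemma A_rho2_pos : 0 <= A * rho ^ 2.
Proof. pose proof A_big. apply Rmult_le_pos; nra. Qed.

Lemma bd_S1 n z : inv n z -> bd K (4 * M0 * rho) n (S1 z).
Proof.
  intros [_ [[B1 [_ [B2 _]]] _]]. pose proof K_ge1. eapply bd_mono; [apply K_ge1| |].
  - apply bd_add; [apply B2|]. apply bd_coef with (M := 3 * M0); [|apply B1].
    intros s Hs. destruct (coef_lin 2 (-1) ah mu ah_ok mu_ok) as [_ X].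
    specialize (X s Hs). rewrite (Rabs_right 2), (Rabs_left (-1)) in X by lra.
    replace (2 * ah s - mu s) with (2 * ah s + -1 * mu s) by ring. lra.
  - nra.
Qed.
Lemma bd_S2 n z : inv n z -> bd K (2 * M0 * rho) n (S2 z).
Proof.
  intros [_ [[B1 [_ [B2 _]]] _]]. eapply bd_mono; [apply K_ge1| |].
  - apply bd_sub; apply bd_coef; [apply al'_ok|apply B1|apply al_ok|apply B2].
  - lra.
Qed.
Lemma bd_Qm n z : inv n z -> bd K (2 * M0 * rho) n (Qm z).
Proof.
  intros [_ [[B1 [_ [B2 _]]] _]].
  apply bd_coef; [|apply B1]. intros s Hs. rewrite Rabs_mult, (Rabs_right 2) by lra.
  assert (X := proj2 al_ok s Hs). lra.
Qed.
Lemma bd_Rm n z : inv n z -> bd K (6 * M0 ^ 2 * rho) n (Rm z).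
Proof.
  intros [_ [[B1 [_ [B2 _]]] _]]. eapply bd_mono; [apply K_ge1| |].
  - apply bd_sub; [apply bd_coef with (M := 5 * M0 ^ 2); [|apply B1]|apply bd_coef; [apply al_ok|apply B2]].
    intros s Hs. assert (X1 := proj2 (coef_mul al mu al_ok mu_ok) s Hs).
    assert (X2 := proj2 (coef_mul al ah al_ok ah_ok) s Hs). assert (X3 := proj2 al_ok s Hs).
    replace (al s * mu s + 2 * al s * (1 - ah s)) with (al s * mu s + (2 * al s + -2 * (al s * ah s))) by ring.
    triang. apply Rle_trans with (M0 * M0 + (2 * M0 + 2 * (M0 * M0))); [|nra].
    apply Rplus_le_compat; auto. triang.
    rewrite (Rabs_mult 2), (Rabs_mult (-2)), (Rabs_right 2), (Rabs_left (-2)) by lra. lra.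
  - assert (M0 * rho <= M0 ^ 2 * rho) by (apply Rmult_le_compat_r; nra). lra.
Qed.
Lemma bd_QRm n z : inv n z -> bd K (3080 * M0 ^ 3 * rho) n (QRm z).
Proof.
  intros H. assert (B1 := bd_Qm n z H). assert (B2 := bd_Rm n z H). destruct M0_pow3 as [H1 [H2 H3]].
  assert (B3 := bd_mulz K K_ge1 _ _ n _ _ B1 B2 ltac:(pos) ltac:(pos)).
  eapply bd_mono; [apply K_ge1|apply bd_add; [apply bd_add; [apply B1|apply B2]|]|].
  - intros j l Hjl. apply B3. lia.
  - assert (0 <= M0 ^ 3 * rho) by (apply Rmult_le_pos; lra). assert (M0 ^ 3 * rho * rho <= M0 ^ 3 * rho) by nra.
    assert (M0 * rho <= M0 ^ 3 * rho) by nra. assert (M0 ^ 2 * rho <= M0 ^ 3 * rho) by nra.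
    replace (256 * (2 * M0 * rho) * (6 * M0 ^ 2 * rho)) with (3072 * (M0 ^ 3 * rho * rho)) by ring. lra.
Qed.

(** All terms are at least quadratic, hence of size [rho^2]. The product of [N] with [QRm] is cubic
    with a factor [A], and the smallness of [rho] absorbs it. *)
Lemma bd_newN n z : inv n z -> bd K (2000000 * M0 ^ 3 * rho ^ 2) (S n) (newN z).
Proof.
  intros H. assert (B1 := bd_S1 n z H). assert (B2 := bd_S2 n z H). assert (B3 := bd_Qm n z H).
  assert (B4 := bd_QRm n z H). destruct M0_pow3 as [H1 [H2 H3]]. pose proof A_rho2_pos as HAp.
  assert (C1 := bd_mulz K K_ge1 _ _ n _ _ B1 B2 ltac:(pos) ltac:(pos)).
  assert (C1' : bd K (256 * (4 * M0 * rho) * (2 * M0 * rho)) n (mulz (S1 z) (S2 z))) by (intros j l Hjl; apply C1; lia).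
  assert (C2 := bd_mulz K K_ge1 _ _ n _ _ B3 C1' ltac:(pos) ltac:(pos)).
  destruct H as [_ [[P1 [P2 [P3 [P4 P5]]]] _]].
  assert (C3 := bd_mulz K K_ge1 _ _ n _ _ P2 P2 ltac:(pos) ltac:(pos)).
  assert (C3' : bd K (256 * rho * rho) n (mulz (dth (ps z)) (dth (ps z)))) by (intros j l Hjl; apply C3; lia).
  assert (C4 := bd_mulz K K_ge1 _ _ n _ _ P1 C3' ltac:(pos) ltac:(pos)).
  assert (C5 := bd_mulz K K_ge1 _ _ n _ _ P4 B4 HAp ltac:(pos)). eapply bd_mono; [apply K_ge1| |].
  - unfold newN, Bq. apply bd_sub; [apply bd_add; [apply bd_add; [apply C1|apply C2]|apply bd_add; apply bd_coef]|apply C5].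
    + apply al_ok. + apply C3.
    + intros s Hs. apply (proj2 (coef_mul al nu al_ok nu_ok) s Hs).
    + apply C4.
  - destruct small1 as [X1 [X2 X3]]. set (u := M0 ^ 3 * rho ^ 2).
    assert (Hu : 0 <= u) by (unfold u; apply Rmult_le_pos; nra).
    assert (E1 : 256 * (4 * M0 * rho) * (2 * M0 * rho) <= 2048 * u).
    { unfold u. replace (256 * (4 * M0 * rho) * (2 * M0 * rho)) with (2048 * (M0 ^ 2 * rho ^ 2)) by ring.
      assert (M0 ^ 2 * rho ^ 2 <= M0 ^ 3 * rho ^ 2) by (apply Rmult_le_compat_r; nra). lra. }
    assert (E2 : 256 * (2 * M0 * rho) * (256 * (4 * M0 * rho) * (2 * M0 * rho)) <= 1048576 * u).
    { unfold u. replace (256 * (2 * M0 * rho) * (256 * (4 * M0 * rho) * (2 * M0 * rho))) with (1048576 * (M0 ^ 3 * rho ^ 2 * rho)) by ring.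
      fold u. nra. }
    assert (E3 : M0 * (256 * rho * rho) <= 256 * u).
    { unfold u. replace (M0 * (256 * rho * rho)) with (256 * (M0 * rho ^ 2)) by ring.
      assert (M0 * rho ^ 2 <= M0 ^ 3 * rho ^ 2) by (apply Rmult_le_compat_r; nra). lra. }
    assert (E4 : M0 * M0 * (256 * rho * (256 * rho * rho)) <= 65536 * u).
    { replace (M0 * M0 * (256 * rho * (256 * rho * rho))) with (65536 * (M0 ^ 2 * rho ^ 2 * rho)) by ring.
      assert (M0 ^ 2 * rho ^ 2 <= u) by (apply Rmult_le_compat_r; nra).
      assert (0 <= M0 ^ 2 * rho ^ 2) by (apply Rmult_le_pos; nra). nra. }
    assert (E5 : 256 * (A * rho ^ 2) * (3080 * M0 ^ 3 * rho) <= u).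
    { replace (256 * (A * rho ^ 2) * (3080 * M0 ^ 3 * rho)) with (rho ^ 2 * (788480 * (A * M0 ^ 3 * rho))) by ring.
      assert (0 <= A * M0 ^ 3 * rho). { pose proof A_big. apply Rmult_le_pos; nra. }
      assert (788480 * (A * M0 ^ 3 * rho) <= 1) by lra.
      apply Rle_trans with (rho ^ 2 * 1); [apply Rmult_le_compat_l; nra|]. unfold u. nra. }
    replace (2000000 * M0 ^ 3 * rho ^ 2) with (2000000 * u) by (unfold u; ring). lra.
Qed.

Lemma bd_newM n z : inv n z -> bd K (1000 * M0 * rho ^ 2) (S n) (newM z).
Proof.
  intros H. assert (B3 := bd_Qm n z H). pose proof A_rho2_pos as HAp.
  destruct H as [_ [[P1 [P2 [P3 [P4 P5]]]] _]].
  assert (C3 := bd_mulz K K_ge1 _ _ n _ _ P1 P2 ltac:(pos) ltac:(pos)).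
  assert (C5 := bd_mulz K K_ge1 _ _ n _ _ B3 P5 ltac:(pos) HAp). eapply bd_mono; [apply K_ge1| |].
  - unfold newM. apply bd_sub; [apply bd_coef|apply C5]; [|apply C3].
    intros s Hs. destruct (coef_lin 2 (-1) al nu al_ok nu_ok) as [_ X].
    specialize (X s Hs). replace (2 * al s - nu s) with (2 * al s + -1 * nu s) by ring. exact X.
  - rewrite (Rabs_right 2), (Rabs_left (-1)) by lra. destruct small1 as [X1 [X2 X3]].
    replace (256 * (2 * M0 * rho) * (A * rho ^ 2)) with (512 * M0 * rho ^ 2 * (A * rho)) by ring.
    pose proof A_big. assert (0 <= A * rho) by nra.
    replace ((2 + - -1) * M0 * (256 * rho * rho)) with (768 * (M0 * rho ^ 2)) by ring.
    assert (Z : A * rho <= 1 / 10). { assert (A * rho <= A * M0 ^ 3 * rho). { destruct M0_pow3 as [H1 _]. rewrite <- (Rmult_1_r A) at 1. apply Rmult_le_compat_r; [lra|]. apply Rmult_le_compat_l; lra. } lra. }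
    assert (0 <= M0 * rho ^ 2) by (apply Rmult_le_pos; nra). nra.
Qed.

(** The diagonal coefficient of [lam] at [(a, a)] is stored one order higher, which costs a factor
    [K = 8 / rho] and turns [A rho^2] into [8 A rho]. As [zo] leaves in [Xa] only terms of size
    [A rho^2], the product is cubic in [rho]. The first-order part of [Xa] would give a multiple of
    [A rho^2], which smallness of [rho] could not absorb. *)
Lemma bd_lam n z : la0 z -> inv n z -> bd K (10240 * M0 * A ^ 2 * rho ^ 3) (S n) (mul (lamd z) (zo (Xa z))).
Proof.
  intros L H j l Hjl s Hs. pose proof A_rho2_pos as HAp. pose proof A_big as HA1.
  destruct H as [_ [[P1 [P2 [P3 [P4 P5]]]] [P6 [P7 P8]]]].
  assert (BX : bd K (5 * M0 * (A * rho ^ 2)) n (zo (Xa z))).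
  { eapply bd_mono with (r := 2 * M0 * (A * rho ^ 2) + 2 * M0 * (A * rho ^ 2) + M0 * (A * rho ^ 2)); [apply K_ge1| |lra].
    intros j' l' H' t Ht. assert (Q1 := P6 j' l' H' t Ht). assert (Q2 := P7 j' l' H' t Ht). assert (Q3 := P4 j' l' H' t Ht).
    unfold zo in *. destruct (Nat.leb_spec (j' + l') 1).
    { rewrite Rabs_R0. pose proof (wt_pos K K_ge1 j' l'). apply Rmult_le_pos; [|lra]. nra. }
    unfold Xa. rewrite !Rmult_plus_distr_r. assert (X1 := proj2 sc_ok t Ht). assert (X2 := proj2 b_ok t Ht).
    triang. apply Rplus_le_compat; [triang; apply Rplus_le_compat|];
    rewrite !Rabs_mult, ?(Rabs_right 2), ?(Rabs_left (-2)) by lra; rewrite (Rmult_assoc _ (A * rho ^ 2)); apply Rmult_le_compat; auto; try apply Rabs_pos; try lra.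
    - pose proof (Rabs_pos (sc t)). lra. - pose proof (Rabs_pos (b t)). lra. }
  replace (10240 * M0 * A ^ 2 * rho ^ 3) with (256 * (8 * A * rho) * (5 * M0 * (A * rho ^ 2))) by ring.
  apply bd_mul; [apply K_ge1|nra|nra|]. intros a c Ha Hc.
  assert (Pw : 0 <= 8 * A * rho * wt K a c * (5 * M0 * (A * rho ^ 2) * wt K (j - a) (l - c))).
  { pose proof (wt_pos K K_ge1 a c). pose proof (wt_pos K K_ge1 (j - a) (l - c)).
    apply Rmult_le_pos; apply Rmult_le_pos; nra. }
  destruct (Nat.eq_dec (a + c) 0) as [E|E].
  { replace a with 0%nat in * by lia. replace c with 0%nat in * by lia. rewrite lamd00, Rmult_0_l, Rabs_R0; auto. }
  destruct (Nat.leb_spec (j - a + (l - c)) 1) as [E2|E2].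
  { unfold zo. destruct (Nat.leb_spec (j - a + (l - c)) 1); [|lia]. rewrite Rmult_0_r, Rabs_R0; auto. }
  rewrite Rabs_mult. apply Rmult_le_compat; try apply Rabs_pos; [|apply BX; auto; lia].
  unfold lamd. destruct (Nat.eqb_spec a c).
  - subst c. eapply Rle_trans; [apply P8; auto; lia|].
    unfold wt. replace (S a + a)%nat with (S (a + a)) by lia. simpl pow at 2.
    pose proof (qw_decr a). pose proof (qw_pos a). pose proof (qw_pos (S a)).
    assert (0 < K ^ (a + a)) by (apply pow_lt; pose proof K_ge1; lra).
    replace (A * rho ^ 2 * (K * K ^ (a + a) * (qw (S a) * qw a))) with (8 * A * rho * (K ^ (a + a) * (qw (S a) * qw a))).
    + apply Rmult_le_compat_l; [nra|]. apply Rmult_le_compat_l; [lra|]. apply Rmult_le_compat_r; lra.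
    + rewrite K_def. field. lra.
  - rewrite Rabs_R0. pose proof (wt_pos K K_ge1 a c). apply Rmult_le_pos; nra.
Qed.

Lemma cont_newN n z : inv n z -> arr_cont (S n) (newN z).
Proof.
  intros [[P1 [P2 [P3 P4]]] _]. assert (k1 : arr_cont n (S1 z)).
  { apply (arr_cont_add n (yy z) (fun j l s => (2 * ah s - mu s) * ps z j l s)); auto.
    apply (arr_cont_coef n (ps z) (fun s => 2 * ah s - mu s)); auto. intros s Hs.
    apply continuous_Rminus; [apply continuous_Rmult; [apply continuous_const|now apply ah_ok]|now apply mu_ok]. }
  assert (k2 : arr_cont n (S2 z)).
  { apply (arr_cont_sub n (fun j l s => al' s * ps z j l s) (fun j l s => al s * yy z j l s)); apply arr_cont_coef; auto; [apply al'_ok|apply al_ok]. }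
  assert (k3 : arr_cont n (Qm z)).
  { apply (arr_cont_coef n (ps z) (fun s => 2 * al s)); auto. intros s Hs. apply continuous_Rmult; [apply continuous_const|now apply al_ok]. }
  assert (k4 : arr_cont n (Rm z)).
  { apply (arr_cont_sub n (fun j l s => (al s * mu s + 2 * al s * (1 - ah s)) * ps z j l s) (fun j l s => al s * yy z j l s)).
    - apply (arr_cont_coef n (ps z) (fun s => al s * mu s + 2 * al s * (1 - ah s))); auto. intros s Hs.
      apply continuous_Rplus; [apply continuous_Rmult; [now apply al_ok|now apply mu_ok]|].
      apply continuous_Rmult; [apply continuous_Rmult; [apply continuous_const|now apply al_ok]|].
      apply continuous_Rminus; [apply continuous_const|now apply ah_ok].
    - apply arr_cont_coef; auto. apply al_ok. }
  assert (k5 : arr_cont n (QRm z)).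
  { apply (arr_cont_add n (fun j l s => Qm z j l s + Rm z j l s) (mulz (Qm z) (Rm z))).
    - now apply arr_cont_add. - now apply arr_cont_weak, mulz_cont. }
  assert (k6 := mulz_cont n _ _ k1 k2). assert (k7 := mulz_cont n _ _ k3 (arr_cont_weak _ _ k6)).
  assert (k8 := mulz_cont n _ _ (arr_cont_dth _ _ P1) (arr_cont_dth _ _ P1)).
  assert (k9 := mulz_cont n _ _ P1 (arr_cont_weak _ _ k8)). assert (k10 := mulz_cont n _ _ P3 k5).
  apply (arr_cont_sub (S n) (Bq z) (mulz (nn z) (QRm z))); auto.
  apply (arr_cont_add (S n) (fun j l s => mulz (S1 z) (S2 z) j l s + mulz (Qm z) (mulz (S1 z) (S2 z)) j l s)
    (fun j l s => al s * mulz (dth (ps z)) (dth (ps z)) j l s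
     + (al s * nu s) * mulz (ps z) (mulz (dth (ps z)) (dth (ps z))) j l s)).
  - now apply arr_cont_add.
  - apply (arr_cont_add (S n) (fun j l s => al s * mulz (dth (ps z)) (dth (ps z)) j l s)
     (fun j l s => (al s * nu s) * mulz (ps z) (mulz (dth (ps z)) (dth (ps z))) j l s)).
    + apply arr_cont_coef; auto. apply al_ok.
    + apply (arr_cont_coef (S n) (mulz (ps z) (mulz (dth (ps z)) (dth (ps z)))) (fun s => al s * nu s)); auto.
      intros s Hs. apply continuous_Rmult; [now apply al_ok|now apply nu_ok].
Qed.

Lemma cont_newM n z : inv n z -> arr_cont (S n) (newM z).
Proof.
  intros [[P1 [P2 [P3 P4]]] _]. assert (k3 : arr_cont n (Qm z)).
  { apply (arr_cont_coef n (ps z) (fun s => 2 * al s)); auto. intros s Hs. apply continuous_Rmult; [apply continuous_const|now apply al_ok]. }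
  apply (arr_cont_sub (S n) (fun j l s => (2 * al s - nu s) * mulz (ps z) (dth (ps z)) j l s) (mulz (Qm z) (mm z))).
  - apply (arr_cont_coef (S n) (mulz (ps z) (dth (ps z))) (fun s => 2 * al s - nu s)).
    + intros s Hs. apply continuous_Rminus; [apply continuous_Rmult; [apply continuous_const|now apply al_ok]|now apply nu_ok].
    + apply mulz_cont; auto. now apply arr_cont_dth.
  - now apply mulz_cont.
Qed.

Lemma cont_newG n z : la0 z -> (forall j l s t, la z j l s = la z j l t) -> inv n z -> arr_cont (S n) (newG z).
Proof.
  intros L Lc H. assert (k := cont_newN n z H).
  apply (arr_cont_add (S n) (fun j l s => h s * newN z j l s) (mul (lamd z) (zo (Xa z)))).
  - now apply arr_cont_coef.
  - apply mulzo_cont; [| |now intros; apply lamd00].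
    + intros j l Hjl s Hs. unfold lamd. destruct (Nat.eqb j l).
      * apply (continuous_ext (fun _ => la z (S j) l 0)); [intros; apply Lc|apply continuous_const].
      * apply continuous_const.
    + destruct H as [[P1 [P2 [P3 P4]]] _].
      apply (arr_cont_add n (fun j l s => (-2 * sc s) * yy z j l s + (2 * b s) * ps z j l s) (fun j l s => sc s * nn z j l s)).
      * apply (arr_cont_add n (fun j l s => (-2 * sc s) * yy z j l s) (fun j l s => (2 * b s) * ps z j l s)).
        -- apply (arr_cont_coef n (yy z) (fun s => -2 * sc s)); auto. intros s Hs. apply continuous_Rmult; [apply continuous_const|now apply sc_ok].
        -- apply (arr_cont_coef n (ps z) (fun s => 2 * b s)); auto. intros s Hs. apply continuous_Rmult; [apply continuous_const|now apply b_ok].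
      * apply arr_cont_coef; auto. apply sc_ok.
Qed.

Lemma la_const j l s t : la Zf j l s = la Zf j l t.
Proof. destruct Zf_fix as [_ [_ [_ [_ E]]]]. rewrite E. simpl. destruct (Nat.leb (j + l) 1); auto. Qed.

Lemma sol_at_spec n j l : inv n Zf -> (j + l < S n)%nat ->
  sol_spec h b Cs (absdiff j l) (cB * wt K j l) (newN Zf j l) (newG Zf j l) (sgnM Zf j l) (sol_at Zf j l).
Proof.
  intros H Hjl. unfold sol_at, SOL. apply (epsilon_spec (inhabits _)).
  assert (B1 := bd_newN n Zf H j l Hjl). assert (B2 := bd_newM n Zf H j l Hjl).
  assert (B3 := bd_lam n Zf Zf_la0 H j l Hjl). pose proof (wt_pos K K_ge1 j l) as W.
  destruct cF_big as [c1 [c2 c3]]. destruct M0_pow3 as [m1 [m2 m3]].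
  assert (Hr : 0 < rho ^ 2) by (apply pow_lt; lra). destruct small1 as [X1 [X2 X3]].
  assert (L1 : 2000000 * M0 ^ 3 * rho ^ 2 <= cB) by (rewrite cB_def; apply Rmult_le_compat_r; lra).
  assert (L2 : 1000 * M0 * rho ^ 2 <= cB).
  { rewrite cB_def. apply Rmult_le_compat_r; [lra|]. rewrite cF_def.
    assert (0 <= (M0 + 1) * (2000000 * M0 ^ 3)) by nra. lra. }
  assert (HcB : 0 <= cB) by (rewrite cB_def; nra). apply solver.
  - apply Rmult_le_pos; lra.
  - now apply (cont_newN n).
  - apply (cont_newG n); auto. + apply Zf_la0. + apply la_const.
  - intros s Hs. unfold sgnM. destruct (Nat.leb l j); [|apply continuous_Ropp]; now apply (cont_newM n).
  - intros s Hs. eapply Rle_trans; [now apply B1|]. apply Rmult_le_compat_r; lra.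
  - intros s Hs. unfold newG. triang. assert (D : 0 < 1/4 - s ^ 2 <= 1/4) by (unfold I in Hs; nra).
    apply le_div_intro; [lra|]. rewrite Rmult_plus_distr_r.
    assert (Y1 : Rabs (h s * newN Zf j l s) * (1/4 - s ^ 2) <= M0 * (2000000 * M0 ^ 3 * rho ^ 2 * wt K j l)).
    { rewrite Rabs_mult. replace (Rabs (h s) * Rabs (newN Zf j l s) * (1/4 - s ^ 2)) with (Rabs (h s) * (1/4 - s ^ 2) * Rabs (newN Zf j l s)) by ring.
      apply Rmult_le_compat; [apply Rmult_le_pos; [apply Rabs_pos|lra]|apply Rabs_pos| |now apply B1].
      apply Rle_div_r; [lra|]. now apply h_bound. }
    assert (Y2 : Rabs (mul (lamd Zf) (zo (Xa Zf)) j l s) * (1/4 - s ^ 2) <= 10240 * M0 * A ^ 2 * rho ^ 3 * wt K j l).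
    { eapply Rle_trans; [|exact (B3 s Hs)]. pose proof (Rabs_pos (mul (lamd Zf) (zo (Xa Zf)) j l s)). nra. }
    assert (Y3 : 10240 * M0 * A ^ 2 * rho ^ 3 <= rho ^ 2).
    { replace (10240 * M0 * A ^ 2 * rho ^ 3) with (10240 * (A ^ 2 * M0 * rho) * rho ^ 2) by ring.
      pose proof A_big. assert (0 <= A ^ 2 * M0 * rho) by (apply Rmult_le_pos; nra).
      assert (10240 * (A ^ 2 * M0 * rho) <= 1) by lra. nra. }
    assert (Y4 : M0 * (2000000 * M0 ^ 3 * rho ^ 2 * wt K j l) + 10240 * M0 * A ^ 2 * rho ^ 3 * wt K j l <= cB * wt K j l).
    { replace (M0 * (2000000 * M0 ^ 3 * rho ^ 2 * wt K j l) + 10240 * M0 * A ^ 2 * rho ^ 3 * wt K j l)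
        with ((M0 * (2000000 * M0 ^ 3) * rho ^ 2 + 10240 * M0 * A ^ 2 * rho ^ 3) * wt K j l) by ring.
      apply Rmult_le_compat_r; [lra|]. rewrite cB_def, cF_def.
      replace (((M0 + 1) * (2000000 * M0 ^ 3) + 1 + 1000 * M0) * rho ^ 2)
        with (M0 * (2000000 * M0 ^ 3) * rho ^ 2 + rho ^ 2 + (2000000 * M0 ^ 3 + 1000 * M0) * rho ^ 2) by ring.
      assert (0 <= (2000000 * M0 ^ 3 + 1000 * M0) * rho ^ 2) by (apply Rmult_le_pos; lra). lra. }
    lra.
  - intros s Hs. unfold sgnM. assert (Z : Rabs (newM Zf j l s) <= cB * wt K j l).
    { eapply Rle_trans; [now apply B2|]. apply Rmult_le_compat_r; lra. }
    destruct (Nat.leb l j); rewrite ?Rabs_Ropp; exact Z.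
Qed.

Lemma qw0 : qw 0 = 1.
Proof. unfold qw. simpl. field. Qed.
Lemma qw1 : qw 1 = 1 / 4.
Proof. unfold qw. simpl. field. Qed.
Lemma wt_one j l : (j + l = 1)%nat -> wt K j l = 2 / rho.
Proof.
  intros H. unfold wt. rewrite H. rewrite K_def.
  destruct j as [|[|]]; try lia; destruct l as [|[|]]; try lia; rewrite qw0, qw1; field; lra.
Qed.

(** Bounds below order [n] bound the sources at order [n], since products gain an order, and the
    solver returns the bounds at order [n]. *)
Lemma inv_all n : inv n Zf.
Proof.
  induction n as [|n IH].
  { split; [|split]; [split; [|split; [|split]]|split; [|split; [|split; [|split]]]|split; [|split]]; intros j l H; lia. }
  destruct Zf_fix as [E1 [E2 [E3 [E4 E5]]]]. pose proof A_big as HA. pose proof A_rho2 as HAr.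
  destruct cF_big as [c1 [c2 c3]]. destruct M0_pow3 as [m1 [m2 m3]].
  assert (Hr : 0 < rho ^ 2) by (apply pow_lt; lra). assert (SP := fun j l => sol_at_spec n j l IH).
  assert (HCs : Cs * cB <= A * rho ^ 2) by (rewrite cB_def, A_def; nra).
  assert (HcB : 0 <= cB) by (rewrite cB_def; nra).
  assert (PS : forall j l, (j + l < S n)%nat -> (2 <= j + l)%nat -> ps Zf j l = fst (snd (sol_at Zf j l)) /\ yy Zf j l = snd (snd (sol_at Zf j l))).
  { intros j l H H2. rewrite E1, E2. simpl. destruct (j + l)%nat as [|[|]]; try lia. auto. }
  assert (PS1 : forall j l, (j + l = 1)%nat -> ps Zf j l = (fun _ => 1) /\ yy Zf j l = (fun _ => 0)).
  { intros j l H. rewrite E1, E2. simpl. rewrite H. auto. }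
  assert (PS0 : forall j l, (j + l = 0)%nat -> ps Zf j l = (fun _ => 0) /\ yy Zf j l = (fun _ => 0)).
  { intros j l H. rewrite E1, E2. simpl. rewrite H. auto. }
  assert (HB : forall j l, (j + l < S n)%nat -> (2 <= j + l)%nat -> forall s, I s ->
     Rabs (ps Zf j l s) <= A * rho ^ 2 * wt K j l /\ Rabs (dth (ps Zf) j l s) <= A * rho ^ 2 * wt K j l /\
     Rabs (yy Zf j l s) <= A * rho ^ 2 * wt K j l).
  { intros j l H H2 s Hs. destruct (PS j l H H2) as [Q1 Q2]. destruct (SP j l H) as [_ [_ [_ [Q5 Q6]]]].
    specialize (Q5 s Hs). specialize (Q6 s Hs). rewrite <- Q1 in Q5. rewrite <- Q2 in Q6.
    pose proof (wt_pos K K_ge1 j l) as W.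
    assert (Z : Cs * (cB * wt K j l) <= A * rho ^ 2 * wt K j l) by (rewrite <- Rmult_assoc; apply Rmult_le_compat_r; lra).
    pose proof (Rabs_pos (ps Zf j l s)). pose proof (pos_INR (absdiff j l)).
    assert (0 <= 2 * INR (absdiff j l) * Rabs (ps Zf j l s)) by (apply Rmult_le_pos; lra).
    split; [lra|]. split; [|lra]. unfold dth. rewrite !Rabs_mult, (Rabs_right 2), <- absdiff_INR by lra. lra. }
  assert (C1 : arr_cont (S n) (ps Zf) /\ arr_cont (S n) (yy Zf)).
  { split; intros j l H s Hs; (destruct (Nat.eq_dec (j + l) 0) as [e|e]; [|destruct (Nat.eq_dec (j + l) 1) as [e1|e1]]).
    - rewrite (proj1 (PS0 j l e)). apply continuous_const.
    - rewrite (proj1 (PS1 j l e1)). apply continuous_const.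
    - rewrite (proj1 (PS j l H ltac:(lia))). eapply cont_of_derive. apply (SP j l H); auto.
    - rewrite (proj2 (PS0 j l e)). apply continuous_const.
    - rewrite (proj2 (PS1 j l e1)). apply continuous_const.
    - rewrite (proj2 (PS j l H ltac:(lia))). eapply cont_of_derive. apply (SP j l H); auto. }
  assert (Bz : forall j l, 0 <= rho * wt K j l) by (intros; pose proof (wt_pos K K_ge1 j l); nra).
  assert (Ba : forall j l, 0 <= A * rho ^ 2 * wt K j l) by (intros; pose proof (wt_pos K K_ge1 j l); apply Rmult_le_pos; nra).
  assert (Bar : forall j l, A * rho ^ 2 * wt K j l <= rho * wt K j l).
  { intros. apply Rmult_le_compat_r; auto. left; apply wt_pos, K_ge1. }
  split; [|split].
  - split; [apply C1|]. split; [apply C1|]. split.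
    + rewrite E3. now apply cont_newN.
    + rewrite E4. now apply cont_newM.
  - split; [|split; [|split; [|split]]].
    + intros j l H s Hs. destruct (Nat.eq_dec (j + l) 0) as [e|e]; [|destruct (Nat.eq_dec (j + l) 1) as [e1|e1]].
      * rewrite (proj1 (PS0 j l e)), Rabs_R0. auto.
      * rewrite (proj1 (PS1 j l e1)), Rabs_R1, wt_one by auto. replace (rho * (2 / rho)) with 2 by (field; lra). lra.
      * destruct (HB j l H ltac:(lia) s Hs) as [Q _]. specialize (Bar j l). lra.
    + intros j l H s Hs. destruct (Nat.eq_dec (j + l) 0) as [e|e]; [|destruct (Nat.eq_dec (j + l) 1) as [e1|e1]].
      * unfold dth. rewrite (proj1 (PS0 j l e)), Rmult_0_r, Rabs_R0. auto.
      * unfold dth. rewrite (proj1 (PS1 j l e1)), wt_one by auto. replace (rho * (2 / rho)) with 2 by (field; lra).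
        destruct j as [|[|]]; try lia; destruct l as [|[|]]; try lia; simpl; apply Rabs_le; lra.
      * destruct (HB j l H ltac:(lia) s Hs) as [_ [Q _]]. specialize (Bar j l). lra.
    + intros j l H s Hs. destruct (Nat.eq_dec (j + l) 0) as [e|e]; [|destruct (Nat.eq_dec (j + l) 1) as [e1|e1]].
      * rewrite (proj2 (PS0 j l e)), Rabs_R0. auto.
      * rewrite (proj2 (PS1 j l e1)), Rabs_R0. auto.
      * destruct (HB j l H ltac:(lia) s Hs) as [_ [_ Q]]. specialize (Bar j l). lra.
    + rewrite E3. eapply bd_mono; [apply K_ge1|now apply bd_newN|]. apply Rmult_le_compat_r; lra.
    + rewrite E4. eapply bd_mono; [apply K_ge1|now apply bd_newM|]. apply Rmult_le_compat_r; [lra|].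
      apply Rle_trans with cF; auto. rewrite cF_def. assert (0 <= (M0 + 1) * (2000000 * M0 ^ 3)) by nra. lra.
  - split; [|split].
    + intros j l H s Hs. unfold zo. destruct (Nat.leb_spec (j + l) 1); [rewrite Rabs_R0; auto|]. apply HB; auto.
    + intros j l H s Hs. unfold zo. destruct (Nat.leb_spec (j + l) 1); [rewrite Rabs_R0; auto|]. apply HB; auto.
    + intros j l H s Hs. rewrite E5. simpl. destruct (Nat.leb_spec (j + l) 1); [rewrite Rabs_R0; auto|].
      destruct (Nat.eqb j (S l)); [|rewrite Rabs_R0; auto].
      destruct (SP j l H) as [_ [Q _]]. pose proof (wt_pos K K_ge1 j l) as W.
      assert (Z : Cs * (cB * wt K j l) <= A * rho ^ 2 * wt K j l) by (rewrite <- Rmult_assoc; apply Rmult_le_compat_r; lra).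
      rewrite Rabs_div, (Rabs_right 2) by lra. pose proof (Rabs_pos (fst (sol_at Zf j l))). lra.
Qed.

End Majorant.

Definition e10 : arr := fun a c _ => match a, c with 1%nat, O => 1 | _, _ => 0 end.
Definition e01 : arr := fun a c _ => match a, c with O, 1%nat => 1 | _, _ => 0 end.

Lemma sum_single (f : nat -> R) n k : (k <= n)%nat -> (forall i, (i <= n)%nat -> i <> k -> f i = 0) ->
  sum_f_R0 f n = f k.
Proof.
  induction n as [|n IH]; intros Hk H; simpl.
  - now replace k with 0%nat by lia.
  - destruct (Nat.eq_dec k (S n)) as [->|Hne].
    + rewrite (sum_eq _ (fun _ => 0)); [rewrite sum_cte; ring|]. intros i Hi. apply H; lia.
    + rewrite IH by (try lia; intros; apply H; lia). rewrite (H (S n)) by lia. ring.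
Qed.
Lemma sum_zero (f : nat -> R) n : (forall i, (i <= n)%nat -> f i = 0) -> sum_f_R0 f n = 0.
Proof. intros H. rewrite (sum_eq _ (fun _ => 0)); [rewrite sum_cte; ring|auto]. Qed.

Lemma mul_e10 f j l s : mul f e10 j l s = match j with O => 0 | S j' => f j' l s end.
Proof.
  unfold mul. destruct j as [|j].
  - apply sum_zero. intros a Ha. apply sum_zero. intros c Hc. replace (0 - a)%nat with 0%nat by lia. simpl. ring.
  - rewrite (sum_single _ _ j) by (try lia; intros i Hi Hne; apply sum_zero; intros c Hc; unfold e10;
      destruct (S j - i)%nat as [|[|]] eqn:E; try lia; ring).
    rewrite (sum_single _ _ l) by (try lia; intros c Hc Hne; unfold e10;
      replace (S j - j)%nat with 1%nat by lia; destruct (l - c)%nat eqn:E; try lia; ring).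
    replace (S j - j)%nat with 1%nat by lia. rewrite Nat.sub_diag. simpl. ring.
Qed.
Lemma mul_e01 f j l s : mul f e01 j l s = match l with O => 0 | S l' => f j l' s end.
Proof.
  unfold mul. destruct l as [|l].
  - apply sum_zero. intros a Ha. apply sum_zero. intros c Hc. unfold e01.
    replace (0 - c)%nat with 0%nat by lia. destruct (j - a)%nat; ring.
  - rewrite (sum_single _ _ j) by (try lia; intros i Hi Hne; apply sum_zero; intros c Hc; unfold e01;
      destruct (j - i)%nat eqn:E; try lia; ring).
    rewrite (sum_single _ _ l) by (try lia; intros c Hc Hne; unfold e01;
      replace (j - j)%nat with 0%nat by lia; destruct (S l - c)%nat as [|[|]] eqn:E; try lia; ring).
    rewrite Nat.sub_diag. replace (S l - l)%nat with 1%nat by lia. simpl. ring.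
Qed.
End Recursion.

(** Here [lam] is the diagonal series itself; [pred] undoes the shift made by [lamd]. In terms of
    angular derivatives, [- (dth (dth psi) - 4 psi)] is [psi_thth + 4 psi]. *)
Definition formal_system (psi Y N m lam : arr) : Prop :=
  let z := mkstate psi Y N m (fun j l s => lam (pred j) l s) in
  (forall j l s, I s -> is_derive (psi j l) s (- Y j l s + N j l s)) /\
  (forall j l s, I s -> is_derive (Y j l) s
     (- 2 * h s * Y j l s - (dth (dth psi) j l s - 4 * psi j l s)
      + h s * N j l s + dth m j l s + mul lam (Xa z) j l s)) /\
  (forall j l s, N j l s = newN z j l s) /\
  (forall j l s, m j l s = newM z j l s).

Lemma formal_solution :
  exists K (psi Y N m lam : arr), 1 <= K /\
    formal_system psi Y N m lam /\
    (sym 1 psi /\ sym 1 Y /\ sym 1 N /\ sym (-1) m /\ sym 1 lam) /\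
    (forall j l s, I s -> Rabs (psi j l s) <= K ^ S (j + l) /\ Rabs (Y j l s) <= K ^ S (j + l) /\
       Rabs (N j l s) <= K ^ S (j + l) /\ Rabs (m j l s) <= K ^ S (j + l) /\ Rabs (lam j l s) <= K ^ S (j + l)) /\
    (forall j l s, I s -> continuous (psi j l) s /\ continuous (Y j l) s /\ continuous (N j l) s /\
       continuous (m j l) s) /\
    (forall j l s t, lam j l s = lam j l t) /\ (forall j l s, j <> l -> lam j l s = 0) /\
    (forall s, psi 0%nat 0%nat s = 0 /\ psi 1%nat 0%nat s = 1 /\ psi 0%nat 1%nat s = 1) /\
    (forall s, Y 0%nat 0%nat s = 0 /\ N 0%nat 0%nat s = 0 /\ m 0%nat 0%nat s = 0).
Proof.
  set (cF := (M0 + 1) * (2000000 * M0 ^ 3) + 1 + 1000 * M0). set (A := (Cs + 1) * cF).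
  assert (m3 : 1 <= M0 ^ 3) by (assert (1 <= M0 ^ 2) by nra; nra). assert (HcF : 1 <= cF) by (unfold cF; nra).
  assert (HA : 1 <= A) by (unfold A; nra). assert (HA2 : 1 <= A ^ 2) by nra.
  assert (HAM : 1 <= A ^ 2 * M0 ^ 3) by nra. set (rho := / (100000000 * A ^ 2 * M0 ^ 3)).
  assert (Hrho : 0 < rho <= 1).
  { unfold rho. split; [apply Rinv_0_lt_compat; lra|]. rewrite <- Rinv_1. apply Rinv_le_contravar; lra. }
  assert (Hsm : 100000000 * A ^ 2 * M0 ^ 3 * rho <= 1) by (unfold rho; right; field; nra).
  set (K := 8 / rho). set (cB := cF * rho ^ 2). set (z := Zf K cB). assert (Hinv : forall n, inv K rho A n z).
  { exact (inv_all K cB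
      rho A cF Hrho eq_refl eq_refl eq_refl eq_refl Hsm). }
  assert (HK : 1 <= K) by (unfold K; apply le_div_intro; lra).
  destruct (Zf_fix K cB) as [E1 [E2 [E3 [E4 E5]]]]. fold z in E1, E2, E3, E4, E5.
  destruct (Zf_sym K cB) as [Y1 [Y2 [Y3 Y4]]]. fold z in Y1, Y2, Y3, Y4.
  assert (L0 : la0 z) by (intros s; reflexivity).
  assert (Lc : forall j l s t, la z j l s = la z j l t) by (apply la_const).
  assert (SP : forall j l, sol_spec h b Cs (absdiff j l) (cB * wt K j l) (newN z j l)
     (newG z j l) (sgnM z j l) (sol_at K cB z j l)).
  { intros j l. apply (sol_at_spec K cB
      rho A cF Hrho eq_refl eq_refl eq_refl eq_refl Hsm (S (j + l))); [apply Hinv|lia]. }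
  assert (RS := sol_at_sym K cB z (conj Y1 (conj Y2 (conj Y3 Y4)))). clearbody z.
  assert (N1 : forall j l s, (j + l <= 1)%nat -> nn z j l s = 0).
  { intros j l s H. rewrite E3. simpl. unfold newN, Bq. rewrite !mulz_first by auto. ring. }
  assert (M1 : forall j l s, (j + l <= 1)%nat -> mm z j l s = 0).
  { intros j l s H. rewrite E4. simpl. unfold newM. rewrite !mulz_first by auto. ring. }
  assert (P1 : forall j l s, (j + l = 1)%nat -> ps z j l s = 1 /\ yy z j l s = 0).
  { intros j l s H. rewrite E1, E2. simpl. rewrite H. auto. }
  assert (P0 : forall s, ps z 0%nat 0%nat s = 0 /\ yy z 0%nat 0%nat s = 0).
  { intros s. rewrite E1, E2. simpl. auto. }
  assert (PS : forall j l, (2 <= j + l)%nat -> ps z j l = fst (snd (sol_at K cB z j l)) /\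
      yy z j l = snd (snd (sol_at K cB z j l))).
  { intros j l H. rewrite E1, E2. simpl. destruct (j + l)%nat as [|[|]]; try lia. auto. }
  set (lam := lamd z). assert (LamS : sym 1 lam) by apply lamd_sym.
  assert (Lam00 : forall s, lam 0%nat 0%nat s = 0) by (intros; apply L0).
  set (z' := mkstate (ps z) (yy z) (nn z) (mm z) (fun j l s => lam (pred j) l s)).
  (* The first-order part of [Xa] is [2 b] times the sum of the two variables, so multiplying by it
     shifts [lam] by one index. *)
  assert (XE : forall j l s, mul lam (Xa z) j l s = mul lam (zo (Xa z)) j l s
      + 2 * b s * (match j with O => 0 | S j' => lam j' l s end + match l with O => 0 | S l' => lam j l' s end)).
  { intros j l s. rewrite <- (mul_e10 lam j l s), <- (mul_e01 lam j l s).
    unfold mul. rewrite Rmult_plus_distr_l, !scal_sum, <- !sum_plus.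
    apply sum_eq. intros a Ha. rewrite !(Rmult_comm (sum_f_R0 _ _) (2 * b s)), !scal_sum, <- !sum_plus.
    apply sum_eq. intros c Hc. set (u := (j - a)%nat). set (v := (l - c)%nat). unfold zo.
    destruct (Nat.leb_spec (u + v) 1) as [H|H].
    - destruct u as [|[|]]; destruct v as [|[|]]; try lia; simpl; unfold Xa.
      + destruct (P0 s) as [-> ->]. rewrite N1 by lia. ring.
      + destruct (P1 0%nat 1%nat s eq_refl) as [-> ->]. rewrite N1 by lia. ring.
      + destruct (P1 1%nat 0%nat s eq_refl) as [-> ->]. rewrite N1 by lia. ring.
    - destruct u as [|[|]]; destruct v as [|[|]]; simpl; try lia; ring. }
  (* The shifted terms are what the solver writes as [lam b]: next to the diagonal at most one of
     them survives, and elsewhere both they and the multiplier vanish. *)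
  assert (RES : forall j l s, (2 <= j + l)%nat ->
     2 * b s * (match j with O => 0 | S j' => lam j' l s end + match l with O => 0 | S l' => lam j l' s end)
      = fst (sol_at K cB z j l) * b s).
  { intros j l s Hjl. assert (R1 : forall i s, (1 <= i)%nat -> lam i i s = fst (sol_at K cB z (S i) i) / 2).
    { intros i t Hi. unfold lam, lamd. rewrite Nat.eqb_refl, E5. cbn [la Phi].
      destruct (Nat.leb_spec (S i + i) 1); [lia|]. now rewrite Nat.eqb_refl. }
    assert (R2 : forall j l t, j <> l -> lam j l t = 0).
    { intros j' l' t H. unfold lam, lamd. apply Nat.eqb_neq in H. now rewrite H. }
    destruct (Nat.eq_dec (absdiff j l) 1) as [e|e].
    - unfold absdiff in e. assert (e' : j = S l \/ l = S j) by lia. destruct e' as [->| ->].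
      + rewrite R1 by lia. destruct l as [|l]; [lia|]. rewrite (R2 (S (S l)) l) by lia. field.
      + rewrite R1 by lia. rewrite (RS (S j) j). destruct j as [|j]; [lia|]. rewrite (R2 j (S (S j))) by lia. field.
    - destruct (SP j l) as [_ [_ [Q _]]]. rewrite (Q e). unfold absdiff in e.
      assert (H1 : match j with O => 0 | S j' => lam j' l s end = 0) by (destruct j; auto; apply R2; lia).
      assert (H2 : match l with O => 0 | S l' => lam j l' s end = 0) by (destruct l; auto; apply R2; lia).
      rewrite H1, H2. ring. }
  assert (wq : forall j l, wt K j l <= K ^ (j + l)).
  { intros j l. unfold wt. pose proof (qw_le1 j). pose proof (qw_le1 l). pose proof (qw_pos j). pose proof (qw_pos l).
    assert (0 < K ^ (j + l)) by (apply pow_lt; lra). assert (qw j * qw l <= 1) by nra. nra. }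
  assert (HAr : A * rho ^ 2 <= 1).
  { assert (A * rho <= A ^ 2 * M0 ^ 3 * rho) by (apply Rmult_le_compat_r; nra).
    assert (0 < A * rho) by nra. nra. }
  assert (BK : forall (f : arr) r, 0 <= r <= 1 -> (forall n, bd K r n f) -> forall j l s, I s -> Rabs (f j l s) <= K ^ (j + l)).
  { intros f r Hr Hf j l s Hs. eapply Rle_trans; [apply (Hf (S (j + l)) j l); auto|].
    specialize (wq j l). pose proof (wt_pos K HK j l). nra. }
  assert (KS : forall n x, x <= K ^ n -> x <= K ^ S n).
  { intros n x Hx. simpl. assert (0 < K ^ n) by (apply pow_lt; lra). nra. }
  assert (Ar0 : 0 <= A * rho ^ 2) by (apply Rmult_le_pos; [lra|apply pow2_ge_0]).
  exists K, (ps z), (yy z), (nn z), (mm z), lam.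
  split; [exact HK|]. split; [|split; [|split; [|split; [|split; [|split; [|split]]]]]].
  - unfold formal_system. fold z'. split; [|split; [|split]].
    + intros j l s Hs. destruct (Nat.le_gt_cases 2 (j + l)) as [H|H].
      * rewrite (proj1 (PS j l H)), (proj2 (PS j l H)). destruct (SP j l) as [[Q _] _].
        eapply derive_eq; [apply Q; auto|]. rewrite E3. reflexivity.
      * rewrite N1 by lia. apply (is_derive_ext (fun _ => match (j + l)%nat with O => 0 | _ => 1 end)).
        { intros t. destruct (Nat.eq_dec (j + l) 1) as [e|e].
          - rewrite e. symmetry. apply P1; auto.
          - replace j with 0%nat by lia. replace l with 0%nat by lia. symmetry; apply P0. }
        eapply derive_eq; [apply is_derive_const|]. unfold zero; simpl.
        destruct (Nat.eq_dec (j + l) 1) as [e|e]; [destruct (P1 j l s e) as [_ ->]; ring|].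
        replace j with 0%nat by lia. replace l with 0%nat by lia. destruct (P0 s) as [_ ->]. ring.
    + intros j l s Hs. change (Xa z') with (Xa z). rewrite XE. destruct (Nat.le_gt_cases 2 (j + l)) as [H|H].
      * rewrite RES by auto. destruct (SP j l) as [[_ Q] _].
        rewrite (proj2 (PS j l H)). eapply derive_eq; [apply Q; auto|].
        rewrite <- (proj1 (PS j l H)), <- (proj2 (PS j l H)).
        assert (En : newN z j l s = nn z j l s) by (now rewrite E3).
        assert (Em : newM z j l s = mm z j l s) by (now rewrite E4).
        unfold newG. rewrite En. unfold dth, sgnM. rewrite Em, absdiff_INR. fold lam.
        destruct (Nat.leb_spec l j) as [h0|h0].
        -- apply le_INR in h0. rewrite Rabs_right by lra. ring.
        -- assert (h1 : INR j <= INR l) by (apply le_INR; lia). rewrite Rabs_left1 by lra. ring.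
      * rewrite mulzo_first by lia. rewrite N1 by lia. unfold dth. rewrite M1 by lia.
        apply (is_derive_ext (fun _ => 0)).
        { intros t. destruct (Nat.eq_dec (j + l) 1) as [e|e].
          - symmetry. apply P1; auto.
          - replace j with 0%nat by lia. replace l with 0%nat by lia. symmetry; apply P0. }
        eapply derive_eq; [apply is_derive_const|]. unfold zero; simpl.
        destruct (Nat.eq_dec (j + l) 1) as [e|e].
        -- destruct (P1 j l s e) as [Q1 Q2]. rewrite ?Q1, ?Q2.
           destruct j as [|[|]]; try lia; destruct l as [|[|]]; try lia; rewrite Lam00; simpl; ring.
        -- replace j with 0%nat by lia. replace l with 0%nat by lia. destruct (P0 s) as [Q1 Q2]. rewrite ?Q1, ?Q2. simpl. ring.
    + intros j l s. exact (f_equal (fun f : arr => f j l s) E3).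
    + intros j l s. exact (f_equal (fun f : arr => f j l s) E4).
  - auto.
  - intros j l s Hs. assert (i1 := fun n => proj1 (proj1 (proj2 (Hinv n)))).
    assert (i2 := fun n => proj1 (proj2 (proj2 (proj1 (proj2 (Hinv n)))))).
    assert (i3 := fun n => proj1 (proj2 (proj2 (proj2 (proj1 (proj2 (Hinv n))))))).
    assert (i4 := fun n => proj2 (proj2 (proj2 (proj2 (proj1 (proj2 (Hinv n))))))).
    assert (i5 := fun n => proj2 (proj2 (proj2 (proj2 (Hinv n))))). split; [|split; [|split; [|split]]].
    + apply KS, (BK (ps z) rho); auto; lra.
    + apply KS, (BK (yy z) rho); auto; lra.
    + apply KS, (BK (nn z) (A * rho ^ 2)); auto; lra.
    + apply KS, (BK (mm z) (A * rho ^ 2)); auto; lra.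
    + unfold lam, lamd. destruct (Nat.eqb_spec j l).
      * replace (S (j + l)) with (S j + l)%nat by lia. apply (BK (la z) (A * rho ^ 2)); auto; lra.
      * rewrite Rabs_R0. apply pow_le; lra.
  - intros j l s Hs. destruct (proj1 (Hinv (S (j + l)))) as [c1 [c2 [c3 c4]]].
    split; [|split; [|split]]; [apply c1|apply c2|apply c3|apply c4]; auto; lia.
  - intros j l s t. unfold lam, lamd. destruct (Nat.eqb j l); auto.
  - intros j l s H. unfold lam, lamd. apply Nat.eqb_neq in H. now rewrite H.
  - intros s. split; [apply P0|]. split; apply P1; auto.
  - intros s. split; [apply P0|]. split; [apply N1; lia|apply M1; lia].
Qed.
End Formal.

(** * Functions with weighted radial regularity *)

Definition D (s : R) : R := 1/4 - s ^ 2.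
Definition fn := R -> R -> R.

Lemma D_pos s : In1 s -> 0 < D s.
Proof. unfold In1, D. nra. Qed.
Lemma D_le s : D s <= 1/4.
Proof. unfold D. nra. Qed.

(** The second clause is periodicity, in the form that suits an angle known only through its cosine
    and sine. *)
Definition bdd (f : fn) : Prop :=
  (exists C, 0 <= C /\ forall s th, In1 s -> Rabs (f s th) <= C) /\
  (forall s th th', In1 s -> cos th = cos th' -> sin th = sin th' -> f s th = f s th').
Definition dS (f g : fn) : Prop := forall s th, In1 s -> is_derive (fun x => f x th) s (g s th).
Definition dT (f g : fn) : Prop := forall s th, In1 s -> is_derive (f s) th (g s th).

(* The order of differentiability is [j] in the radial and [q] in the angular variable;
   radial derivatives are weighted by the distance to the ends of the interval. *)
Inductive nice : nat -> nat -> fn -> Prop :=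
  nice_i j q f : bdd f ->
    (forall i, j = S i -> exists g, dS f (fun s th => g s th / D s) /\ nice i q g) ->
    (forall i, q = S i -> exists g, dT f g /\ nice j i g) -> nice j q f.

Lemma nice_bdd j q f : nice j q f -> bdd f.
Proof. now intros []. Qed.
Lemma nice_s j q f : nice (S j) q f -> exists g, dS f (fun s th => g s th / D s) /\ nice j q g.
Proof. intros H. inversion H; subst. auto. Qed.
Lemma nice_t j q f : nice j (S q) f -> exists g, dT f g /\ nice j q g.
Proof. intros H. inversion H; subst. auto. Qed.
Lemma nice_ind2 (P : nat -> nat -> Prop) :
  (forall j q, (forall i, j = S i -> P i q) -> (forall i, q = S i -> P j i) -> P j q) -> forall j q, P j q.
Proof.
  intros H. induction j as [|j IHj]; induction q as [|q IHq]; apply H; intros i Hi; try discriminate;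
   injection Hi as <-; auto.
Qed.

Lemma nice_ext j q : forall f g, (forall s th, In1 s -> f s th = g s th) -> nice j q f -> nice j q g.
Proof.
  revert j q. apply (nice_ind2 (fun j q => forall f g, _ -> nice j q f -> nice j q g)).
  intros j q H1 H2 f g E H. constructor.
  - destruct (nice_bdd _ _ _ H) as [[C [C0 HC]] Hp]. split.
    + exists C. split; auto. intros. rewrite <- E by auto. auto.
    + intros. rewrite <- !E by auto. auto.
  - intros i ->. destruct (nice_s _ _ _ H) as [f' [F1 F2]]. exists f'. split; auto.
    intros s th Hs. apply (is_derive_ext_loc (fun x => f x th)); [|apply F1; auto].
    eapply filter_imp; [|apply (locally_itv (-(1/2)) (1/2) s Hs)]. intros x Hx. now apply E.
  - intros i ->. destruct (nice_t _ _ _ H) as [f' [F1 F2]]. exists f'. split; auto.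
    intros s th Hs. apply (is_derive_ext (f s)); [|apply F1; auto]. intros; now apply E.
Qed.

Lemma nice_dec_j j q : forall f, nice (S j) q f -> nice j q f.
Proof.
  revert j q. apply (nice_ind2 (fun j q => forall f, nice (S j) q f -> nice j q f)).
  intros j q H1 H2 f H. constructor; [eapply nice_bdd; eauto| |].
  - intros i ->. destruct (nice_s _ _ _ H) as [f' [F1 F2]]. exists f'. split; auto.
  - intros i ->. destruct (nice_t _ _ _ H) as [f' [F1 F2]]. exists f'. split; auto.
Qed.
Lemma nice_dec_q j q : forall f, nice j (S q) f -> nice j q f.
Proof.
  revert j q. apply (nice_ind2 (fun j q => forall f, nice j (S q) f -> nice j q f)).
  intros j q H1 H2 f H. constructor; [eapply nice_bdd; eauto| |].
  - intros i ->. destruct (nice_s _ _ _ H) as [f' [F1 F2]]. exists f'. split; auto.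
  - intros i ->. destruct (nice_t _ _ _ H) as [f' [F1 F2]]. exists f'. split; auto.
Qed.
Lemma nice_le i j p q f : (i <= j)%nat -> (p <= q)%nat -> nice j q f -> nice i p f.
Proof. intros H1 H2 H. induction H1; [induction H2; auto; apply IHle; now apply nice_dec_q|apply IHle, nice_dec_j; auto]. Qed.

Lemma nice_s_of j q f f' : nice (S j) q f -> dS f f' -> nice j q (fun s th => D s * f' s th).
Proof.
  intros H Hf. destruct (nice_s _ _ _ H) as [g [G1 G2]]. eapply nice_ext; [|exact G2].
  intros s th Hs. simpl. pose proof (D_pos s Hs). assert (E : f' s th = g s th / D s).
  { rewrite <- (is_derive_unique _ _ _ (Hf s th Hs)). now apply is_derive_unique, G1. }
  rewrite E. field. lra.
Qed.
Lemma nice_t_of j q f f' : nice j (S q) f -> dT f f' -> nice j q f'.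
Proof.
  intros H Hf. destruct (nice_t _ _ _ H) as [g [G1 G2]]. eapply nice_ext; [|exact G2].
  intros s th Hs. rewrite <- (is_derive_unique _ _ _ (Hf s th Hs)). symmetry. now apply is_derive_unique, G1.
Qed.

Lemma nice_const j q c : nice j q (fun _ _ => c).
Proof.
  revert c. revert j q. apply (nice_ind2 (fun j q => forall c, nice j q (fun _ _ => c))).
  intros j q H1 H2 c. constructor.
  - split; auto. exists (Rabs c). split; [apply Rabs_pos|]. intros; lra.
  - intros i ->. exists (fun _ _ => 0). split; auto. intros s th _. derive. unfold Rdiv; ring.
  - intros i ->. exists (fun _ _ => 0). split; auto. intros s th _. apply derive_cst.
Qed.

Lemma bdd_add f g : bdd f -> bdd g -> bdd (fun s th => f s th + g s th).
Proof.
  intros [[A [A0 HA]] PA] [[B [B0 HB]] PB]. split.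
  - exists (A + B). split; [lra|]. intros s th Hs. triang. apply Rplus_le_compat; auto.
  - intros s th th' Hs Hc Hsn. f_equal; auto.
Qed.
Lemma bdd_mul f g : bdd f -> bdd g -> bdd (fun s th => f s th * g s th).
Proof.
  intros [[A [A0 HA]] PA] [[B [B0 HB]] PB]. split.
  - exists (A * B). split; [apply Rmult_le_pos; lra|]. intros s th Hs. rewrite Rabs_mult.
    apply Rmult_le_compat; auto using Rabs_pos.
  - intros s th th' Hs Hc Hsn. f_equal; auto.
Qed.

Lemma nice_add j q f g : nice j q f -> nice j q g -> nice j q (fun s th => f s th + g s th).
Proof.
  revert f g. revert j q. apply (nice_ind2 (fun j q => forall f g, nice j q f -> nice j q g -> nice j q (fun s th => f s th + g s th))).
  intros j q H1 H2 f g Hf Hg. constructor.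
  - apply bdd_add; eapply nice_bdd; eauto.
  - intros i ->. destruct (nice_s _ _ _ Hf) as [f' [F1 F2]]. destruct (nice_s _ _ _ Hg) as [g' [G1 G2]].
    exists (fun s th => f' s th + g' s th). split; auto. intros s th Hs. pose proof (D_pos s Hs).
    derive. field. lra.
  - intros i ->. destruct (nice_t _ _ _ Hf) as [f' [F1 F2]]. destruct (nice_t _ _ _ Hg) as [g' [G1 G2]].
    exists (fun s th => f' s th + g' s th). split; auto. intros s th Hs. apply derive_plus; auto.
Qed.
Lemma nice_mul j q f g : nice j q f -> nice j q g -> nice j q (fun s th => f s th * g s th).
Proof.
  revert f g. revert j q. apply (nice_ind2 (fun j q => forall f g, nice j q f -> nice j q g -> nice j q (fun s th => f s th * g s th))).
  intros j q H1 H2 f g Hf Hg. constructor.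
  - apply bdd_mul; eapply nice_bdd; eauto.
  - intros i ->. destruct (nice_s _ _ _ Hf) as [f' [F1 F2]]. destruct (nice_s _ _ _ Hg) as [g' [G1 G2]].
    exists (fun s th => f' s th * g s th + f s th * g' s th). split.
    + intros s th Hs. pose proof (D_pos s Hs). derive. cbv beta. field. lra.
    + apply nice_add; apply (H1 i); auto using nice_dec_j.
  - intros i ->. destruct (nice_t _ _ _ Hf) as [f' [F1 F2]]. destruct (nice_t _ _ _ Hg) as [g' [G1 G2]].
    exists (fun s th => f' s th * g s th + f s th * g' s th). split.
    + intros s th Hs. apply derive_mult; auto.
    + apply nice_add; apply (H2 i); auto using nice_dec_q.
Qed.
Lemma nice_opp j q f : nice j q f -> nice j q (fun s th => - f s th).
Proof.
  intros H. apply (nice_ext _ _ (fun s th => -1 * f s th)); [intros; ring|].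
  apply nice_mul; auto using nice_const.
Qed.
Lemma nice_sub j q f g : nice j q f -> nice j q g -> nice j q (fun s th => f s th - g s th).
Proof. intros. apply nice_add; auto using nice_opp. Qed.

(** A function inherits the regularity of its logarithmic derivatives; this handles [exp (- T)]
    without a logarithm. *)
Lemma nice_ode j q f a b : bdd f ->
  dS f (fun s th => a s th * f s th / D s) -> dT f (fun s th => b s th * f s th) ->
  nice j q a -> nice j q b -> nice j q f.
Proof.
  intros Hf Hs Ht. revert j q. apply (nice_ind2 (fun j q => nice j q a -> nice j q b -> nice j q f)).
  intros j q H1 H2 Ha Hb. constructor; auto.
  - intros i ->. eexists; split; [exact Hs|]. apply nice_mul; auto using nice_dec_j.
  - intros i ->. eexists; split; [exact Ht|]. apply nice_mul; auto using nice_dec_q.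
Qed.

Lemma nice_inv j q f c : 0 < c -> (forall s th, In1 s -> c <= Rabs (f s th)) -> nice j q f ->
  nice j q (fun s th => / f s th).
Proof.
  intros Hc Hb. revert j q. apply (nice_ind2 (fun j q => nice j q f -> nice j q (fun s th => / f s th))).
  assert (NZ : forall s th, In1 s -> f s th <> 0).
  { intros s th Hs E. specialize (Hb s th Hs). rewrite E, Rabs_R0 in Hb. lra. }
  intros j q H1 H2 Hf. constructor.
  - destruct (nice_bdd _ _ _ Hf) as [[A [A0 HA]] PA]. split.
    + exists (/ c). split; [left; now apply Rinv_0_lt_compat|]. intros s th Hs.
      rewrite Rabs_inv. apply Rinv_le_contravar; auto.
    + intros s th th' Hs E1 E2. f_equal. auto.
  - intros i ->. destruct (nice_s _ _ _ Hf) as [f' [F1 F2]].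
    exists (fun s th => - f' s th * (/ f s th * / f s th)). split.
    + intros s th Hs. pose proof (D_pos s Hs).
      eapply derive_eq; [apply (derive_inv (fun x => f x th)); [apply F1; auto|now apply NZ]|].
      specialize (NZ s th Hs). simpl. field. lra.
    + apply nice_mul; [now apply nice_opp|]. apply nice_mul; apply (H1 i); auto using nice_dec_j.
  - intros i ->. destruct (nice_t _ _ _ Hf) as [f' [F1 F2]].
    exists (fun s th => - f' s th * (/ f s th * / f s th)). split.
    + intros s th Hs. eapply derive_eq; [apply (derive_inv (f s)); [apply F1; auto|now apply NZ]|].
      specialize (NZ s th Hs). simpl. field. lra.
    + apply nice_mul; [now apply nice_opp|]. apply nice_mul; apply (H2 i); auto using nice_dec_q.
Qed.

Lemma nice_trig j q : nice j q (fun _ th => cos th) /\ nice j q (fun _ th => sin th).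
Proof.
  revert j q. apply (nice_ind2 (fun j q => nice j q (fun _ th => cos th) /\ nice j q (fun _ th => sin th))).
  intros j q H1 H2. split; constructor.
  - split; auto. exists 1. split; [lra|]. intros s th _. apply Rabs_le, COS_bound.
  - intros i ->. exists (fun _ _ => 0). split; [|apply nice_const]. intros s th _. derive. unfold Rdiv; ring.
  - intros i ->. exists (fun _ th => - sin th). split; [intros s th _; apply is_derive_cos|]. apply nice_opp. now apply H2.
  - split; auto. exists 1. split; [lra|]. intros s th _. apply Rabs_le, SIN_bound.
  - intros i ->. exists (fun _ _ => 0). split; [|apply nice_const]. intros s th _. derive. unfold Rdiv; ring.
  - intros i ->. exists (fun _ th => cos th). split; [intros s th _; apply is_derive_sin|]. now apply H2.
Qed.

Ltac nice_tac := repeat first [solve [auto] | apply nice_const | apply nice_add | apply nice_sub | apply nice_opp | apply nice_mul].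

Definition snice (j : nat) (c : R -> R) : Prop := forall q, nice j q (fun s _ => c s).
Lemma snice_O c C : (forall s, In1 s -> Rabs (c s) <= C) -> snice 0 c.
Proof.
  intros H. intros q. revert q. induction q as [|q IH]; constructor; try discriminate;
   try (split; auto; exists (Rmax 0 C); split; [apply Rmax_l|]; intros s th Hs; eapply Rle_trans; [now apply H|apply Rmax_r]).
  intros i Hi. exists (fun _ _ => 0). split; [|apply nice_const]. intros s th _. apply derive_cst.
Qed.
Lemma snice_D j : snice j D.
Proof.
  assert (Hb : bdd (fun s _ : R => s)).
  { split; auto. exists 1. split; [lra|]. intros s th Hs. unfold In1 in Hs. apply Rabs_le. lra. }
  assert (H : forall j q, nice j q (fun s _ => s) /\ nice j q (fun s _ => D s)).
  { apply nice_ind2. intros a q H1 H2. assert (N : nice a q (fun s _ => s)).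
    { constructor; auto.
      - intros i ->. exists (fun s _ => D s). split; [|now apply H1]. intros s th Hs. pose proof (D_pos s Hs).
        derive. field. lra.
      - intros i ->. exists (fun _ _ => 0). split; [|apply nice_const]. intros s th _. apply derive_cst. }
    split; auto. eapply (nice_ext _ _ (fun s _ => 1/4 - s * s)); [intros; unfold D; simpl; ring|].
    apply nice_sub; [apply nice_const|]. now apply nice_mul. }
  intros q. apply H.
Qed.
Lemma snice_S' j (c c' : R -> R) C : (forall s, In1 s -> Rabs (c s) <= C) -> (forall s, In1 s -> is_derive c s (c' s / D s)) ->
  snice j c' -> snice (S j) c.
Proof.
  intros Hb Hd Hc q. induction q as [|q IH]; constructor; try discriminate;
   try (apply (nice_bdd 0 0); apply (snice_O c C Hb)).
  - intros i Hi. injection Hi as <-. exists (fun s _ => c' s). split; [|apply Hc]. intros s th Hs. now apply Hd.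
  - intros i Hi. injection Hi as <-. exists (fun s _ => c' s). split; [|apply Hc]. intros s th Hs. now apply Hd.
  - intros i Hi. exists (fun _ _ => 0). split; [|apply nice_const]. intros s th _. apply derive_cst.
Qed.
Lemma snice_mul j c d : snice j c -> snice j d -> snice j (fun s => c s * d s).
Proof. intros H1 H2 q. apply nice_mul; auto. Qed.
Lemma snice_add j c d : snice j c -> snice j d -> snice j (fun s => c s + d s).
Proof. intros H1 H2 q. apply nice_add; auto. Qed.
Lemma snice_sub j c d : snice j c -> snice j d -> snice j (fun s => c s - d s).
Proof. intros H1 H2 q. apply nice_sub; auto. Qed.
Lemma snice_opp j c : snice j c -> snice j (fun s => - c s).
Proof. intros H1 q. apply nice_opp; auto. Qed.
Lemma snice_const j c : snice j (fun _ => c).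
Proof. intros q. apply nice_const. Qed.
Lemma snice_inv j f c : 0 < c -> (forall s, In1 s -> c <= Rabs (f s)) -> snice j f -> snice j (fun s => / f s).
Proof. intros Hc H Hf q. apply (nice_inv j q (fun s _ => f s) c); auto. Qed.
Lemma snice_ext j f g : (forall s, In1 s -> f s = g s) -> snice j f -> snice j g.
Proof. intros E H q. eapply nice_ext; [|apply H]. intros. now apply E. Qed.
Lemma snice_dec j f : snice (S j) f -> snice j f.
Proof. intros H q. apply nice_dec_j, H. Qed.
Lemma snice_S j (c c' : R -> R) C : (forall s, In1 s -> Rabs (c s) <= C) -> (forall s, In1 s -> is_derive c s (c' s)) ->
  snice j c' -> snice (S j) c.
Proof.
  intros Hb Hd Hc. apply (snice_S' j c (fun s => D s * c' s) C); auto.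
  - intros s Hs. pose proof (D_pos s Hs). derive. field. lra.
  - apply snice_mul; auto using snice_D.
Qed.
Lemma snice_bound j c : snice j c -> exists C, 0 <= C /\ forall s, In1 s -> Rabs (c s) <= C.
Proof. intros H. destruct (nice_bdd _ _ _ (H 0%nat)) as [[C [C0 HC]] _]. exists C. split; auto. Qed.

(** Powers of positive parts serve as cutoffs: they have finite regularity and are explicit where
    they vanish. *)
Lemma derive_pos_pow n x : is_derive (fun t => Rmax 0 t ^ (S (S n))) x (INR (S (S n)) * Rmax 0 x ^ (S n)).
Proof.
  destruct (Rtotal_order x 0) as [H|[->|H]].
  - apply (is_derive_ext_loc (fun _ => 0)).
    + eapply filter_imp; [|apply (locally_itv (x - 1) 0 x)]; [|lra]. intros t Ht. rewrite Rmax_left by lra. simpl. ring.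
    + derive. rewrite Rmax_left by lra. simpl. ring.
  - apply is_derive_Reals. intros eps He. rewrite (Rmax_left 0 0) by lra.
    set (d := Rmin 1 eps). assert (Hd : 0 < d) by (apply Rmin_glb_lt; lra).
    exists (mkposreal d Hd). intros h Hh Hhd. simpl in Hhd. rewrite Rplus_0_l.
    assert (d <= 1) by apply Rmin_l. assert (d <= eps) by apply Rmin_r.
    replace ((Rmax 0 h ^ S (S n) - 0 ^ S (S n)) / h - INR (S (S n)) * 0 ^ S n) with (Rmax 0 h ^ S (S n) / h)
      by (simpl; field; auto).
    assert (Hm : 0 <= Rmax 0 h <= Rabs h).
    { split; [apply Rmax_l|]. apply Rmax_lub; [apply Rabs_pos|apply Rle_abs]. }
    unfold Rdiv. rewrite Rabs_mult, Rabs_inv, Rabs_right by (apply Rle_ge, pow_le; lra).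
    assert (0 < Rabs h) by now apply Rabs_pos_lt. apply Rle_lt_trans with (Rabs h ^ S (S n) * / Rabs h).
    + apply Rmult_le_compat_r; [left; now apply Rinv_0_lt_compat|]. now apply pow_incr.
    + replace (Rabs h ^ S (S n) * / Rabs h) with (Rabs h * Rabs h ^ n) by (simpl; field; lra).
      assert (Rabs h ^ n <= 1) by (rewrite <- (pow1 n); apply pow_incr; lra).
      assert (0 <= Rabs h ^ n) by (apply pow_le; lra). nra.
  - apply (is_derive_ext_loc (fun t => t ^ S (S n))).
    + eapply filter_imp; [|apply (locally_itv 0 (x + 1) x)]; [|lra]. intros t Ht. rewrite Rmax_right by lra. auto.
    + rewrite Rmax_right by lra. derive. cbv beta; simpl pred; ring.
Qed.

Lemma snice_pos_pow j : forall n (w w' : R -> R) C, (j <= n)%nat -> (forall s, In1 s -> Rabs (w s) <= C) ->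
  (forall s, In1 s -> is_derive w s (w' s)) -> snice j w' ->
  snice j (fun s => Rmax 0 (w s) ^ S n).
Proof.
  induction j as [|j IH]; intros n w w' C Hn Hb Hd Hw.
  - apply (snice_O _ (C ^ S n)). intros s Hs. rewrite <- RPow_abs. apply pow_incr. split; [apply Rabs_pos|].
    eapply Rle_trans; [|apply (Hb s Hs)]. unfold Rmax. destruct (Rle_dec 0 (w s)); [lra|]. rewrite Rabs_R0. apply Rabs_pos.
  - destruct n as [|n]; [lia|].
    apply (snice_S j _ (fun s => INR (S (S n)) * Rmax 0 (w s) ^ (S n) * w' s) (C ^ S (S n))).
    + intros s Hs. rewrite <- RPow_abs. apply pow_incr. split; [apply Rabs_pos|].
      eapply Rle_trans; [|apply (Hb s Hs)]. unfold Rmax. destruct (Rle_dec 0 (w s)); [lra|]. rewrite Rabs_R0. apply Rabs_pos.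
    + intros s Hs. eapply derive_eq; [apply (derive_comp (fun t => Rmax 0 t ^ S (S n)) w); [apply derive_pos_pow|apply Hd; auto]|].
      ring.
    + apply snice_mul; [|now apply snice_dec]. apply snice_mul; [apply snice_const|].
      apply (IH n w w' C); auto; try lia. now apply snice_dec.
Qed.

(** * Summation of the power series at a small amplitude *)

Lemma sum_tri (H : nat -> nat -> R) n :
  sum_f_R0 (fun j => sum_f_R0 (fun a => H a (j - a)%nat) j) n =
  sum_f_R0 (fun a => sum_f_R0 (fun b => H a b) (n - a)) n.
Proof.
  induction n as [|n IH]; [reflexivity|]. rewrite tech5, IH, (tech5 _ n), (tech5 _ n), Nat.sub_diag.
  change (sum_f_R0 (fun b => H (S n) b) 0) with (H (S n) 0%nat). rewrite <- Rplus_assoc. f_equal.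
  rewrite <- sum_plus. apply sum_eq. intros a Ha. rewrite (Nat.sub_succ_l a n) by auto. now rewrite tech5.
Qed.
Lemma sum_tri_swap (H : nat -> nat -> R) n :
  sum_f_R0 (fun a => sum_f_R0 (fun b => H a b) (n - a)) n = sum_f_R0 (fun b => sum_f_R0 (fun a => H a b) (n - b)) n.
Proof.
  rewrite <- sum_tri, <- (sum_tri (fun b a => H a b)). apply sum_eq. intros j Hj.
  rewrite <- sum_rev. apply sum_eq. intros a Ha. f_equal; lia.
Qed.
(** Both sides run over the quadruples [(a, c, b, d)] of sum [n]: the left groups them by the first
    index [a + b] of the product, the right by the order [a + c] of the first factor. *)
Lemma sum_regroup (F : nat -> nat -> nat -> nat -> R) n :
  sum_f_R0 (fun j => sum_f_R0 (fun a => sum_f_R0 (fun c => F a c (j - a)%nat (n - j - c)%nat) (n - j)) j) n =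
  sum_f_R0 (fun k => sum_f_R0 (fun a => sum_f_R0 (fun b => F a (k - a)%nat b (n - k - b)%nat) (n - k)) k) n.
Proof.
  transitivity (sum_f_R0 (fun a => sum_f_R0 (fun b => sum_f_R0 (fun c => F a c b (n - a - b - c)%nat) (n - a - b)) (n - a)) n).
  - rewrite <- sum_tri. apply sum_eq. intros j Hj. apply sum_eq. intros a Ha.
    replace (n - a - (j - a))%nat with (n - j)%nat by lia. reflexivity.
  - transitivity (sum_f_R0 (fun a => sum_f_R0 (fun c => sum_f_R0 (fun b => F a c b (n - a - c - b)%nat) (n - a - c)) (n - a)) n).
    + apply sum_eq. intros a Ha. rewrite sum_tri_swap. apply sum_eq. intros c Hc.
      apply sum_eq. intros b Hb. f_equal; lia.
    + rewrite <- sum_tri. apply sum_eq. intros j Hj. apply sum_eq. intros a Ha.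
      replace (n - a - (j - a))%nat with (n - j)%nat by lia. reflexivity.
Qed.
Lemma sum_prod (f g : nat -> R) n m :
  sum_f_R0 f n * sum_f_R0 g m = sum_f_R0 (fun a => sum_f_R0 (fun b => f a * g b) m) n.
Proof. rewrite sum_mult_r. apply sum_eq. intros a _. rewrite scal_sum. apply sum_eq. intros; ring. Qed.
Lemma derive_sum (f f' : nat -> R -> R) n x : (forall j, (j <= n)%nat -> is_derive (f j) x (f' j x)) ->
  is_derive (fun t => sum_f_R0 (fun j => f j t) n) x (sum_f_R0 (fun j => f' j x) n).
Proof.
  induction n as [|n IH]; intros H; simpl; [apply H; auto|].
  apply (derive_plus (fun t => sum_f_R0 (fun j => f j t) n)); auto.
Qed.

(** For [q > 0], [y <= exp y] at [y = (n + 1) ln 2 / q], raised to the power [q]. *)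
Lemma poly_exp q : exists C, 0 < C /\ forall n, (INR n + 1) ^ q <= C * 2 ^ n.
Proof.
  assert (L2 : 0 < ln 2) by (rewrite <- ln_1; apply ln_increasing; lra). destruct q as [|q].
  - exists 1. split; [lra|]. intros n. assert (1 <= 2 ^ n) by (apply pow_R1_Rle; lra). simpl. lra.
  - set (x := ln 2 / INR (S q)). assert (Hq : 0 < INR (S q)) by (apply lt_0_INR; lia).
    assert (Hx : 0 < x) by (apply Rdiv_lt_0_compat; lra).
    exists (2 * (/ x) ^ S q). assert (0 < (/ x) ^ S q) by (apply pow_lt, Rinv_0_lt_compat; auto). split; [lra|]. intros n.
    pose proof (pos_INR n). assert (E : (INR n + 1) * x <= exp ((INR n + 1) * x)).
    { pose proof (exp_ineq1_le ((INR n + 1) * x)). lra. }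
    assert (E2 : ((INR n + 1) * x) ^ S q <= exp ((INR n + 1) * x) ^ S q).
    { apply pow_incr. split; auto. apply Rmult_le_pos; lra. }
    assert (E3 : exp ((INR n + 1) * x) ^ S q = 2 * 2 ^ n).
    { rewrite <- Rpower_pow by apply exp_pos. unfold Rpower. rewrite ln_exp.
      replace (INR (S q) * ((INR n + 1) * x)) with (INR (S n) * ln 2) by (rewrite (S_INR n); unfold x; field; lra).
      change (exp (INR (S n) * ln 2)) with (Rpower 2 (INR (S n))). rewrite Rpower_pow by lra. reflexivity. }
    rewrite E3, Rpow_mult_distr in E2. replace (2 * (/ x) ^ S q * 2 ^ n) with (2 * 2 ^ n * / (x ^ S q)) by (rewrite pow_inv; ring).
    apply (le_div_intro _ (2 * 2 ^ n)); auto. now apply pow_lt.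
Qed.

Lemma trig_mult_eq th th' : cos th = cos th' -> sin th = sin th' ->
  forall n, cos (INR n * (2 * th)) = cos (INR n * (2 * th')) /\ sin (INR n * (2 * th)) = sin (INR n * (2 * th')).
Proof.
  intros H1 H2. induction n as [|n [I1 I2]]; [simpl; rewrite !Rmult_0_l; auto|].
  rewrite S_INR, !Rmult_plus_distr_r, !Rmult_1_l, !cos_plus, !sin_plus, I1, I2, !cos_2a, !sin_2a, H1, H2. auto.
Qed.

Section Eval.
Variables (eps K : R).
Hypothesis eps0 : 0 <= eps.
Hypothesis K1 : 1 <= K.
Hypothesis epsK : eps * K <= 1/8.

Definition trig (t : R -> R) : Prop := t = cos \/ t = sin.
Lemma trig_le t x : trig t -> Rabs (t x) <= 1.
Proof. intros [->| ->]; apply Rabs_le; [apply COS_bound|apply SIN_bound]. Qed.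
Lemma trig_cos : trig cos. Proof. now left. Qed.
Lemma trig_sin : trig sin. Proof. now right. Qed.

(** The polynomial factor makes the class stable under [dth] and under products. *)
Definition pbd (f : arr) : Prop := exists C q, 0 <= C /\
  forall j l s, In1 s -> Rabs (f j l s) <= C * (INR (j + l) + 1) ^ q * K ^ (j + l).

(* For real coefficients, [E cos f] and [E sin f] are the real and imaginary parts of the sum of the series. *)
Definition coef (t : R -> R) (f : arr) (n : nat) : fn := fun s th =>
  sum_f_R0 (fun j => f j (n - j)%nat s * t (2 * (INR j - INR (n - j)) * th)) n.
Definition E (t : R -> R) (f : arr) : fn := fun s th => Series (fun n => coef t f n s th * eps ^ n).

Lemma coef_ext t f g n s th : (forall j l, f j l s = g j l s) -> coef t f n s th = coef t g n s th.
Proof. intros H. apply sum_eq. intros j Hj. now rewrite H. Qed.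
Lemma E_ext t f g s th : (forall j l, f j l s = g j l s) -> E t f s th = E t g s th.
Proof. intros H. apply Series_ext. intros n. now rewrite (coef_ext t f g). Qed.

Lemma coef_bound t f n s th B : trig t -> (forall j, (j <= n)%nat -> Rabs (f j (n - j)%nat s) <= B) ->
  Rabs (coef t f n s th) <= B * (INR n + 1).
Proof.
  intros Ht H. unfold coef. rewrite <- S_INR, <- sum_cte. apply sum_abs_le. intros j Hj.
  rewrite Rabs_mult. rewrite <- (Rmult_1_r B). apply Rmult_le_compat; auto using Rabs_pos. now apply trig_le.
Qed.
Lemma quarter_series C : ex_series (fun n => C * (1/4) ^ n).
Proof. apply (ex_series_scal_l C (fun n => (1/4) ^ n)), ex_series_geom. rewrite Rabs_right; lra. Qed.
(** The geometric factor is at most [(1/8)^n], and [2^n] absorbs the polynomial. *)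
Lemma dom t f : trig t -> pbd f -> exists M, (forall n s th, In1 s -> Rabs (coef t f n s th * eps ^ n) <= M * (1/4) ^ n).
Proof.
  intros Ht [C [q [HC H]]]. destruct (poly_exp (S q)) as [P [P0 HP]]. exists (C * P). intros n s th Hs.
  rewrite Rabs_mult, (Rabs_right (eps ^ n)) by (apply Rle_ge, pow_le; lra).
  assert (0 <= eps ^ n) by (apply pow_le; lra). assert (0 < K ^ n) by (apply pow_lt; lra).
  apply Rle_trans with (C * (INR n + 1) ^ q * K ^ n * (INR n + 1) * eps ^ n).
  - apply Rmult_le_compat_r; auto. apply coef_bound; auto. intros j Hj. specialize (H j (n - j)%nat s Hs).
    replace (j + (n - j))%nat with n in H by lia. auto.
  - replace (C * (INR n + 1) ^ q * K ^ n * (INR n + 1) * eps ^ n) with (C * ((INR n + 1) ^ S q * (eps * K) ^ n))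
      by (rewrite Rpow_mult_distr; simpl; ring).
    rewrite Rmult_assoc. apply Rmult_le_compat_l; auto.
    replace (P * (1/4) ^ n) with (P * 2 ^ n * (1/8) ^ n) by (rewrite Rmult_assoc, <- Rpow_mult_distr; do 2 f_equal; lra).
    apply Rmult_le_compat; auto.
    + apply pow_le. pose proof (pos_INR n). lra.
    + apply pow_le. apply Rmult_le_pos; lra.
    + apply pow_incr. split; [apply Rmult_le_pos; lra|auto].
Qed.
Lemma E_ex t f s th : trig t -> pbd f -> In1 s -> ex_series (fun n => Rabs (coef t f n s th * eps ^ n)).
Proof.
  intros Ht Hf Hs. destruct (dom t f Ht Hf) as [M HM].
  apply (ex_series_dom _ (fun n => M * (1/4) ^ n)); [|apply quarter_series].
  intros n. rewrite Rabs_Rabsolu. now apply HM.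
Qed.
Lemma E_bdd t f : trig t -> pbd f -> bdd (E t f).
Proof.
  intros Ht Hf. destruct (dom t f Ht Hf) as [M HM]. split.
  - exists (Rmax 0 (Series (fun n => M * (1/4) ^ n))). split; [apply Rmax_l|]. intros s th Hs.
    eapply Rle_trans; [|apply Rmax_r]. apply (Series_dom _ (fun n => M * (1/4) ^ n)); auto using quarter_series.
  - intros s th th' Hs H1 H2. apply Series_ext. intros n. f_equal. apply sum_eq. intros j Hj. f_equal.
    destruct (trig_mult_eq th th' H1 H2 j) as [A1 A2]. destruct (trig_mult_eq th th' H1 H2 (n - j)) as [B1 B2].
    replace (2 * (INR j - INR (n - j)) * th) with (INR j * (2 * th) - INR (n - j) * (2 * th)) by ring.
    replace (2 * (INR j - INR (n - j)) * th') with (INR j * (2 * th') - INR (n - j) * (2 * th')) by ring.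
    destruct Ht as [->| ->]; [rewrite !cos_minus|rewrite !sin_minus]; rewrite A1, A2, B1, B2; auto.
Qed.

Lemma pbd_add f g : pbd f -> pbd g -> pbd (fun j l s => f j l s + g j l s).
Proof.
  intros [C [q [HC H]]] [C' [q' [HC' H']]]. exists (C + C'), (q + q')%nat. split; [lra|]. intros j l s Hs.
  triang. specialize (H j l s Hs). specialize (H' j l s Hs).
  set (x := INR (j + l) + 1) in *. assert (Hx : 1 <= x) by (unfold x; pose proof (pos_INR (j + l)); lra).
  assert (0 < K ^ (j + l)) by (apply pow_lt; lra).
  assert (x ^ q <= x ^ (q + q')) by (apply Rle_pow; auto; lia). assert (x ^ q' <= x ^ (q + q')) by (apply Rle_pow; auto; lia).
  rewrite !Rmult_plus_distr_r. apply Rplus_le_compat; (eapply Rle_trans; [eassumption|]);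
   (apply Rmult_le_compat_r; [lra|]); apply Rmult_le_compat_l; auto.
Qed.
Lemma pbd_coef c C f : (forall s, In1 s -> Rabs (c s) <= C) -> pbd f -> pbd (fun j l s => c s * f j l s).
Proof.
  intros Hc [C' [q [HC' H]]]. exists (Rabs C * C'), q. split; [apply Rmult_le_pos; auto using Rabs_pos|]. intros j l s Hs.
  rewrite Rabs_mult. replace (Rabs C * C' * (INR (j + l) + 1) ^ q * K ^ (j + l)) with (Rabs C * (C' * (INR (j + l) + 1) ^ q * K ^ (j + l))) by ring.
  apply Rmult_le_compat; auto using Rabs_pos. eapply Rle_trans; [now apply Hc|apply Rle_abs].
Qed.
Lemma pbd_dth f : pbd f -> pbd (dth f).
Proof.
  intros [C [q [HC H]]]. exists (2 * C), (S q). split; [lra|]. intros j l s Hs. unfold dth. rewrite Rabs_mult.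
  specialize (H j l s Hs). assert (Hx : Rabs (2 * (INR j - INR l)) <= 2 * (INR (j + l) + 1)).
  { rewrite plus_INR. pose proof (pos_INR j). pose proof (pos_INR l). apply Rabs_le. lra. }
  replace (2 * C * (INR (j + l) + 1) ^ S q * K ^ (j + l)) with (2 * (INR (j + l) + 1) * (C * (INR (j + l) + 1) ^ q * K ^ (j + l))) by (simpl; ring).
  apply Rmult_le_compat; auto using Rabs_pos.
Qed.
Lemma pbd_ext f g : (forall j l s, In1 s -> f j l s = g j l s) -> pbd f -> pbd g.
Proof. intros H [C [q [HC H']]]. exists C, q. split; auto. intros. rewrite <- H; auto. Qed.
Lemma pbd_mul f g : pbd f -> pbd g -> pbd (mul f g).
Proof.
  intros [C [q [HC H]]] [C' [q' [HC' H']]]. exists (C * C'), (q + q' + 2)%nat. split; [now apply Rmult_le_pos|].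
  intros j l s Hs. set (x := INR (j + l) + 1). assert (Hx : 1 <= x) by (unfold x; pose proof (pos_INR (j + l)); lra).
  assert (B : forall a c, (a <= j)%nat -> (c <= l)%nat -> Rabs (f a c s * g (j - a)%nat (l - c)%nat s) <= C * C' * x ^ (q + q') * K ^ (j + l)).
  { intros a c Ha Hc. rewrite Rabs_mult. specialize (H a c s Hs). specialize (H' (j - a)%nat (l - c)%nat s Hs).
    assert (Hu : forall u, (u <= j + l)%nat -> 0 <= INR u + 1 <= x).
    { intros u Hu. pose proof (pos_INR u). apply le_INR in Hu. unfold x. lra. }
    assert (P1 : (INR (a + c) + 1) ^ q <= x ^ q) by (apply pow_incr, Hu; lia).
    assert (P2 : (INR (j - a + (l - c)) + 1) ^ q' <= x ^ q') by (apply pow_incr, Hu; lia).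
    assert (Z1 : 0 < K ^ (a + c)) by (apply pow_lt; lra). assert (Z2 : 0 < K ^ (j - a + (l - c))) by (apply pow_lt; lra).
    eapply Rle_trans; [apply Rmult_le_compat; [apply Rabs_pos|apply Rabs_pos|exact H|exact H']|].
    replace (C * C' * x ^ (q + q') * K ^ (j + l)) with ((C * x ^ q * K ^ (a + c)) * (C' * x ^ q' * K ^ (j - a + (l - c)))).
    - assert (0 <= (INR (a + c) + 1) ^ q) by (apply pow_le, Hu; lia).
      assert (0 <= (INR (j - a + (l - c)) + 1) ^ q') by (apply pow_le, Hu; lia).
      apply Rmult_le_compat; try (apply Rmult_le_pos; [apply Rmult_le_pos; auto|lra]);
       (apply Rmult_le_compat_r; [lra|]); now apply Rmult_le_compat_l.
    - replace (j + l)%nat with (a + c + (j - a + (l - c)))%nat by lia. rewrite !pow_add. ring. }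
  assert (Z : 0 <= C * C' * x ^ (q + q') * K ^ (j + l)) by (apply Rmult_le_pos; [apply Rmult_le_pos; [now apply Rmult_le_pos|apply pow_le; lra]|apply pow_le; lra]).
  set (Kn := K ^ (j + l)) in *. unfold mul. eapply Rle_trans; [apply (sum_abs_le _ (fun _ => C * C' * x ^ (q + q') * Kn * x))|].
  - intros a Ha. eapply Rle_trans; [apply (sum_abs_le _ (fun _ => C * C' * x ^ (q + q') * Kn)); intros c Hc; now apply B|].
    rewrite sum_cte. apply Rmult_le_compat_l; auto. unfold x. rewrite S_INR, plus_INR. pose proof (pos_INR j). lra.
  - rewrite sum_cte. rewrite !pow_add. simpl (x ^ 2).
    assert (INR (S j) <= x) by (unfold x; rewrite S_INR, plus_INR; pose proof (pos_INR l); lra).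
    rewrite pow_add in Z. assert (0 <= x) by lra.
    replace (C * C' * (x ^ q * x ^ q' * (x * (x * 1))) * Kn) with (C * C' * (x ^ q * x ^ q') * Kn * x * x) by ring.
    apply Rmult_le_compat_l; auto. now apply Rmult_le_pos.
Qed.
Lemma pbd_zc f : pbd f -> pbd (zc f).
Proof.
  intros [C [q [HC H]]]. exists C, q. split; auto. intros j l s Hs. destruct (Nat.eq_dec (j + l) 0) as [e|e].
  - assert (j = 0%nat) by lia. assert (l = 0%nat) by lia. subst. rewrite zc_z, Rabs_R0. pose proof (pos_INR (0 + 0)).
    apply Rmult_le_pos; [apply Rmult_le_pos; auto; apply pow_le; lra|apply pow_le; lra].
  - rewrite zc_nz; auto.
Qed.

Lemma E_add t f g s th : trig t -> pbd f -> pbd g -> In1 s ->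
  E t (fun j l s => f j l s + g j l s) s th = E t f s th + E t g s th.
Proof.
  intros Ht Hf Hg Hs. unfold E. rewrite <- Series_plus; try (apply ex_series_Rabs, E_ex; auto).
  apply Series_ext. intros n. rewrite <- Rmult_plus_distr_r. f_equal. unfold coef. rewrite <- sum_plus. apply sum_eq. intros; ring.
Qed.
Lemma E_coef t (c : R -> R) f s th : E t (fun j l s => c s * f j l s) s th = c s * E t f s th.
Proof.
  unfold E. rewrite <- Series_scal_l. apply Series_ext. intros n. rewrite <- Rmult_assoc. f_equal. unfold coef. rewrite scal_sum.
  apply sum_eq. intros; ring.
Qed.
(** Exchanging the two indices within a fixed order changes the sign of the sum. *)
Lemma E_antisym (t : R -> R) sg f s th : (forall x, t (- x) = - sg * t x) -> sg * sg = 1 -> sym sg f -> E t f s th = 0.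
Proof.
  intros Ht Hsg H. unfold E. rewrite (Series_ext _ (fun n => 0 * (1/4) ^ n)); [rewrite Series_scal_l; ring|].
  intros n. assert (X : coef t f n s th = - coef t f n s th); [|nra].
  unfold coef at 1. rewrite <- sum_rev. rewrite <- (Rmult_1_l (coef _ _ _ _ _)), Ropp_mult_distr_l. unfold coef. rewrite scal_sum.
  apply sum_eq. intros j Hj. replace (n - (n - j))%nat with j by lia. rewrite (H j (n - j)%nat).
  replace (2 * (INR (n - j) - INR j) * th) with (- (2 * (INR j - INR (n - j)) * th)) by ring. rewrite Ht. ring [Hsg].
Qed.

Lemma E_sin_sym f s th : sym 1 f -> E sin f s th = 0.
Proof. apply E_antisym; [intros; rewrite sin_neg|]; ring. Qed.
Lemma E_cos_asym f s th : sym (-1) f -> E cos f s th = 0.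
Proof. apply E_antisym; [intros; rewrite cos_neg|]; ring. Qed.

Lemma coef_trig_mul (t t1 t2 t3 t4 : R -> R) e f g n s th :
  (forall x y, t (x + y) = t1 x * t2 y + e * (t3 x * t4 y)) ->
  coef t (mul f g) n s th = sum_f_R0 (fun k => coef t1 f k s th * coef t2 g (n - k) s th
     + e * (coef t3 f k s th * coef t4 g (n - k) s th)) n.
Proof.
  intros Ht. set (F := fun a c b d => f a c s * g b d s * t (2 * (INR a - INR c) * th + 2 * (INR b - INR d) * th)).
  transitivity (sum_f_R0 (fun j => sum_f_R0 (fun a => sum_f_R0 (fun c => F a c (j - a)%nat (n - j - c)%nat) (n - j)) j) n).
  - apply sum_eq. intros j Hj. unfold mul. rewrite sum_mult_r. apply sum_eq. intros a Ha. rewrite sum_mult_r.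
    apply sum_eq. intros c Hc. unfold F. f_equal. f_equal. rewrite !minus_INR by lia. ring.
  - rewrite sum_regroup. apply sum_eq. intros k Hk. unfold coef. rewrite !sum_prod, (Rmult_comm e), sum_mult_r, <- sum_plus.
    apply sum_eq. intros a Ha. rewrite sum_mult_r, <- sum_plus. apply sum_eq. intros b Hb. unfold F. rewrite Ht. ring.
Qed.
(** One statement covers the addition formulas of [cos] and [sin], that is, the real and imaginary
    parts of a product of absolutely convergent series. *)
Lemma E_mul_gen (t t1 t2 t3 t4 : R -> R) e f g s th : trig t1 -> trig t2 -> trig t3 -> trig t4 ->
  (forall x y, t (x + y) = t1 x * t2 y + e * (t3 x * t4 y)) -> pbd f -> pbd g -> In1 s ->
  E t (mul f g) s th = E t1 f s th * E t2 g s th + e * (E t3 f s th * E t4 g s th).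
Proof.
  intros T1 T2 T3 T4 Ht Hf Hg Hs. apply is_series_unique.
  assert (P : forall u v, trig u -> trig v -> is_series (fun n => sum_f_R0 (fun k => coef u f k s th * eps ^ k * (coef v g (n - k) s th * eps ^ (n - k))) n)
     (E u f s th * E v g s th)).
  { intros u v Hu Hv. apply (is_series_mult (fun n => coef u f n s th * eps ^ n) (fun n => coef v g n s th * eps ^ n));
     try (apply Series_correct, ex_series_Rabs); apply E_ex; auto. }
  assert (Q := is_series_plus _ _ _ _ (P t1 t2 T1 T2) (is_series_scal e _ _ (P t3 t4 T3 T4))).
  eapply is_series_ext; [|exact Q]. intros n. cbv beta. rewrite (coef_trig_mul t t1 t2 t3 t4 e) by auto.
  change (sum_f_R0 (fun k => coef t1 f k s th * eps ^ k * (coef t2 g (n - k) s th * eps ^ (n - k))) n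
   + e * sum_f_R0 (fun k => coef t3 f k s th * eps ^ k * (coef t4 g (n - k) s th * eps ^ (n - k))) n =
   sum_f_R0 (fun k => coef t1 f k s th * coef t2 g (n - k) s th + e * (coef t3 f k s th * coef t4 g (n - k) s th)) n * eps ^ n).
  rewrite (Rmult_comm e), !sum_mult_r, <- sum_plus. apply sum_eq. intros k Hk.
  replace (eps ^ n) with (eps ^ k * eps ^ (n - k)) by (rewrite <- pow_add; f_equal; lia). ring.
Qed.
Lemma E_mul_cos f g s th : pbd f -> pbd g -> In1 s ->
  E cos (mul f g) s th = E cos f s th * E cos g s th - E sin f s th * E sin g s th.
Proof.
  intros. rewrite (E_mul_gen cos cos cos sin sin (-1)) by (auto using trig_cos, trig_sin; intros; rewrite cos_plus; ring). ring.
Qed.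
Lemma E_mul_sin f g s th : pbd f -> pbd g -> In1 s ->
  E sin (mul f g) s th = E sin f s th * E cos g s th + E cos f s th * E sin g s th.
Proof.
  intros. rewrite (E_mul_gen sin sin cos cos sin 1) by (auto using trig_cos, trig_sin; intros; rewrite sin_plus; ring). ring.
Qed.
Lemma zc_id f : (forall s, f 0%nat 0%nat s = 0) -> forall j l s, zc f j l s = f j l s.
Proof. intros H [|j] [|l] s; auto. Qed.
Lemma E_zc t f s th : (forall s, f 0%nat 0%nat s = 0) -> E t (zc f) s th = E t f s th.
Proof. intros H. apply E_ext. intros. now apply zc_id. Qed.

Lemma E_dT (t t' : R -> R) sg f : trig t -> trig t' -> (forall x, is_derive t x (sg * t' x)) -> pbd f ->
  dT (E t f) (fun s th => sg * E t' (dth f) s th).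
Proof.
  intros Ht Ht' Hd Hf s th Hs. unfold E. rewrite <- Series_scal_l.
  destruct (dom t' (dth f) Ht' (pbd_dth f Hf)) as [M HM].
  apply (derive_Series (fun n th => coef t f n s th * eps ^ n) (fun n th => sg * (coef t' (dth f) n s th * eps ^ n))
    (fun n => Rabs sg * M * (1/4) ^ n) (th - 1) (th + 1)); try lra.
  - intros n x _. unfold coef. eapply derive_eq.
    + apply (derive_mult (fun x => sum_f_R0 _ n) (fun _ => eps ^ n)); [|apply derive_cst].
      apply (derive_sum _ (fun j x => f j (n - j)%nat s * (sg * t' (2 * (INR j - INR (n - j)) * x) * (2 * (INR j - INR (n - j)))))). intros j Hj.
      apply derive_scal. apply (derive_comp t (fun x => 2 * (INR j - INR (n - j)) * x)); [apply Hd|].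
      eapply derive_eq; [apply derive_scal, derive_id|ring].
    + rewrite Rmult_0_r, Rplus_0_r, <- Rmult_assoc. f_equal. rewrite scal_sum. apply sum_eq. intros j Hj. unfold dth. ring.
  - intros n x _. rewrite Rabs_mult, Rmult_assoc. apply Rmult_le_compat_l; [apply Rabs_pos|auto].
  - intros x _. apply ex_series_Rabs, E_ex; auto.
  - apply quarter_series.
Qed.
Lemma E_dS t f g : trig t -> pbd f -> pbd g ->
  (forall j l s, In1 s -> is_derive (f j l) s (g j l s / D s)) ->
  dS (E t f) (fun s th => E t g s th / D s).
Proof.
  intros Ht Hf Hg Hd s th Hs. destruct (dom t g Ht Hg) as [M HM]. unfold In1 in Hs.
  set (a := (s - 1/2) / 2). set (b := (s + 1/2) / 2).
  assert (Hab : forall x, a < x < b -> In1 x /\ Rabs (/ D x) <= / ((a + 1/2) * (1/2 - b))).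
  { intros x Hx. assert (Hi : In1 x) by (unfold In1, a, b in *; lra). split; auto. pose proof (D_pos x Hi).
    rewrite Rabs_right by (apply Rle_ge; left; now apply Rinv_0_lt_compat).
    assert (0 < a + 1/2) by (unfold a; lra). assert (0 < 1/2 - b) by (unfold b; lra).
    apply Rinv_le_contravar; [now apply Rmult_lt_0_compat|].
    replace (D x) with ((x + 1/2) * (1/2 - x)) by (unfold D; field). apply Rmult_le_compat; lra. }
  unfold E, Rdiv. rewrite <- Series_scal_r.
  apply (derive_Series (fun n s => coef t f n s th * eps ^ n) (fun n s => coef t g n s th * eps ^ n * / D s)
    (fun n => M * (/ ((a + 1/2) * (1/2 - b))) * (1/4) ^ n) a b).
  - intros n x Hx. destruct (Hab x Hx) as [Hi _]. unfold coef. eapply derive_eq.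
    + apply (derive_mult (fun x => sum_f_R0 _ n) (fun _ => eps ^ n)); [|apply derive_cst].
      apply (derive_sum _ (fun j x => g j (n - j)%nat x / D x * t (2 * (INR j - INR (n - j)) * th))). intros j Hj.
      derive. cbv beta; ring.
    + rewrite Rmult_0_r, Rplus_0_r. rewrite (Rmult_assoc _ (eps ^ n)), (Rmult_comm (eps ^ n) (/ D x)), <- Rmult_assoc. apply f_equal2; [|reflexivity].
      rewrite sum_mult_r. apply sum_eq. intros j Hj. unfold Rdiv. ring.
  - intros n x Hx. destruct (Hab x Hx) as [Hi HD]. rewrite Rabs_mult.
    replace (M * / ((a + 1/2) * (1/2 - b)) * (1/4) ^ n) with (M * (1/4) ^ n * / ((a + 1/2) * (1/2 - b))) by ring.
    apply Rmult_le_compat; auto using Rabs_pos.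
  - intros x Hx. apply ex_series_Rabs, E_ex; auto. apply Hab, Hx.
  - apply quarter_series.
  - unfold a, b. lra.
Qed.

(** All angular derivatives are demanded at once, since [dth] costs only a polynomial factor; the
    radial order [j] has to be raised step by step through the equations. *)
Definition smooth (j : nat) (f : arr) : Prop := forall t q, trig t -> nice j q (E t f).

Lemma E_dT_cos f : pbd f -> dT (E cos f) (fun s th => -1 * E sin (dth f) s th).
Proof. apply E_dT; auto using trig_cos, trig_sin. intros x. eapply derive_eq; [apply is_derive_cos|ring]. Qed.
Lemma E_dT_sin f : pbd f -> dT (E sin f) (fun s th => 1 * E cos (dth f) s th).
Proof. apply E_dT; auto using trig_cos, trig_sin. intros x. eapply derive_eq; [apply is_derive_sin|ring]. Qed.

Lemma smooth_O f : pbd f -> smooth 0 f.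
Proof.
  intros Hf t q. revert t f Hf. induction q as [|q IH]; intros t f Hf Ht; constructor; try discriminate; auto using E_bdd.
  intros i Hi. injection Hi as <-. destruct Ht as [->| ->].
  - eexists; split; [now apply E_dT_cos|]. apply nice_mul; [apply nice_const|]. apply IH; auto using pbd_dth, trig_sin.
  - eexists; split; [now apply E_dT_sin|]. apply nice_mul; [apply nice_const|]. apply IH; auto using pbd_dth, trig_cos.
Qed.
Lemma smooth_dth j f : pbd f -> smooth j f -> smooth j (dth f).
Proof.
  intros Hf Hs t q Ht. destruct Ht as [->| ->].
  - apply (nice_ext _ _ (fun s th => 1 * E cos (dth f) s th)); [intros; ring|]. apply (nice_t_of _ _ (E sin f)); auto using E_dT_sin.
    apply Hs, trig_sin.
  - apply (nice_ext _ _ (fun s th => -1 * (-1 * E sin (dth f) s th))); [intros; ring|]. apply nice_mul; [apply nice_const|].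
    apply (nice_t_of _ _ (E cos f)); auto using E_dT_cos. apply Hs, trig_cos.
Qed.
Lemma smooth_S j f g : pbd f -> pbd g -> (forall j l s, In1 s -> is_derive (f j l) s (g j l s / D s)) ->
  smooth j g -> smooth (S j) f.
Proof.
  intros Hf Hg Hd Hs t q. revert t f g Hf Hg Hd Hs. induction q as [|q IH]; intros t f g Hf Hg Hd Hs Ht; constructor; try discriminate; auto using E_bdd.
  - intros i Hi. injection Hi as <-. eexists; split; [now apply (E_dS t f g)|]. now apply Hs.
  - intros i Hi. injection Hi as <-. eexists; split; [now apply (E_dS t f g)|]. now apply Hs.
  - intros i Hi. injection Hi as <-.
    assert (Hd' : forall j l s, In1 s -> is_derive (dth f j l) s (dth g j l s / D s)).
    { intros a l s Hi. unfold dth. derive. unfold Rdiv; ring. }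
    destruct Ht as [->| ->].
    + eexists; split; [now apply E_dT_cos|]. apply nice_mul; [apply nice_const|].
      apply (IH sin (dth f) (dth g)); auto using pbd_dth, trig_sin, smooth_dth.
    + eexists; split; [now apply E_dT_sin|]. apply nice_mul; [apply nice_const|].
      apply (IH cos (dth f) (dth g)); auto using pbd_dth, trig_cos, smooth_dth.
Qed.

Lemma tail_bound (a : nat -> R) m : (forall n, (m <= n)%nat -> Rabs (a n) <= K * (2 * (eps * K)) ^ n) ->
  Rabs (Series (fun n => a (m + n)%nat)) <= 2 * K * (2 * (eps * K)) ^ m.
Proof.
  intros H. assert (P : 0 <= 2 * (eps * K) <= 1/4) by (split; [apply Rmult_le_pos; [lra|apply Rmult_le_pos; lra]|lra]).
  eapply Rle_trans; [apply (Series_dom _ (fun n => K * (2 * (eps * K)) ^ m * (1/4) ^ n))|].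
  - intros n. eapply Rle_trans; [apply H; lia|]. rewrite pow_add, <- Rmult_assoc.
    assert (0 <= (2 * (eps * K)) ^ m) by (apply pow_le; lra).
    apply Rmult_le_compat_l; [apply Rmult_le_pos; lra|]. apply pow_incr; lra.
  - apply quarter_series.
  - rewrite Series_scal_l, Series_geom by (rewrite Rabs_right; lra).
    assert (0 <= (2 * (eps * K)) ^ m) by (apply pow_le; lra). nra.
Qed.
Lemma E_small t f s th : trig t -> (forall j l, Rabs (f j l s) <= K ^ S (j + l)) -> f 0%nat 0%nat s = 0 ->
  Rabs (E t f s th) <= 4 * K ^ 2 * eps /\ Rabs (E t f s th - coef t f 1 s th * eps) <= 8 * K ^ 3 * eps ^ 2.
Proof.
  intros Ht Hf H0. assert (B : forall n, Rabs (coef t f n s th * eps ^ n) <= K * (2 * (eps * K)) ^ n).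
  { intros n. rewrite Rabs_mult, (Rabs_right (eps ^ n)) by (apply Rle_ge, pow_le; lra).
    assert (0 <= eps ^ n) by (apply pow_le; lra). assert (0 < K ^ S n) by (apply pow_lt; lra).
    apply Rle_trans with (K ^ S n * (INR n + 1) * eps ^ n).
    - apply Rmult_le_compat_r; auto. apply coef_bound; auto. intros j Hj. specialize (Hf j (n - j)%nat).
      replace (j + (n - j))%nat with n in Hf by lia. auto.
    - assert (INR n + 1 <= 2 ^ n). { clear. induction n; [simpl; lra|]. rewrite S_INR. simpl. pose proof (pos_INR n). lra. }
      rewrite !Rpow_mult_distr. simpl (K ^ S n). replace (K * (2 ^ n * (eps ^ n * K ^ n))) with (K * K ^ n * 2 ^ n * eps ^ n) by ring.
      apply Rmult_le_compat_r; auto. apply Rmult_le_compat_l; auto. simpl in *. lra. }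
  assert (Ex : ex_series (fun n => coef t f n s th * eps ^ n)).
  { apply (ex_series_dom _ (fun n => K * (1/4) ^ n)); [|apply quarter_series]. intros n. eapply Rle_trans; [apply B|].
    apply Rmult_le_compat_l; [lra|]. apply pow_incr. split; [apply Rmult_le_pos; [lra|apply Rmult_le_pos; lra]|lra]. }
  assert (C0 : coef t f 0 s th = 0) by (unfold coef; simpl; rewrite H0; ring).
  unfold E. rewrite (Series_incr_1 _ Ex), C0, Rmult_0_l, Rplus_0_l. split.
  - eapply Rle_trans; [apply (tail_bound (fun n => coef t f n s th * eps ^ n) 1); auto|]. simpl. right; ring.
  - rewrite Series_incr_1 by (now apply (ex_series_incr_1 (fun n => coef t f n s th * eps ^ n))).
    replace (coef t f 1 s th * eps ^ 1 + Series (fun k => coef t f (S (S k)) s th * eps ^ S (S k)) - coef t f 1 s th * eps)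
     with (Series (fun k => coef t f (S (S k)) s th * eps ^ S (S k))) by (simpl; ring).
    eapply Rle_trans; [apply (tail_bound (fun n => coef t f n s th * eps ^ n) 2); auto|]. simpl. right; ring.
Qed.
End Eval.

(** * The radial profile *)

Lemma cosh_sq x : cosh x ^ 2 = 1 + sinh x ^ 2.
Proof.
  unfold cosh, sinh. assert (H : exp x * exp (- x) = 1) by (rewrite <- exp_plus, Rplus_opp_r; apply exp_0). nra.
Qed.
Lemma cosh_even x : cosh (- x) = cosh x.
Proof. unfold cosh. rewrite Ropp_involutive. lra. Qed.
Lemma sinh_odd x : sinh (- x) = - sinh x.
Proof. unfold sinh. rewrite Ropp_involutive. lra. Qed.
Lemma cosh_pos x : 0 < cosh x.
Proof. unfold cosh. pose proof (exp_pos x). pose proof (exp_pos (- x)). lra. Qed.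
Lemma cosh_ge1 x : 1 <= cosh x.
Proof. pose proof (cosh_sq x). pose proof (cosh_pos x). pose proof (pow2_ge_0 (sinh x)). nra. Qed.
Lemma exp_cosh x : exp x = cosh x + sinh x.
Proof. unfold cosh, sinh. lra. Qed.
Lemma expN_cosh x : exp (- x) = cosh x - sinh x.
Proof. unfold cosh, sinh. lra. Qed.
Lemma sinh_ge x : 0 <= x -> x <= sinh x.
Proof.
  intros Hx. destruct (Req_dec x 0) as [->|Hne]; [rewrite sinh_0; lra|].
  destruct (mvt sinh cosh 0 x) as [c [H1 H2]]; [lra|intros; apply derive_sinh|].
  rewrite sinh_0 in H2. pose proof (cosh_ge1 c). nra.
Qed.
Lemma sinh_le x : 0 <= x -> sinh x <= x * cosh x.
Proof.
  intros Hx. destruct (Req_dec x 0) as [->|Hne]; [rewrite sinh_0; lra|].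
  destruct (mvt (fun x => x * cosh x - sinh x) (fun x => x * sinh x) 0 x) as [c [H1 H2]]; [lra| |].
  - intros t _. derive. cbv beta. ring.
  - rewrite sinh_0 in H2. pose proof (sinh_ge c). assert (0 <= c * sinh c * (x - 0)) by (apply Rmult_le_pos; [apply Rmult_le_pos|]; lra). lra.
Qed.
Lemma cosh_sq_le x : cosh x ^ 2 * (1 - x ^ 2) <= 1.
Proof.
  assert (H : sinh x ^ 2 <= x ^ 2 * cosh x ^ 2).
  { destruct (Rle_dec 0 x) as [h|h].
    - pose proof (sinh_le x h). pose proof (sinh_ge x h). rewrite <- Rpow_mult_distr. apply pow_incr. lra.
    - pose proof (sinh_le (- x)). pose proof (sinh_ge (- x)). rewrite sinh_odd, cosh_even in *.
      replace (sinh x ^ 2) with ((- sinh x) ^ 2) by ring. replace (x ^ 2 * cosh x ^ 2) with ((- x * cosh x) ^ 2) by ring.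
      apply pow_incr. lra. }
  pose proof (cosh_sq x). nra.
Qed.

Lemma antiderivative_open (f : R -> R) (a b c : R) : a < c < b ->
  (forall x, a < x < b -> continuous f x) ->
  exists F : R -> R, F c = 0 /\ forall x, a < x < b -> is_derive F x (f x).
Proof.
  intros Hc Hf. exists (fun x => RInt f c x). split; [apply (RInt_point c f)|].
  intros x Hx. apply (is_derive_RInt f (fun x => RInt f c x) c x); [|auto].
  eapply filter_imp; [|apply (locally_itv a b x Hx)]. intros y Hy.
  apply (RInt_correct (V := R_CompleteNormedModule)), (ex_RInt_continuous (V := R_CompleteNormedModule)).
  intros z Hz. apply Hf. unfold Rmin, Rmax in Hz. destruct (Rle_dec c y); lra.
Qed.
Lemma between_In1 s z : In1 s -> Rmin s 0 <= z <= Rmax s 0 -> In1 z.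
Proof. unfold In1, Rmin, Rmax. destruct (Rle_dec s 0); lra. Qed.
Lemma odd_antiderivative (F f : R -> R) : F 0 = 0 -> (forall s, In1 s -> is_derive F s (f s)) ->
  (forall s, In1 s -> f (- s) = f s) -> forall s, In1 s -> F (- s) = - F s.
Proof.
  intros H0 Hd He s Hs. assert (E := eq_of_derive_zero (fun t => F t + F (- t)) s 0).
  cbv beta in E. rewrite Ropp_0, H0 in E. assert (F s + F (- s) = 0 + 0); [apply E|lra].
  intros z Hz. apply between_In1 in Hz; auto.
  eapply derive_eq; [apply derive_plus; [apply Hd; auto|apply (derive_comp F (fun t => - t)); [apply Hd; unfold In1 in *; lra|apply derive_opp, derive_id]]|].
  rewrite He by auto. ring.
Qed.
Lemma even_antiderivative (F f : R -> R) : (forall s, In1 s -> is_derive F s (f s)) ->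
  (forall s, In1 s -> f (- s) = - f s) -> forall s, In1 s -> F (- s) = F s.
Proof.
  intros Hd He s Hs. assert (E := eq_of_derive_zero (fun t => F t - F (- t)) s 0).
  cbv beta in E. rewrite Ropp_0 in E. assert (F s - F (- s) = F 0 - F 0); [apply E|lra].
  intros z Hz. apply between_In1 in Hz; auto.
  eapply derive_eq; [apply derive_minus; [apply Hd; auto|apply (derive_comp F (fun t => - t)); [apply Hd; unfold In1 in *; lra|apply derive_opp, derive_id]]|].
  rewrite He by auto. ring.
Qed.
Lemma snice_continuous c j s : snice (S j) c -> In1 s -> continuous c s.
Proof.
  intros H Hs. destruct (nice_s _ _ _ (H 0%nat)) as [g [G _]]. apply (cont_of_derive _ _ _ (G s 0 Hs)).
Qed.

Lemma D_der s : is_derive D s (- 2 * s).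
Proof. unfold D. auto_derive; auto; ring. Qed.
Lemma continuous_of_D_mul (g : R -> R) s : In1 s -> continuous (fun s => D s * g s) s -> continuous g s.
Proof.
  intros Hs H. apply (continuous_ext_loc _ (fun s => / D s * (D s * g s))).
  - eapply filter_imp; [|apply (locally_itv _ _ s Hs)]. intros y Hy. pose proof (D_pos y Hy). simpl. field. lra.
  - apply continuous_Rmult; auto. apply continuous_Rinv; [apply (cont_of_derive _ _ _ (D_der s))|]. pose proof (D_pos s Hs). lra.
Qed.

Lemma snice_sq j c : snice j c -> snice j (fun s => c s ^ 2).
Proof. intros H. apply (snice_ext j (fun s => c s * c s)); [intros; ring|]. now apply snice_mul. Qed.
Ltac snice_tac := repeat first [assumption | apply snice_const | apply snice_add | apply snice_sub
  | apply snice_opp | apply snice_mul | apply snice_sq].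

(* [K] is the regularity of the profile, [N] the order to which the weight [p_p] vanishes at both ends. *)
Record profile (K N : nat) := {
  p_al : R -> R; p_ald : R -> R; p_mu : R -> R; p_mud : R -> R; p_gh : R -> R; p_ghd : R -> R;
  p_sc : R -> R; p_bb : R -> R; p_h : R -> R; p_p : R -> R; p_S : R -> R;
  p_al_snice : snice K p_al; p_ald_snice : snice K p_ald; p_mu_snice : snice K p_mu;
  p_gh_snice : snice K p_gh; p_ghd_snice : snice K p_ghd; p_sc_snice : snice K p_sc; p_bb_snice : snice K p_bb;
  p_dh_snice : snice K (fun s => D s * p_h s);
  p_al_der : forall s, In1 s -> is_derive p_al s (p_ald s);
  p_mu_der : forall s, In1 s -> is_derive p_mu s (p_mud s);
  p_gh_der : forall s, In1 s -> is_derive p_gh s (p_ghd s);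
  p_p_der : forall s, In1 s -> is_derive p_p s (p_h s * p_p s);
  p_S_der : forall s, In1 s -> is_derive p_S s (p_sc s);
  p_ident1 : forall lam s, In1 s ->
    p_mu s = (p_h s + lam * p_sc s) - p_al s * ((p_h s + lam * p_sc s) * p_gh s + p_ghd s);
  p_ident2 : forall lam s, In1 s -> (p_h s + lam * p_sc s) * p_mu s +
    ((p_h s + lam * p_sc s) * p_gh s + p_ghd s) * (p_ald s - 2 * p_al s) + p_mud s = 4 + 2 * lam * p_bb s;
  p_ident3 : forall s, In1 s -> (p_al s * p_gh s = 1 /\ p_ald s * p_gh s + p_al s * p_ghd s = 0) \/
    (p_S s = 0 /\ p_sc s = 0 /\ exp (2 * s) * p_p s * (p_h s * p_gh s + p_ghd s) = -1);
  p_ident4 : forall s, -(1/2) < s <= -(2/5) ->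
    p_al s * p_gh s = 1 /\ p_ald s * p_gh s + p_al s * p_ghd s = 0 /\ p_gh s <> 0;
  p_pos : forall s, 0 < p_p s;
  p_le : exists C, 0 < C /\ forall s, In1 s -> p_p s <= C * D s ^ N;
  p_hbound : exists C, 0 < C /\ forall s, In1 s -> Rabs (p_h s) <= C / D s;
  p_solver : exists C, 0 < C /\ solvable p_h p_bb C
}.

#[export] Hint Resolve p_al_der p_mu_der p_gh_der p_p_der p_S_der : deriv.

Section Profile.
Variables (K N : nat) (k1 : R).
Hypothesis K1 : (1 <= K)%nat.
Hypothesis N1 : (1 <= N)%nat.
Hypothesis k1_pos : 0 < k1.
(** Near the ends [om] is [k1 D] times a factor at most 1, and [2 h om = 3 sig - om'] then gives
    [D h] the size [1 / k1]; a small [k1] produces a high order of vanishing of [p]. *)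
Hypothesis k1_small : k1 * (INR N + 10) <= 2/5.

(* [c1] is 1 near the ends and 0 in the middle region [9/100 <= D], [c2] vanishes near the ends. In the middle
   region all functions are explicit in [cosh] and [sinh]; near the ends [om] is proportional to [D], which
   produces the vanishing weight. *)
Let e := S (S K).
Definition yc (s : R) := (D s - 1/100) / (8/100).
Definition wc (s : R) := 1 - Rmax 0 (yc s) ^ e.
Definition wcd (s : R) := - (INR e * Rmax 0 (yc s) ^ S K * (- 25 * s)).
Definition c1 (s : R) := Rmax 0 (wc s) ^ e.
Definition c1d (s : R) := INR e * Rmax 0 (wc s) ^ S K * wcd s.
Definition c2 (s : R) := Rmax 0 (D s - 9/100) ^ e.
Definition c2d (s : R) := INR e * Rmax 0 (D s - 9/100) ^ S K * (- 2 * s).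
(** [wh s] is [cosh (2 s)], and [omm] is the derivative of [sinh s / wh s]. *)
Definition wh (s : R) := 2 * cosh s ^ 2 - 1.
Definition omm (s : R) := cosh s * (3 - 2 * cosh s ^ 2) / wh s ^ 2.
Definition ommd (s : R) := sinh s * (4 * cosh s ^ 4 - 12 * cosh s ^ 2 - 3) / wh s ^ 3.
Definition kap (s : R) := (1 - c1 s) + c1 s * (k1 * D s).
Definition kapd (s : R) := - c1d s + (c1d s * (k1 * D s) + c1 s * (k1 * (- 2 * s))).
Definition om (s : R) := omm s * kap s.
Definition omd (s : R) := ommd s * kap s + omm s * kapd s.

Lemma k1_le : k1 <= 1/25.
Proof. assert (0 <= INR N) by apply pos_INR. nra. Qed.

Lemma yc_der s : is_derive yc s (- 25 * s).
Proof. unfold yc, D. auto_derive; auto. field. Qed.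
Lemma wc_der s : is_derive wc s (wcd s).
Proof.
  unfold wc, wcd. eapply derive_eq;
   [apply derive_minus; [apply derive_cst|apply (derive_comp (fun t => Rmax 0 t ^ e) yc); [apply derive_pos_pow|apply yc_der]]|].
  unfold e. ring.
Qed.
Lemma c1_der s : is_derive c1 s (c1d s).
Proof.
  unfold c1, c1d. eapply derive_eq;
   [apply (derive_comp (fun t => Rmax 0 t ^ e) wc); [apply derive_pos_pow|apply wc_der]|]. unfold e. ring.
Qed.
Lemma c2_der s : is_derive c2 s (c2d s).
Proof.
  unfold c2, c2d. eapply derive_eq;
   [apply (derive_comp (fun t => Rmax 0 t ^ e) (fun s => D s - 9/100)); [apply derive_pos_pow|apply derive_minus; [apply D_der|apply derive_cst]]|]. unfold e. ring.
Qed.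
#[local] Hint Resolve D_der yc_der wc_der c1_der c2_der : deriv.
Lemma wh_ge s : 1 <= wh s.
Proof. unfold wh. pose proof (cosh_ge1 s). nra. Qed.
Lemma omm_der s : is_derive omm s (ommd s).
Proof.
  unfold omm, ommd, Rdiv. pose proof (wh_ge s) as H.
  assert (Hw : is_derive (fun s => wh s ^ 2) s (2 * (4 * cosh s * sinh s) * wh s)).
  { eapply derive_eq; [apply (derive_pow wh)|].
    - unfold wh. apply derive_minus; [apply derive_scal, derive_pow, derive_cosh|apply derive_cst].
    - simpl. ring. }
  eapply derive_eq; [apply derive_mult; [apply derive_mult; [apply derive_cosh|apply derive_minus; [apply derive_cst|apply derive_scal, derive_pow, derive_cosh]]|apply derive_inv; [exact Hw|]]|].
  - apply pow_nonzero. lra.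
  - cbv beta. simpl INR. simpl pred. unfold wh in *. field. lra.
Qed.
Lemma kap_der s : is_derive kap s (kapd s).
Proof.
  unfold kap, kapd. derive. cbv beta. ring.
Qed.
Lemma om_der s : is_derive om s (omd s).
Proof. unfold om, omd. apply derive_mult; [apply omm_der|apply kap_der]. Qed.

#[local] Hint Resolve omm_der kap_der om_der : deriv.
Lemma D_even s : D (- s) = D s.
Proof. unfold D. ring. Qed.
Lemma c1_even s : c1 (- s) = c1 s.
Proof. unfold c1, wc, yc. now rewrite D_even. Qed.
Lemma c2_even s : c2 (- s) = c2 s.
Proof. unfold c2. now rewrite D_even. Qed.
Lemma c1d_odd s : c1d (- s) = - c1d s.
Proof. unfold c1d, wcd, wc, yc. rewrite D_even. ring. Qed.
Lemma om_even s : om (- s) = om s.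
Proof. unfold om, omm, kap, wh. now rewrite cosh_even, c1_even, D_even. Qed.
Lemma omd_odd s : omd (- s) = - omd s.
Proof.
  unfold omd, ommd, omm, kap, kapd, wh. rewrite cosh_even, sinh_odd, c1_even, D_even, c1d_odd.
  pose proof (wh_ge s). unfold wh in *. field. lra.
Qed.

Lemma c1_range s : In1 s -> 0 <= c1 s <= 1.
Proof.
  intros Hs. unfold c1, wc. assert (0 <= Rmax 0 (yc s)) by apply Rmax_l.
  assert (0 <= Rmax 0 (yc s) ^ e) by now apply pow_le.
  assert (0 <= Rmax 0 (1 - Rmax 0 (yc s) ^ e) <= 1) by (split; [apply Rmax_l|apply Rmax_lub; lra]).
  split; [now apply pow_le|]. apply Rle_trans with (1 ^ e); [apply pow_incr; lra|rewrite pow1; lra].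
Qed.
Lemma c1_end s : D s <= 1/100 -> c1 s = 1 /\ c1d s = 0.
Proof.
  intros H. assert (E : Rmax 0 (yc s) = 0) by (apply Rmax_left; unfold yc; lra).
  unfold c1, c1d, wcd, wc. rewrite E. unfold e. rewrite (pow_i (S (S K))), (pow_i (S K)) by lia. rewrite Rminus_0_r, Rmax_right by lra.
  rewrite pow1. split; auto. ring.
Qed.
Lemma c1_mid s : 9/100 <= D s -> c1 s = 0 /\ c1d s = 0.
Proof.
  intros H. assert (E : 1 <= yc s) by (unfold yc; lra).
  assert (E2 : 1 <= Rmax 0 (yc s) ^ e) by (rewrite Rmax_right by lra; now apply pow_R1_Rle).
  assert (E3 : Rmax 0 (wc s) = 0) by (apply Rmax_left; unfold wc; lra).
  unfold c1, c1d. rewrite E3. unfold e. rewrite (pow_i (S (S K))), (pow_i (S K)) by lia. split; ring.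
Qed.
Lemma c1_pos s : D s < 9/100 -> 0 < c1 s.
Proof.
  intros H. unfold c1. apply pow_lt. apply Rlt_le_trans with (wc s); [|apply Rmax_r]. unfold wc.
  assert (E : 0 <= Rmax 0 (yc s) < 1) by (split; [apply Rmax_l|apply Rmax_lub_lt; unfold yc; lra]).
  assert (Rmax 0 (yc s) ^ e < 1).
  { unfold e. assert (0 <= Rmax 0 (yc s) ^ S K <= 1).
    { split; [apply pow_le; lra|]. rewrite <- (pow1 (S K)). apply pow_incr; lra. }
    change (Rmax 0 (yc s) ^ S (S K)) with (Rmax 0 (yc s) * Rmax 0 (yc s) ^ S K). nra. }
  lra.
Qed.
Lemma c2_out s : D s <= 9/100 -> c2 s = 0 /\ c2d s = 0.
Proof.
  intros H. assert (E : Rmax 0 (D s - 9/100) = 0) by (apply Rmax_left; lra).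
  unfold c2, c2d. rewrite E. unfold e. rewrite (pow_i (S (S K))), (pow_i (S K)) by lia. split; ring.
Qed.
Lemma c2_nonneg s : 0 <= c2 s.
Proof. unfold c2. apply pow_le, Rmax_l. Qed.

Lemma cosh_bound s : In1 s -> 1 <= cosh s <= 116/100 /\ cosh s ^ 2 <= 4/3.
Proof.
  intros Hs. pose proof (cosh_sq_le s). pose proof (cosh_ge1 s). unfold In1 in Hs.
  assert (s ^ 2 <= 1/4) by nra. assert (cosh s ^ 2 <= 4/3) by nra. split; [split|]; auto. nra.
Qed.
Lemma wh_le s : In1 s -> wh s <= 5/3.
Proof. intros Hs. destruct (cosh_bound s Hs). unfold wh. lra. Qed.
Lemma omm_range s : In1 s -> 1/10 <= omm s <= 1.
Proof.
  intros Hs. destruct (cosh_bound s Hs) as [[H1 H2] H3]. pose proof (wh_ge s). pose proof (wh_le s Hs).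
  unfold omm. set (c := cosh s) in *. set (w := wh s) in *. assert (1 <= w ^ 2 <= 25/9) by nra. split.
  - apply le_div_intro; [lra|]. nra.
  - apply div_le_intro; [lra|]. assert (c * (3 - 2 * c ^ 2) <= 1); [|lra]. nra.
Qed.
Lemma ommd_bound s : In1 s -> Rabs (ommd s) <= 9.
Proof.
  intros Hs. destruct (cosh_bound s Hs) as [[H1 H2] H3]. pose proof (wh_ge s).
  unfold ommd, Rdiv. rewrite Rabs_mult, Rabs_inv. rewrite (Rabs_right (wh s ^ 3)) by (apply Rle_ge, pow_le; lra).
  assert (1 <= wh s ^ 3) by (apply pow_R1_Rle; lra).
  assert (Hsh : Rabs (sinh s) <= 3/5). { pose proof (cosh_sq s). apply Rabs_le. nra. }
  assert (Rabs (4 * cosh s ^ 4 - 12 * cosh s ^ 2 - 3) <= 15).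
  { replace (cosh s ^ 4) with ((cosh s ^ 2) ^ 2) by ring. set (x := cosh s ^ 2) in *. assert (1 <= x) by (unfold x; nra).
    apply Rabs_le. nra. }
  apply (div_le_intro _ 9 (wh s ^ 3)); [lra|]. rewrite Rabs_mult.
  assert (Rabs (sinh s) * Rabs (4 * cosh s ^ 4 - 12 * cosh s ^ 2 - 3) <= 3/5 * 15)
    by (apply Rmult_le_compat; auto using Rabs_pos). lra.
Qed.
Lemma kap_range s : In1 s -> 0 < kap s <= 1 /\ k1 * D s <= kap s.
Proof.
  intros Hs. pose proof (c1_range s Hs). pose proof (D_pos s Hs). pose proof (D_le s). pose proof k1_le. unfold kap.
  assert (0 < k1 * D s <= 1/100) by (split; [now apply Rmult_lt_0_compat|nra]). split; [split|]; nra.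
Qed.
Lemma kap_end s : D s <= 1/100 -> kap s = k1 * D s /\ kapd s = k1 * (- 2 * s).
Proof. intros H. destruct (c1_end s H) as [A B]. unfold kap, kapd. rewrite A, B. split; ring. Qed.
Lemma kap_mid s : 9/100 <= D s -> kap s = 1 /\ kapd s = 0.
Proof. intros H. destruct (c1_mid s H) as [A B]. unfold kap, kapd. rewrite A, B. split; ring. Qed.
Lemma om_pos s : In1 s -> 0 < om s <= 1.
Proof.
  intros Hs. pose proof (omm_range s Hs). pose proof (proj1 (kap_range s Hs)). unfold om. split; [apply Rmult_lt_0_compat; lra|nra].
Qed.

Lemma cosh_snice j : snice j cosh /\ snice j sinh.
Proof.
  assert (Hs : forall s, In1 s -> Rabs (sinh s) <= 1).
  { intros s Hs. destruct (cosh_bound s Hs) as [_ H]. pose proof (cosh_sq s). apply Rabs_le. nra. }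
  assert (Hc : forall s, In1 s -> Rabs (cosh s) <= 2).
  { intros s H. destruct (cosh_bound s H). rewrite Rabs_right; lra. }
  induction j as [|j [IH1 IH2]].
  - split; eapply snice_O; eauto.
  - split; eapply snice_S; eauto using derive_cosh, derive_sinh.
Qed.
Lemma exp_snice j : snice j exp /\ snice j (fun s => exp (- s)).
Proof.
  destruct (cosh_snice j) as [H1 H2]. split.
  - eapply snice_ext; [intros; symmetry; apply exp_cosh|]. now apply snice_add.
  - eapply snice_ext; [intros; symmetry; apply expN_cosh|]. now apply snice_sub.
Qed.
Lemma id_snice j : snice j (fun s => s).
Proof.
  induction j as [|j IH]; [apply (snice_O _ 1)|apply (snice_S j _ (fun _ => 1) 1)].
  - intros s Hs; unfold In1 in Hs; apply Rabs_le; lra.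
  - intros s Hs; unfold In1 in Hs; apply Rabs_le; lra.
  - intros; apply derive_id.
  - apply snice_const.
Qed.
Lemma wh_snice j : snice j wh /\ snice j (fun s => / wh s).
Proof.
  assert (H : snice j wh).
  { unfold wh. apply (snice_ext j (fun s => 2 * (cosh s * cosh s) - 1)); [intros; ring|].
    apply snice_sub; [|apply snice_const]. apply snice_mul; [apply snice_const|]. apply snice_mul; apply cosh_snice. }
  split; auto. apply (snice_inv j wh 1); auto; [lra|]. intros s _. pose proof (wh_ge s). rewrite Rabs_right; lra.
Qed.
Lemma yc_bound s : In1 s -> Rabs (yc s) <= 4.
Proof. intros Hs. pose proof (D_pos s Hs). pose proof (D_le s). unfold yc. apply Rabs_le. lra. Qed.
Lemma lin_snice j a : snice j (fun s => a * s).
Proof. apply snice_mul; [apply snice_const|apply id_snice]. Qed.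
Lemma wcd_snice : snice K wcd.
Proof.
  unfold wcd. apply snice_opp, snice_mul; [|apply lin_snice]. apply snice_mul; [apply snice_const|].
  apply (snice_pos_pow K K yc (fun s => -25 * s) 4); auto using yc_bound, yc_der, lin_snice.
Qed.
Lemma wc_bound : exists C, forall s, In1 s -> Rabs (wc s) <= C.
Proof.
  exists (1 + 4 ^ e). intros s Hs. unfold wc. triang. rewrite Rabs_R1, Rabs_Ropp.
  apply Rplus_le_compat_l. rewrite <- RPow_abs. apply pow_incr. split; [apply Rabs_pos|].
  pose proof (yc_bound s Hs). rewrite Rabs_right by (apply Rle_ge, Rmax_l). apply Rmax_lub; [lra|].
  eapply Rle_trans; [apply Rle_abs|]; auto.
Qed.
Lemma c1d_snice : snice K c1d.
Proof.
  destruct wc_bound as [C HC]. apply snice_mul; [|apply wcd_snice]. apply snice_mul; [apply snice_const|].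
  apply (snice_pos_pow K K wc wcd C); auto using wc_der, wcd_snice.
Qed.
Lemma c1_snice : snice K c1.
Proof.
  destruct wc_bound as [C HC]. apply (snice_pos_pow K (S K) wc wcd C); auto using wc_der, wcd_snice.
Qed.
Lemma c2_aux s : In1 s -> Rabs (D s - 9/100) <= 1.
Proof. intros Hs. pose proof (D_pos s Hs). pose proof (D_le s). apply Rabs_le. lra. Qed.
Lemma c2_aux_der s : is_derive (fun s => D s - 9/100) s (- 2 * s).
Proof. derive. ring. Qed.
Lemma c2_snice : snice K c2.
Proof. apply (snice_pos_pow K (S K) (fun s => D s - 9/100) (fun s => -2 * s) 1); auto using c2_aux, c2_aux_der, lin_snice. Qed.
Lemma c2d_snice : snice K c2d.
Proof.
  apply snice_mul; [|apply lin_snice]. apply snice_mul; [apply snice_const|].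
  apply (snice_pos_pow K K (fun s => D s - 9/100) (fun s => -2 * s) 1); auto using c2_aux, c2_aux_der, lin_snice.
Qed.
Lemma omm_snice j : snice j omm.
Proof.
  apply (snice_ext j (fun s => cosh s * (3 - 2 * cosh s ^ 2) * ((/ wh s) ^ 2))).
  { intros s _. unfold omm, Rdiv. now rewrite pow_inv. }
  destruct (cosh_snice j). apply snice_mul; [|apply snice_sq, wh_snice]. apply snice_mul; auto.
  apply snice_sub; [apply snice_const|]. apply snice_mul; [apply snice_const|]. now apply snice_sq.
Qed.
Lemma ommd_snice j : snice j ommd.
Proof.
  apply (snice_ext j (fun s => sinh s * (4 * (cosh s ^ 2) ^ 2 - 12 * cosh s ^ 2 - 3) * ((/ wh s) ^ 2 * / wh s))).
  { intros s _. unfold ommd. pose proof (wh_ge s). field. lra. }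
  destruct (cosh_snice j). destruct (wh_snice j). snice_tac.
Qed.
Lemma kap_snice : snice K kap /\ snice K kapd.
Proof.
  pose proof c1_snice. pose proof c1d_snice. pose proof (snice_D K). pose proof (lin_snice K (-2)).
  split; unfold kap, kapd; snice_tac.
Qed.
Lemma om_snice : snice K om /\ snice K omd.
Proof.
  destruct kap_snice. pose proof (omm_snice K). pose proof (ommd_snice K). split.
  - now apply snice_mul.
  - apply snice_add; apply snice_mul; auto.
Qed.
(** The quotient [f = D / kap] satisfies [D f' = (- 2 s - f kap') f], so its regularity follows from
    that of [kap'] although [D] and [kap] both vanish at the ends. *)
Lemma Dkap_snice : snice K (fun s => D s / kap s).
Proof.
  assert (Hb : forall s, In1 s -> Rabs (D s / kap s) <= / k1).
  { intros s Hs. destruct (kap_range s Hs) as [[H1 H2] H3]. pose proof (D_pos s Hs).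
    rewrite Rabs_right by (apply Rle_ge, Rmult_le_pos; [lra|left; now apply Rinv_0_lt_compat]).
    apply div_le_intro; auto. apply (Rmult_le_reg_l k1); auto. rewrite <- Rmult_assoc, Rinv_r; lra. }
  destruct kap_snice as [_ H]. revert H. generalize K at 1 2 as j. induction j as [|j IH]; intros H.
  - now apply (snice_O _ (/ k1)).
  - apply (snice_S' j _ (fun s => (- 2 * s - D s / kap s * kapd s) * (D s / kap s)) (/ k1)); auto.
    + intros s Hs. destruct (kap_range s Hs) as [[H1 H2] H3]. pose proof (D_pos s Hs).
      eapply derive_eq; [apply derive_mult; [apply D_der|apply derive_inv; [apply kap_der|lra]]|]. cbv beta. field. lra.
    + apply snice_dec in H. specialize (IH H). apply snice_mul; auto. apply snice_sub; [apply lin_snice|]. now apply snice_mul.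
Qed.

(** The base flow has speed [p |sig|]; [sig] is odd and decreasing, so the flow reverses its
    direction across [s = 0]. *)
Variable sig : R -> R.
Hypothesis sig0 : sig 0 = 0.
Hypothesis sig_der : forall s, In1 s -> is_derive sig s (- om s).

Lemma In1_opp s : In1 s -> In1 (- s).
Proof. unfold In1; lra. Qed.

Lemma sig_odd s : In1 s -> sig (- s) = - sig s.
Proof. apply (odd_antiderivative sig (fun s => - om s)); auto. intros t _. now rewrite om_even. Qed.
Lemma const_mid (f : R -> R) s t : (forall s, -(2/5) <= s <= 2/5 -> is_derive f s 0) ->
  -(2/5) <= s <= 2/5 -> -(2/5) <= t <= 2/5 -> f s = f t.
Proof.
  intros H Hs' Ht. apply eq_of_derive_zero. intros z Hz. apply H. unfold Rmin, Rmax in Hz. destruct (Rle_dec s t); lra.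
Qed.
Lemma sig_mid s : -(2/5) <= s <= 2/5 -> sig s = - sinh s / wh s.
Proof.
  intros Hs'. assert (E : sig s + sinh s / wh s = sig 0 + sinh 0 / wh 0).
  { apply (const_mid (fun s => sig s + sinh s / wh s)); auto; [|lra]. intros x Hx.
    pose proof (wh_ge x) as Hw. unfold Rdiv. eapply derive_eq; [apply derive_plus; [apply sig_der; unfold In1; lra|
      apply derive_mult; [apply derive_sinh|apply derive_inv; [|lra]]]|].
    + unfold wh. apply derive_minus; [apply derive_scal, derive_pow, derive_cosh|apply derive_cst].
    + destruct (kap_mid x) as [Hk _]; [unfold D; nra|]. unfold om. rewrite Hk.
      cbv beta. unfold omm. pose proof (cosh_sq x). simpl INR. simpl pred. field_simplify_eq; [|lra].
      replace (sinh x ^ 2) with (cosh x ^ 2 - 1) by lra. unfold wh. ring. }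
  rewrite sig0, sinh_0 in E. unfold Rdiv in *. lra.
Qed.
Lemma sig_decr s t : In1 s -> In1 t -> s <= t -> sig t <= sig s.
Proof.
  intros H1 H2 H3. unfold In1 in *.
  assert (E := mono_of_derive (fun s => - sig s) (fun s => om s) (-(1/2)) (1/2)). cbv beta in E.
  cut (- sig s <= - sig t); [lra|]. apply E; try lra.
  - intros x Hx. derive. ring.
  - intros x Hx. apply Rlt_le, om_pos; auto.
Qed.
Lemma sig_bound s : In1 s -> Rabs (sig s) <= 1/2.
Proof.
  intros Hi. assert (L := lip_of_derive sig (fun s => - om s) (-(1/2)) (1/2) 1 sig_der).
  assert (Z : Rabs (sig s - sig 0) <= 1 * Rabs (s - 0)).
  { apply L; unfold In1 in *; try lra. intros x Hx. rewrite Rabs_Ropp. destruct (om_pos x Hx). rewrite Rabs_right; lra. }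
  rewrite sig0, !Rminus_0_r in Z. unfold In1 in Hi. assert (Rabs s <= 1/2) by (apply Rabs_le; lra). lra.
Qed.
(** From [s^2 <= 4/25] follow [cosh^2 <= 25/21] and [wh <= 29/21]. *)
Lemma sinh_wh_lower s : 0 <= s <= 2/5 -> s * (21/29) <= sinh s / wh s.
Proof.
  intros Hs'. pose proof (wh_ge s). apply le_div_intro; [lra|]. pose proof (sinh_ge s ltac:(lra)).
  assert (wh s <= 29/21). { unfold wh. pose proof (cosh_sq_le s). assert (s ^ 2 <= 4/25) by nra. assert (0 <= cosh s ^ 2) by apply pow2_ge_0. nra. }
  nra.
Qed.
Lemma sig_left s : -(1/2) < s <= -(2/5) -> 28/100 <= sig s.
Proof.
  intros Hs'. apply Rle_trans with (sig (-(2/5))).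
  - rewrite sig_odd, sig_mid by (unfold In1; lra). pose proof (sinh_wh_lower (2/5)). unfold Rdiv in *. lra.
  - apply sig_decr; unfold In1; lra.
Qed.

Definition den (s : R) := sig s ^ 2 + c2 s.
Definition dend (s : R) := - 2 * sig s * om s + c2d s.
Definition d0 := (12/100) ^ e.
Lemma d0_pos : 0 < d0.
Proof. apply pow_lt. lra. Qed.
(** The terms of [den] cover each other's zeros: for [|s| < 1/5] one has [D - 9/100 >= 12/100],
    which bounds [c2], and beyond [|sig| >= 12/100]. *)
Lemma den_ge s : In1 s -> d0 <= den s.
Proof.
  intros Hs'. pose proof (c2_nonneg s) as P2. assert (Hd : d0 <= (12/100) ^ 2).
  { unfold d0, e. change ((12/100) ^ S (S K)) with (12/100 * (12/100 * (12/100) ^ K)).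
    assert ((12/100) ^ K <= 1 ^ K) by (apply pow_incr; lra). rewrite pow1 in *. lra. }
  assert (A : forall s, - (1/2) < s < 0 -> d0 <= den s \/ - s < 1/5).
  { intros t Ht. destruct (Rlt_dec (- s) (1/5)) as [h|h]; [|]. all: destruct (Rlt_dec (- t) (1/5)) as [h'|h']; auto; left.
    all: pose proof (c2_nonneg t) as P3; assert (12/100 <= sig t); [|unfold den; nra].
    all: destruct (Rle_dec t (-(2/5))) as [k|k]; [pose proof (sig_left t); lra|].
    all: assert (X := sinh_wh_lower (- t) ltac:(lra)); rewrite sig_mid by lra; rewrite sinh_odd in X; unfold wh in *; rewrite cosh_even in X; lra. }
  destruct (Rlt_dec (Rabs s) (1/5)) as [h|h].
  - unfold den. assert (d0 <= c2 s); [|pose proof (pow2_ge_0 (sig s)); lra].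
    unfold d0, c2. apply pow_incr. split; [lra|]. eapply Rle_trans; [|apply Rmax_r]. unfold D.
    apply Rabs_def2 in h. nra.
  - unfold In1 in Hs'. destruct (Rle_dec 0 s) as [k|k].
    + rewrite Rabs_right in h by lra. destruct (A (- s)) as [B|B]; try lra.
      unfold den in *. rewrite sig_odd, c2_even in B by (unfold In1; lra). lra.
    + rewrite Rabs_left in h by lra. destruct (A s) as [B|B]; lra.
Qed.
Lemma den_der s : In1 s -> is_derive den s (dend s).
Proof.
  intros Hs'. unfold den, dend. derive. simpl. ring.
Qed.

#[local] Hint Resolve den_der : deriv.
Definition th (s : R) := 2 * cosh s * sinh s / wh s.
(** Where [c2 = 0] this is [1 / gh], so that the displaced label carries the whole perturbation;
    since [gh] vanishes at [s = 0], [c2] regularises the quotient in the middle. *)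
Definition al (s : R) := exp s * sig s / den s.
Definition ald (s : R) := exp s * (sig s - om s) / den s - exp s * sig s * dend s / den s ^ 2.
Definition gh (s : R) := exp (- s) * sig s.
Definition ghd (s : R) := - exp (- s) * (sig s + om s).
Definition ah (s : R) := al s * gh s.
Definition mu (s : R) := (2 * th s * c2 s + sig s * (om s + sig s)) / den s.
Definition mud (s : R) :=
  (4 / wh s ^ 2 * c2 s + 2 * th s * c2d s - om s * (om s + sig s) + sig s * (omd s - om s)) / den s
  - (2 * th s * c2 s + sig s * (om s + sig s)) * dend s / den s ^ 2.
Definition nu (s : R) := 2 * al s * (1 - ah s) + al s * mu s - ald s.
(** [sc] is the direction in which [h] varies with [lam], supported where [al gh = 1]; there the
    second identity of the profile turns it into [bb = sc om / sig]. *)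
Definition sc (s : R) := sig s * c1 s.
Definition bb (s : R) := c1 s * om s.
(** [2 h om + om' = 3 sig] is what [ident2] demands where [c2 = 0]; in the middle the same formula
    yields [2 tanh (2 s)], the logarithmic derivative of [cosh (2 s)]. *)
Definition hh (s : R) := (3 * sig s - omd s) / (2 * om s).

Lemma al_der s : In1 s -> is_derive al s (ald s).
Proof.
  intros Hs'. pose proof (den_ge s Hs'). pose proof d0_pos. unfold al, ald, Rdiv. derive. cbv beta. field. lra.
Qed.
Lemma gh_der s : In1 s -> is_derive gh s (ghd s).
Proof.
  intros Hs'. unfold gh, ghd. derive. cbv beta. ring.
Qed.
Lemma th_der s : is_derive th s (2 / wh s ^ 2).
Proof.
  pose proof (wh_ge s). unfold th, Rdiv. eapply derive_eq;
    [apply derive_mult; [apply derive_mult; [apply derive_scal, derive_cosh|apply derive_sinh]|apply derive_inv; [|lra]]|].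
  - unfold wh. apply derive_minus; [apply derive_scal, derive_pow, derive_cosh|apply derive_cst].
  - cbv beta. simpl INR. simpl pred. pose proof (cosh_sq s). field_simplify_eq; [|lra].
    replace (sinh s ^ 2) with (cosh s ^ 2 - 1) by lra. unfold wh. ring.
Qed.
#[local] Hint Resolve al_der gh_der th_der : deriv.
Lemma mu_der s : In1 s -> is_derive mu s (mud s).
Proof.
  intros Hs'. pose proof (den_ge s Hs'). pose proof d0_pos. pose proof (wh_ge s). unfold mu, mud, Rdiv. derive.
  cbv beta. field. lra.
Qed.

Lemma zones s : In1 s -> (-(2/5) <= s <= 2/5 /\ 9/100 <= D s) \/ ((s < -(2/5) \/ 2/5 < s) /\ D s < 9/100).
Proof.
  intros Hs'. unfold In1, D in *. destruct (Rlt_dec s (-(2/5))); [right; split; [lra|nra]|].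
  destruct (Rlt_dec (2/5) s); [right; split; [lra|nra]|left; split; [lra|nra]].
Qed.
Lemma hh_mid s : -(2/5) <= s <= 2/5 -> hh s = 2 * th s.
Proof.
  intros Hs'. assert (Hi : In1 s) by (unfold In1; lra). destruct (kap_mid s) as [A B]; [unfold D; nra|].
  unfold hh. pose proof (proj1 (om_pos s Hi)) as Ho. unfold om, omd in *. rewrite A, B in *. rewrite sig_mid by auto.
  pose proof (wh_ge s) as Hw. destruct (omm_range s Hi). destruct (cosh_bound s Hi) as [[C1 _] C2]. unfold omm, ommd, th.
  field_simplify_eq.
  - unfold wh. ring.
  - split; [lra|]. split; [|lra]. nra.
Qed.
Lemma sig_nz s : In1 s -> D s < 9/100 -> sig s <> 0.
Proof.
  intros Hs' Hd. destruct (zones s Hs') as [[_ Z]|[[Z|Z] _]]; [lra| |]; unfold In1 in *.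
  - pose proof (sig_left s). lra.
  - pose proof (sig_left (- s) ltac:(lra)). rewrite sig_odd in * by (unfold In1; lra). lra.
Qed.

Lemma ident1 lam s : In1 s -> mu s = (hh s + lam * sc s) - al s * ((hh s + lam * sc s) * gh s + ghd s).
Proof.
  intros Hs'. pose proof (den_ge s Hs') as Hd. pose proof d0_pos as P0. unfold mu, al, gh, ghd, sc.
  assert (Ee : exp s * exp (- s) = 1) by (rewrite <- exp_plus, Rplus_opp_r; apply exp_0).
  replace (exp s * sig s / den s * ((hh s + lam * (sig s * c1 s)) * (exp (- s) * sig s) + - exp (- s) * (sig s + om s)))
    with (exp s * exp (- s) * (sig s / den s * ((hh s + lam * (sig s * c1 s)) * sig s - (sig s + om s)))) by (field; lra).
  rewrite Ee. assert (X : 2 * th s * c2 s = (hh s + lam * (sig s * c1 s)) * c2 s).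
  { destruct (zones s Hs') as [[Z1 Z2]|[_ Z]].
    - rewrite hh_mid by auto. destruct (c1_mid s Z2) as [-> _]. ring.
    - destruct (c2_out s) as [-> _]; [lra|]. ring. }
  rewrite X. unfold den in *. field. lra.
Qed.
(** This combination becomes the coefficient of [psi] in the equation for [Y]; the value 4 at
    [lam = 0] is what puts constants in the kernel at frequency 2. Off the middle it is the equation
    defining [hh]. In the middle it is an identity modulo [cosh^2 = 1 + sinh^2], valid with [den] as
    a free variable. *)
Lemma ident2 lam s : In1 s ->
  (hh s + lam * sc s) * mu s + ((hh s + lam * sc s) * gh s + ghd s) * (ald s - 2 * al s) + mud s = 4 + 2 * lam * bb s.
Proof.
  intros Hs'. pose proof (den_ge s Hs') as Hd. pose proof d0_pos as P0.
  assert (Ee : exp s * exp (- s) = 1) by (rewrite <- exp_plus, Rplus_opp_r; apply exp_0).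
  assert (E2 : ((hh s + lam * sc s) * gh s + ghd s) * (ald s - 2 * al s) =
    exp s * exp (- s) * (((hh s + lam * sc s) * sig s - (sig s + om s)) * ((sig s - om s) / den s - sig s * dend s / den s ^ 2 - 2 * (sig s / den s)))).
  { unfold gh, ghd, ald, al. field. lra. }
  rewrite E2, Ee. clear E2. destruct (zones s Hs') as [[Z1 Z2]|[_ Z]].
  - unfold sc, bb. rewrite hh_mid by auto. destruct (c1_mid s Z2) as [-> _]. destruct (kap_mid s Z2) as [A B].
    assert (Eo : om s = omm s) by (unfold om; rewrite A; ring).
    assert (Eod : omd s = ommd s) by (unfold omd; rewrite A, B; ring).
    unfold mu, mud, dend. replace (c2 s) with (den s - sig s ^ 2) by (unfold den; ring).
    rewrite Eo, Eod, sig_mid by auto. unfold th, omm, ommd. pose proof (wh_ge s) as Hw.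
    pose proof (cosh_sq s) as Hc. set (d := den s) in *. clearbody d.
    assert (Hw2 : wh s = 1 + 2 * sinh s ^ 2) by (unfold wh; lra).
    assert (Hc4 : cosh s ^ 4 = (1 + sinh s ^ 2) ^ 2) by (rewrite <- Hc; ring).
    rewrite Hc4, Hc. set (C := cosh s) in *. set (S := sinh s) in *. set (w := wh s) in *. clearbody w C S.
    subst w. field_simplify_eq; [|lra]. ring [Hc].
  - destruct (c2_out s) as [A B]; [lra|]. pose proof (sig_nz s Hs' Z). pose proof (proj1 (om_pos s Hs')).
    unfold mu, mud, sc, bb, hh, dend, den in *. rewrite A, B in *. pose proof (wh_ge s). field. repeat split; auto; try lra.
Qed.

Lemma sig_snice : snice K sig.
Proof.
  apply snice_dec. apply (snice_S K sig (fun s => - om s) (1/2)); auto using sig_bound. apply snice_opp, om_snice.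
Qed.
Lemma den_snice : snice K (fun s => / den s).
Proof.
  apply (snice_inv K den d0); auto using d0_pos.
  - intros s Hi. pose proof (den_ge s Hi). pose proof d0_pos. rewrite Rabs_right; lra.
  - apply snice_add; [apply snice_sq, sig_snice|apply c2_snice].
Qed.
Lemma coefs_snice : snice K al /\ snice K ald /\ snice K mu /\ snice K gh /\ snice K ghd /\ snice K sc /\ snice K bb.
Proof.
  pose proof sig_snice. pose proof den_snice. destruct (exp_snice K). destruct om_snice. pose proof c1_snice.
  pose proof c2_snice. pose proof c2d_snice. destruct (cosh_snice K). destruct (wh_snice K).
  assert (snice K dend) by (unfold dend; snice_tac). assert (snice K th) by (unfold th, Rdiv; snice_tac).
  assert (snice K ald).
  { apply (snice_ext K (fun s => exp s * (sig s - om s) * / den s - exp s * sig s * dend s * (/ den s) ^ 2)); [|snice_tac].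
    intros s Hi. pose proof (den_ge s Hi). pose proof d0_pos. unfold ald. field. lra. }
  split; [|split; [|split; [|split; [|split; [|split]]]]]; try assumption; unfold al, mu, gh, ghd, sc, bb, Rdiv; snice_tac.
Qed.
Lemma dh_snice : snice K (fun s => D s * hh s).
Proof.
  assert (Ho : snice K (fun s => / omm s)).
  { apply (snice_inv K omm (1/10)); [lra| |apply omm_snice]. intros s Hi. pose proof (omm_range s Hi). rewrite Rabs_right; lra. }
  apply (snice_ext K (fun s => 3/2 * sig s * (D s / kap s) * / omm s - 1/2 * D s * ommd s * / omm s - 1/2 * (D s / kap s) * kapd s)).
  - intros s Hi. pose proof (omm_range s Hi). destruct (kap_range s Hi). unfold hh, om, omd. field. lra.
  - pose proof sig_snice. pose proof Dkap_snice. pose proof (ommd_snice K). destruct kap_snice. pose proof (snice_D K). snice_tac.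
Qed.

Lemma coef_continuous c s : snice K c -> In1 s -> continuous c s.
Proof. intros H. assert (E : K = S (pred K)) by lia. rewrite E in H. apply (snice_continuous c _ s H). Qed.
Lemma potentials_exist : (exists Hp : R -> R, Hp 0 = 0 /\ forall s, In1 s -> is_derive Hp s (hh s)) /\
  exists Hs : R -> R, Hs 0 = 0 /\ forall s, In1 s -> is_derive Hs s (sc s).
Proof.
  assert (I0 : - (1/2) < 0 < 1/2) by lra. split; apply (antiderivative_open _ _ _ _ I0); intros s Hs.
  - apply (continuous_of_D_mul hh s Hs), (coef_continuous _ s dh_snice Hs).
  - apply coef_continuous; auto. apply coefs_snice.
Qed.

Variables Hp Hs : R -> R.
Hypothesis Hp0 : Hp 0 = 0.
Hypothesis Hp_der : forall s, In1 s -> is_derive Hp s (hh s).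
Hypothesis Hs0 : Hs 0 = 0.
Hypothesis Hs_der : forall s, In1 s -> is_derive Hs s (sc s).
Definition pp (s : R) := exp (Hp s).

Lemma hh_odd s : In1 s -> hh (- s) = - hh s.
Proof.
  intros Hi. unfold hh. rewrite sig_odd, omd_odd, om_even by auto. pose proof (om_pos s Hi). field. lra.
Qed.
Lemma pp_pos s : 0 < pp s.
Proof. apply exp_pos. Qed.
Lemma pp_der s : In1 s -> is_derive pp s (hh s * pp s).
Proof.
  intros Hi. unfold pp. derive. ring.
Qed.
Lemma wh_der s : is_derive wh s (2 * th s * wh s).
Proof.
  unfold wh at 1. pose proof (wh_ge s). derive. unfold th. simpl. field. lra.
Qed.
#[local] Hint Resolve pp_der wh_der : deriv.
Lemma pp_mid s : -(2/5) <= s <= 2/5 -> pp s = wh s.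
Proof.
  intros Hs'. assert (E := const_mid (fun s => wh s * exp (- Hp s))).
  assert (Z : wh s * exp (- Hp s) = wh 0 * exp (- Hp 0)).
  { apply (E) ; try lra. intros x Hx. derive. rewrite hh_mid by auto. cbv beta. ring. }
  rewrite Hp0, Ropp_0, exp_0 in Z. unfold wh at 2 in Z. rewrite cosh_0 in Z.
  unfold pp. rewrite exp_Ropp in Z. pose proof (exp_pos (Hp s)) as P.
  apply (Rmult_eq_reg_r (/ exp (Hp s))); [|apply Rinv_neq_0_compat; lra]. rewrite Z, Rinv_r; lra.
Qed.
Lemma Hs_mid s : -(2/5) <= s <= 2/5 -> Hs s = 0.
Proof.
  intros Hs'. rewrite <- Hs0. apply const_mid; try lra. intros x Hx. derive. unfold sc.
  destruct (c1_mid x) as [-> _]; [unfold D; nra|ring].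
Qed.
(** Either the stream function depends on the label alone, or the vorticity is constant; the
    parameter [lam] acts in the first region only. *)
Lemma ident3 s : In1 s -> (ah s = 1 /\ ald s * gh s + al s * ghd s = 0) \/ (Hs s = 0 /\ sc s = 0 /\ exp (2 * s) * pp s * (hh s * gh s + ghd s) = -1).
Proof.
  intros Hi. destruct (zones s Hi) as [[Z1 Z2]|[_ Z]].
  - right. split; [now apply Hs_mid|]. split; [unfold sc; destruct (c1_mid s Z2) as [-> _]; ring|].
    rewrite pp_mid, hh_mid by auto. unfold gh, ghd.
    destruct (kap_mid s Z2) as [A B]. assert (Eo : om s = omm s) by (unfold om; rewrite A; ring).
    rewrite Eo, sig_mid by auto. unfold omm, th. pose proof (wh_ge s) as Hw. pose proof (cosh_sq s) as Hc.
    rewrite Rmult_comm, <- Rmult_assoc. replace (2 * s) with (s + s) by ring. rewrite exp_plus.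
    assert (Ee : exp s * exp (- s) = 1) by (rewrite <- exp_plus, Rplus_opp_r; apply exp_0).
    assert (F1 : forall X Y, (X * (exp (- s) * (- sinh s / wh s)) + - exp (- s) * Y) * (exp s * exp s) * wh s =
       (exp s * exp (- s)) * (exp s * (wh s * (X * (- sinh s / wh s) - Y)))) by (intros; ring).
    rewrite F1, Ee. rewrite exp_cosh. assert (Hw2 : wh s = 1 + 2 * sinh s ^ 2) by (unfold wh; lra).
    set (C := cosh s) in *. set (S := sinh s) in *. set (w := wh s) in *. clearbody w C S. subst w.
    field_simplify_eq; [|lra]. ring [Hc].
  - left. destruct (c2_out s) as [A B]; [lra|]. pose proof (sig_nz s Hi Z).
    unfold ah, ald, ghd, dend, al, gh, den. rewrite A, B. assert (Ee : exp s * exp (- s) = 1) by (rewrite <- exp_plus, Rplus_opp_r; apply exp_0).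
    split; [replace (exp s * sig s / (sig s ^ 2 + 0) * (exp (- s) * sig s)) with (exp s * exp (- s)) by (field; auto); auto|].
    field. auto.
Qed.
Lemma ident4 s : -(1/2) < s <= -(2/5) -> ah s = 1 /\ ald s * gh s + al s * ghd s = 0 /\ gh s <> 0.
Proof.
  intros Hs'. assert (Hi : In1 s) by (unfold In1; lra). pose proof (sig_left s Hs').
  assert (Ee : exp s * exp (- s) = 1) by (rewrite <- exp_plus, Rplus_opp_r; apply exp_0).
  pose proof (exp_pos (- s)). destruct (c2_out s) as [A B]; [unfold D; nra|]. split; [|split].
  - unfold ah, al, gh, den. rewrite A.
    replace (exp s * sig s / (sig s ^ 2 + 0) * (exp (- s) * sig s)) with (exp s * exp (- s)) by (field; lra). auto.
  - unfold ald, ghd, dend, al, gh, den. rewrite A, B. field. lra.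
  - unfold gh. assert (0 < exp (- s) * sig s) by (apply Rmult_lt_0_compat; lra). lra.
Qed.

(** [D h = (3/2) sig / (omm k1) - D omm' / (2 omm) + s] there. With [sig >= 28/100], [omm <= 1] and
    [1 / k1 >= (5/2) (N + 10)] the first term exceeds [N + 10], and the other two add up to less
    than 1. *)
Lemma hh_end s : -(1/2) < s <= -(49/100) -> INR N + 9 <= D s * hh s.
Proof.
  intros Hs'. assert (Hi : In1 s) by (unfold In1; lra). destruct (kap_end s) as [A B]; [unfold D; nra|].
  pose proof (sig_left s ltac:(lra)) as S1. destruct (omm_range s Hi) as [O1 O2]. pose proof (ommd_bound s Hi) as O3.
  pose proof (D_pos s Hi) as Dp. assert (Dl : D s <= 1/100) by (unfold D; nra).
  unfold hh, om, omd. rewrite A, B.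
  replace (D s * ((3 * sig s - (ommd s * (k1 * D s) + omm s * (k1 * (- 2 * s)))) / (2 * (omm s * (k1 * D s)))))
   with (3/2 * (sig s / (omm s * k1)) - D s * (ommd s / (2 * omm s)) + s) by (field; lra).
  assert (L1 : 28/40 * (INR N + 10) <= sig s / (omm s * k1)).
  { apply le_div_intro; [apply Rmult_lt_0_compat; lra|]. assert (0 <= k1 * (INR N + 10)) by (pose proof (pos_INR N); apply Rmult_le_pos; lra).
    assert (omm s * (k1 * (INR N + 10)) <= 1 * (2/5)) by (apply Rmult_le_compat; lra). lra. }
  assert (L2 : Rabs (ommd s / (2 * omm s)) <= 45).
  { unfold Rdiv. rewrite Rabs_mult, Rabs_inv, (Rabs_right (2 * omm s)) by lra. apply (div_le_intro _ 45); lra. }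
  apply Rabs_le_between in L2. assert (D s * (ommd s / (2 * omm s)) <= 1/100 * 45); [|pose proof (pos_INR N); lra].
  destruct (Rle_dec 0 (ommd s / (2 * omm s))); [apply Rmult_le_compat; lra|nra].
Qed.

Lemma hh_bound : exists C, 0 < C /\ forall s, In1 s -> Rabs (hh s) <= C / D s.
Proof.
  destruct (snice_bound _ _ dh_snice) as [C [C0 HC]]. exists (C + 1). split; [lra|]. intros s Hi.
  pose proof (D_pos s Hi). apply le_div_intro; auto. specialize (HC s Hi). rewrite Rabs_mult, (Rabs_right (D s)) in HC by lra. lra.
Qed.
Lemma Hp_even s : In1 s -> Hp (- s) = Hp s.
Proof. apply (even_antiderivative Hp hh); auto using hh_odd. Qed.
(** [p / D^N] has logarithmic derivative [h + 2 N s / D], nonnegative for [s <= -49/100] by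
    [hh_end]; it is largest at -49/100 there. The rest of the left half is compact, and [p] is
    even. *)
Lemma pp_le : exists C, 0 < C /\ forall s, In1 s -> pp s <= C * D s ^ N.
Proof.
  destruct hh_bound as [Ch [Ch0 HC]].
  set (B := Ch / (1/250) * 1). set (f := fun s => Hp s + - INR N * ln (D s)).
  assert (D49 : 0 < D (-(49/100))) by (unfold D; lra). exists (exp (f (-(49/100))) + exp B * / ((1/250) ^ N)).
  assert (P1 : 0 < exp B * / ((1/250) ^ N)) by (apply Rmult_lt_0_compat; [apply exp_pos|apply Rinv_0_lt_compat, pow_lt; lra]).
  assert (P2 := exp_pos (f (-(49/100)))). split; [lra|].
  assert (A : forall s, -(1/2) < s <= 0 -> pp s <= (exp (f (-(49/100))) + exp B * / ((1/250) ^ N)) * D s ^ N).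
  { intros s Hs'. assert (Hi : In1 s) by (unfold In1; lra). pose proof (D_pos s Hi) as Dp.
    assert (0 < D s ^ N) by now apply pow_lt. rewrite Rmult_plus_distr_r.
    assert (0 < exp (f (-(49/100))) * D s ^ N) by now apply Rmult_lt_0_compat.
    assert (0 < exp B * / ((1/250) ^ N) * D s ^ N) by now apply Rmult_lt_0_compat.
    destruct (Rle_dec s (-(49/100))) as [h|h].
    - assert (M : f s <= f (-(49/100))).
      { destruct (Req_dec s (-(49/100))) as [E|E]; [rewrite E; lra|].
        destruct (mvt f (fun s => hh s + - INR N * (-2 * s / D s)) s (-(49/100))) as [c [Hc1 Hc2]]; [lra| |].
        - intros x Hx. assert (Ix : In1 x) by (unfold In1; lra). unfold f. apply derive_plus; [now apply Hp_der|].
          apply derive_scal. eapply derive_eq; [apply (derive_comp ln D); [|apply D_der]|].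
          + apply is_derive_Reals, derivable_pt_lim_ln, D_pos, Ix.
          + unfold Rdiv; ring.
        - assert (Ic : In1 c) by (unfold In1; lra). pose proof (D_pos c Ic). pose proof (hh_end c ltac:(lra)) as E1.
          assert (0 <= hh c + - INR N * (-2 * c / D c)); [|assert (0 <= (hh c + - INR N * (-2 * c / D c)) * (-(49/100) - s)) by (apply Rmult_le_pos; lra); lra].
          replace (hh c + - INR N * (-2 * c / D c)) with ((D c * hh c + 2 * c * INR N) / D c) by (field; lra).
          apply le_div_intro; auto. pose proof (pos_INR N). nra. }
      assert (pp s <= exp (f (-(49/100))) * D s ^ N); [|lra]. replace (pp s) with (exp (f s) * D s ^ N).
      + apply Rmult_le_compat_r; [lra|]. destruct M as [M|M]; [left; now apply exp_increasing|rewrite M; lra].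
      + unfold f, pp. rewrite <- Rpower_pow by auto. unfold Rpower. rewrite <- exp_plus. f_equal. ring.
    - assert (pp s <= exp B * / ((1/250) ^ N) * D s ^ N); [|lra].
      assert (L := lip_of_derive Hp hh (-(495/1000)) (495/1000) (Ch / (1/250))).
      assert (Z : Rabs (Hp s - Hp 0) <= Ch / (1/250) * Rabs (s - 0)).
      { apply L; try lra.
        - intros x Hx. apply Hp_der. unfold In1; lra.
        - intros x Hx. assert (Ix : In1 x) by (unfold In1; lra). eapply Rle_trans; [now apply HC|].
          unfold Rdiv. apply Rmult_le_compat_l; [lra|]. apply Rinv_le_contravar; [lra|]. unfold D; nra. }
      rewrite Hp0, !Rminus_0_r in Z. apply Rle_trans with (exp B * 1).
      + rewrite Rmult_1_r. assert (Q : Hp s <= B).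
        { eapply Rle_trans; [apply Rle_abs|]. eapply Rle_trans; [exact Z|]. unfold B.
          assert (0 < Ch / (1/250)) by (apply Rdiv_lt_0_compat; lra). assert (Rabs s <= 1) by (apply Rabs_le; lra). nra. }
        unfold pp. destruct Q as [Q|Q]; [left; now apply exp_increasing|rewrite Q; lra].
      + rewrite Rmult_assoc. apply Rmult_le_compat_l; [left; apply exp_pos|].
        rewrite Rmult_comm. apply (le_div_intro 1 (D s ^ N)); [apply pow_lt; lra|]. rewrite Rmult_1_l. apply pow_incr. unfold D; nra. }
  intros s Hi. destruct (Rle_dec s 0) as [h|h]; [apply A; unfold In1 in Hi; lra|].
  unfold pp in *. rewrite <- Hp_even, <- D_even by auto. apply A. unfold In1 in Hi; lra.
Qed.

Lemma squeeze_left u v B y : -(1/2) < y -> 0 <= B -> (forall x, -(1/2) < x < y -> u <= v + B * (x + 1/2)) -> u <= v.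
Proof.
  intros Hy HB H. destruct (Rle_dec u v) as [h|h]; auto. exfalso.
  set (d := Rmin ((y + 1/2) / 2) ((u - v) / (2 * (B + 1)))).
  assert (Hd : 0 < d) by (apply Rmin_glb_lt; [lra|apply Rdiv_lt_0_compat; lra]).
  assert (d <= (y + 1/2) / 2) by apply Rmin_l. assert (Hd2 : d <= (u - v) / (2 * (B + 1))) by apply Rmin_r.
  assert (Hd3 : d * (2 * (B + 1)) <= u - v).
  { apply (Rmult_le_compat_r (2 * (B + 1))) in Hd2; [|lra]. unfold Rdiv in Hd2. rewrite Rmult_assoc, Rinv_l in Hd2; lra. }
  specialize (H (d - 1/2) ltac:(lra)). nra.
Qed.
Lemma pp2_le : exists C, 0 < C /\ forall s, In1 s -> pp s ^ 2 <= C * (s + 1/2).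
Proof.
  destruct pp_le as [C [C0 HC]]. exists (C ^ 2). split; [apply pow_lt; lra|]. intros s Hi.
  specialize (HC s Hi). pose proof (pp_pos s). pose proof (D_pos s Hi). pose proof (D_le s).
  destruct N as [|n]; [lia|].
  assert (D s ^ S n <= D s). { simpl. assert (D s ^ n <= 1) by (rewrite <- (pow1 n); apply pow_incr; lra). nra. }
  assert (0 < D s ^ S n) by now apply pow_lt.
  apply Rle_trans with ((C * D s ^ S n) ^ 2); [apply pow_incr; lra|]. rewrite Rpow_mult_distr.
  apply Rmult_le_compat_l; [apply pow2_ge_0|]. assert (D s <= s + 1/2) by (unfold D, In1 in *; nra). nra.
Qed.

(** Near the end, comparing [(p^2 Y)' = 4 p^2 psi] with [(p^2 om)' = 3 p^2 sig] bounds [Y], and the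
    length 1/10 of the interval keeps [psi] close to 1, hence positive. The Wronskian [W] of [psi]
    against [sig], weighted by [p^2], then decreases from 0. In the middle [p psi] is an
    axisymmetric harmonic perturbation, hence affine in [s]; the sign of [W] at -2/5 makes its slope
    so negative that it changes sign before [s = 0]. *)
Lemma zero_mode_profile (psi Y : R -> R) A :
  (forall s, -(1/2) < s < 1/4 -> is_derive psi s (- Y s + 0)) ->
  (forall s, -(1/2) < s < 1/4 -> is_derive Y s (- 2 * hh s * Y s - (-4) * psi s + 0)) ->
  0 <= A -> (forall s, -(1/2) < s < 1/4 -> Rabs (psi s) <= A /\ Rabs (Y s) <= A /\ Rabs (psi s - 1) <= A * (s + 1/2)) ->
  psi 0 < 0 /\ 0 < Y 0.
Proof.
  intros D1 D2 HA HB. destruct pp2_le as [C [C0 HC]]. set (a := -(2/5)).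
  assert (Fd : forall s, -(1/2) < s < 1/4 -> is_derive (fun s => pp s ^ 2 * Y s) s (4 * pp s ^ 2 * psi s)).
  { intros s Hs'. assert (Hi : In1 s) by (unfold In1; lra). derive. simpl. ring. }
  assert (Gd : forall s, -(1/2) < s < 1/4 -> is_derive (fun s => pp s ^ 2 * om s) s (3 * pp s ^ 2 * sig s)).
  { intros s Hs'. assert (Hi : In1 s) by (unfold In1; lra). pose proof (om_pos s Hi).
    derive. simpl. unfold hh. field. lra. }
  destruct (completeness (fun x => exists s, -(1/2) < s <= a /\ x = Rabs (psi s - 1))) as [M [M1 M2]].
  { exists A. intros x [s [Hs' ->]]. destruct (HB s) as [_ [_ B3]]; [unfold a in *; lra|]. unfold a in *. nra. }
  { exists (Rabs (psi a - 1)), a. unfold a; split; auto; lra. }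
  assert (HM : forall s, -(1/2) < s <= a -> Rabs (psi s - 1) <= M) by (intros s Hs'; apply M1; exists s; auto).
  assert (M0 : 0 <= M) by (eapply Rle_trans; [apply Rabs_pos|apply (HM a)]; unfold a; lra).
  assert (HY : forall y, -(1/2) < y <= a -> Rabs (Y y) <= 22/10 * (1 + M)).
  { intros y Hy. unfold a in *. assert (Iy : In1 y) by (unfold In1; lra). pose proof (pp_pos y) as Py.
    (* The quotient of the two right-hand sides: at most [4 (1 + M)] above, at least 3 times the
       bound 28/100 of [sig] below. *)
    set (c := 4 * (1 + M) / (3 * (28/100))). assert (c0 : 0 < c) by (apply Rdiv_lt_0_compat; lra).
    assert (E : Rabs (pp y ^ 2 * Y y) <= c * (pp y ^ 2 * om y)).
    { apply (squeeze_left _ _ (C * A) y); [lra|apply Rmult_le_pos; lra|]. intros x Hx. assert (Ix : In1 x) by (unfold In1; lra).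
      assert (E := cmp_of_derive_closed (fun s => pp s ^ 2 * Y s) (fun s => 4 * pp s ^ 2 * psi s)
        (fun s => c * (pp s ^ 2 * om s)) (fun s => c * (3 * pp s ^ 2 * sig s)) x y ltac:(lra)).
      assert (E' : Rabs (pp y ^ 2 * Y y - pp x ^ 2 * Y x) <= c * (pp y ^ 2 * om y) - c * (pp x ^ 2 * om x)).
      { apply E.
        - intros t Ht. apply Fd. lra.
        - intros t Ht. apply derive_scal, Gd. lra.
        - intros t Ht. pose proof (sig_left t ltac:(lra)) as St. specialize (HM t ltac:(lra)). pose proof (pp_pos t) as Pt.
          assert (P2 : 0 < pp t ^ 2) by now apply pow_lt. assert (Rabs (psi t) <= 1 + M).
          { replace (psi t) with (1 + (psi t - 1)) by ring. triang. rewrite Rabs_R1. lra. }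
          rewrite !Rabs_mult, (Rabs_right 4), (Rabs_right (pp t ^ 2)) by lra.
          apply Rle_trans with (pp t ^ 2 * (4 * (1 + M))); [nra|].
          replace (c * (3 * pp t ^ 2 * sig t)) with (pp t ^ 2 * (c * (3 * sig t))) by ring. apply Rmult_le_compat_l; [lra|].
          replace (4 * (1 + M)) with (c * (3 * (28/100))) by (unfold c; field). apply Rmult_le_compat_l; lra. }
      destruct (HB x ltac:(lra)) as [_ [B2 _]]. specialize (HC x Ix). pose proof (pow2_ge_0 (pp x)).
      assert (Rabs (pp x ^ 2 * Y x) <= C * A * (x + 1/2)).
      { rewrite Rabs_mult, (Rabs_right (pp x ^ 2)) by lra.
        apply Rle_trans with (C * (x + 1/2) * A); [|lra]. apply Rmult_le_compat; auto using Rabs_pos. }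
      assert (0 <= c * (pp x ^ 2 * om x)) by (destruct (om_pos x Ix); apply Rmult_le_pos; [lra|apply Rmult_le_pos; lra]).
      replace (pp y ^ 2 * Y y) with ((pp y ^ 2 * Y y - pp x ^ 2 * Y x) + pp x ^ 2 * Y x) by ring. triang. lra. }
    assert (Om : om y <= 46/100).
    { destruct (kap_range y Iy) as [[K1' K2] _]. destruct (omm_range y Iy) as [O1 _]. destruct (cosh_bound y Iy) as [[B1 B2] B3].
      apply Rle_trans with (omm y); [unfold om; nra|]. unfold omm. pose proof (cosh_sq y) as Cq. pose proof (sinh_ge (- y) ltac:(lra)) as Sg.
      rewrite sinh_odd in Sg. assert (16/100 <= sinh y ^ 2) by nra. assert (33/25 <= wh y) by (unfold wh; lra).
      apply div_le_intro; [nra|]. assert (cosh y * (3 - 2 * cosh y ^ 2) <= 116/100 * (68/100)) by (apply Rmult_le_compat; lra). nra. }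
    assert (P2 : 0 < pp y ^ 2) by now apply pow_lt. rewrite Rabs_mult, (Rabs_right (pp y ^ 2)) in E by lra.
    assert (Rabs (Y y) <= c * om y) by (apply (Rmult_le_reg_l (pp y ^ 2)); auto; lra).
    apply Rle_trans with (c * (46/100)); [assert (c * om y <= c * (46/100)) by (apply Rmult_le_compat_l; lra); lra|]. unfold c. lra. }
  assert (MM : M <= 22/100 * (1 + M)).
  { apply M2. intros z [y [Hy ->]]. apply (squeeze_left _ _ A y); [unfold a in *; lra|lra|]. intros x Hx.
    destruct (mvt psi (fun s => - Y s + 0) x y) as [c [E1 E2]]; [lra|intros; apply D1; unfold a in *; lra|].
    destruct (HB x) as [_ [_ B3]]; [unfold a in *; lra|]. specialize (HY c ltac:(lra)).
    replace (psi y - 1) with ((psi y - psi x) + (psi x - 1)) by ring. triang.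
    assert (Rabs (psi y - psi x) <= 22/100 * (1 + M)); [|lra].
    rewrite E2, Rabs_mult, (Rabs_right (y - x)), Rplus_0_r, Rabs_Ropp by lra.
    apply Rle_trans with (22/10 * (1 + M) * (1/10)); [|lra]. apply Rmult_le_compat; auto using Rabs_pos; unfold a in *; lra. }
  assert (Pp : forall s, -(1/2) < s <= a -> 0 < psi s).
  { intros s Hs'. specialize (HM s Hs'). apply Rabs_le_between in HM. lra. }
  set (W := fun s => - (pp s ^ 2 * Y s * sig s) + psi s * (pp s ^ 2 * om s)).
  assert (Wd : forall s, -(1/2) < s < 1/4 -> is_derive W s (- (pp s ^ 2 * psi s * sig s))).
  { intros s Hs'. assert (Hi : In1 s) by (unfold In1; lra). unfold W. eapply derive_eq; [apply derive_plus; [apply derive_opp, derive_mult;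
      [now apply Fd|now apply sig_der]|apply derive_mult; [now apply D1|now apply Gd]]|]. cbv beta. ring. }
  assert (Wn : forall x y, -(1/2) < x -> x < y -> y <= a -> W y < W x).
  { intros x y H1 H2 H3. unfold a in *. destruct (mvt W (fun s => - (pp s ^ 2 * psi s * sig s)) x y) as [c [E1 E2]]; [lra|intros; apply Wd; lra|].
    assert (0 < pp c ^ 2 * psi c * sig c).
    { pose proof (sig_left c ltac:(lra)). apply Rmult_lt_0_compat; [apply Rmult_lt_0_compat|lra]; [apply pow_lt, pp_pos|apply Pp; lra]. }
    nra. }
  assert (W0 : W (-(45/100)) <= 0).
  { apply (squeeze_left _ _ (C * (2 * A)) (-(45/100))); [lra|apply Rmult_le_pos; lra|]. intros x Hx. unfold a in *.
    assert (Ix : In1 x) by (unfold In1; lra). assert (E := Wn x (-(45/100)) ltac:(lra) ltac:(lra) ltac:(lra)).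
    destruct (HB x ltac:(lra)) as [B1 [B2 _]]. specialize (HC x Ix). pose proof (pow2_ge_0 (pp x)).
    assert (W x <= C * (2 * A) * (x + 1/2)); [|lra]. assert (Z1 : - Y x * sig x + psi x * om x <= 2 * A).
    { apply Rabs_le_between in B1. apply Rabs_le_between in B2. pose proof (sig_bound x Ix) as S1. pose proof (sig_left x ltac:(lra)).
      apply Rabs_le_between in S1. destruct (om_pos x Ix). nra. }
    unfold W. replace (- (pp x ^ 2 * Y x * sig x) + psi x * (pp x ^ 2 * om x)) with (pp x ^ 2 * (- Y x * sig x + psi x * om x)) by ring.
    apply Rle_trans with (pp x ^ 2 * (2 * A)); [apply Rmult_le_compat_l; lra|].
    replace (C * (2 * A) * (x + 1/2)) with (C * (x + 1/2) * (2 * A)) by ring. apply Rmult_le_compat_r; lra. }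
  assert (Wa : W a < 0) by (assert (W a < W (-(45/100))) by (apply Wn; unfold a; lra); lra).
  (* [X] is the derivative of [wh psi], with [psi' = - Y]; since [wh'' = 4 wh], the equation for
     [k = -4] says that it is constant. *)
  set (X := fun s => 2 * th s * wh s * psi s - wh s * Y s).
  assert (phid : forall s, a <= s <= 0 -> is_derive (fun s => wh s * psi s) s (X s)).
  { intros s Hs'. unfold a in *. derive. unfold X. ring. }
  assert (Xc : forall s, a <= s <= 0 -> X s = X a).
  { intros s Hs'. unfold a in *. destruct (Req_dec s (-(2/5))) as [->|Hne]; auto.
    destruct (mvt X (fun _ => 0) (-(2/5)) s) as [c [_ E]]; [lra| |lra]. intros x Hx. unfold X. pose proof (wh_ge x).
    derive. cbv beta. rewrite hh_mid by lra. pose proof (cosh_sq x) as Cq.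
    assert (E4 : cosh x ^ 2 * sinh x ^ 2 = (wh x ^ 2 - 1) / 4) by (replace (sinh x ^ 2) with (cosh x ^ 2 - 1) by lra; unfold wh; field).
    assert (E5 : th x ^ 2 * wh x ^ 2 = wh x ^ 2 - 1).
    { replace (th x ^ 2 * wh x ^ 2) with (4 * (cosh x ^ 2 * sinh x ^ 2)) by (unfold th; field; lra). rewrite E4. field. }
    transitivity (psi x * (4 / wh x) * (1 + th x ^ 2 * wh x ^ 2 - wh x ^ 2)); [field; lra|]. rewrite E5. ring. }
  assert (Pa : 0 < psi a) by (apply Pp; unfold a; lra). assert (Xa : X a * (2/5) + wh a * psi a < 0 /\ X a < 0).
  { unfold W in Wa. unfold X. pose proof (wh_ge a) as Hw. pose proof (pp_pos a) as Ppa. assert (P2 : 0 < pp a ^ 2) by now apply pow_lt.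
    assert (Q : - Y a * sig a + psi a * om a < 0) by (apply (Rmult_lt_reg_l (pp a ^ 2)); auto; lra). clear Wa.
    destruct (kap_mid a) as [Ka _]; [unfold a, D; lra|]. unfold om in Q. rewrite Ka in Q. rewrite sig_mid in Q by (unfold a; lra).
    unfold th. pose proof (cosh_sq a) as Cq. pose proof (sinh_ge (2/5) ltac:(lra)) as S1. pose proof (sinh_le (2/5) ltac:(lra)) as S2.
    replace (sinh (2/5)) with (- sinh a) in S1, S2 by (unfold a; rewrite sinh_odd; ring).
    replace (cosh (2/5)) with (cosh a) in S2 by (unfold a; apply cosh_even).
    unfold omm in Q. replace (2 * (2 * cosh a * sinh a / wh a) * wh a) with (4 * cosh a * sinh a) by (field; lra).
    set (c := cosh a) in *. set (S := sinh a) in *. set (w := wh a) in *. set (y := Y a) in *. set (f := psi a) in *.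
    assert (Ew : w = 2 * c ^ 2 - 1) by reflexivity. clearbody c S w y f.
    assert (Q2 : y * S * w + f * (c * (3 - 2 * c ^ 2)) < 0).
    { apply (Rmult_lt_compat_r (w ^ 2)) in Q; [|apply pow_lt; lra].
      replace ((- y * (- S / w) + f * (c * (3 - 2 * c ^ 2) / w ^ 2 * 1)) * w ^ 2) with (y * S * w + f * (c * (3 - 2 * c ^ 2))) in Q by (field; lra). lra. }
    assert (Q3 : c * f * w < S * (4 * c * S * f - w * y)).
    { assert (E : S * (4 * c * S * f - w * y) - c * f * w = - (y * S * w + f * (c * (3 - 2 * c ^ 2)))
        + 4 * c * f * (S ^ 2 + 1 - c ^ 2)) by (rewrite Ew; ring).
      replace (S ^ 2 + 1 - c ^ 2) with 0 in E by lra. lra. }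
    set (x := 4 * c * S * f - w * y) in *. clearbody x. assert (S < 0) by lra.
    assert (0 < c) by nra. assert (0 < c * f * w) by (apply Rmult_lt_0_compat; [apply Rmult_lt_0_compat|]; lra).
    assert (x < 0) by nra. split; auto.
    assert ((- S) * (- x) <= 2/5 * c * (- x)) by (apply Rmult_le_compat_r; lra).
    apply (Rmult_lt_reg_l c); auto. lra. }
  assert (E0 := Xc 0 ltac:(unfold a; lra)). assert (W1 : wh 0 = 1) by (unfold wh; rewrite cosh_0; ring).
  unfold X at 1 in E0. unfold th in E0. rewrite W1, sinh_0 in E0.
  destruct (mvt (fun s => wh s * psi s) X a 0) as [c [E1 E2]]; [unfold a; lra|auto|].
  rewrite (Xc c), W1 in E2 by lra. split; [|lra]. destruct Xa as [Xa _]. unfold a in *. lra.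
Qed.

Lemma profile_of_potentials : inhabited (profile K N).
Proof.
  assert (hb := hh_bound). destruct coefs_snice as [q1 [q2 [q3 [q4 [q5 [q6 q7]]]]]].
  constructor. unshelve refine (Build_profile K N al ald mu mud gh ghd sc bb hh pp Hs q1 q2 q3 q4 q5 q6 q7 dh_snice
    al_der mu_der gh_der pp_der Hs_der ident1 ident2 ident3 ident4 pp_pos pp_le hb _).
  destruct hb as [Ch [Ch0 HC]]. apply (linear_solver pp hh (1/100) (4 * Ch)).
  - intros; apply pp_pos.
  - exact pp_der.
  - lra.
  - lra.
  - intros s Hs'. assert (Hi : In1 s) by (unfold In1; lra).
    assert (E := hh_end s ltac:(lra)). pose proof (D_pos s Hi). pose proof (pos_INR N).
    apply div_le_intro; [lra|]. assert (D s <= s + 1/2) by (unfold D; nra). destruct (Rle_dec 0 (hh s)); nra.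
  - intros s Hs'. assert (Hi : In1 s) by (unfold In1; lra). eapply Rle_trans; [now apply HC|]. pose proof (D_pos s Hi).
    apply div_le_intro; auto. replace (4 * Ch / (s + 1/2) * D s) with (Ch * (4 * (D s / (s + 1/2)))) by (field; lra).
    rewrite <- (Rmult_1_r Ch) at 1. apply Rmult_le_compat_l; [lra|].
    replace (D s / (s + 1/2)) with (1/2 - s) by (unfold D; field; lra). lra.
  - exact hh_odd.
  - intros s Hs'. apply (coef_continuous _ s q7 Hs').
  - intros s Hs'. pose proof (c1_range s Hs'). destruct (om_pos s Hs'). unfold bb. split; [apply Rmult_le_pos; lra|nra].
  - intros s _. unfold bb. now rewrite c1_even, om_even.
  - intros s Hs'. assert (Hi : In1 s) by (unfold In1; lra). unfold bb. apply Rmult_lt_0_compat; [|now apply om_pos].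
    apply c1_pos. unfold D; nra.
  - intros psi Y [L1 L2] [A1 B1] [A2 B2].
    destruct (zero_mode_profile psi Y (Rmax 0 (Rmax A1 A2))) as [Z1 Z2]; auto.
    + apply Rmax_l.
    + intros s Hs'. destruct (B1 s Hs'). pose proof (B2 s Hs').
      assert (A1 <= Rmax 0 (Rmax A1 A2)) by (eapply Rle_trans; [apply Rmax_l|apply Rmax_r]).
      assert (A2 <= Rmax 0 (Rmax A1 A2)) by (eapply Rle_trans; [apply Rmax_r|apply Rmax_r]).
      split; [lra|]. split; [lra|]. eapply Rle_trans; [eassumption|]. apply Rmult_le_compat_r; lra.
    + lra.
Qed.
End Profile.

Lemma profile_exists K N : (1 <= K)%nat -> (1 <= N)%nat -> inhabited (profile K N).
Proof.
  intros HK HN. assert (HN0 : 0 < INR N + 10) by (pose proof (pos_INR N); lra).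
  assert (k0 : 0 < 2/5 / (INR N + 10)) by (apply Rdiv_lt_0_compat; lra).
  assert (ks : 2/5 / (INR N + 10) * (INR N + 10) <= 2/5) by (right; field; lra).
  assert (I0 : - (1/2) < 0 < 1/2) by lra.
  destruct (antiderivative_open (fun s => - om K (2/5 / (INR N + 10)) s) _ _ _ I0) as [sig [s0 sd]].
  { intros x _. apply continuous_Ropp, (cont_of_derive _ _ _ (om_der K _ x)). }
  destruct (potentials_exist K N _ HK HN k0 ks sig s0 sd) as [[Hp [Hp0 Hpd]] [Hs [Hs0 Hsd]]].
  exact (profile_of_potentials K N _ HK HN k0 ks sig s0 sd Hp Hs Hp0 Hpd Hs0 Hsd).
Qed.

(** * From coefficients to functions: the nonlinear system and its regularity *)

(** The names in [t] are angular derivatives. [N_eq] and [M_eq] express that the velocity built from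
    [Y] and [Mm] is the gradient of the stream function; the smallness clauses keep [Q], [T_s] and
    the remaining denominator away from 0; the last two clauses serve to exclude a locally radial
    flow. *)
Record solution (K N : nat) (P : profile K N) := {
  lam : R; psi : fn; Y : fn; Nn : fn; Mm : fn; psit : fn; psitt : fn; Yt : fn; Nt : fn; Mt : fn;
  psi_s : dS psi (fun s th => - Y s th + Nn s th);
  psit_s : dS psit (fun s th => - Yt s th + Nt s th);
  psi_t : dT psi psit; psit_t : dT psit psitt; Y_t : dT Y Yt; N_t : dT Nn Nt; M_t : dT Mm Mt;
  Y_s : dS Y (fun s th => - 2 * p_h _ _ P s * Y s th + psitt s th + 4 * psi s th + p_h _ _ P s * Nn s th - Mt s th
     + lam * (- 2 * p_sc _ _ P s * Y s th + 2 * p_bb _ _ P s * psi s th + p_sc _ _ P s * Nn s th));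
  psi_nice : forall q, nice K q psi; psit_nice : forall q, nice K q psit; Y_nice : forall q, nice K q Y;
  N_nice : forall q, nice K q Nn; M_nice : forall q, nice K q Mm;
  Q_small : forall s th, In1 s -> 1/2 <= 1 + 2 * p_al _ _ P s * psi s th;
  T_small : forall s th, In1 s ->
    Rabs (p_ald _ _ P s * psi s th + p_al _ _ P s * (- Y s th + Nn s th)) <= 1/4;
  R_small : forall s th, In1 s -> let al := p_al _ _ P s in let ah := al * p_gh _ _ P s in
    1/2 <= 1 - al * (Y s th - p_mu _ _ P s * psi s th) + 2 * al * (1 - ah) * psi s th;
  N_eq : forall s th, In1 s -> let al := p_al _ _ P s in let ah := al * p_gh _ _ P s in
    let mu := p_mu _ _ P s in let nu := 2 * al * (1 - ah) + al * mu - p_ald _ _ P s in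
    let vp := Y s th - mu * psi s th in let Q := 1 + 2 * al * psi s th in
    Nn s th * Q * (1 - al * vp + 2 * al * (1 - ah) * psi s th) =
    Q * (vp + 2 * ah * psi s th) * (p_ald _ _ P s * psi s th - al * Y s th)
      - al * psit s th ^ 2 * (1 + nu * psi s th);
  M_eq : forall s th, In1 s -> let al := p_al _ _ P s in let ah := al * p_gh _ _ P s in
    let nu := 2 * al * (1 - ah) + al * p_mu _ _ P s - p_ald _ _ P s in
    Mm s th * (1 + 2 * al * psi s th) = (2 * al - nu) * psi s th * psit s th;
  psit_axes : forall s, psit s 0 = 0 /\ psit s (PI / 2) = 0;
  psi_nonconst : psi (-(9/20)) 0 <> psi (-(9/20)) (PI / 2)
}.

Lemma sym_zero f : sym (-1) f -> forall s, f 0%nat 0%nat s = 0.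
Proof. intros H s. specialize (H 0%nat 0%nat s). lra. Qed.

Section Build.
Variables (Kc Nc : nat) (P : profile Kc Nc).
Let al := p_al _ _ P. Let ald := p_ald _ _ P. Let mu := p_mu _ _ P. Let sc := p_sc _ _ P.
Let bb := p_bb _ _ P. Let h := p_h _ _ P.
Let ah s := al s * p_gh _ _ P s.
Let nu s := 2 * al s * (1 - ah s) + al s * mu s - ald s.
Let al_sn : snice Kc al := p_al_snice _ _ P. Let ald_sn : snice Kc ald := p_ald_snice _ _ P.
Let mu_sn : snice Kc mu := p_mu_snice _ _ P. Let sc_sn : snice Kc sc := p_sc_snice _ _ P.
Let bb_sn : snice Kc bb := p_bb_snice _ _ P. Let dh_sn : snice Kc (fun s => D s * h s) := p_dh_snice _ _ P.
Lemma ah_snice : snice Kc ah.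
Proof. apply snice_mul; [apply p_al_snice|apply p_gh_snice]. Qed.
Let ah_sn := ah_snice.
Lemma nu_snice : snice Kc nu.
Proof. unfold nu. snice_tac. Qed.
Let nu_sn := nu_snice. Let D_sn := snice_D Kc.

Variables (eps K M0 : R) (psiA YA NA mA lamA : arr).
Hypothesis K1 : 1 <= K.
Hypothesis M1 : 1 <= M0.
Hypothesis eps0 : 0 < eps.
Hypothesis epsK : eps * (100 * M0 ^ 2 * K ^ 3) <= 1.
Hypothesis sys : formal_system al ald mu nu ah sc bb h psiA YA NA mA lamA.
Hypothesis sys_sym : sym 1 psiA /\ sym 1 YA /\ sym 1 NA /\ sym (-1) mA /\ sym 1 lamA.
Hypothesis sys_bd : forall j l s, In1 s -> Rabs (psiA j l s) <= K ^ S (j + l) /\ Rabs (YA j l s) <= K ^ S (j + l) /\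
   Rabs (NA j l s) <= K ^ S (j + l) /\ Rabs (mA j l s) <= K ^ S (j + l) /\ Rabs (lamA j l s) <= K ^ S (j + l).
Hypothesis lam_const : forall j l s t, lamA j l s = lamA j l t.
Hypothesis lam_diag : forall j l s, j <> l -> lamA j l s = 0.
Hypothesis psi_first : forall s, psiA 0%nat 0%nat s = 0 /\ psiA 1%nat 0%nat s = 1 /\ psiA 0%nat 1%nat s = 1.
Hypothesis zero_first : forall s, YA 0%nat 0%nat s = 0 /\ NA 0%nat 0%nat s = 0 /\ mA 0%nat 0%nat s = 0.
Hypothesis cbd : forall s, In1 s -> Rabs (al s) <= M0 /\ Rabs (ald s) <= M0 /\ Rabs (mu s) <= M0 /\ Rabs (ah s) <= M0.

Let z := mkstate psiA YA NA mA (fun j l s => lamA (pred j) l s).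
Lemma e0 : 0 <= eps. Proof. lra. Qed.
Lemma MK : 1 <= M0 ^ 2 /\ 1 <= K ^ 2 /\ K <= K ^ 3 /\ 1 <= K ^ 3.
Proof. assert (1 <= M0 ^ 2) by nra. assert (1 <= K ^ 2) by nra. split; auto. split; auto. simpl. split; nra. Qed.
Lemma eK3 : eps * K ^ 3 <= 1/100 /\ eps * K <= 1/8 /\ 4 * K ^ 2 * eps * M0 ^ 2 <= 1/25.
Proof.
  destruct MK as [A [B [C D]]]. assert (0 <= eps * K ^ 3) by (apply Rmult_le_pos; lra).
  assert (X : eps * K ^ 3 * (100 * M0 ^ 2) <= 1) by lra.
  assert (eps * K ^ 3 <= 1/100) by nra. split; auto. split; [assert (eps * K <= eps * K ^ 3) by (apply Rmult_le_compat_l; lra); lra|].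
  assert (K ^ 2 <= K ^ 3) by (simpl; nra). assert (eps * K ^ 2 <= eps * K ^ 3) by (apply Rmult_le_compat_l; lra).
  assert (eps * K ^ 2 * M0 ^ 2 <= eps * K ^ 3 * M0 ^ 2) by (apply Rmult_le_compat_r; lra). lra.
Qed.
Let eK := proj1 (proj2 eK3).
Notation Ec f := (E eps cos f).
Notation Es f := (E eps sin f).
Notation pb := (pbd K).

Lemma pbK f : (forall j l s, In1 s -> Rabs (f j l s) <= K ^ S (j + l)) -> pb f.
Proof. intros H. exists K, 0%nat. split; [lra|]. intros j l s Hs. specialize (H j l s Hs). simpl in *. lra. Qed.
Lemma pb_psi : pb psiA. Proof. apply pbK. intros j l s Hs. apply sys_bd, Hs. Qed.
Lemma pb_Y : pb YA. Proof. apply pbK. intros j l s Hs. apply sys_bd, Hs. Qed.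
Lemma pb_N : pb NA. Proof. apply pbK. intros j l s Hs. apply sys_bd, Hs. Qed.
Lemma pb_m : pb mA. Proof. apply pbK. intros j l s Hs. apply sys_bd, Hs. Qed.
Lemma pb_lam : pb lamA. Proof. apply pbK. intros j l s Hs. apply sys_bd, Hs. Qed.
Hint Resolve pb_psi pb_Y pb_N pb_m pb_lam pbd_add pbd_dth pbd_mul pbd_zc trig_cos trig_sin e0 eK K1 : pb.

Lemma pb_c j c f : snice j c -> pb f -> pb (fun j l s => c s * f j l s).
Proof. intros Hc Hf. destruct (snice_bound j c Hc) as [C [_ HC]]. now apply (pbd_coef K c C). Qed.
Lemma pb_mulz f g : pb f -> pb g -> pb (mulz f g).
Proof. intros. apply pbd_mul; auto with pb. Qed.
Lemma pb_sub f g : pb f -> pb g -> pb (fun j l s => f j l s - g j l s).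
Proof.
  intros Hf Hg. apply (pbd_ext K (fun j l s => f j l s + (-1) * g j l s)); [intros; ring|].
  apply pbd_add; auto with pb. apply (pb_c 0 (fun _ => -1)); auto using snice_const.
Qed.
Hint Resolve pb_mulz pb_sub : pb.
Hint Extern 3 (pbd _ _) => apply (pb_c Kc); [snice_tac|] : pb.
Lemma E_sub t f g s th : trig t -> pb f -> pb g -> In1 s ->
  E eps t (fun j l s => f j l s - g j l s) s th = E eps t f s th - E eps t g s th.
Proof.
  intros Ht Hf Hg Hs. rewrite (E_ext eps t _ (fun j l s => f j l s + (fun _ => -1) s * g j l s)) by (intros; ring).
  rewrite (E_add eps K) by (auto with pb; apply (pb_c 0 (fun _ => -1)); auto using snice_const).
  rewrite (E_coef eps t (fun _ => -1)). ring.
Qed.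
Lemma E_mulz_cos f g s th : pb f -> pb g -> (forall s, f 0%nat 0%nat s = 0) -> (forall s, g 0%nat 0%nat s = 0) -> In1 s ->
  Ec (mulz f g) s th = Ec f s th * Ec g s th - Es f s th * Es g s th.
Proof.
  intros Hf Hg F0 G0 Hs. unfold mulz. rewrite (E_mul_cos eps K) by auto with pb.
  now rewrite !(E_zc eps) by auto.
Qed.
Lemma E_mulz_sin f g s th : pb f -> pb g -> (forall s, f 0%nat 0%nat s = 0) -> (forall s, g 0%nat 0%nat s = 0) -> In1 s ->
  Es (mulz f g) s th = Es f s th * Ec g s th + Ec f s th * Es g s th.
Proof.
  intros Hf Hg F0 G0 Hs. unfold mulz. rewrite (E_mul_sin eps K) by auto with pb.
  now rewrite !(E_zc eps) by auto.
Qed.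
Lemma mulz_00 f g s : mulz f g 0%nat 0%nat s = 0.
Proof. apply mulz_first. simpl. lia. Qed.
Lemma mulz_sym1 f g : sym 1 f -> sym 1 g -> sym 1 (mulz f g).
Proof. intros Hf Hg. apply (sym_eq (1 * 1)); [now apply mulz_sym|ring]. Qed.

Let psi0 := Ec psiA. Let Y0 := Ec YA. Let N0 := Ec NA.
(** An antisymmetric array sums to [i] times [E sin], and the factor [i] between [dth] and the
    angular derivative makes this real function [- E sin]. *)
Let M0f : fn := fun s th => - Es mA s th.
Let psit0 : fn := fun s th => - Es (dth psiA) s th.

Lemma S1_facts : pb (S1 mu ah z) /\ sym 1 (S1 mu ah z) /\ (forall s, S1 mu ah z 0%nat 0%nat s = 0) /\
  forall s th, In1 s -> Ec (S1 mu ah z) s th = Y0 s th + (2 * ah s - mu s) * psi0 s th.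
Proof.
  destruct sys_sym as [A [B _]].
  unfold S1; simpl. split; [auto with pb|]. split; [intros j l s; rewrite (A j l s), (B j l s); ring|].
  split; [intros s; rewrite (proj1 (psi_first s)), (proj1 (zero_first s)); ring|].
  intros s th Hs. rewrite (E_add eps K) by auto with pb. now rewrite (E_coef eps cos (fun s => 2 * ah s - mu s)).
Qed.
Lemma S2_facts : pb (S2 al ald z) /\ sym 1 (S2 al ald z) /\ (forall s, S2 al ald z 0%nat 0%nat s = 0) /\
  forall s th, In1 s -> Ec (S2 al ald z) s th = ald s * psi0 s th - al s * Y0 s th.
Proof.
  destruct sys_sym as [A [B _]].
  unfold S2; simpl. split; [auto with pb|]. split; [intros j l s; rewrite (A j l s), (B j l s); ring|].
  split; [intros s; rewrite (proj1 (psi_first s)), (proj1 (zero_first s)); ring|].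
  intros s th Hs. rewrite E_sub by auto with pb. now rewrite (E_coef eps cos ald), (E_coef eps cos al).
Qed.
Lemma Qm_facts : pb (Qm al z) /\ sym 1 (Qm al z) /\ (forall s, Qm al z 0%nat 0%nat s = 0) /\
  forall s th, In1 s -> Ec (Qm al z) s th = 2 * al s * psi0 s th.
Proof.
  destruct sys_sym as [A _]. unfold Qm; simpl. split; [auto with pb|].
  split; [intros j l s; rewrite (A j l s); ring|]. split; [intros s; rewrite (proj1 (psi_first s)); ring|].
  intros s th Hs. now rewrite (E_coef eps cos (fun s => 2 * al s)).
Qed.
Lemma Rm_facts : pb (Rm al mu ah z) /\ sym 1 (Rm al mu ah z) /\ (forall s, Rm al mu ah z 0%nat 0%nat s = 0) /\
  forall s th, In1 s -> Ec (Rm al mu ah z) s th = (al s * mu s + 2 * al s * (1 - ah s)) * psi0 s th - al s * Y0 s th.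
Proof.
  destruct sys_sym as [A [B _]].
  unfold Rm; simpl. split; [auto with pb|]. split; [intros j l s; rewrite (A j l s), (B j l s); ring|].
  split; [intros s; rewrite (proj1 (psi_first s)), (proj1 (zero_first s)); ring|].
  intros s th Hs. rewrite E_sub by auto with pb. now rewrite (E_coef eps cos (fun s => al s * mu s + 2 * al s * (1 - ah s))), (E_coef eps cos al).
Qed.
Lemma QRm_facts : pb (QRm al mu ah z) /\ sym 1 (QRm al mu ah z) /\ (forall s, QRm al mu ah z 0%nat 0%nat s = 0) /\
  forall s th, In1 s -> 1 + Ec (QRm al mu ah z) s th =
    (1 + 2 * al s * psi0 s th) * (1 - al s * (Y0 s th - mu s * psi0 s th) + 2 * al s * (1 - ah s) * psi0 s th).
Proof.
  destruct Qm_facts as [A1 [A2 [A3 A4]]]. destruct Rm_facts as [B1 [B2 [B3 B4]]].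
  assert (C := mulz_sym1 _ _ A2 B2). assert (pm := pb_mulz _ _ A1 B1). unfold QRm. split; [auto with pb|].
  split; [intros j l s; rewrite (A2 j l s), (B2 j l s), (C j l s); ring|].
  split; [intros s; rewrite A3, B3, mulz_00; ring|].
  intros s th Hs. rewrite !(E_add eps K), E_mulz_cos, (E_sin_sym eps _ _ _ A2), A4, B4 by auto with pb. ring.
Qed.
Lemma Bq_facts : pb (Bq al ald mu nu ah z) /\ (forall s th, In1 s -> Ec (Bq al ald mu nu ah z) s th =
    (1 + 2 * al s * psi0 s th) * (Y0 s th - mu s * psi0 s th + 2 * ah s * psi0 s th) * (ald s * psi0 s th - al s * Y0 s th)
      - al s * psit0 s th ^ 2 * (1 + nu s * psi0 s th)).
Proof.
  destruct Qm_facts as [A1 [A2 [A3 A4]]]. destruct S1_facts as [B1 [B2 [B3 B4]]]. destruct S2_facts as [C1 [C2 [C3 C4]]].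
  destruct sys_sym as [Sp _]. assert (Sd := dth_sym _ Sp). assert (Z0 := sym_zero _ Sd).
  assert (pd : pb (dth psiA)) by auto with pb. assert (pdd := pb_mulz _ _ pd pd).
  assert (pss := pb_mulz _ _ B1 C1). assert (Sss := mulz_sym1 _ _ B2 C2).
  assert (Sdd : sym 1 (mulz (dth psiA) (dth psiA))) by (apply (sym_eq ((-1) * (-1))); [now apply mulz_sym|ring]).
 
  assert (pe := pb_mulz _ _ A1 pss). assert (pf := pb_mulz _ _ pb_psi pdd).
  assert (p1 := pb_c Kc al _ al_sn pdd). assert (p2 := pb_c Kc (fun s => al s * nu s) _ (snice_mul _ _ _ al_sn nu_sn) pf). cbv beta in p2.
  unfold Bq; simpl. split; [auto 10 with pb|]. intros s th Hs.
  rewrite !(E_add eps K) by auto 10 with pb. rewrite (E_coef eps cos al), (E_coef eps cos (fun s => al s * nu s)).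
  rewrite (E_mulz_cos (Qm al z)), (E_mulz_cos (S1 mu ah z)), (E_mulz_cos psiA), (E_mulz_cos (dth psiA)) by (auto using mulz_00 with pb; intros; apply psi_first).
  rewrite (E_sin_sym eps _ _ _ A2), (E_sin_sym eps _ _ _ B2), (E_sin_sym eps _ _ _ Sp), (E_cos_asym eps _ _ _ Sd), A4, B4, C4 by auto.
  unfold psit0. fold psi0. ring.
Qed.
Lemma N0_eq s th : In1 s ->
  N0 s th * (1 + 2 * al s * psi0 s th) * (1 - al s * (Y0 s th - mu s * psi0 s th) + 2 * al s * (1 - ah s) * psi0 s th) =
    (1 + 2 * al s * psi0 s th) * (Y0 s th - mu s * psi0 s th + 2 * ah s * psi0 s th) * (ald s * psi0 s th - al s * Y0 s th)
      - al s * psit0 s th ^ 2 * (1 + nu s * psi0 s th).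
Proof.
  intros Hs. destruct QRm_facts as [A1 [A2 [A3 A4]]]. destruct Bq_facts as [B1 B2]. destruct sys as [_ [_ [HN _]]].
  destruct sys_sym as [_ [_ [Sn _]]]. rewrite <- B2, Rmult_assoc, <- A4 by auto. unfold N0.
  assert (X : Ec NA s th = Ec (Bq al ald mu nu ah z) s th - Ec NA s th * Ec (QRm al mu ah z) s th).
  { rewrite (E_ext eps cos NA (fun j l s => Bq al ald mu nu ah z j l s - mulz NA (QRm al mu ah z) j l s)) at 1 by (intros; rewrite HN; reflexivity).
    rewrite E_sub, E_mulz_cos, (E_sin_sym eps _ _ _ Sn) by (auto using pb_mulz with pb; intros; apply zero_first). ring. }
  lra.
Qed.
Lemma M0_eq s th : In1 s -> M0f s th * (1 + 2 * al s * psi0 s th) = (2 * al s - nu s) * psi0 s th * psit0 s th.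
Proof.
  intros Hs. destruct Qm_facts as [A1 [A2 [A3 A4]]]. destruct sys as [_ [_ [_ HM]]].
  destruct sys_sym as [Sp [_ [_ [Sm _]]]]. assert (Sd := dth_sym _ Sp).
  assert (pd : pb (dth psiA)) by auto with pb.
  assert (X : Es mA s th = (2 * al s - nu s) * (psi0 s th * Es (dth psiA) s th) - 2 * al s * psi0 s th * Es mA s th).
  { rewrite (E_ext eps sin mA (fun j l s => (2 * al s - nu s) * mulz psiA (dth psiA) j l s - mulz (Qm al z) mA j l s)) at 1 by (intros; rewrite HM; reflexivity).
    rewrite E_sub by (auto using pb_mulz with pb). rewrite (E_coef eps sin (fun s => 2 * al s - nu s)).
    rewrite !E_mulz_sin by (auto with pb; try (intros; apply psi_first); try (intros; apply zero_first); now apply sym_zero).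
    rewrite (E_sin_sym eps _ _ _ Sp), (E_sin_sym eps _ _ _ A2), A4 by auto. fold psi0. ring. }
  unfold M0f, psit0. lra.
Qed.
Lemma small f s th t : trig t -> In1 s -> (forall j l s, In1 s -> Rabs (f j l s) <= K ^ S (j + l)) -> (forall s, f 0%nat 0%nat s = 0) ->
  Rabs (E eps t f s th) <= / (25 * M0 ^ 2).
Proof.
  intros Ht Hs Hf H0. destruct (E_small eps K e0 K1 eK t f s th Ht (fun j l => Hf j l s Hs) (H0 s)) as [A _].
  eapply Rle_trans; [exact A|]. destruct MK as [B _]. assert (C := proj2 (proj2 eK3)).
  rewrite <- (Rmult_1_l (/ _)). apply (le_div_intro _ 1); lra.
Qed.
Lemma bounds s th : In1 s -> 1/2 <= 1 + 2 * al s * psi0 s th /\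
  Rabs (ald s * psi0 s th + al s * (- Y0 s th + N0 s th)) <= 1/4 /\
  1/2 <= 1 - al s * (Y0 s th - mu s * psi0 s th) + 2 * al s * (1 - ah s) * psi0 s th.
Proof.
  intros Hs. assert (A : Rabs (psi0 s th) <= / (25 * M0 ^ 2)) by (apply small; auto with pb; [intros; now apply sys_bd|intros; apply psi_first]).
  assert (B : Rabs (Y0 s th) <= / (25 * M0 ^ 2)) by (apply small; auto with pb; [intros; now apply sys_bd|intros; apply zero_first]).
  assert (C : Rabs (N0 s th) <= / (25 * M0 ^ 2)) by (apply small; auto with pb; [intros; now apply sys_bd|intros; apply zero_first]).
  destruct (cbd s Hs) as [c1 [c2 [c3 c4]]]. destruct MK as [HM _].
  set (d := / (25 * M0 ^ 2)) in *. assert (Hd : d * M0 ^ 2 = 1/25) by (unfold d; field; lra).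
  assert (Hd0 : 0 < d) by (apply Rinv_0_lt_compat; lra).
  assert (pr : forall x y a b, Rabs x <= a -> Rabs y <= b -> Rabs (x * y) <= a * b).
  { intros. rewrite Rabs_mult. apply Rmult_le_compat; auto using Rabs_pos. }
  assert (M01 : d * M0 <= 1/25) by (assert (d * M0 <= d * M0 ^ 2) by (apply Rmult_le_compat_l; nra); lra).
  assert (h1 := pr _ _ _ _ c1 A). assert (h2 := pr _ _ _ _ c1 B). assert (h3 := pr _ _ _ _ c1 C). assert (h4 := pr _ _ _ _ c2 A).
  assert (h5 := pr _ _ _ _ c1 (pr _ _ _ _ c3 A)). assert (h6 := pr _ _ _ _ c1 (pr _ _ _ _ c4 A)).
  apply Rabs_le_between in h1, h2, h3, h4, h5, h6. split; [|split; [apply Rabs_le|]]; nra.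
Qed.

(** The algebraic equations express [N] and [M] through [psi], [Y] and the angular derivative of
    [psi], with denominators at least 1/2; hence they share the radial regularity of these. *)
Lemma smooth_step j : (j <= Kc)%nat -> smooth eps j psiA -> smooth eps j YA -> smooth eps j NA /\ smooth eps j mA.
Proof.
  intros Hj Hp HY.
  assert (cl : forall c, snice Kc c -> forall q, nice j q (fun s _ => c s)) by (intros c Hc q; apply (nice_le j Kc q q); auto).
  assert (np : forall q, nice j q psi0) by (intros q; apply Hp, trig_cos).
  assert (nY : forall q, nice j q Y0) by (intros q; apply HY, trig_cos).
  assert (npt : forall q, nice j q psit0).
  { intros q. apply nice_opp. apply (smooth_dth eps K e0 K1 eK j psiA pb_psi Hp sin q trig_sin). }
  assert (nal := cl _ al_sn). assert (nald := cl _ ald_sn).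
  assert (nmu := cl _ mu_sn). assert (nah := cl _ ah_sn). assert (nnu := cl _ nu_sn).
  assert (nQ : forall q, nice j q (fun s th => / (1 + 2 * al s * psi0 s th))).
  { intros q. apply (nice_inv _ _ _ (1/2)); [lra|intros s th Hs; destruct (bounds s th Hs); rewrite Rabs_right; lra|].
    apply nice_add; [apply nice_const|]. apply nice_mul; auto. apply nice_mul; auto using nice_const. }
  assert (nR : forall q, nice j q (fun s th => / (1 - al s * (Y0 s th - mu s * psi0 s th) + 2 * al s * (1 - ah s) * psi0 s th))).
  { intros q. apply (nice_inv _ _ _ (1/2)); [lra|intros s th Hs; destruct (bounds s th Hs) as [_ [_ Hb]]; rewrite Rabs_right; lra|].
    nice_tac. }
  split; intros t q Ht; destruct Ht as [->| ->].
  - apply (nice_ext _ _ (fun s th => ((1 + 2 * al s * psi0 s th) * (Y0 s th - mu s * psi0 s th + 2 * ah s * psi0 s th) * (ald s * psi0 s th - al s * Y0 s th)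
      - al s * (psit0 s th * psit0 s th) * (1 + nu s * psi0 s th)) * / (1 + 2 * al s * psi0 s th) * / (1 - al s * (Y0 s th - mu s * psi0 s th) + 2 * al s * (1 - ah s) * psi0 s th))).
    + intros s th Hs. replace (psit0 s th * psit0 s th) with (psit0 s th ^ 2) by ring. rewrite <- N0_eq by auto.
      destruct (bounds s th Hs) as [Hb1 [_ Hb2]]. unfold N0. field. lra.
    + nice_tac.
  - apply (nice_ext _ _ (fun _ _ => 0)); [|apply nice_const]. intros s th Hs. symmetry. apply E_sin_sym, sys_sym.
  - apply (nice_ext _ _ (fun _ _ => 0)); [|apply nice_const]. intros s th Hs. symmetry. apply E_cos_asym, sys_sym.
  - apply (nice_ext _ _ (fun s th => - ((2 * al s - nu s) * psi0 s th * psit0 s th * / (1 + 2 * al s * psi0 s th)))).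
    + intros s th Hs. rewrite <- M0_eq by auto. destruct (bounds s th Hs) as [Hb1 _]. unfold M0f. field. lra.
    + apply nice_opp. nice_tac.
Qed.

Definition Lam := E eps cos lamA 0 0.
(** A diagonal array has no angular dependence, so its series sums to a number: the value of the
    parameter of the profile. *)
Lemma E_lam s th : E eps cos lamA s th = Lam.
Proof.
  apply Series_ext. intros n. f_equal. apply sum_eq. intros j Hj.
  destruct (Nat.eq_dec j (n - j)) as [e|e]; [|rewrite !lam_diag by auto; ring].
  rewrite (lam_const _ _ s 0), <- e. unfold Rminus. rewrite Rplus_opp_r, !Rmult_0_r, !Rmult_0_l. auto.
Qed.
Lemma E_lam_mul t f s th : trig t -> pb f -> In1 s -> E eps t (mul lamA f) s th = Lam * E eps t f s th.
Proof.
  intros [->| ->] Hf Hs.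
  - rewrite (E_mul_cos eps K), E_lam, (E_sin_sym eps lamA) by (auto with pb; apply sys_sym). ring.
  - rewrite (E_mul_sin eps K), E_lam, (E_sin_sym eps lamA) by (auto with pb; apply sys_sym). ring.
Qed.

Definition gpsi : arr := fun j l s => D s * (NA j l s - YA j l s).
Definition XA := Xa sc bb z.
Definition gY : arr := fun j l s => (-2 * (D s * h s)) * YA j l s + (-1 * D s) * dth (dth psiA) j l s + (4 * D s) * psiA j l s
   + (D s * h s) * NA j l s + D s * (dth mA j l s + mul lamA XA j l s).
Lemma pb_X : pb XA.
Proof. unfold XA, Xa; simpl. auto 10 with pb. Qed.
Lemma pb_gpsi : pb gpsi.
Proof. apply (pb_c 0 D); [apply snice_D|]. apply pb_sub; auto with pb. Qed.
Lemma pb_gY : pb gY.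
Proof. pose proof pb_X. unfold gY. auto 20 with pb. Qed.
Lemma psi_dA j l s : In1 s -> is_derive (psiA j l) s (gpsi j l s / D s).
Proof.
  intros Hs. destruct sys as [H _]. pose proof (D_pos s Hs). derive. unfold gpsi. field. lra.
Qed.
Lemma Y_dA j l s : In1 s -> is_derive (YA j l) s (gY j l s / D s).
Proof.
  intros Hs. destruct sys as [_ [H _]]. pose proof (D_pos s Hs). derive. fold z. fold XA. unfold gY. field. lra.
Qed.
Lemma E_gpsi t s th : trig t -> In1 s -> E eps t gpsi s th = D s * (E eps t NA s th - E eps t YA s th).
Proof. intros Ht Hs. unfold gpsi. rewrite (E_coef eps t D (fun j l s => NA j l s - YA j l s)), E_sub by auto with pb. auto. Qed.
Lemma E_gY t s th : trig t -> In1 s -> E eps t gY s th =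
  (-2 * (D s * h s)) * E eps t YA s th + (-1 * D s) * E eps t (dth (dth psiA)) s th + (4 * D s) * E eps t psiA s th
   + (D s * h s) * E eps t NA s th + D s * (E eps t (dth mA) s th + Lam * (-2 * sc s * E eps t YA s th + 2 * bb s * E eps t psiA s th + sc s * E eps t NA s th)).
Proof.
  intros Ht Hs. pose proof pb_X.
 
  unfold gY. rewrite !(E_add eps K) by auto 10 with pb.
  rewrite (E_coef eps t (fun s => -2 * (D s * h s))), (E_coef eps t (fun s => -1 * D s)), (E_coef eps t (fun s => 4 * D s)), (E_coef eps t (fun s => D s * h s)),
    (E_coef eps t D (fun j l s => dth mA j l s + mul lamA XA j l s)).
  rewrite (E_add eps K), E_lam_mul by auto with pb. do 4 f_equal. unfold XA, Xa; simpl. rewrite !(E_add eps K) by auto 10 with pb.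
  now rewrite (E_coef eps t (fun s => -2 * sc s)), (E_coef eps t (fun s => 2 * bb s)), (E_coef eps t sc).
Qed.
(** Bootstrap: [D] times the radial derivatives of [psi] and [Y] are expressed by quantities whose
    regularity is already known, and by angular derivatives, which are all available. It runs up to
    the regularity [Kc] of the coefficients. *)
Lemma all_smooth j : (j <= Kc)%nat -> smooth eps j psiA /\ smooth eps j YA.
Proof.
  induction j as [|j IH]; intros Hj; [split; apply (smooth_O eps K); auto with pb|].
  destruct IH as [Hp HY]; [lia|]. destruct (smooth_step j) as [HN HM]; auto; [lia|].
  assert (cl : forall c, snice Kc c -> forall q, nice j q (fun s _ => c s)) by (intros c Hc q; apply (nice_le j Kc q q); auto; lia).
  assert (nD : forall q, nice j q (fun s _ => D s)) by (intros q; apply snice_D). assert (ndh := cl _ dh_sn).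
  assert (nsc := cl _ sc_sn). assert (nbb := cl _ bb_sn).
  assert (Hpt := smooth_dth eps K e0 K1 eK j _ pb_psi Hp).
  assert (Hptt := smooth_dth eps K e0 K1 eK j _ (pbd_dth K _ pb_psi) Hpt).
  assert (Hmt := smooth_dth eps K e0 K1 eK j _ pb_m HM). split.
  - apply (smooth_S eps K e0 K1 eK j psiA gpsi); auto using pb_psi, pb_gpsi, psi_dA. intros t q Ht.
    apply (nice_ext _ _ (fun s th => D s * (E eps t NA s th - E eps t YA s th))); [intros; now rewrite E_gpsi|].
    apply nice_mul; auto. apply nice_sub; auto.
  - apply (smooth_S eps K e0 K1 eK j YA gY); auto using pb_Y, pb_gY, Y_dA. intros t q Ht.
    eapply nice_ext; [intros; symmetry; apply E_gY; auto|]. nice_tac.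
Qed.

Lemma build : inhabited (solution Kc Nc P).
Proof.
  destruct (all_smooth Kc (le_n _)) as [Hp HY]. destruct (smooth_step Kc (le_n _) Hp HY) as [HN HM].
  assert (Hpt := smooth_dth eps K e0 K1 eK Kc _ pb_psi Hp). assert (pd : pb (dth psiA)) by auto with pb.
  constructor. refine (Build_solution Kc Nc P Lam psi0 Y0 N0 M0f psit0 (fun s th => - Ec (dth (dth psiA)) s th)
    (fun s th => - Es (dth YA) s th) (fun s th => - Es (dth NA) s th) (fun s th => - Ec (dth mA) s th) _ _ _ _ _ _ _ _ _ _ _ _ _ _ _ _ _ _ _ _).
  - intros s th Hs. pose proof (D_pos s Hs). eapply derive_eq; [apply (E_dS eps K e0 K1 eK cos psiA gpsi); auto using psi_dA, pb_gpsi with pb|].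
    cbv beta. rewrite E_gpsi by auto with pb. unfold Y0, N0. field. lra.
  - intros s th Hs. pose proof (D_pos s Hs). eapply derive_eq;
     [apply derive_opp, (E_dS eps K e0 K1 eK sin (dth psiA) (dth gpsi)); auto using pb_gpsi with pb|].
    + intros j l x Hx. unfold dth. eapply derive_eq; [apply derive_scal, psi_dA, Hx|]. unfold Rdiv; ring.
    + cbv beta. rewrite (E_ext eps sin (dth gpsi) (fun j l s => D s * (dth NA j l s - dth YA j l s))) by (intros; unfold dth, gpsi; ring).
      rewrite (E_coef eps sin D (fun j l s => dth NA j l s - dth YA j l s)), E_sub by auto with pb. field. lra.
  - intros s th Hs. eapply derive_eq; [apply (E_dT_cos eps K e0 K1 eK); auto with pb|]. unfold psit0. ring.
  - intros s th Hs. eapply derive_eq; [apply derive_opp, (E_dT_sin eps K e0 K1 eK); auto with pb|]. cbv beta. ring.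
  - intros s th Hs. eapply derive_eq; [apply (E_dT_cos eps K e0 K1 eK); auto with pb|]. cbv beta. ring.
  - intros s th Hs. eapply derive_eq; [apply (E_dT_cos eps K e0 K1 eK); auto with pb|]. cbv beta. ring.
  - intros s th Hs. eapply derive_eq; [apply derive_opp, (E_dT_sin eps K e0 K1 eK); auto with pb|]. cbv beta. ring.
  - intros s th Hs. pose proof (D_pos s Hs). eapply derive_eq; [apply (E_dS eps K e0 K1 eK cos YA gY); auto using Y_dA, pb_gY with pb|].
    cbv beta. rewrite E_gY by auto with pb. unfold Y0, N0, psi0, h, sc, bb. field. lra.
  - intros q. apply Hp, trig_cos.
  - intros q. apply nice_opp. apply Hpt, trig_sin.
  - intros q. apply HY, trig_cos.
  - intros q. apply HN, trig_cos.
  - intros q. apply nice_opp. apply HM, trig_sin.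
  - intros s th Hs. apply (bounds s th Hs).
  - intros s th Hs. apply (bounds s th Hs).
  - intros s th Hs. apply (bounds s th Hs).
  - intros s th Hs. apply (N0_eq s th Hs).
  - intros s th Hs. apply (M0_eq s th Hs).
  - intros s. assert (Z : forall th, (forall j l, sin (2 * (INR j - INR l) * th) = 0) -> psit0 s th = 0).
    { intros th H. unfold psit0, E. rewrite (Series_ext _ (fun n => 0 * (1/4) ^ n)); [rewrite Series_scal_l; ring|].
      intros n. rewrite !Rmult_0_l. apply Rmult_eq_0_compat_r. unfold coef. rewrite <- (Rmult_0_l (INR (S n))), <- sum_cte.
      apply sum_eq. intros j Hj. rewrite H. ring. }
    split; apply Z; intros j l.
    + rewrite Rmult_0_r. apply sin_0.
    + replace (2 * (INR j - INR l) * (PI / 2)) with (INR j * PI - INR l * PI) by field.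
      assert (sn : forall n, sin (INR n * PI) = 0).
      { intros n. apply sin_eq_0_1. exists (Z.of_nat n). now rewrite <- INR_IZR_INZ. }
      rewrite sin_minus, !sn. ring.
  (* The first-order term is [2 eps cos (2 th)] and the remainder [8 K^3 eps^2] is at most
     [(8/100) eps], so the values at 0 and [PI / 2] differ by about [4 eps]. *)
  - assert (Hs : In1 (-(9/20))) by (unfold In1; lra).
    assert (C : forall th, coef cos psiA 1 (-(9/20)) th = 2 * cos (2 * th)).
    { intros th. unfold coef. simpl. destruct (psi_first (-(9/20))) as [_ [-> ->]].
      replace (2 * (0 - 1) * th) with (- (2 * th)) by ring. rewrite cos_neg. replace (2 * (1 - 0) * th) with (2 * th) by ring. ring. }
    assert (B : forall th, Rabs (psi0 (-(9/20)) th - 2 * cos (2 * th) * eps) <= 8/100 * eps).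
    { intros th. destruct (E_small eps K e0 K1 eK cos psiA (-(9/20)) th trig_cos) as [_ X].
      - intros. now apply sys_bd.
      - apply psi_first.
      - rewrite C in X. eapply Rle_trans; [exact X|]. assert (Y := proj1 eK3). nra. }
    assert (B1 := B 0). assert (B2 := B (PI / 2)). replace (2 * (PI / 2)) with PI in B2 by field. rewrite Rmult_0_r, cos_0 in B1. rewrite cos_PI in B2.
    apply Rabs_le_between in B1. apply Rabs_le_between in B2. lra.
Qed.
End Build.

Theorem solution_exists K N : (1 <= K)%nat -> (1 <= N)%nat -> exists P : profile K N, inhabited (solution K N P).
Proof.
  intros HK HN. destruct (profile_exists K N HK HN) as [P]. exists P.
  pose proof (ah_snice K N P) as nah. pose proof (nu_snice K N P) as nnu.
  destruct K as [|K']; [lia|]. set (K := S K') in *.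
  assert (ok : forall c, snice K c -> exists C, 0 <= C /\ forall M, C <= M -> coef_ok M c).
  { intros c Hc. destruct (snice_bound _ _ Hc) as [C [C0 HC]]. exists C. split; auto. intros M HM. split.
    - intros s Hs. apply (snice_continuous c K'); auto.
    - intros s Hs. specialize (HC s Hs). lra. }
  destruct (ok _ (p_al_snice _ _ P)) as [B1 [b1 k1]]. destruct (ok _ (p_ald_snice _ _ P)) as [B2 [b2 k2]].
  destruct (ok _ (p_mu_snice _ _ P)) as [B3 [b3 k3]]. destruct (ok _ nnu) as [B4 [b4 k4]]. destruct (ok _ nah) as [B5 [b5 k5]].
  destruct (ok _ (p_sc_snice _ _ P)) as [B6 [b6 k6]]. destruct (ok _ (p_bb_snice _ _ P)) as [B7 [b7 k7]].
  destruct (p_hbound _ _ P) as [Ch [Ch0 HCh]]. destruct (p_solver _ _ P) as [Cs [Cs0 HCs]].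
  set (M0 := 1 + B1 + B2 + B3 + B4 + B5 + B6 + B7 + Ch). assert (HM : 1 <= M0) by (unfold M0; lra).
  specialize (k1 M0 ltac:(unfold M0; lra)). specialize (k2 M0 ltac:(unfold M0; lra)). specialize (k3 M0 ltac:(unfold M0; lra)).
  specialize (k4 M0 ltac:(unfold M0; lra)). specialize (k5 M0 ltac:(unfold M0; lra)). specialize (k6 M0 ltac:(unfold M0; lra)).
  specialize (k7 M0 ltac:(unfold M0; lra)). assert (HChM : Ch <= M0) by (unfold M0; lra). clearbody M0.
  destruct (formal_solution _ _ _ _ _ _ _ (p_h _ _ P) M0 Cs HM Cs0 k1 k2 k3 k4 k5 k6 k7)
    as [Kb [psiA [YA [NA [mA [lamA [HK1 [sys [ss [sbd [_ [lc [ld [pf zf]]]]]]]]]]]]]].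
  - intros s Hs. apply (continuous_of_D_mul _ s Hs), (snice_continuous _ K' s (p_dh_snice _ _ P) Hs).
  - intros s Hs. eapply Rle_trans; [apply HCh, Hs|]. apply Rmult_le_compat_r; auto. left. apply Rinv_0_lt_compat, (D_pos s Hs).
  - exact HCs.
  - assert (H2 : 1 <= M0 ^ 2) by nra. assert (H3 : 1 <= Kb ^ 3) by (apply pow_R1_Rle; auto).
    assert (H4 : 0 < 100 * M0 ^ 2 * Kb ^ 3) by (apply Rmult_lt_0_compat; lra).
    apply (build K N P (/ (100 * M0 ^ 2 * Kb ^ 3)) Kb M0 psiA YA NA mA lamA); auto.
    + now apply Rinv_0_lt_compat.
    + rewrite Rinv_l; lra.
    + intros s Hs. split; [apply k1|split; [apply k2|split; [apply k3|apply k5]]]; auto.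
Qed.

(** * Differentiation in two variables and implicit differentiation *)

Definition jc (f : fn) : Prop := forall s th, In1 s -> continuous (fun q : R * R => f (fst q) (snd q)) (s, th).

Lemma jc_mul f g : jc f -> jc g -> jc (fun s th => f s th * g s th).
Proof. intros Hf Hg s th Hs. apply (continuous_mult (K := R_AbsRing) (fun q : R * R => f (fst q) (snd q)) (fun q => g (fst q) (snd q))); auto. Qed.
Lemma jc_s (c : R -> R) : (forall s, In1 s -> continuous c s) -> jc (fun s _ => c s).
Proof. intros H s th Hs. apply (continuous_comp (fun q : R * R => fst q) c); [apply continuous_fst|apply H, Hs]. Qed.
Lemma locally_In1 (s th : R) : In1 s -> locally (th, s) (fun u : R * R => In1 (snd u)).
Proof.
  intros Hs. destruct (locally_itv _ _ s Hs) as [d Hd]. exists d. intros [a b] [_ Hb]. apply Hd, Hb.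
Qed.

(** Continuity in [s] at fixed [th], together with a Lipschitz bound in [th] uniform in [s]. *)
Lemma jc_nice f : nice 1 1 f -> jc f.
Proof.
  intros H s th Hs. destruct (nice_s _ _ _ H) as [fs [Fs _]]. destruct (nice_t _ _ _ H) as [ft [Ft Nt]].
  destruct (nice_bdd _ _ _ Nt) as [[C [C0 HC]] _].
  assert (L : forall x a b, In1 x -> Rabs (f x b - f x a) <= C * Rabs (b - a)).
  { intros x a b Hx. apply (lip_of_derive (f x) (ft x) (Rmin a b - 1) (Rmax a b + 1) C); auto.
    - pose proof (Rmin_l a b). pose proof (Rmax_l a b). lra.
    - pose proof (Rmin_r a b). pose proof (Rmax_r a b). lra. }
  assert (Cs := cont_of_derive _ _ _ (Fs s th Hs)).
  intros Q [eps HQ]. destruct (Cs (ball (f s th) (pos_div_2 eps))) as [d1 Hd1]; [now exists (pos_div_2 eps)|].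
  destruct (locally_itv _ _ s Hs) as [d2 Hd2].
  assert (He : 0 < eps / 2 / (C + 1)) by (apply Rdiv_lt_0_compat; [apply (cond_pos (pos_div_2 eps))|lra]).
  assert (Hd : 0 < Rmin (Rmin d1 d2) (eps / 2 / (C + 1))) by (apply Rmin_glb_lt; auto; apply Rmin_glb_lt; apply cond_pos).
  exists (mkposreal _ Hd). intros [x y] [Hx Hy]. simpl in Hx, Hy. apply HQ. simpl.
  assert (m1 : Rmin (Rmin d1 d2) (eps / 2 / (C + 1)) <= d1) by (eapply Rle_trans; apply Rmin_l).
  assert (m2 : Rmin (Rmin d1 d2) (eps / 2 / (C + 1)) <= d2) by (eapply Rle_trans; [apply Rmin_l|apply Rmin_r]).
  assert (m3 : Rmin (Rmin d1 d2) (eps / 2 / (C + 1)) <= eps / 2 / (C + 1)) by apply Rmin_r.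
  assert (X1 : ball (f s th) (pos_div_2 eps) (f x th)) by (apply Hd1; eapply ball_le; [exact m1|exact Hx]).
  assert (Ix : In1 x) by (apply Hd2; eapply ball_le; [exact m2|exact Hx]).
  specialize (L x th y Ix). change (Rabs (f x y - f s th) < eps). change (Rabs (f x th - f s th) < eps / 2) in X1.
  change (Rabs (y - th) < Rmin (Rmin d1 d2) (eps / 2 / (C + 1))) in Hy.
  assert (Z : C * Rabs (y - th) <= eps / 2).
  { assert (Rabs (y - th) <= eps / 2 / (C + 1)) by lra. pose proof (Rabs_pos (y - th)).
    apply Rle_trans with ((C + 1) * (eps / 2 / (C + 1))); [apply Rmult_le_compat; lra|]. right. field. lra. }
  replace (f x y - f s th) with ((f x y - f x th) + (f x th - f s th)) by ring.
  eapply Rle_lt_trans; [apply Rabs_triang|]. lra.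
Qed.

Lemma chain2 (G Gs Gt : fn) (sg vt : R -> R) (w a b : R) : dS G Gs -> dT G Gt -> jc Gt -> In1 (sg w) ->
  is_derive sg w a -> is_derive vt w b ->
  is_derive (fun x => G (sg x) (vt x)) w (Gs (sg w) (vt w) * a + Gt (sg w) (vt w) * b).
Proof.
  intros HS HT HC Hs Ha Hb. assert (F : filterdiff (fun u : R * R => G (snd u) (fst u)) (locally (vt w, sg w))
    (fun u => plus (scal (fst u) (Gt (sg w) (vt w))) (scal (snd u) (Gs (sg w) (vt w))))).
  { apply (is_derive_filterdiff (fun th s => G s th) (vt w) (sg w) (fun th s => Gt s th) (Gs (sg w) (vt w))).
    - eapply filter_imp; [|apply (locally_In1 (sg w) (vt w) Hs)]. intros [th s] H. simpl in *. now apply HT.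
    - now apply HS.
    - specialize (HC (sg w) (vt w) Hs).
      apply (continuous_comp (fun u : R * R => (snd u, fst u)) (fun q : R * R => Gt (fst q) (snd q))); [|exact HC].
      apply (continuous_comp_2 (fun u : R * R => snd u) (fun u : R * R => fst u) (fun a b => (a, b)));
        [apply continuous_snd|apply continuous_fst|]. apply (continuous_ext (fun q : R * R => q)); [intros [? ?]; auto|apply continuous_id]. }
  assert (Z := filterdiff_comp'_2 vt sg (fun th s => G s th) w (fun y => scal y b) (fun y => scal y a)
    (fun u v => plus (scal u (Gt (sg w) (vt w))) (scal v (Gs (sg w) (vt w)))) Hb Ha F).
  unfold is_derive. eapply filterdiff_ext_lin; [exact Z|]. intros y. simpl. unfold scal, plus; simpl. unfold mult; simpl. ring.
Qed.

Lemma derive_lip (f : R -> R) x l : is_derive f x l -> locally x (fun y => Rabs (f y - f x) <= (Rabs l + 1) * Rabs (y - x)).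
Proof.
  intros H. apply is_derive_Reals in H. destruct (H 1 Rlt_0_1) as [d Hd]. exists d. refine (fun (y : R) Hy => _).
  change (Rabs (y - x) < d) in Hy. destruct (Req_dec y x) as [->|Hne]; [unfold Rminus; rewrite !Rplus_opp_r, Rabs_R0; lra|].
  assert (Hn : y - x <> 0) by lra. specialize (Hd (y - x) Hn Hy). replace (x + (y - x)) with y in Hd by ring.
  assert (A : Rabs ((f y - f x) / (y - x)) <= Rabs l + 1).
  { replace ((f y - f x) / (y - x)) with (l + ((f y - f x) / (y - x) - l)) by ring. triang. lra. }
  replace (f y - f x) with ((f y - f x) / (y - x) * (y - x)) by (field; auto). rewrite Rabs_mult.
  apply Rmult_le_compat_r; auto. apply Rabs_pos.
Qed.
Lemma derive_quad (f : R -> R) x C : locally x (fun y => Rabs (f y - f x) <= C * Rabs (y - x) ^ 2) -> is_derive f x 0.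
Proof.
  intros [d Hd]. apply is_derive_Reals. intros eps He.
  assert (Hm : 0 < Rmin d (eps / (Rabs C + 1))) by (apply Rmin_glb_lt; [apply cond_pos|apply Rdiv_lt_0_compat; auto; pose proof (Rabs_pos C); lra]).
  exists (mkposreal _ Hm). intros h Hh0 Hh. simpl in Hh. assert (Rmin d (eps / (Rabs C + 1)) <= d) by apply Rmin_l.
  assert (Rmin d (eps / (Rabs C + 1)) <= eps / (Rabs C + 1)) by apply Rmin_r.
  assert (X : Rabs (f (x + h) - f x) <= C * Rabs (x + h - x) ^ 2) by (apply Hd; change (Rabs (x + h - x) < d); replace (x + h - x) with h by ring; lra).
  replace (x + h - x) with h in X by ring. rewrite Rminus_0_r. unfold Rdiv. rewrite Rabs_mult, Rabs_inv.
  pose proof (Rabs_pos_lt h Hh0) as P. pose proof (Rabs_pos C). pose proof (Rle_abs C).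
  apply Rle_lt_trans with (C * Rabs h ^ 2 * / Rabs h); [apply Rmult_le_compat_r; auto; left; now apply Rinv_0_lt_compat|].
  replace (C * Rabs h ^ 2 * / Rabs h) with (C * Rabs h) by (field; lra).
  apply Rle_lt_trans with (Rabs C * Rabs h); [apply Rmult_le_compat_r; lra|].
  assert (E : eps / (Rabs C + 1) * (Rabs C + 1) = eps) by (field; lra). nra.
Qed.
(** A pointwise implicit function theorem: [m] is a defect vanishing at [x], and [c] an inverse
    slope, close to [c0], to be supplied by the mean value theorem. *)
Lemma derive_implicit (f m : R -> R) x m' c0 : is_derive m x m' -> m x = 0 ->
  (forall e, 0 < e -> locally x (fun y => exists c, Rabs (c - c0) <= e /\ f y - f x = m y * c)) -> is_derive f x (m' * c0).
Proof.
  intros Hm H0 Hc. apply is_derive_Reals. intros eps He. destruct (derive_lip _ _ _ Hm) as [d1 Hd1].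
  set (e := eps / (2 * (Rabs m' + 2))). pose proof (Rabs_pos m'). pose proof (Rabs_pos c0).
  assert (He' : 0 < e) by (apply Rdiv_lt_0_compat; lra). destruct (Hc e He') as [d2 Hd2].
  assert (He2 : 0 < eps / (2 * (Rabs c0 + 1))) by (apply Rdiv_lt_0_compat; lra).
  apply is_derive_Reals in Hm. destruct (Hm _ He2) as [d3 Hd3].
  assert (Hd : 0 < Rmin (Rmin d1 d2) d3) by (apply Rmin_glb_lt; [apply Rmin_glb_lt|]; apply cond_pos).
  exists (mkposreal _ Hd). intros h Hh0 Hh. simpl in Hh.
  assert (Rmin (Rmin d1 d2) d3 <= d1) by (eapply Rle_trans; apply Rmin_l).
  assert (Rmin (Rmin d1 d2) d3 <= d2) by (eapply Rle_trans; [apply Rmin_l|apply Rmin_r]).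
  assert (Rmin (Rmin d1 d2) d3 <= d3) by apply Rmin_r. assert (Eh : x + h - x = h) by ring.
  assert (X1 : Rabs (m (x + h) - m x) <= (Rabs m' + 1) * Rabs (x + h - x)) by (apply Hd1; change (Rabs (x + h - x) < d1); rewrite Eh; lra).
  destruct (Hd2 (x + h)) as [c [X2 X3]]; [change (Rabs (x + h - x) < d2); rewrite Eh; lra|].
  assert (X4 := Hd3 h Hh0 ltac:(lra)). rewrite Eh, H0, Rminus_0_r in X1. rewrite H0, Rminus_0_r in X4.
  rewrite X3. pose proof (Rabs_pos_lt h Hh0) as P. assert (X5 : Rabs (m (x + h) / h) <= Rabs m' + 1).
  { unfold Rdiv. rewrite Rabs_mult, Rabs_inv. apply (div_le_intro _ (Rabs m' + 1) (Rabs h)); auto. }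
  replace (m (x + h) * c / h - m' * c0) with (m (x + h) / h * (c - c0) + c0 * (m (x + h) / h - m')) by (field; auto).
  eapply Rle_lt_trans; [apply Rabs_triang|]. rewrite !Rabs_mult.
  assert (Y1 : Rabs (m (x + h) / h) * Rabs (c - c0) <= (Rabs m' + 1) * e) by (apply Rmult_le_compat; auto using Rabs_pos).
  assert (Y2 : Rabs c0 * Rabs (m (x + h) / h - m') <= Rabs c0 * (eps / (2 * (Rabs c0 + 1)))) by (apply Rmult_le_compat_l; lra).
  assert (Y3 : Rabs c0 * (eps / (2 * (Rabs c0 + 1))) <= eps / 2).
  { apply Rle_trans with ((Rabs c0 + 1) * (eps / (2 * (Rabs c0 + 1)))); [apply Rmult_le_compat_r; lra|right; field; lra]. }
  assert (Y4 : (Rabs m' + 1) * e < eps / 2).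
  { apply Rlt_le_trans with ((Rabs m' + 2) * e); [apply Rmult_lt_compat_r; lra|right; unfold e; field; lra]. }
  lra.
Qed.

(** An integrand of size [D] gives a primitive reaching its limits at both ends quadratically, which
    permits a differentiable extension by constants. *)
Lemma antiderivative_flat (f : R -> R) C : (forall s, In1 s -> continuous f s) -> (forall s, In1 s -> Rabs (f s) <= C * D s) ->
  exists F c B, 0 <= B /\ (forall s, In1 s -> is_derive F s (f s)) /\
    (forall s, In1 s -> Rabs (F s) <= B * (s + 1/2) ^ 2 /\ Rabs (F s - c) <= B * (1/2 - s) ^ 2).
Proof.
  assert (A : forall f C, (forall s, In1 s -> continuous f s) -> (forall s, In1 s -> Rabs (f s) <= C * D s) ->
    exists F, (forall s, In1 s -> is_derive F s (f s)) /\ (forall s, In1 s -> Rabs (F s) <= Rabs C * (s + 1/2) ^ 2)).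
  { clear. intros f C Hf Hb. assert (Hb' : forall x, -(1/2) < x < 1/2 -> Rabs (f x) <= Rabs C).
    { intros x Hx. eapply Rle_trans; [now apply Hb|]. pose proof (D_pos x Hx). pose proof (D_le x). pose proof (Rle_abs C). pose proof (Rabs_pos C). nra. }
    destruct (antiderivative_left f (-(1/2)) (1/2) (Rabs C) ltac:(lra) Hf Hb') as [F [HF HB]]. exists F. split; auto. intros s Hs.
    apply (squeeze_left _ _ (Rabs C) s); [unfold In1 in Hs; lra|apply Rabs_pos|]. intros x Hx. unfold In1 in Hs.
    assert (E := cmp_of_derive F f (fun s => Rabs C * (s + 1/2) ^ 2) (fun s => Rabs C * (2 * (s + 1/2))) (-(1/2)) (1/2) HF).
    assert (E' : Rabs (F s - F x) <= Rabs C * (s + 1/2) ^ 2 - Rabs C * (x + 1/2) ^ 2).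
    { apply E; try lra.
      - intros y _. apply derive_scal. derive. simpl. ring.
      - intros y Hy. eapply Rle_trans; [now apply Hb|]. pose proof (Rle_abs C). pose proof (Rabs_pos C). pose proof (D_pos y Hy).
        apply Rle_trans with (Rabs C * D y); [apply Rmult_le_compat_r; lra|]. apply Rmult_le_compat_l; auto. unfold D; nra. }
    specialize (HB x ltac:(lra)). replace (F s) with ((F s - F x) + F x) by ring. triang.
    assert (0 <= Rabs C * (x + 1/2) ^ 2) by (apply Rmult_le_pos; [apply Rabs_pos|apply pow2_ge_0]).
    replace (x - - (1/2)) with (x + 1/2) in HB by ring. lra. }
  intros Hf Hb. destruct (A f C Hf Hb) as [F [F1 F2]]. destruct (A (fun s => f (- s)) C) as [G [G1 G2]].
  { intros s Hs. apply (continuous_comp (fun x => - x) f); [apply (cont_of_derive _ _ (-1)); eapply derive_eq; [apply derive_opp, derive_id|ring]|].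
    apply Hf. now apply In1_opp. }
  { intros s Hs. rewrite <- D_even. apply Hb. now apply In1_opp. }
  exists F, (F 0 + G 0), (Rabs C). split; [apply Rabs_pos|]. split; auto. intros s Hs. split; auto.
  assert (L := lip_of_derive (fun s => F s + G (- s)) (fun _ => 0) (-(1/2)) (1/2) 0).
  assert (Z : Rabs (F s + G (- s) - (F 0 + G (- 0))) <= 0 * Rabs (s - 0)).
  { apply L; unfold In1 in *; try lra; [|intros; rewrite Rabs_R0; lra]. intros x Hx.
    eapply derive_eq; [apply derive_plus; [apply F1; auto|apply (derive_comp G (fun x => - x)); [apply G1; lra|apply derive_opp, derive_id]]|].
    rewrite Ropp_involutive. ring. }
  rewrite Rmult_0_l, Ropp_0 in Z. assert (Z2 : F s + G (- s) - (F 0 + G 0) = 0).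
  { destruct (Req_dec (F s + G (- s) - (F 0 + G 0)) 0) as [e|e]; auto. apply Rabs_pos_lt in e. lra. }
  replace (F s - (F 0 + G 0)) with (- G (- s)) by lra. rewrite Rabs_Ropp.
  specialize (G2 (- s) (In1_opp s Hs)). replace (1/2 - s) with (- s + 1/2) by ring. auto.
Qed.

(** * Extension by constants, polar angle, and radial symmetry about an arbitrary centre *)

Definition per (G : fn) : Prop :=
  forall s th th', In1 s -> cos th = cos th' -> sin th = sin th' -> G s th = G s th'.
(** Quadratic contact with the constants at the two ends, so that the extension has zero derivative
    there. [s = -1/2] is the outer edge of the annulus, whence [cm] outside and [cp] in the hole. *)
Definition flat (cm cp : R) (G : fn) : Prop := exists C, 0 <= C /\ forall s th, In1 s ->
  Rabs (G s th - cm) <= C * (s + 1/2) ^ 2 /\ Rabs (G s th - cp) <= C * (1/2 - s) ^ 2.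
Definition ext (cm cp : R) (G : fn) : fn := fun s th =>
  if Rle_dec s (-(1/2)) then cm else if Rle_dec (1/2) s then cp else G s th.
Definition ang (x y : R) : R :=
  if Rle_dec 0 y then acos (x / sqrt (x ^ 2 + y ^ 2)) else - acos (x / sqrt (x ^ 2 + y ^ 2)).

Lemma ext_in cm cp G s th : In1 s -> ext cm cp G s th = G s th.
Proof. intros Hs. unfold ext, In1 in *. destruct (Rle_dec s (-(1/2))); [lra|]. destruct (Rle_dec (1/2) s); [lra|auto]. Qed.
Lemma ext_l cm cp G th : ext cm cp G (-(1/2)) th = cm.
Proof. unfold ext. destruct (Rle_dec (-(1/2)) (-(1/2))); [auto|lra]. Qed.
Lemma ext_r cm cp G th : ext cm cp G (1/2) th = cp.
Proof. unfold ext. destruct (Rle_dec (1/2) (-(1/2))); [lra|]. destruct (Rle_dec (1/2) (1/2)); [auto|lra]. Qed.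
Lemma flat_ext cm cp G : flat cm cp G -> exists C, 0 <= C /\ forall s th, -(1/2) <= s <= 1/2 ->
  Rabs (ext cm cp G s th - cm) <= C * (s + 1/2) ^ 2 /\ Rabs (ext cm cp G s th - cp) <= C * (1/2 - s) ^ 2.
Proof.
  intros [C [C0 HC]]. exists C. split; auto. intros s th Hs. assert (Z : Rabs (cp - cm) <= C * (1/2)).
  { destruct (HC 0 0) as [A B]; [unfold In1; lra|]. replace (cp - cm) with ((G 0 0 - cm) - (G 0 0 - cp)) by ring.
    triang. rewrite Rabs_Ropp. simpl in *. lra. }
  destruct (Req_dec s (-(1/2))) as [->|h1].
  - rewrite ext_l. replace (cm - cm) with 0 by ring. rewrite Rabs_R0, Rabs_minus_sym. simpl. lra.
  - destruct (Req_dec s (1/2)) as [->|h2].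
    + rewrite ext_r. replace (cp - cp) with 0 by ring. rewrite Rabs_R0. simpl. lra.
    + rewrite ext_in by (unfold In1; lra). apply HC. unfold In1; lra.
Qed.

Lemma ang_spec x y : x ^ 2 + y ^ 2 <> 0 ->
  x = sqrt (x ^ 2 + y ^ 2) * cos (ang x y) /\ y = sqrt (x ^ 2 + y ^ 2) * sin (ang x y).
Proof.
  intros H. assert (P : 0 < x ^ 2 + y ^ 2) by (pose proof (pow2_ge_0 x); pose proof (pow2_ge_0 y); lra).
  set (r := sqrt (x ^ 2 + y ^ 2)). assert (Hr : 0 < r) by now apply sqrt_lt_R0.
  assert (Hr2 : r * r = x ^ 2 + y ^ 2) by (apply sqrt_sqrt; lra).
  assert (B : -1 <= x / r <= 1) by (split; [apply le_div_intro|apply div_le_intro]; auto; nra).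
  assert (S : r * sin (acos (x / r)) = Rabs y).
  { rewrite sin_acos by auto. unfold Rsqr. replace (1 - x / r * (x / r)) with ((y / r) * (y / r)).
    - change (y / r * (y / r)) with (Rsqr (y / r)). rewrite sqrt_Rsqr_abs. unfold Rdiv. rewrite Rabs_mult, Rabs_inv, (Rabs_right r) by lra. field. lra.
    - apply (Rmult_eq_reg_r (r * r)); [|nra]. field_simplify; [|lra|lra]. lra. }
  unfold ang. fold r. destruct (Rle_dec 0 y) as [h|h].
  - rewrite cos_acos by auto. split; [field; lra|]. rewrite S, Rabs_right; lra.
  - rewrite cos_neg, sin_neg, cos_acos by auto. split; [field; lra|]. rewrite <- Ropp_mult_distr_r, S, Rabs_left; lra.
Qed.

Lemma cont2_of_bounded (f f1 f2 : R -> R -> R) C :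
  (forall x y, is_derive (fun t => f t y) x (f1 x y)) -> (forall x y, is_derive (fun t => f x t) y (f2 x y)) ->
  (forall x y, Rabs (f1 x y) <= C /\ Rabs (f2 x y) <= C) -> cont2 f.
Proof.
  intros H1 H2 HC x y. assert (C0 : 0 <= C) by (eapply Rle_trans; [apply Rabs_pos|apply (HC 0 0)]).
  assert (L : forall a b, Rabs (f a b - f x y) <= C * (Rabs (a - x) + Rabs (b - y))).
  { intros a b. assert (L1 : Rabs (f a b - f x b) <= C * Rabs (a - x)).
    { apply (lip_of_derive (fun t => f t b) (fun t => f1 t b) (Rmin a x - 1) (Rmax a x + 1) C); auto.
      - intros t _. apply HC.
      - pose proof (Rmin_r a x). pose proof (Rmax_r a x). lra.
      - pose proof (Rmin_l a x). pose proof (Rmax_l a x). lra. }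
    assert (L2 : Rabs (f x b - f x y) <= C * Rabs (b - y)).
    { apply (lip_of_derive (f x) (f2 x) (Rmin b y - 1) (Rmax b y + 1) C).
      - intros t _. apply H2.
      - intros t _. apply HC.
      - pose proof (Rmin_r b y). pose proof (Rmax_r b y). lra.
      - pose proof (Rmin_l b y). pose proof (Rmax_l b y). lra. }
    replace (f a b - f x y) with ((f a b - f x b) + (f x b - f x y)) by ring. triang. lra. }
  intros Q [eps HQ]. assert (Hd : 0 < eps / (2 * (C + 1))) by (apply Rdiv_lt_0_compat; [apply cond_pos|lra]).
  exists (mkposreal _ Hd). intros [a b] [Ha Hb]. apply HQ.
  change (Rabs (a - x) < eps / (2 * (C + 1))) in Ha. change (Rabs (b - y) < eps / (2 * (C + 1))) in Hb.
  change (Rabs (f a b - f x y) < eps). eapply Rle_lt_trans; [apply L|].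
  apply Rle_lt_trans with ((C + 1) * (Rabs (a - x) + Rabs (b - y))).
  - apply Rmult_le_compat_r; [|lra]. pose proof (Rabs_pos (a - x)). pose proof (Rabs_pos (b - y)). lra.
  - replace (pos eps) with ((C + 1) * (2 * (eps / (2 * (C + 1))))) by (field; lra). apply Rmult_lt_compat_l; lra.
Qed.

Lemma cont2_plus f g : cont2 f -> cont2 g -> cont2 (fun x y => f x y + g x y).
Proof. intros Hf Hg x y. apply (continuous_plus (fun q : R * R => f (fst q) (snd q)) (fun q => g (fst q) (snd q))); auto. Qed.
Lemma cont2_mult f g : cont2 f -> cont2 g -> cont2 (fun x y => f x y * g x y).
Proof. intros Hf Hg x y. apply (continuous_mult (K := R_AbsRing) (fun q : R * R => f (fst q) (snd q)) (fun q => g (fst q) (snd q))); auto. Qed.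
Lemma cont2_const c : cont2 (fun _ _ => c).
Proof. intros x y. apply continuous_const. Qed.

Lemma chain_plane (f fx fy : R -> R -> R) (X Z : R -> R) (w a b : R) :
  (forall x y, is_derive (fun t => f t y) x (fx x y)) -> (forall x y, is_derive (fun t => f x t) y (fy x y)) -> cont2 fx ->
  is_derive X w a -> is_derive Z w b ->
  is_derive (fun t => f (X t) (Z t)) w (fx (X w) (Z w) * a + fy (X w) (Z w) * b).
Proof.
  intros Hx Hy Hc Ha Hb. assert (F : filterdiff (fun u : R * R => f (fst u) (snd u)) (locally (X w, Z w))
    (fun u => plus (scal (fst u) (fx (X w) (Z w))) (scal (snd u) (fy (X w) (Z w))))).
  { apply (is_derive_filterdiff f (X w) (Z w) fx (fy (X w) (Z w))); auto.
    apply filter_forall. intros [p q]. apply Hx. }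
  assert (G := filterdiff_comp'_2 X Z f w (fun y => scal y a) (fun y => scal y b)
    (fun u v => plus (scal u (fx (X w) (Z w))) (scal v (fy (X w) (Z w)))) Ha Hb F).
  unfold is_derive. eapply filterdiff_ext_lin; [exact G|]. intros y. simpl. unfold scal, plus; simpl. unfold mult; simpl. ring.
Qed.

(** [f] is constant along the rotation of the point about the centre; its derivative at angle 0 says
    that the velocity is orthogonal to the radius. *)
Lemma radial_tangent (f v1 v2 : R -> R -> R) (isd : bool) A B r Rad x y :
  (forall x y, is_derive (fun t => f t y) x (- v2 x y)) -> (forall x y, is_derive (fun t => f x t) y (v1 x y)) -> cont2 v2 ->
  (forall x y x' y', region isd A B r Rad x y -> region isd A B r Rad x' y' ->
     dist2 A B x y = dist2 A B x' y' -> f x y = f x' y') ->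
  region isd A B r Rad x y -> (x - A) * v1 x y + (y - B) * v2 x y = 0.
Proof.
  intros Hx Hy Hc Hr Hreg.
  set (X := fun t => A + ((x - A) * cos t - (y - B) * sin t)). set (Z := fun t => B + ((x - A) * sin t + (y - B) * cos t)).
  assert (Ed : forall t, dist2 A B (X t) (Z t) = dist2 A B x y).
  { intros t. unfold dist2. f_equal. pose proof (sin2_cos2 t) as S. unfold Rsqr in S.
    transitivity (((x - A) ^ 2 + (y - B) ^ 2) * (sin t * sin t + cos t * cos t)); [unfold X, Z; ring|rewrite S; ring]. }
  assert (Ef : forall t, f x y = f (X t) (Z t)).
  { intros t. apply Hr; auto. unfold region in *. now rewrite Ed. }
  assert (DX : is_derive X 0 (- (y - B))).
  { eapply derive_eq; [apply derive_plus; [apply derive_cst|apply derive_minus; apply derive_scal; [apply is_derive_cos|apply is_derive_sin]]|].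
    rewrite sin_0, cos_0. ring. }
  assert (DZ : is_derive Z 0 (x - A)).
  { eapply derive_eq; [apply derive_plus; [apply derive_cst|apply derive_plus; apply derive_scal; [apply is_derive_sin|apply is_derive_cos]]|].
    rewrite sin_0, cos_0. ring. }
  assert (X0 : X 0 = x) by (unfold X; rewrite sin_0, cos_0; ring). assert (Z0 : Z 0 = y) by (unfold Z; rewrite sin_0, cos_0; ring).
  assert (Hc' : cont2 (fun x y => - v2 x y)).
  { intros p q. apply (continuous_opp (fun q : R * R => v2 (fst q) (snd q))), Hc. }
  assert (Q1 := chain_plane f _ _ X Z 0 _ _ Hx Hy Hc' DX DZ).
  assert (Q2 := is_derive_ext _ _ 0 0 Ef (derive_cst (f x y) 0)).
  assert (E := eq_trans (eq_sym (is_derive_unique _ _ _ Q1)) (is_derive_unique _ _ _ Q2)). cbv beta in E. rewrite X0, Z0 in E. lra.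
Qed.

(** Seen as a real function, [i] has derivative 0 everywhere. *)
Lemma locally_constant (i : R -> nat) : (forall t, locally t (fun u => i u = i t)) -> forall t, i t = i 0.
Proof.
  intros H. assert (Dv : forall t, is_derive (fun t => INR (i t)) t 0).
  { intros t. apply (is_derive_ext_loc (fun _ => INR (i t))); [|apply derive_cst].
    eapply filter_imp; [|apply H]. intros u ->. auto. }
  intros t. apply INR_eq.
  assert (L := lip_of_derive (fun t => INR (i t)) (fun _ => 0) (- Rabs t - 1) (Rabs t + 1) 0).
  assert (Z : Rabs (INR (i t) - INR (i 0)) <= 0 * Rabs (t - 0)).
  { pose proof (Rabs_pos t). pose proof (Rle_abs t). pose proof (Rle_abs (- t)). rewrite Rabs_Ropp in *.
    apply L; auto; try lra. intros; rewrite Rabs_R0; lra. }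
  rewrite Rmult_0_l in Z. destruct (Req_dec (INR (i t) - INR (i 0)) 0); [lra|]. apply Rabs_pos_lt in H0. lra.
Qed.

(** * The label as a function on the plane *)

Section Flow.
Variables (K N : nat) (P : profile K N) (Sl : solution K N P).
Let al := p_al _ _ P. Let ald := p_ald _ _ P.
Let x := psi _ _ _ Sl. Let xt := psit _ _ _ Sl. Let y := Y _ _ _ Sl. Let n := Nn _ _ _ Sl.

Definition Q : fn := fun s th => 1 + 2 * al s * x s th.
Definition W : fn := fun s th => ald s * x s th + al s * (- y s th + n s th).
Definition T : fn := fun s th => - s + / 2 * ln (Q s th).
Definition Ts : fn := fun s th => -1 + W s th * / Q s th.
Definition Tt : fn := fun s th => al s * xt s th * / Q s th.
(** The inverse of the distance to the origin, which is [exp T] on the curve. *)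
Definition Ex : fn := fun s th => exp (- T s th).

Lemma Q_ge s th : In1 s -> 1/2 <= Q s th.
Proof. apply (Q_small _ _ _ Sl). Qed.
Lemma Q_s : dS Q (fun s th => 2 * W s th).
Proof.
  intros s th Hs. unfold Q. eapply derive_eq; [apply derive_plus; [apply derive_cst|apply derive_mult;
    [apply derive_scal, (p_al_der _ _ P s Hs)|apply (psi_s _ _ _ Sl s th Hs)]]|].
  unfold W, al, ald, x, y, n. ring.
Qed.
Lemma Q_t : dT Q (fun s th => 2 * al s * xt s th).
Proof.
  intros s th Hs. unfold Q. eapply derive_eq; [apply derive_plus; [apply derive_cst|apply derive_scal, (psi_t _ _ _ Sl s th Hs)]|].
  unfold xt. ring.
Qed.
#[local] Hint Resolve Q_s Q_t : deriv.
Lemma ln_der z : 0 < z -> is_derive ln z (/ z).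
Proof. intros H. apply is_derive_Reals. now apply derivable_pt_lim_ln. Qed.
Lemma T_s : dS T Ts.
Proof.
  intros s th Hs. pose proof (Q_ge s th Hs). unfold T. eapply derive_eq; [apply derive_plus; [apply derive_opp, derive_id|
    apply derive_scal, (derive_comp ln (fun s => Q s th)); [apply ln_der; lra|now apply Q_s]]|]. unfold Ts. field. lra.
Qed.
Lemma T_t : dT T Tt.
Proof.
  intros s th Hs. pose proof (Q_ge s th Hs). unfold T. eapply derive_eq; [apply derive_plus; [apply derive_cst|
    apply derive_scal, (derive_comp ln (Q s)); [apply ln_der; lra|now apply Q_t]]|]. unfold Tt. field. lra.
Qed.
#[local] Hint Resolve T_s T_t : deriv.
Lemma Ts_range s th : In1 s -> -(3/2) <= Ts s th <= -(1/2).
Proof.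
  intros Hs. pose proof (Q_ge s th Hs) as HQ. pose proof (T_small _ _ _ Sl s th Hs) as HW. fold al ald x y n in HW.
  fold (W s th) in HW. assert (A : Rabs (W s th * / Q s th) <= 1/2).
  { rewrite Rabs_mult, Rabs_inv, (Rabs_right (Q s th)) by lra. apply (div_le_intro _ (1/2) (Q s th)); lra. }
  apply Rabs_le_between in A. unfold Ts. lra.
Qed.
Lemma x_nice q : nice K q x. Proof. apply psi_nice. Qed.
Lemma xt_nice q : nice K q xt. Proof. apply psit_nice. Qed.
Lemma y_nice q : nice K q y. Proof. apply Y_nice. Qed.
Lemma n_nice q : nice K q n. Proof. apply N_nice. Qed.
Hint Resolve x_nice xt_nice y_nice n_nice : nd.
Lemma al_nice q : nice K q (fun s _ => al s). Proof. apply p_al_snice. Qed.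
Lemma ald_nice q : nice K q (fun s _ => ald s). Proof. apply p_ald_snice. Qed.
Hint Resolve al_nice ald_nice nice_const nice_add nice_opp nice_mul : nd.
Lemma Q_nice q : nice K q Q.
Proof. unfold Q. auto 6 with nd. Qed.
Lemma Qinv_nice q : nice K q (fun s th => / Q s th).
Proof.
  apply (nice_inv _ _ Q (1/2)); [lra| |apply Q_nice]. intros s th Hs. pose proof (Q_ge s th Hs). rewrite Rabs_right; lra.
Qed.
Hint Resolve Q_nice Qinv_nice : nd.
Lemma Ts_nice q : nice K q Ts.
Proof. unfold Ts, W. auto 10 with nd. Qed.
Lemma Tt_nice q : nice K q Tt.
Proof. unfold Tt. auto 10 with nd. Qed.
Lemma Tsinv_nice q : nice K q (fun s th => / Ts s th).
Proof.
  apply (nice_inv _ _ Ts (1/2)); [lra| |apply Ts_nice]. intros s th Hs. pose proof (Ts_range s th Hs). rewrite Rabs_left; lra.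
Qed.
Lemma T_per : per T.
Proof. intros s th th' Hs H1 H2. unfold T. f_equal. f_equal. f_equal. now apply (proj2 (nice_bdd _ _ _ (Q_nice 0))). Qed.
Lemma T_bdd : exists B, 0 <= B /\ forall s th, In1 s -> Rabs (T s th) <= B.
Proof.
  destruct (nice_bdd _ _ _ (Q_nice 0)) as [[C [C0 HC]] _]. exists (2 + C). split; [lra|]. intros s th Hs.
  pose proof (Q_ge s th Hs) as HQ. specialize (HC s th Hs). rewrite Rabs_right in HC by lra.
  pose proof (exp_ineq1_le (ln (Q s th))) as E1. rewrite exp_ln in E1 by lra.
  pose proof (exp_ineq1_le (- ln (Q s th))) as E2. rewrite exp_Ropp, exp_ln in E2 by lra.
  assert (/ Q s th <= 2) by (replace 2 with (/ (1/2)) by field; apply Rinv_le_contravar; lra).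
  unfold T, In1 in *. apply Rabs_le. lra.
Qed.
Lemma Ex_nice q : nice K q Ex.
Proof.
  destruct T_bdd as [B [B0 HB]].
  apply (nice_ode K q Ex (fun s th => - (D s * Ts s th)) (fun s th => - Tt s th)).
  - split.
    + exists (exp B). split; [left; apply exp_pos|]. intros s th Hs. specialize (HB s th Hs). apply Rabs_le_between in HB.
      unfold Ex. rewrite Rabs_right by (left; apply exp_pos). destruct (Req_dec (- T s th) B) as [->|h]; [lra|]. left. apply exp_increasing. lra.
    + intros s th th' Hs H1 H2. unfold Ex. now rewrite (T_per s th th').
  - intros s th Hs. pose proof (D_pos s Hs). unfold Ex. derive. field. lra.
  - intros s th Hs. unfold Ex. derive. ring.
  - apply nice_opp, nice_mul; [apply snice_D|apply Ts_nice].
  - apply nice_opp, Tt_nice.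
Qed.

Lemma T_decr a b th : In1 a -> In1 b -> a <= b -> (b - a) / 2 <= T a th - T b th <= 3/2 * (b - a).
Proof.
  intros Ha Hb Hab. destruct (Req_dec a b) as [->|Hne]; [lra|].
  destruct (mvt (fun s => T s th) (fun s => Ts s th) a b) as [c [H1 H2]]; [lra| |].
  - intros s Hs. apply T_s. unfold In1 in *; lra.
  - pose proof (Ts_range c th) as R. assert (In1 c) by (unfold In1 in *; lra). specialize (R H). nra.
Qed.
Lemma T_lip : exists L, 0 <= L /\ forall s a b, In1 s -> Rabs (T s b - T s a) <= L * Rabs (b - a).
Proof.
  destruct (nice_bdd _ _ _ (Tt_nice 0)) as [[C [C0 HC]] _]. exists C. split; auto. intros s a b Hs.
  apply (lip_of_derive (T s) (Tt s) (Rmin a b - 1) (Rmax a b + 1) C).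
  - intros t _. now apply T_t.
  - intros t _. now apply HC.
  - pose proof (Rmin_l a b). pose proof (Rmax_l a b). lra.
  - pose proof (Rmin_r a b). pose proof (Rmax_r a b). lra.
Qed.

(* The radial label of the streamline through the point of log-polar coordinates [(t, th)];
   it is clamped to an endpoint outside the annulus. *)
Definition sspec (t th m : R) : Prop := -(1/2) <= m <= 1/2 /\
  forall s, In1 s -> (s < m -> t < T s th) /\ (m < s -> T s th <= t).
(** The supremum of the labels [s] with [t < T s th], to which -1/2 is added so that the set is
    never empty. *)
Lemma sspec_ex t th : exists m, sspec t th m.
Proof.
  destruct (completeness (fun s => s = -(1/2) \/ (In1 s /\ t < T s th))) as [m [M1 M2]].
  - exists (1/2). intros s [->|[Hs _]]; [lra|unfold In1 in Hs; lra].
  - exists (-(1/2)). now left.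
  - assert (A : -(1/2) <= m) by (apply M1; now left).
    assert (B : m <= 1/2) by (apply M2; intros s [->|[Hs _]]; [lra|unfold In1 in Hs; lra]).
    exists m. split; [lra|]. intros s Hs. split; intros H.
    + destruct (classic (exists s', s < s' /\ (s' = -(1/2) \/ In1 s' /\ t < T s' th))) as [[s' [H1 [->|[H2 H3]]]]|H'].
      * unfold In1 in Hs. lra.
      * pose proof (T_decr s s' th Hs H2). lra.
      * exfalso. assert (m <= s); [|lra]. apply M2. intros s' Hs'. destruct (Rle_dec s' s); auto. exfalso. apply H'. exists s'. split; [lra|auto].
    + destruct (Rle_dec (T s th) t) as [h|h]; auto. exfalso. assert (s <= m); [|lra]. apply M1. right. split; auto. lra.
Qed.
Definition Sm (t th : R) : R := proj1_sig (constructive_indefinite_description _ (sspec_ex t th)).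
Lemma Sm_spec t th : sspec t th (Sm t th).
Proof. unfold Sm. now destruct (constructive_indefinite_description _ (sspec_ex t th)). Qed.
(** [T] decreases in [s] at a rate of at least 1/2 and is Lipschitz in [th]. Clamped labels may be
    ends of the interval, so the comparison is made between labels moved inwards by [e]. *)
Lemma Sm_lip : exists L, 0 <= L /\ forall t th t' th', Rabs (Sm t th - Sm t' th') <= L * (Rabs (t - t') + Rabs (th - th')).
Proof.
  destruct T_lip as [L [L0 HL]].
  assert (A : forall t th t' th', Sm t th <= Sm t' th' -> Sm t' th' - Sm t th <= (2 + 2 * L) * (Rabs (t - t') + Rabs (th - th'))).
  { intros t th t' th' H. destruct (Sm_spec t th) as [A1 A2]. destruct (Sm_spec t' th') as [B1 B2].
    set (a := Sm t th) in *. set (b := Sm t' th') in *.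
    set (R0 := (2 + 2 * L) * (Rabs (t - t') + Rabs (th - th'))).
    destruct (Rle_dec (b - a) R0) as [h|h]; auto. exfalso.
    assert (R0pos : 0 <= R0) by (apply Rmult_le_pos; [lra|]; pose proof (Rabs_pos (t - t')); pose proof (Rabs_pos (th - th')); lra).
    set (e := (b - a - R0) / 3). assert (He : 0 < e) by (unfold e; lra).
    assert (I1 : In1 (a + e)) by (unfold In1, e; lra). assert (I2 : In1 (b - e)) by (unfold In1, e; lra).
    destruct (A2 _ I1) as [_ X1]. destruct (B2 _ I2) as [X2 _]. specialize (X1 ltac:(lra)). specialize (X2 ltac:(lra)).
    assert (X3 := T_decr (a + e) (b - e) th' I1 I2 ltac:(unfold e in *; lra)). assert (X4 := HL (a + e) th th' I1).
    apply Rabs_le_between in X4. rewrite Rabs_minus_sym in X4. pose proof (Rle_abs (t - t')). pose proof (Rabs_pos (th - th')). pose proof (Rabs_pos (t - t')).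
    assert (X5 : (b - e - (a + e)) / 2 < Rabs (t - t') + L * Rabs (th - th')) by lra.
    assert (X6 : (b - e - (a + e)) = R0 + e) by (unfold e; field).
    assert (X7 : 2 * (Rabs (t - t') + L * Rabs (th - th')) <= R0) by (unfold R0; nra). lra. }
  exists (2 + 2 * L). split; [lra|]. intros t th t' th'. destruct (Rle_dec (Sm t th) (Sm t' th')) as [h|h].
  - rewrite Rabs_left1 by lra. specialize (A t th t' th' h). lra.
  - rewrite Rabs_right by lra. specialize (A t' th' t th ltac:(lra)). rewrite (Rabs_minus_sym t' t), (Rabs_minus_sym th' th) in A. auto.
Qed.
Lemma sspec_unique t th th' m m' : cos th = cos th' -> sin th = sin th' -> sspec t th m -> sspec t th' m' -> m = m'.
Proof.
  intros H1 H2. assert (A : forall th th' m m', cos th = cos th' -> sin th = sin th' -> sspec t th m -> sspec t th' m' -> m <= m').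
  { intros a b u v E1 E2 [U1 U2] [V1 V2]. destruct (Rle_dec u v) as [h|h]; auto. exfalso.
    assert (Hi : In1 ((u + v) / 2)) by (unfold In1; lra). destruct (U2 _ Hi) as [X _]. destruct (V2 _ Hi) as [_ Z].
    specialize (X ltac:(lra)). specialize (Z ltac:(lra)). rewrite (T_per _ a b) in X by auto. lra. }
  intros S1 S2. apply Rle_antisym; [apply (A th th')|apply (A th' th)]; auto.
Qed.
Lemma Sm_T s th : In1 s -> Sm (T s th) th = s.
Proof.
  intros Hs. apply (sspec_unique (T s th) th th); auto using Sm_spec. split; [unfold In1 in Hs; lra|]. intros s' Hs'. split; intros H.
  - pose proof (T_decr s' s th Hs' Hs). lra.
  - pose proof (T_decr s s' th Hs Hs'). lra.
Qed.
Lemma T_Sm t th : In1 (Sm t th) -> T (Sm t th) th = t.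
Proof.
  intros Hi. destruct (Sm_spec t th) as [_ H]. set (m := Sm t th) in *. apply Rle_antisym.
  - destruct (Rle_dec (T m th) t) as [h|h]; auto. exfalso.
    set (e := Rmin ((1/2 - m) / 2) ((T m th - t) / 3)). assert (e <= (1/2 - m) / 2) by apply Rmin_l. assert (e <= (T m th - t) / 3) by apply Rmin_r.
    assert (0 < e) by (apply Rmin_glb_lt; unfold In1 in Hi; lra). assert (I2 : In1 (m + e)) by (unfold In1 in *; lra).
    destruct (H _ I2) as [_ X]. specialize (X ltac:(lra)). pose proof (T_decr m (m + e) th Hi I2). lra.
  - destruct (Rle_dec t (T m th)) as [h|h]; auto. exfalso.
    set (e := Rmin ((m + 1/2) / 2) ((t - T m th) / 3)). assert (e <= (m + 1/2) / 2) by apply Rmin_l. assert (e <= (t - T m th) / 3) by apply Rmin_r.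
    assert (0 < e) by (apply Rmin_glb_lt; unfold In1 in Hi; lra). assert (I2 : In1 (m - e)) by (unfold In1 in *; lra).
    destruct (H _ I2) as [X _]. specialize (X ltac:(lra)). pose proof (T_decr (m - e) m th I2 Hi). lra.
Qed.
Lemma Sm_end : exists B, 0 <= B /\ (forall t th, t < - B -> Sm t th = 1/2) /\ (forall t th, B < t -> Sm t th = -(1/2)).
Proof.
  destruct T_bdd as [B [B0 HB]]. exists B. split; auto. split; intros t th Ht; destruct (Sm_spec t th) as [A1 A2].
  - destruct (Req_dec (Sm t th) (1/2)) as [h|h]; auto. exfalso. assert (Hi : In1 ((Sm t th + 1/2) / 2)) by (unfold In1; lra).
    destruct (A2 _ Hi) as [_ X]. specialize (X ltac:(lra)). specialize (HB _ th Hi). apply Rabs_le_between in HB. lra.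
  - destruct (Req_dec (Sm t th) (-(1/2))) as [h|h]; auto. exfalso. assert (Hi : In1 ((Sm t th - 1/2) / 2)) by (unfold In1; lra).
    destruct (A2 _ Hi) as [X _]. specialize (X ltac:(lra)). specialize (HB _ th Hi). apply Rabs_le_between in HB. lra.
Qed.

(* A function of the label and the angle as a function of the point [(X, Z)] of the plane, extended by
   constants: [cp] in the hole of the annulus (including the origin) and [cm] outside. *)
Definition FF (cm cp : R) (G : fn) (X Z : R) : R :=
  if Req_EM_T (X ^ 2 + Z ^ 2) 0 then cp else ext cm cp G (Sm (/2 * ln (X ^ 2 + Z ^ 2)) (ang X Z)) (ang X Z).

(** Any angle with the right cosine and sine gives the same value, by periodicity of [T] and [G];
    this frees derivatives from the branch cut of [ang]. *)
Lemma FF_polar cm cp G X Z th : per G -> X ^ 2 + Z ^ 2 <> 0 ->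
  X = sqrt (X ^ 2 + Z ^ 2) * cos th -> Z = sqrt (X ^ 2 + Z ^ 2) * sin th ->
  FF cm cp G X Z = ext cm cp G (Sm (/2 * ln (X ^ 2 + Z ^ 2)) th) th.
Proof.
  intros HG H H1 H2. unfold FF. destruct (Req_EM_T (X ^ 2 + Z ^ 2) 0) as [e|_]; [easy|].
  destruct (ang_spec X Z H) as [A1 A2]. assert (Hp : 0 < X ^ 2 + Z ^ 2) by (pose proof (pow2_ge_0 X); pose proof (pow2_ge_0 Z); lra).
  apply sqrt_lt_R0 in Hp. set (r := sqrt (X ^ 2 + Z ^ 2)) in *.
  assert (Ec : cos (ang X Z) = cos th) by (apply (Rmult_eq_reg_l r); lra).
  assert (Es : sin (ang X Z) = sin th) by (apply (Rmult_eq_reg_l r); lra).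
  rewrite (sspec_unique _ _ _ _ _ Ec Es (Sm_spec _ _) (Sm_spec _ _)).
  unfold ext. destruct (Rle_dec _ _); auto. destruct (Rle_dec _ _); auto. apply HG; auto. unfold In1; lra.
Qed.
Lemma FF_at cm cp G s th : per G -> In1 s -> FF cm cp G (exp (T s th) * cos th) (exp (T s th) * sin th) = G s th.
Proof.
  intros HG Hs. pose proof (exp_pos (T s th)) as Pe.
  assert (E : (exp (T s th) * cos th) ^ 2 + (exp (T s th) * sin th) ^ 2 = exp (T s th) ^ 2).
  { pose proof (sin2_cos2 th) as Q0. unfold Rsqr in Q0. nra. }
  assert (Esq : sqrt (exp (T s th) ^ 2) = exp (T s th)) by (apply sqrt_pow2; lra).
  rewrite (FF_polar _ _ _ _ _ th); auto; rewrite E; [|nra|now rewrite Esq|now rewrite Esq].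
  replace (/ 2 * ln (exp (T s th) ^ 2)) with (T s th).
  - rewrite Sm_T by auto. now apply ext_in.
  - replace (exp (T s th) ^ 2) with (exp (T s th + T s th)) by (rewrite exp_plus; ring). rewrite ln_exp. field.
Qed.

Definition good (cm cp : R) (G Gs Gt : fn) : Prop := dS G Gs /\ dT G Gt /\ jc Gt /\ flat cm cp G /\ per G.
(** Cartesian derivatives in label coordinates: the label has derivative [1 / Ts] in [t] and
    [- Tt / Ts] in [th], and [Ex] is the inverse radius. *)
Definition g1 (Gs Gt : fn) : fn := fun s th =>
  Gs s th * (Ex s th * (cos th + Tt s th * sin th) * / Ts s th) - Gt s th * (Ex s th * sin th).
Definition g2 (Gs Gt : fn) : fn := fun s th =>
  Gs s th * (Ex s th * (sin th - Tt s th * cos th) * / Ts s th) + Gt s th * (Ex s th * cos th).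

(** Implicit differentiation of [T (Sm t th) th = t]: the defect is [tau - T s0 vt] with the label
    frozen, and the mean value theorem in the label gives the slope. *)
Lemma label_derive (tau vt : R -> R) w a b : (1 <= K)%nat -> is_derive tau w a -> is_derive vt w b -> In1 (Sm (tau w) (vt w)) ->
  is_derive (fun z => Sm (tau z) (vt z)) w ((a - Tt (Sm (tau w) (vt w)) (vt w) * b) * / Ts (Sm (tau w) (vt w)) (vt w)) /\
  locally w (fun z => In1 (Sm (tau z) (vt z))).
Proof.
  intros HK Ha Hb Hi. destruct Sm_lip as [L [L0 HL]].
  set (sg := fun z => Sm (tau z) (vt z)). set (s0 := sg w). change (In1 s0) in Hi.
  assert (La := derive_lip _ _ _ Ha). assert (Lb := derive_lip _ _ _ Hb).
  set (C := L * (Rabs a + 1 + (Rabs b + 1))).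
  assert (Ls : locally w (fun z => Rabs (sg z - s0) <= C * Rabs (z - w))).
  { eapply filter_imp; [|apply (filter_and _ _ La Lb)]. intros z [A B]. unfold sg, s0. eapply Rle_trans; [apply HL|].
    unfold C. rewrite Rmult_assoc. apply Rmult_le_compat_l; auto. lra. }
  assert (C0 : 0 <= C) by (apply Rmult_le_pos; auto; pose proof (Rabs_pos a); pose proof (Rabs_pos b); lra).
  assert (Lim : forall e, 0 < e -> locally w (fun z => Rabs (sg z - s0) < e)).
  { intros e He. assert (Hd : 0 < e / (C + 1)) by (apply Rdiv_lt_0_compat; lra).
    eapply filter_imp; [|apply (filter_and _ _ Ls (ex_intro (fun d : posreal => forall z, ball w d z -> Rabs (z - w) < e / (C + 1)) (mkposreal _ Hd) (fun z Hz => Hz)))].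
    intros z [A B]. pose proof (Rabs_pos (z - w)). eapply Rle_lt_trans; [exact A|].
    apply Rle_lt_trans with ((C + 1) * Rabs (z - w)); [nra|]. replace e with ((C + 1) * (e / (C + 1))) at 1 by (field; lra). apply Rmult_lt_compat_l; lra. }
  assert (LI : locally w (fun z => In1 (sg z))).
  { set (e := Rmin (s0 + 1/2) (1/2 - s0)). assert (e <= s0 + 1/2) by apply Rmin_l. assert (e <= 1/2 - s0) by apply Rmin_r.
    eapply filter_imp; [|apply (Lim e)]; [|apply Rmin_glb_lt; unfold In1 in Hi; lra]. intros z Hz. apply Rabs_def2 in Hz. unfold In1 in *. lra. }
  split; [|exact LI]. assert (Hm : is_derive (fun z => tau z - T s0 (vt z)) w (a - Tt s0 (vt w) * b)).
  { apply derive_minus; auto. apply (derive_comp (T s0) vt); auto. now apply T_t. }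
  assert (M0 : tau w - T s0 (vt w) = 0) by (unfold s0, sg in *; rewrite T_Sm by auto; ring).
  apply (derive_implicit sg (fun z => tau z - T s0 (vt z)) w _ (/ Ts s0 (vt w)) Hm M0).
  intros e He. assert (JT : jc (fun s th => / Ts s th)) by (apply jc_nice, (nice_le 1 K 1 1); auto using Tsinv_nice).
  destruct (JT s0 (vt w) Hi (fun v => Rabs (v - / Ts s0 (vt w)) <= e)) as [d Hd].
  { exists (mkposreal e He). intros v Hv. left. exact Hv. }
  assert (Cv := cont_of_derive _ _ _ Hb).
  assert (Lv : locally w (fun z => Rabs (vt z - vt w) < d)) by (apply (Cv (fun v => Rabs (v - vt w) < d)); exists d; intros v Hv; exact Hv).
  eapply filter_imp; [|apply (filter_and _ _ LI (filter_and _ _ (Lim d (cond_pos d)) Lv))].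
  intros z [Iz [Dz Vz]]. assert (ET : T (sg z) (vt z) = tau z) by (apply T_Sm, Iz).
  assert (X : exists c, (c - s0) * (c - sg z) <= 0 /\ In1 c /\ T (sg z) (vt z) - T s0 (vt z) = Ts c (vt z) * (sg z - s0)).
  { destruct (Rtotal_order s0 (sg z)) as [h|[h|h]].
    - destruct (mvt (fun s => T s (vt z)) (fun s => Ts s (vt z)) s0 (sg z) h) as [c [A B]]; [intros; apply T_s; unfold In1 in *; lra|].
      exists c. split; [nra|]. split; auto. unfold In1 in *; lra.
    - exists s0. split; [rewrite <- h; nra|]. split; auto. rewrite <- h. ring.
    - destruct (mvt (fun s => T s (vt z)) (fun s => Ts s (vt z)) (sg z) s0 h) as [c [A B]]; [intros; apply T_s; unfold In1 in *; lra|].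
      exists c. split; [nra|]. split; [unfold In1 in *; lra|lra]. }
  destruct X as [c [X1 [X2 X3]]]. exists (/ Ts c (vt z)). split.
  - apply (Hd (c, vt z)). split; [|exact Vz]. change (Rabs (c - s0) < d).
    eapply Rle_lt_trans; [|exact Dz]. destruct (Rle_dec s0 c); [rewrite (Rabs_right (c - s0)) by lra|rewrite (Rabs_left (c - s0)) by lra].
    + destruct (Req_dec c s0) as [->|]; [pose proof (Rabs_pos (sg z - s0)); lra|]. assert (c - sg z <= 0) by nra. pose proof (Rle_abs (sg z - s0)). lra.
    + assert (0 <= c - sg z) by nra. pose proof (Rle_abs (- (sg z - s0))). rewrite Rabs_Ropp in *. lra.
  - rewrite ET in X3. rewrite X3. pose proof (Ts_range c (vt z) X2). unfold s0. field. lra.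
Qed.

(** After rotation by [th0] the point lies on the positive first axis, so [th0 + atan (v / u)] is a
    smooth branch of the angle near [w]. *)
Lemma polar_local (X Z : R -> R) w a b : is_derive X w a -> is_derive Z w b -> X w ^ 2 + Z w ^ 2 <> 0 ->
  let th0 := ang (X w) (Z w) in let r0 := sqrt (X w ^ 2 + Z w ^ 2) in
  exists tau vt, is_derive tau w ((cos th0 * a + sin th0 * b) / r0) /\ is_derive vt w ((- sin th0 * a + cos th0 * b) / r0) /\
   vt w = th0 /\ tau w = /2 * ln (X w ^ 2 + Z w ^ 2) /\
   locally w (fun z => X z ^ 2 + Z z ^ 2 <> 0 /\ tau z = /2 * ln (X z ^ 2 + Z z ^ 2) /\
     X z = sqrt (X z ^ 2 + Z z ^ 2) * cos (vt z) /\ Z z = sqrt (X z ^ 2 + Z z ^ 2) * sin (vt z)).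
Proof.
  intros HX HZ H0 th0 r0. destruct (ang_spec _ _ H0) as [A1 A2]. fold th0 r0 in A1, A2.
  assert (Hp : 0 < X w ^ 2 + Z w ^ 2) by (pose proof (pow2_ge_0 (X w)); pose proof (pow2_ge_0 (Z w)); lra).
  assert (Hr : 0 < r0) by now apply sqrt_lt_R0.
  assert (Hr2 : r0 * r0 = X w ^ 2 + Z w ^ 2) by (apply sqrt_sqrt; lra).
  set (u := fun z => cos th0 * X z + sin th0 * Z z). set (v := fun z => - sin th0 * X z + cos th0 * Z z).
  assert (SC := sin2_cos2 th0). unfold Rsqr in SC.
  assert (Du : is_derive u w (cos th0 * a + sin th0 * b)) by (apply derive_plus; apply derive_scal; auto).
  assert (Dv : is_derive v w (- sin th0 * a + cos th0 * b)) by (apply derive_plus; apply derive_scal; auto).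
  assert (U0 : u w = r0) by (unfold u; rewrite A1, A2; transitivity (r0 * (sin th0 * sin th0 + cos th0 * cos th0)); [ring|rewrite SC; ring]).
  assert (V0 : v w = 0) by (unfold v; rewrite A1, A2; ring).
  exists (fun z => /2 * ln (X z ^ 2 + Z z ^ 2)), (fun z => th0 + atan (v z * / u z)).
  split; [|split; [|split; [|split]]]; auto.
  - eapply derive_eq; [apply derive_scal, (derive_comp ln (fun z => X z ^ 2 + Z z ^ 2)); [apply ln_der; auto|
      apply derive_plus; apply derive_pow; eauto]|].
    simpl INR. simpl pred. rewrite !pow_1, <- Hr2. rewrite A1, A2. field. lra.
  - assert (Da : is_derive atan (v w * / u w) (/ (1 + (v w * / u w) ^ 2))) by (apply is_derive_Reals, derivable_pt_lim_atan).
    eapply derive_eq; [apply derive_plus; [apply derive_cst|apply (derive_comp atan (fun z => v z * / u z)); [exact Da|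
      apply derive_mult; [exact Dv|apply derive_inv; [exact Du|lra]]]]|].
    cbv beta. rewrite V0, U0. field. lra.
  - cbv beta. rewrite V0, Rmult_0_l, atan_0. apply Rplus_0_r.
  - assert (Lu : locally w (fun z => 0 < u z)).
    { assert (Cu := cont_of_derive _ _ _ Du). apply (Cu (fun q => 0 < q)). rewrite U0. exists (mkposreal r0 Hr). intros q Hq.
      change (Rabs (q - r0) < r0) in Hq. apply Rabs_def2 in Hq. lra. }
    eapply filter_imp; [|exact Lu]. intros z Hu. assert (E : X z ^ 2 + Z z ^ 2 = u z ^ 2 + v z ^ 2).
    { unfold u, v. transitivity ((sin th0 * sin th0 + cos th0 * cos th0) * (X z ^ 2 + Z z ^ 2)); [rewrite SC; ring|ring]. }
    assert (P2 : 0 < X z ^ 2 + Z z ^ 2) by (rewrite E; pose proof (pow2_ge_0 (v z)); nra).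
    split; [lra|]. split; [reflexivity|].
    set (q := v z * / u z). assert (Hq : u z * q = v z) by (unfold q; field; lra).
    assert (Er : sqrt (X z ^ 2 + Z z ^ 2) = u z * sqrt (1 + q ^ 2)).
    { rewrite E, <- Hq. replace (u z ^ 2 + (u z * q) ^ 2) with (u z ^ 2 * (1 + q ^ 2)) by ring.
      rewrite sqrt_mult, sqrt_pow2; auto; try lra; [apply pow2_ge_0|pose proof (pow2_ge_0 q); lra]. }
    assert (Sq : 0 < sqrt (1 + q ^ 2)) by (apply sqrt_lt_R0; pose proof (pow2_ge_0 q); lra).
    assert (EX : X z = cos th0 * u z - sin th0 * v z).
    { unfold u, v. transitivity ((sin th0 * sin th0 + cos th0 * cos th0) * X z); [rewrite SC; ring|ring]. }
    assert (EZ : Z z = sin th0 * u z + cos th0 * v z).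
    { unfold u, v. transitivity ((sin th0 * sin th0 + cos th0 * cos th0) * Z z); [rewrite SC; ring|ring]. }
    rewrite Er, cos_plus, sin_plus, cos_atan, sin_atan. unfold Rsqr. replace (1 + q * q) with (1 + q ^ 2) by ring.
    rewrite EX at 1. rewrite EZ at 1. rewrite <- Hq. split; field; lra.
Qed.

Lemma near_origin : exists d, 0 < d /\ forall cm cp G X Z, X ^ 2 + Z ^ 2 < d -> FF cm cp G X Z = cp.
Proof.
  destruct Sm_end as [B [B0 [H1 _]]]. exists (exp (- 2 * B - 2)). split; [apply exp_pos|]. intros cm cp G X Z H.
  unfold FF. destruct (Req_EM_T (X ^ 2 + Z ^ 2) 0) as [e|e]; auto.
  assert (Hp : 0 < X ^ 2 + Z ^ 2) by (pose proof (pow2_ge_0 X); pose proof (pow2_ge_0 Z); lra).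
  apply ln_increasing in H; auto. rewrite ln_exp in H. rewrite H1 by lra. apply ext_r.
Qed.
Lemma far_away : exists M, 0 <= M /\ forall cm cp G X Z, M < X ^ 2 + Z ^ 2 -> FF cm cp G X Z = cm.
Proof.
  destruct Sm_end as [B [B0 [_ H1]]]. exists (exp (2 * B)). split; [left; apply exp_pos|]. intros cm cp G X Z H.
  pose proof (exp_pos (2 * B)). unfold FF. destruct (Req_EM_T (X ^ 2 + Z ^ 2) 0) as [e|e]; [lra|].
  apply ln_increasing in H; auto. rewrite ln_exp in H. rewrite H1 by lra. apply ext_l.
Qed.

(** Near the origin the function is constant, and where the label is interior it is a chain rule.
    Where the label is clamped, it is Lipschitz along the curve and [G] has quadratic contact with
    the constant, so the increment is quadratic. *)
Lemma FF_derive cm cp G Gs Gt (X Z : R -> R) w a b : (1 <= K)%nat -> good cm cp G Gs Gt -> is_derive X w a -> is_derive Z w b ->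
  is_derive (fun z => FF cm cp G (X z) (Z z)) w (a * FF 0 0 (g1 Gs Gt) (X w) (Z w) + b * FF 0 0 (g2 Gs Gt) (X w) (Z w)).
Proof.
  intros HK [HS [HT [HJ [HF HP]]]] HX HZ. destruct (Req_EM_T (X w ^ 2 + Z w ^ 2) 0) as [e|e].
  - destruct near_origin as [d [Hd Hn]].
    assert (Dq : is_derive (fun z => X z ^ 2 + Z z ^ 2) w (INR 2 * a * X w ^ pred 2 + INR 2 * b * Z w ^ pred 2))
     by (apply derive_plus; apply derive_pow; auto).
    assert (L : locally w (fun z => X z ^ 2 + Z z ^ 2 < d)).
    { assert (Cq := cont_of_derive _ _ _ Dq). apply (Cq (fun q => q < d)). rewrite e. exists (mkposreal d Hd). intros q Hq.
      change (Rabs (q - 0) < d) in Hq. apply Rabs_def2 in Hq. lra. }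
    apply (is_derive_ext_loc (fun _ => cp)); [eapply filter_imp; [|exact L]; intros z Hz; symmetry; now apply Hn|].
    derive. rewrite !Hn by lra. ring.
  - destruct (polar_local X Z w a b HX HZ e) as [tau [vt [D1 [D2 [V0 [T0 L]]]]]].
    set (th0 := ang (X w) (Z w)) in *. set (r0 := sqrt (X w ^ 2 + Z w ^ 2)) in *.
    set (sg := fun z => Sm (tau z) (vt z)). apply (is_derive_ext_loc (fun z => ext cm cp G (sg z) (vt z))).
    { eapply filter_imp; [|exact L]. intros z [L1 [L2 [L3 L4]]]. unfold sg. rewrite L2. symmetry. now apply FF_polar. }
    assert (E : forall G, FF 0 0 G (X w) (Z w) = ext 0 0 G (sg w) th0).
    { intros G'. unfold FF. destruct (Req_EM_T (X w ^ 2 + Z w ^ 2) 0); [easy|]. unfold sg. now rewrite T0, V0. }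
    rewrite !E. assert (Hp : 0 < X w ^ 2 + Z w ^ 2) by (pose proof (pow2_ge_0 (X w)); pose proof (pow2_ge_0 (Z w)); lra).
    assert (Hr : 0 < r0) by now apply sqrt_lt_R0. destruct (classic (In1 (sg w))) as [Hi|Hi].
    + destruct (label_derive tau vt w _ _ HK D1 D2 Hi) as [Ds LI].
      apply (is_derive_ext_loc (fun z => G (sg z) (vt z))); [eapply filter_imp; [|exact LI]; intros z Hz; symmetry; now apply ext_in|].
      rewrite !ext_in by auto. eapply derive_eq; [apply (chain2 G Gs Gt sg vt w _ _ HS HT HJ Hi Ds D2)|].
      fold (sg w). rewrite V0. assert (Er : / r0 = Ex (sg w) th0).
      { unfold Ex, sg. rewrite V0. rewrite T_Sm by (rewrite <- V0; exact Hi). rewrite T0.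
        rewrite exp_Ropp. f_equal. unfold r0. rewrite <- (exp_ln (X w ^ 2 + Z w ^ 2)) at 1 by auto.
        replace (exp (ln (X w ^ 2 + Z w ^ 2))) with (exp (/ 2 * ln (X w ^ 2 + Z w ^ 2)) ^ 2).
        - apply sqrt_pow2. left; apply exp_pos.
        - match goal with |- ?u ^ 2 = _ => replace (u ^ 2) with (u * u) by ring end. rewrite <- exp_plus. f_equal. field. }
      pose proof (Ts_range (sg w) th0 Hi). unfold Rdiv. rewrite Er. unfold g1, g2. field. lra.
    + assert (Z0 : forall H, ext 0 0 H (sg w) th0 = 0).
      { intros H. destruct (Sm_spec (tau w) (vt w)) as [A _]. unfold ext. fold (sg w) in A. destruct (Rle_dec _ _); auto. destruct (Rle_dec _ _); auto.
        exfalso. apply Hi. unfold In1; lra. }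
      rewrite !Z0. replace (a * 0 + b * 0) with 0 by ring.
      destruct Sm_lip as [Ls [Ls0 HL]]. destruct (flat_ext _ _ _ HF) as [C [C0 HC]].
      assert (La := derive_lip _ _ _ D1). assert (Lb := derive_lip _ _ _ D2).
      match type of D1 with is_derive _ _ ?u => match type of D2 with is_derive _ _ ?v => set (M := Ls * (Rabs u + 1 + (Rabs v + 1))) in * end end.
      assert (Q1 : locally w (fun z => Rabs (sg z - sg w) <= M * Rabs (z - w))).
      { eapply filter_imp; [|apply (filter_and _ _ La Lb)]. intros z [A B]. unfold sg. eapply Rle_trans; [apply HL|].
        unfold M. rewrite Rmult_assoc. apply Rmult_le_compat_l; auto. lra. }
      assert (End : sg w = -(1/2) \/ sg w = 1/2).
      { destruct (Sm_spec (tau w) (vt w)) as [A _]. fold (sg w) in A. destruct (Req_dec (sg w) (-(1/2))); auto. destruct (Req_dec (sg w) (1/2)); auto.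
        exfalso. apply Hi. unfold In1; lra. }
      apply (derive_quad _ _ (C * M ^ 2)). eapply filter_imp; [|exact Q1]. intros z Hz.
      destruct (Sm_spec (tau z) (vt z)) as [A _]. fold (sg z) in A. destruct (HC (sg z) (vt z) A) as [B1 B2].
      assert (Sq : (sg z - sg w) ^ 2 <= M ^ 2 * Rabs (z - w) ^ 2).
      { rewrite <- Rpow_mult_distr, <- (pow2_abs (sg z - sg w)). apply pow_incr. split; auto using Rabs_pos. }
      rewrite Rmult_assoc. destruct End as [E1|E1].
      * rewrite E1, ext_l. eapply Rle_trans; [exact B1|]. apply Rmult_le_compat_l; auto. rewrite E1 in Sq. replace (sg z + 1/2) with (sg z - -(1/2)) by ring. auto.
      * rewrite E1, ext_r. eapply Rle_trans; [exact B2|]. apply Rmult_le_compat_l; auto. rewrite E1 in Sq. replace ((1/2 - sg z) ^ 2) with ((sg z - 1/2) ^ 2) by ring. auto.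
Qed.

(** * Regularity of functions carrying the degenerate weight *)

Hypothesis K3 : (3 <= K)%nat.
Hypothesis N3 : (3 <= N)%nat.
Let mu := p_mu _ _ P. Let mud := p_mud _ _ P.
Let gh := p_gh _ _ P. Let ghd := p_ghd _ _ P. Let h := p_h _ _ P. Let sc := p_sc _ _ P. Let bb := p_bb _ _ P.
Let la := lam _ _ _ Sl. Let m := Mm _ _ _ Sl.
Let yt := Yt _ _ _ Sl. Let nt := Nt _ _ _ Sl. Let mt := Mt _ _ _ Sl. Let xtt := psitt _ _ _ Sl.

Definition hl (s : R) := h s + la * sc s.
(** The weight at the parameter [la]: adding [la sc] to [h] multiplies [p] by the exponential of
    [la] times a primitive of [sc]. *)
Definition pl (s : R) := p_p _ _ P s * exp (la * p_S _ _ P s).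
Lemma pl_pos s : 0 < pl s.
Proof. apply Rmult_lt_0_compat; [apply p_pos|apply exp_pos]. Qed.
Lemma pl_der s : In1 s -> is_derive pl s (hl s * pl s).
Proof.
  intros Hs. unfold pl. derive. unfold hl, h, sc. ring.
Qed.
#[local] Hint Resolve pl_der : deriv.
Lemma dl_snice : snice K (fun s => D s * hl s).
Proof.
  apply (snice_ext K (fun s => D s * h s + la * (D s * sc s))); [intros; unfold hl; ring|].
  apply snice_add; [apply p_dh_snice|]. apply snice_mul; [apply snice_const|]. apply snice_mul; [apply snice_D|apply p_sc_snice].
Qed.
Lemma pl_le : exists C, 0 < C /\ forall s, In1 s -> pl s <= C * D s ^ N.
Proof.
  destruct (p_le _ _ P) as [C [C0 HC]]. destruct (snice_bound _ _ (p_sc_snice _ _ P)) as [B [B0 HB]].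
  set (B' := Rabs la * (Rabs (p_S _ _ P 0) + B)).
  exists (C * exp B'). split; [apply Rmult_lt_0_compat; auto; apply exp_pos|]. intros s Hs.
  assert (E : la * p_S _ _ P s <= B').
  { eapply Rle_trans; [apply Rle_abs|]. rewrite Rabs_mult. apply Rmult_le_compat_l; [apply Rabs_pos|].
    assert (L := lip_of_derive (p_S _ _ P) (p_sc _ _ P) (-(1/2)) (1/2) B (p_S_der _ _ P) HB 0 s ltac:(lra) Hs).
    assert (Rabs (s - 0) <= 1) by (unfold In1 in Hs; apply Rabs_le; lra).
    replace (p_S K N P s) with ((p_S K N P s - p_S K N P 0) + p_S K N P 0) by ring. triang. nra. }
  assert (E2 : exp (la * p_S _ _ P s) <= exp B') by (destruct E as [E|E]; [left; now apply exp_increasing|rewrite E; lra]).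
  unfold pl. replace (C * exp B' * D s ^ N) with (C * D s ^ N * exp B') by ring.
  apply Rmult_le_compat; auto; [left; apply p_pos|left; apply exp_pos].
Qed.

(* Every derivative in [(X, Z)] turns [Wn i] into [Wn (S i)]. *)
Definition Wn (i : nat) (g : fn) : fn := fun s th => pl s * (/ D s) ^ i * g s th.
Lemma Wn_bound i g : bdd g -> (i <= N)%nat -> exists C, 0 <= C /\ forall s th, In1 s -> Rabs (Wn i g s th) <= C * D s ^ (N - i).
Proof.
  intros [[A [A0 HA]] _] Hi. destruct pl_le as [C [C0 HC]]. exists (C * A). split; [apply Rmult_le_pos; lra|]. intros s th Hs.
  pose proof (D_pos s Hs) as Dp. pose proof (pl_pos s). assert (0 < (/ D s) ^ i) by (apply pow_lt; now apply Rinv_0_lt_compat).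
  unfold Wn. rewrite !Rabs_mult, (Rabs_right (pl s)), (Rabs_right ((/ D s) ^ i)) by lra.
  replace (C * A * D s ^ (N - i)) with (C * D s ^ N * (/ D s) ^ i * A).
  - apply Rmult_le_compat; auto using Rabs_pos; [apply Rmult_le_pos; lra|]. apply Rmult_le_compat_r; [lra|auto].
  - replace N with ((N - i) + i)%nat at 1 by lia. rewrite pow_add, pow_inv. field. apply pow_nonzero. lra.
Qed.
Lemma D_pow i s : In1 s -> (2 <= i)%nat -> D s ^ i <= (s + 1/2) ^ 2 /\ D s ^ i <= (1/2 - s) ^ 2 /\ D s ^ i <= D s.
Proof.
  intros Hs Hi. pose proof (D_pos s Hs). pose proof (D_le s). assert (A : D s ^ i <= D s ^ 2).
  { replace i with (2 + (i - 2))%nat by lia. rewrite pow_add. rewrite <- (Rmult_1_r (D s ^ 2)) at 2. apply Rmult_le_compat_l; [nra|].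
    rewrite <- (pow1 (i - 2)). apply pow_incr. lra. }
  unfold In1 in Hs. assert (D s <= s + 1/2) by (unfold D; nra). assert (D s <= 1/2 - s) by (unfold D; nra).
  split; [|split]; (eapply Rle_trans; [exact A|]); [apply pow_incr; lra|apply pow_incr; lra|nra].
Qed.
Lemma flat_of G C i : (2 <= i)%nat -> 0 <= C -> (forall s th, In1 s -> Rabs (G s th) <= C * D s ^ i) -> flat 0 0 G.
Proof.
  intros Hi C0 H. exists C. split; auto. intros s th Hs. rewrite Rminus_0_r. destruct (D_pow i s Hs Hi) as [A [B _]].
  split; (eapply Rle_trans; [now apply H|]); now apply Rmult_le_compat_l.
Qed.
Lemma Dinv_der s : In1 s -> is_derive (fun s => / D s) s (2 * s * (/ D s) ^ 2).
Proof.
  intros Hs. pose proof (D_pos s Hs). eapply derive_eq; [apply derive_inv; [apply D_der|lra]|]. field. lra.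
Qed.
Lemma Wn_s i g gs : dS g (fun s th => gs s th / D s) ->
  dS (Wn i g) (Wn (S i) (fun s th => (D s * hl s) * g s th + (2 * INR i * s) * g s th + gs s th)).
Proof.
  intros Hg s th Hs. pose proof (D_pos s Hs). unfold Wn. eapply derive_eq;
   [apply derive_mult; [apply derive_mult; [apply pl_der, Hs|apply derive_pow, Dinv_der, Hs]|apply Hg, Hs]|].
  cbv beta. destruct i as [|i]; simpl pred; simpl ((/ D s) ^ S _); [simpl|]; field; lra.
Qed.
Lemma Wn_t i g gt : dT g gt -> dT (Wn i g) (Wn i gt).
Proof. intros Hg s th Hs. unfold Wn. apply derive_scal, Hg, Hs. Qed.
Lemma pl_cont s : In1 s -> continuous pl s.
Proof. intros Hs. apply (cont_of_derive _ _ _ (pl_der s Hs)). Qed.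
Lemma Wn_jc i g : nice 1 1 g -> jc (Wn i g).
Proof.
  intros H. apply jc_mul; [|now apply jc_nice]. apply jc_s. intros s Hs. apply continuous_Rmult; [now apply pl_cont|].
  eapply cont_of_derive. apply derive_pow, Dinv_der, Hs.
Qed.
Lemma Wn_per i g : bdd g -> per (Wn i g).
Proof. intros [_ H] s th th' Hs H1 H2. unfold Wn. f_equal. auto. Qed.
Lemma Wn_shift i g s th : In1 s -> Wn i g s th = Wn (S i) (fun s th => D s * g s th) s th.
Proof. intros Hs. pose proof (D_pos s Hs). unfold Wn. simpl. field. lra. Qed.

Lemma good_W i g : (i + 2 <= N)%nat -> nice 2 2 g -> exists gs gt, dS g (fun s th => gs s th / D s) /\ dT g gt /\
  good 0 0 (Wn i g) (Wn (S i) (fun s th => (D s * hl s) * g s th + (2 * INR i * s) * g s th + gs s th)) (Wn i gt).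
Proof.
  intros Hi H. destruct (nice_s _ _ _ H) as [gs [Gs _]]. destruct (nice_t _ _ _ H) as [gt [Gt Nt]].
  assert (Hb := nice_bdd _ _ _ H). exists gs, gt. split; auto. split; auto. split; [now apply Wn_s|]. split; [now apply Wn_t|].
  split; [apply Wn_jc; now apply (nice_le 1 2 1 1); auto|]. split; [|now apply Wn_per].
  destruct (Wn_bound i g Hb) as [C [C0 HC]]; [lia|]. apply (flat_of _ C (N - i)); auto. lia.
Qed.

Lemma FF_ext cm cp G H X Z : (forall s th, In1 s -> G s th = H s th) -> FF cm cp G X Z = FF cm cp H X Z.
Proof.
  intros E. unfold FF. destruct (Req_EM_T _ _); auto. unfold ext. destruct (Rle_dec _ _); auto. destruct (Rle_dec _ _); auto.
  apply E. unfold In1; lra.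
Qed.
Lemma FF_op (op : R -> R -> R) G H X Z : op 0 0 = 0 -> FF 0 0 (fun s th => op (G s th) (H s th)) X Z = op (FF 0 0 G X Z) (FF 0 0 H X Z).
Proof.
  intros E. unfold FF. destruct (Req_EM_T _ _); auto. unfold ext. destruct (Rle_dec _ _); auto. destruct (Rle_dec _ _); auto.
Qed.
Lemma FF_bound G C X Z : 0 <= C -> (forall s th, In1 s -> Rabs (G s th) <= C) -> Rabs (FF 0 0 G X Z) <= C.
Proof.
  intros C0 E. unfold FF. destruct (Req_EM_T _ _); [rewrite Rabs_R0; auto|]. unfold ext. destruct (Rle_dec _ _); [rewrite Rabs_R0; auto|].
  destruct (Rle_dec _ _); [rewrite Rabs_R0; auto|]. apply E. unfold In1; lra.
Qed.

Lemma FF_partials cm cp G Gs Gt : good cm cp G Gs Gt -> forall X Z,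
  is_derive (fun t => FF cm cp G t Z) X (FF 0 0 (g1 Gs Gt) X Z) /\ is_derive (fun t => FF cm cp G X t) Z (FF 0 0 (g2 Gs Gt) X Z).
Proof.
  intros H X Z. split.
  - eapply derive_eq; [apply (FF_derive cm cp G Gs Gt (fun t => t) (fun _ => Z) X 1 0); auto; [lia|apply derive_id|apply derive_cst]|]. ring.
  - eapply derive_eq; [apply (FF_derive cm cp G Gs Gt (fun _ => X) (fun t => t) Z 0 1); auto; [lia|apply derive_cst|apply derive_id]|]. ring.
Qed.

Lemma Kle j q f : (j <= K)%nat -> nice K q f -> nice j q f.
Proof. intros Hj H. now apply (nice_le j K q q). Qed.

(** A Cartesian derivative costs one factor [1 / D]: from the weight through [hl], from the power of
    [D], and from the weighted radial derivative of [g]. The angular term gets a factor [D] to fit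
    the same form. *)
Lemma W_step j i g : (S j <= K)%nat -> (i + 2 <= N)%nat -> (1 <= j)%nat -> nice (S j) (S j) g -> exists f1 f2, nice j j f1 /\ nice j j f2 /\ forall X Z,
  is_derive (fun t => FF 0 0 (Wn i g) t Z) X (FF 0 0 (Wn (S i) f1) X Z) /\ is_derive (fun t => FF 0 0 (Wn i g) X t) Z (FF 0 0 (Wn (S i) f2) X Z).
Proof.
  intros HK Hi Hj Hg. destruct (good_W i g Hi) as [gs [gt [Gs [Gt HG]]]]; [now apply (nice_le 2 (S j) 2 (S j)); auto; lia|].
  set (gs' := fun s th => (D s * hl s) * g s th + (2 * INR i * s) * g s th + gs s th) in *.
  assert (Ngs : nice j j gs').
  { assert (N1 : nice j j g) by (apply (nice_le j (S j) j (S j)); auto). assert (N2 : nice j j gs).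
    { assert (X := nice_s_of j (S j) g _ Hg Gs). apply (nice_le j j j (S j)); auto. eapply nice_ext; [|exact X].
      intros s th Hs. pose proof (D_pos s Hs). simpl. field. lra. }
    apply nice_add; auto. apply nice_add; apply nice_mul; auto.
    - apply Kle; [lia|]. apply dl_snice.
    - apply (lin_snice j (2 * INR i)). }
  assert (Ngt : nice j j (fun s th => D s * gt s th)).
  { apply nice_mul; [apply snice_D|]. apply (nice_le j (S j) j j); auto. now apply (nice_t_of _ _ g). }
  assert (NE : nice j j Ex) by (apply Kle, Ex_nice; lia). assert (NT : nice j j Tt) by (apply Kle, Tt_nice; lia).
  assert (NI : nice j j (fun s th => / Ts s th)) by (apply Kle, Tsinv_nice; lia). destruct (nice_trig j j) as [Nc Ns].
  exists (fun s th => gs' s th * (Ex s th * (cos th + Tt s th * sin th) * / Ts s th) - (D s * gt s th) * (Ex s th * sin th)),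
    (fun s th => gs' s th * (Ex s th * (sin th - Tt s th * cos th) * / Ts s th) + (D s * gt s th) * (Ex s th * cos th)).
  split; [|split].
  - nice_tac.
  - nice_tac.
  - intros X Z. destruct (FF_partials _ _ _ _ _ HG X Z) as [D1 D2]. split.
    + derive. apply FF_ext. intros s th Hs. unfold g1. rewrite (Wn_shift i gt) by auto. unfold Wn. ring.
    + derive. apply FF_ext. intros s th Hs. unfold g2. rewrite (Wn_shift i gt) by auto. unfold Wn. ring.
Qed.
Lemma FF_cont i g : (i + 2 <= N)%nat -> nice 2 2 g -> cont2 (FF 0 0 (Wn i g)).
Proof.
  intros Hi Hg. destruct (W_step 1 i g) as [f1 [f2 [N1 [N2 H]]]]; auto; try lia.
  destruct (Wn_bound (S i) f1 (nice_bdd _ _ _ N1)) as [C1 [C10 H1]]; [lia|]. destruct (Wn_bound (S i) f2 (nice_bdd _ _ _ N2)) as [C2 [C20 H2]]; [lia|].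
  apply (cont2_of_bounded _ (FF 0 0 (Wn (S i) f1)) (FF 0 0 (Wn (S i) f2)) (C1 + C2)); [intros; apply H|intros; apply H|].
  assert (B : forall s q, In1 s -> 0 <= D s ^ q <= 1).
  { intros s q Hs. pose proof (D_pos s Hs). pose proof (D_le s). split; [apply pow_le; lra|]. rewrite <- (pow1 q). apply pow_incr. lra. }
  intros X Z. split; apply FF_bound; try lra; intros s th Hs; [eapply Rle_trans; [now apply H1|]|eapply Rle_trans; [now apply H2|]];
   pose proof (B s (N - S i)%nat Hs); nra.
Qed.
(** Each derivative uses up one unit of regularity and one power of [D]; two units of each remain
    for continuity, which is deduced from bounded first derivatives. *)
Lemma CkW k : forall i g, (k + 2 <= K)%nat -> (i + k + 2 <= N)%nat -> nice (S (S k)) (S (S k)) g -> Ck k (FF 0 0 (Wn i g)).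
Proof.
  induction k as [|k IH]; intros i g HK Hi Hg.
  - apply FF_cont; auto; lia.
  - destruct (W_step (S (S k)) i g) as [f1 [f2 [N1 [N2 H]]]]; auto; try lia.
    assert (E1 : d1 (FF 0 0 (Wn i g)) = FF 0 0 (Wn (S i) f1)).
    { extensionality a. extensionality b. apply is_derive_unique, H. }
    assert (E2 : d2 (FF 0 0 (Wn i g)) = FF 0 0 (Wn (S i) f2)).
    { extensionality a. extensionality b. apply is_derive_unique, H. }
    split; [apply FF_cont; [lia|apply (nice_le 2 (S (S (S k))) 2 (S (S (S k)))); auto; lia]|]. split; [intros a b; split; [exact (ex_intro _ _ (proj1 (H a b)))|exact (ex_intro _ _ (proj2 (H a b)))]|].
    rewrite E1, E2. split; (apply IH; [lia|lia|assumption]).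
Qed.

(** * Gradient, Laplacian and the pressure potential *)

(** [pl na] and [pl nb] will be the derivatives of the stream function in [t] and in [th], in
    log-polar coordinates. *)
Definition nb : fn := fun s th => (- xt s th + m s th) * / Ts s th.
Definition na : fn := fun s th => (y s th - mu s * x s th - gh s) + Tt s th * nb s th.
Definition nU1 : fn := fun s th => Ex s th * (cos th * na s th - sin th * nb s th).
Definition nU2 : fn := fun s th => Ex s th * (sin th * na s th + cos th * nb s th).
(** The part of the perturbation that the displaced label does not carry: to first order
    [v0' al psi + be psi = pl psi], where [v0' = gh pl]. *)
Definition be (s : R) := (1 - al s * gh s) * pl s.
Definition bed (s : R) := pl s * (mu s - ald s * gh s).
Definition Vs : fn := fun s th => gh s * pl s + (bed s * x s th + be s * (- y s th + n s th)).
Definition Vt : fn := fun s th => be s * xt s th.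

Lemma mu_eq s : In1 s -> mu s = hl s - al s * (hl s * gh s + ghd s).
Proof. intros Hs. apply (p_ident1 _ _ P la s Hs). Qed.
Lemma be_der s : In1 s -> is_derive be s (bed s).
Proof.
  intros Hs. unfold be, bed. derive. cbv beta. rewrite mu_eq by auto. unfold ald, al, gh, ghd. ring.
Qed.
#[local] Hint Resolve be_der : deriv.
Lemma nb_nice q : nice K q nb.
Proof. apply nice_mul; [|apply Tsinv_nice]. apply nice_add; [apply nice_opp, psit_nice|apply M_nice]. Qed.
Lemma na_nice q : nice K q na.
Proof.
  apply nice_add; [|apply nice_mul; [apply Tt_nice|apply nb_nice]]. apply nice_sub; [|apply p_gh_snice].
  apply nice_sub; [apply Y_nice|]. apply nice_mul; [apply p_mu_snice|apply psi_nice].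
Qed.
Lemma nU_nice q : nice K q nU1 /\ nice K q nU2.
Proof.
  pose proof (na_nice q). pose proof (nb_nice q). pose proof (Ex_nice q). destruct (nice_trig K q).
  split; apply nice_mul; auto; [apply nice_sub|apply nice_add]; apply nice_mul; auto.
Qed.

Lemma N_eq' s th : In1 s -> n s th * (Q s th * (1 - al s * (y s th - mu s * x s th) + 2 * al s * (1 - al s * gh s) * x s th)) =
  Q s th * (y s th - mu s * x s th + 2 * (al s * gh s) * x s th) * (ald s * x s th - al s * y s th)
   - al s * xt s th ^ 2 * (1 + (2 * al s * (1 - al s * gh s) + al s * mu s - ald s) * x s th).
Proof. intros Hs. rewrite <- Rmult_assoc. apply (N_eq _ _ _ Sl s th Hs). Qed.
Lemma M_eq' s th : In1 s -> m s th * Q s th = (2 * al s - (2 * al s * (1 - al s * gh s) + al s * mu s - ald s)) * x s th * xt s th.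
Proof. intros Hs. apply (M_eq _ _ _ Sl s th Hs). Qed.

(** For [u = v0 + be psi] this is the chain rule: [u_th + u_t T_th] at fixed label, and [u_t T_s].
    The nonlinear terms are chosen to make it hold: [A1] rests on the equation for [M], and [A2] on
    that and the equation for [N]. *)
Lemma V_ident s th : In1 s -> Vt s th = pl s * (nb s th + na s th * Tt s th) /\ Vs s th = pl s * (na s th * Ts s th).
Proof.
  intros Hs. pose proof (Q_ge s th Hs) as HQ. pose proof (Ts_range s th Hs) as HT.
  pose proof (N_eq' s th Hs) as HN. pose proof (M_eq' s th Hs) as HM.
  assert (A1 : Ts s th * Vt s th - Vs s th * Tt s th = pl s * (- xt s th + m s th)).
  { unfold Vt, Vs, Ts, Tt, W, be, bed. fold al ald x xt y n.
    apply (Rmult_eq_reg_r (Q s th)); [|lra]. transitivity (pl s * (- xt s th * Q s th + m s th * Q s th)); [|ring]. rewrite HM.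
    unfold Q. fold al x. unfold Q in HQ. fold al x in HQ. field. lra. }
  assert (A2 : Vs s th = Ts s th * (pl s * (y s th - mu s * x s th - gh s)) + Tt s th * (pl s * (- xt s th + m s th))).
  { unfold Vs, Ts, Tt, W, be, bed. fold al ald x xt y n. apply (Rmult_eq_reg_r (Q s th * Q s th)); [|nra].
    transitivity (pl s * (Q s th * (Q s th * (gh s + (mu s - ald s * gh s) * x s th - (1 - al s * gh s) * y s th))) + pl s * (Q s th * Q s th * (1 - al s * gh s) * n s th)); [ring|].
    transitivity (pl s * (Q s th * ((- Q s th + (ald s * x s th - al s * y s th)) * (y s th - mu s * x s th - gh s))
      + al s * xt s th * (- xt s th * Q s th + m s th * Q s th) + Q s th * al s * (y s th - mu s * x s th - gh s) * n s th)).
    2: { field. lra. }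
    rewrite HM. apply Rminus_diag_uniq.
    transitivity (pl s * (n s th * (Q s th * (1 - al s * (y s th - mu s * x s th) + 2 * al s * (1 - al s * gh s) * x s th))
       - (Q s th * (y s th - mu s * x s th + 2 * (al s * gh s) * x s th) * (ald s * x s th - al s * y s th)
       - al s * xt s th ^ 2 * (1 + (2 * al s * (1 - al s * gh s) + al s * mu s - ald s) * x s th)))).
    - unfold Q. fold al x. ring.
    - rewrite HN. ring. }
  assert (A3 : na s th * Ts s th = (y s th - mu s * x s th - gh s) * Ts s th + Tt s th * (- xt s th + m s th)) by (unfold na, nb; field; lra).
  assert (A4 : Vs s th = pl s * (na s th * Ts s th)) by (rewrite A3, A2; ring).
  split; auto. apply (Rmult_eq_reg_l (Ts s th)); [|lra].
  replace (Ts s th * Vt s th) with (Vs s th * Tt s th + pl s * (- xt s th + m s th)) by lra. rewrite A4. unfold nb. field. lra.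
Qed.
Lemma g_V s th : In1 s -> g1 Vs Vt s th = Wn 0 nU1 s th /\ g2 Vs Vt s th = Wn 0 nU2 s th.
Proof.
  intros Hs. pose proof (Ts_range s th Hs) as HT. destruct (V_ident s th Hs) as [A B].
  unfold g1, g2, Wn, nU1, nU2. rewrite A, B. simpl. split; field; lra.
Qed.

Lemma be_x_flat : exists C, 0 <= C /\ forall s th, In1 s ->
  Rabs (be s * x s th) <= C * (s + 1/2) ^ 2 /\ Rabs (be s * x s th) <= C * (1/2 - s) ^ 2.
Proof.
  destruct (Wn_bound 0 (fun s th => (1 - al s * gh s) * x s th)) as [C [C0 HW]]; [|lia|].
  { apply (nice_bdd 0 0), Kle; [lia|]. apply nice_mul; [|apply psi_nice]. apply nice_sub; [apply nice_const|].
    apply nice_mul; [apply p_al_snice|apply p_gh_snice]. }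
  exists C. split; auto. intros s th Hs. specialize (HW s th Hs). unfold Wn in HW. rewrite Rmult_1_r in HW.
  replace (pl s * ((1 - al s * gh s) * x s th)) with (be s * x s th) in HW by (unfold be; ring).
  destruct (D_pow (N - 0) s Hs ltac:(lia)) as [A1 [A2 _]].
  split; (eapply Rle_trans; [exact HW|]); now apply Rmult_le_compat_l.
Qed.
Lemma V_good : exists v0 cm cp, good cm cp (fun s th => v0 s + be s * x s th) Vs Vt.
Proof.
  destruct pl_le as [Cp [Cp0 HCp]]. destruct (snice_bound _ _ (p_gh_snice _ _ P)) as [Cg [Cg0 HCg]].
  destruct (antiderivative_flat (fun s => gh s * pl s) (Cg * Cp)) as [v0 [c [B [B0 [HV HB]]]]].
  - intros s Hs. apply continuous_Rmult; [|now apply pl_cont]. eapply cont_of_derive, p_gh_der, Hs.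
  - intros s Hs. rewrite Rabs_mult, Rmult_assoc. pose proof (pl_pos s). apply Rmult_le_compat; auto using Rabs_pos.
    rewrite Rabs_right by lra. eapply Rle_trans; [now apply HCp|]. apply Rmult_le_compat_l; [lra|]. apply D_pow; auto; lia.
  - exists v0, 0, c. destruct be_x_flat as [Cw [Cw0 Hbe]]. split; [|split; [|split; [|split]]].
    + intros s th Hs. unfold Vs. apply derive_plus; [now apply HV|]. eapply derive_eq; [apply derive_mult; [now apply be_der|apply psi_s, Hs]|]. reflexivity.
    + intros s th Hs. eapply derive_eq; [apply derive_plus; [apply derive_cst|apply derive_scal, psi_t, Hs]|]. unfold Vt, xt. ring.
    + apply jc_mul; [apply jc_s; intros s Hs; eapply cont_of_derive; now apply be_der|]. apply jc_nice, (Kle 1 1); [lia|apply psit_nice].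
    + exists (B + Cw). split; [lra|]. intros s th Hs. destruct (HB s Hs) as [B1 B2]. destruct (Hbe s th Hs) as [E1 E2].
      rewrite !Rmult_plus_distr_r. split.
      * rewrite Rminus_0_r. triang. lra.
      * replace (v0 s + be s * x s th - c) with ((v0 s - c) + be s * x s th) by ring. triang. lra.
    + intros s th th' Hs H1 H2. f_equal. f_equal. now apply (proj2 (nice_bdd _ _ _ (psi_nice _ _ _ Sl 0%nat))).
Qed.

(** The mixed derivative of [T], reached in both orders. *)
Definition tst : fn := fun s th =>
  (ald s * xt s th + al s * (- yt s th + nt s th)) * / Q s th - W s th * (2 * al s * xt s th) * (/ Q s th) ^ 2.
Lemma Ts_t : dT Ts tst.
Proof.
  intros s th Hs. pose proof (Q_ge s th Hs) as HQ. unfold Ts. eapply derive_eq;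
   [apply derive_plus; [apply derive_cst|apply derive_mult; [|apply derive_inv; [apply (Q_t), Hs|lra]]]|].
  - unfold W. apply derive_plus; apply derive_scal; [apply (psi_t _ _ _ Sl), Hs|].
    apply derive_plus; [apply derive_opp, (Y_t _ _ _ Sl), Hs|apply (N_t _ _ _ Sl), Hs].
  - unfold tst. fold al ald x xt y n yt nt. field. lra.
Qed.
Lemma Tt_s : dS Tt tst.
Proof.
  intros s th Hs. pose proof (Q_ge s th Hs) as HQ. unfold Tt. eapply derive_eq;
   [apply derive_mult; [apply derive_mult; [apply (p_al_der _ _ P), Hs|apply (psit_s _ _ _ Sl), Hs]|
     apply (derive_inv (fun s => Q s th)); [apply (Q_s), Hs|lra]]|].
  cbv beta. unfold tst. fold al ald x xt y n yt nt. field. lra.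
Qed.
Lemma Ex_s : dS Ex (fun s th => - Ts s th * Ex s th).
Proof.
  intros s th Hs. unfold Ex. derive. ring.
Qed.
Lemma Ex_t : dT Ex (fun s th => - Tt s th * Ex s th).
Proof.
  intros s th Hs. unfold Ex. derive. ring.
Qed.
Lemma Ex_sq s th : In1 s -> Ex s th ^ 2 * Q s th = exp s * exp s.
Proof.
  intros Hs. pose proof (Q_ge s th Hs) as HQ. rewrite <- (exp_ln (Q s th)) by lra. unfold Ex, T.
  replace (exp (- (- s + / 2 * ln (Q s th))) ^ 2) with (exp (- (- s + / 2 * ln (Q s th))) * exp (- (- s + / 2 * ln (Q s th)))) by ring.
  rewrite <- !exp_plus. f_equal. field.
Qed.

(** [Wn 1] contributes [pl / D], so [F0] is [exp (2 s) pl (hl gh + ghd)], the Laplacian of the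
    stream function; the factor [D] keeps [hl] bounded. *)
Definition f0 : fn := fun s _ => exp s * exp s * ((D s * hl s) * gh s + D s * ghd s).
Lemma f0_nice q : nice K q f0.
Proof.
  apply (snice_mul K (fun s => exp s * exp s)); [apply snice_mul; apply exp_snice|].
  apply snice_add; apply snice_mul; [apply dl_snice|apply p_gh_snice|apply snice_D|apply p_ghd_snice].
Qed.
Definition F0 : fn := Wn 1 f0.
Lemma F0_eq s th : In1 s -> F0 s th = exp s * exp s * (pl s * (hl s * gh s + ghd s)).
Proof. intros Hs. pose proof (D_pos s Hs). unfold F0, Wn, f0. field. lra. Qed.

(** The equation for [Y] is designed for this: by the two identities of the profile all terms
    recombine into [- Q + W], which is [Q T_s], times a function of [s] alone. *)
Lemma pde s th : In1 s ->
  hl s * (y s th - mu s * x s th - gh s) + ((- 2 * h s * y s th + xtt s th + 4 * x s th + h s * n s th - mt s th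
     + la * (- 2 * sc s * y s th + 2 * bb s * x s th + sc s * n s th)) - (mud s * x s th + mu s * (- y s th + n s th)) - ghd s)
   + (- xtt s th + mt s th) = (- Q s th + W s th) * (hl s * gh s + ghd s).
Proof.
  intros Hs. pose proof (p_ident2 _ _ P la s Hs) as I2. fold mu mud gh ghd h sc bb al ald in I2. fold (hl s) in I2.
  pose proof (mu_eq s Hs) as I1. unfold Q, W. fold al ald x y n.
  assert (E : 4 * x s th + la * (2 * bb s * x s th) = (hl s * mu s + (hl s * gh s + ghd s) * (ald s - 2 * al s) + mud s) * x s th) by (rewrite I2; ring).
  set (G := hl s * gh s + ghd s) in *.
  assert (E2 : mu s * (y s th - n s th) = (hl s - al s * G) * (y s th - n s th)) by (rewrite I1 at 1; ring).
  assert (E3 : h s = hl s - la * sc s) by (unfold hl; ring). rewrite E3. unfold G in *. lra.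
Qed.

Lemma good_unique cm cp G Gs Gt Gs' Gt' : good cm cp G Gs Gt -> dS G Gs' -> dT G Gt' ->
  forall s th, In1 s -> Gs s th = Gs' s th /\ Gt s th = Gt' s th.
Proof.
  intros [A [B _]] C E s th Hs. split.
  - rewrite <- (is_derive_unique _ _ _ (A s th Hs)). now apply is_derive_unique, C.
  - rewrite <- (is_derive_unique _ _ _ (B s th Hs)). now apply is_derive_unique, E.
Qed.

(** The Laplacian is [exp (-2 t) (u_tt + u_thth)]; in label variables [u_tt = (u_t)_s / T_s] and
    [u_thth = (u_th)_th - (T_th / T_s) (u_th)_s]. Differentiating [T_s nb = - psit + M] in [th]
    disposes of the angular derivative of [nb], and [exp (-2 T) Q = exp (2 s)] removes the
    dependence on [psi]. *)
Lemma lap X Z : exists l1 l2, is_derive (fun t => FF 0 0 (Wn 0 nU1) t Z) X l1 /\ is_derive (fun t => FF 0 0 (Wn 0 nU2) X t) Z l2 /\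
  l1 + l2 = FF 0 0 F0 X Z.
Proof.
  destruct (nU_nice 2) as [N1 N2].
  destruct (good_W 0 nU1 ltac:(lia) (Kle 2 2 _ ltac:(lia) N1)) as [a1 [a2 [_ [_ GU1]]]].
  destruct (good_W 0 nU2 ltac:(lia) (Kle 2 2 _ ltac:(lia) N2)) as [b1 [b2 [_ [_ GU2]]]].
  destruct (nice_s _ _ _ (Kle 1 1 _ ltac:(lia) (nb_nice 1))) as [nbs [Dbs _]].
  destruct (nice_t _ _ _ (Kle 1 1 _ ltac:(lia) (nb_nice 1))) as [nbt [Dbt _]].
  destruct (nice_t _ _ _ (Kle 1 1 _ ltac:(lia) (Tt_nice 1))) as [ttt [Dtt _]].
  set (ysn := fun s th => - 2 * h s * y s th + xtt s th + 4 * x s th + h s * n s th - mt s th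
     + la * (- 2 * sc s * y s th + 2 * bb s * x s th + sc s * n s th)).
  set (nas := fun s th => (ysn s th - (mud s * x s th + mu s * (- y s th + n s th)) - ghd s) + (tst s th * nb s th + Tt s th * (nbs s th / D s))).
  set (nat := fun s th => (yt s th - mu s * xt s th - 0) + (ttt s th * nb s th + Tt s th * nbt s th)).
  assert (Das : dS na nas).
  { intros s th Hs. apply derive_plus; [apply derive_minus; [apply derive_minus; [exact (Y_s _ _ _ Sl s th Hs)|
      exact (derive_mult mu (fun s => x s th) s _ _ (p_mu_der _ _ P s Hs) (psi_s _ _ _ Sl s th Hs))]|exact (p_gh_der _ _ P s Hs)]|].
    exact (derive_mult (fun s => Tt s th) (fun s => nb s th) s _ _ (Tt_s s th Hs) (Dbs s th Hs)). }
  assert (Dat : dT na nat).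
  { intros s th Hs. apply derive_plus; [apply derive_minus; [apply derive_minus; [exact (Y_t _ _ _ Sl s th Hs)|
      apply derive_scal; exact (psi_t _ _ _ Sl s th Hs)]|apply derive_cst]|].
    exact (derive_mult (Tt s) (nb s) th _ _ (Dtt s th Hs) (Dbt s th Hs)). }
  assert (Cb : forall s th, In1 s -> tst s th * nb s th + Ts s th * nbt s th = - xtt s th + mt s th).
  { intros s th Hs. assert (A : is_derive (fun th => Ts s th * nb s th) th (tst s th * nb s th + Ts s th * nbt s th))
      by (apply derive_mult; [exact (Ts_t s th Hs)|exact (Dbt s th Hs)]).
    assert (B : is_derive (fun th => Ts s th * nb s th) th (- xtt s th + mt s th)).
    { assert (Eb : forall t, - xt s t + m s t = Ts s t * nb s t).
      { intros t. pose proof (Ts_range s t Hs). unfold nb. field. lra. }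
      apply (is_derive_ext _ _ _ _ Eb).
      apply derive_plus; [apply derive_opp; exact (psit_t _ _ _ Sl s th Hs)|exact (M_t _ _ _ Sl s th Hs)]. }
    rewrite <- (is_derive_unique _ _ _ A). now apply is_derive_unique. }
  set (U1s := fun s th => pl s * (hl s * nU1 s th + (- Ts s th * nU1 s th + Ex s th * (cos th * nas s th - sin th * (nbs s th / D s))))).
  set (U2s := fun s th => pl s * (hl s * nU2 s th + (- Ts s th * nU2 s th + Ex s th * (sin th * nas s th + cos th * (nbs s th / D s))))).
  set (U1t := fun s th => pl s * (- Tt s th * nU1 s th + Ex s th * (- sin th * na s th + cos th * nat s th - cos th * nb s th - sin th * nbt s th))).
  set (U2t := fun s th => pl s * (- Tt s th * nU2 s th + Ex s th * (cos th * na s th + sin th * nat s th - sin th * nb s th + cos th * nbt s th))).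
  assert (W0 : forall g s t, pl s * g s t = Wn 0 g s t) by (intros; unfold Wn; simpl; ring).
  assert (E1s : dS (Wn 0 nU1) U1s).
  { intros s th Hs. apply (is_derive_ext _ _ _ _ (fun s => W0 nU1 s th)).
    eapply derive_eq; [apply derive_mult; [now apply pl_der|apply derive_mult; [exact (Ex_s s th Hs)|
      apply derive_minus; apply derive_scal; [exact (Das s th Hs)|exact (Dbs s th Hs)]]]|]. unfold U1s, nU1. ring. }
  assert (E2s : dS (Wn 0 nU2) U2s).
  { intros s th Hs. apply (is_derive_ext _ _ _ _ (fun s => W0 nU2 s th)).
    eapply derive_eq; [apply derive_mult; [now apply pl_der|apply derive_mult; [exact (Ex_s s th Hs)|
      apply derive_plus; apply derive_scal; [exact (Das s th Hs)|exact (Dbs s th Hs)]]]|]. unfold U2s, nU2. ring. }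
  assert (E1t : dT (Wn 0 nU1) U1t).
  { intros s th Hs. apply (is_derive_ext _ _ _ _ (W0 nU1 s)).
    eapply derive_eq; [apply derive_scal, derive_mult; [exact (Ex_t s th Hs)|
      apply derive_minus; apply derive_mult; [apply is_derive_cos|exact (Dat s th Hs)|apply is_derive_sin|exact (Dbt s th Hs)]]|]. unfold U1t, nU1. ring. }
  assert (E2t : dT (Wn 0 nU2) U2t).
  { intros s th Hs. apply (is_derive_ext _ _ _ _ (W0 nU2 s)).
    eapply derive_eq; [apply derive_scal, derive_mult; [exact (Ex_t s th Hs)|
      apply derive_plus; apply derive_mult; [apply is_derive_sin|exact (Dat s th Hs)|apply is_derive_cos|exact (Dbt s th Hs)]]|]. unfold U2t, nU2. ring. }
  eexists; eexists; split; [exact (proj1 (FF_partials _ _ _ _ _ GU1 X Z))|]. split; [exact (proj2 (FF_partials _ _ _ _ _ GU2 X Z))|].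
  rewrite <- (FF_op Rplus) by ring. apply FF_ext. intros s th Hs.
  destruct (good_unique _ _ _ _ _ _ _ GU2 E2s E2t s th Hs) as [q1 q2].
  unfold g1, g2. destruct (good_unique _ _ _ _ _ _ _ GU1 E1s E1t s th Hs) as [r1 r2]. rewrite r1, r2, q1, q2. clear q1 q2 r1 r2.
  rewrite F0_eq by auto. pose proof (Ts_range s th Hs) as HT. pose proof (Q_ge s th Hs) as HQ.
  pose proof (pde s th Hs) as HP. pose proof (Cb s th Hs) as HC. pose proof (Ex_sq s th Hs) as HE.
  assert (SC := sin2_cos2 th). unfold Rsqr in SC. fold (ysn s th) in HP.
  assert (HW : - Q s th + W s th = Q s th * Ts s th) by (unfold Ts; field; lra).
  transitivity (pl s * Ex s th ^ 2 * (hl s * (na s th - Tt s th * nb s th) + nas s th + Ts s th * nbt s th - Tt s th * (nbs s th / D s)) * / Ts s th * (sin th * sin th + cos th * cos th)).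
  - unfold U1s, U1t, U2s, U2t, nU1, nU2. generalize (nbs s th / D s). intros bs. field. lra.
  - rewrite SC. replace (hl s * (na s th - Tt s th * nb s th) + nas s th + Ts s th * nbt s th - Tt s th * (nbs s th / D s)) with
     (hl s * (y s th - mu s * x s th - gh s) + (ysn s th - (mud s * x s th + mu s * (- y s th + n s th)) - ghd s) + (tst s th * nb s th + Ts s th * nbt s th)) by (unfold na, nas; ring).
    rewrite HC, HP, HW, <- HE. field. lra.
Qed.

Lemma F0_bound : exists C, 0 <= C /\ forall s th, In1 s -> Rabs (F0 s th) <= C.
Proof.
  destruct (Wn_bound 1 f0 (nice_bdd _ _ _ (f0_nice 0))) as [C [C0 HC]]; [lia|]. exists C. split; auto. intros s th Hs.
  eapply Rle_trans; [now apply HC|]. destruct (D_pow (N - 1) s Hs ltac:(lia)) as [_ [_ A]]. pose proof (D_le s). nra.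
Qed.
(** Where [be = 0], the potential is a primitive in the label; where the Laplacian is -1, it is
    minus the stream function. In both cases it has the form [H0 - be psi]. *)
Lemma H_good : exists H0 cm cp, good cm cp (fun s th => H0 s + - (be s * x s th)) (fun s th => F0 s th * Vs s th) (fun s th => F0 s th * Vt s th).
Proof.
  destruct V_good as [v0 [cm [cp [V1 [V2 [V3 [V4 V5]]]]]]].
  destruct F0_bound as [Cf [Cf0 HCf]]. destruct pl_le as [Cp [Cp0 HCp]]. destruct (snice_bound _ _ (p_gh_snice _ _ P)) as [Cg [Cg0 HCg]].
  assert (key : forall s, In1 s -> (be s = 0 /\ bed s = 0) \/ (forall th, F0 s th = -1)).
  { intros s Hs. pose proof (mu_eq s Hs) as I1. destruct (p_ident3 _ _ P s Hs) as [[A B]|[A [B C]]]; [left|right].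
    - unfold be, bed. fold al gh in A. fold al ald gh ghd in B. split; [rewrite A; ring|].
      replace (mu s) with (hl s * (1 - al s * gh s) - al s * ghd s) by (rewrite I1; ring). rewrite A.
      replace (hl s * (1 - 1) - al s * ghd s - ald s * gh s) with (- (ald s * gh s + al s * ghd s)) by ring. rewrite B. ring.
    - intros th. rewrite F0_eq by auto. unfold pl, hl, sc. rewrite A, B, !Rmult_0_r, exp_0, Rplus_0_r, Rmult_1_r, <- Rmult_assoc, <- exp_plus.
      replace (s + s) with (2 * s) by ring. exact C. }
  destruct (antiderivative_flat (fun s => F0 s 0 * (gh s * pl s)) (Cf * (Cg * Cp))) as [H0 [c [B [B0 [HV HB]]]]].
  - intros s Hs. apply continuous_Rmult.
    + destruct (nice_s _ _ _ (Kle 1 1 _ ltac:(lia) (f0_nice 1))) as [fs [Fs _]]. eapply cont_of_derive. apply (Wn_s 1 f0 fs Fs s 0 Hs).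
    + apply continuous_Rmult; [|now apply pl_cont]. eapply cont_of_derive, p_gh_der, Hs.
  - intros s Hs. rewrite !Rabs_mult, !Rmult_assoc. pose proof (pl_pos s).
    apply Rmult_le_compat; auto using Rabs_pos; [apply Rmult_le_pos; apply Rabs_pos|]. apply Rmult_le_compat; auto using Rabs_pos.
    rewrite Rabs_right by lra. eapply Rle_trans; [now apply HCp|]. apply Rmult_le_compat_l; [lra|]. apply D_pow; auto; lia.
  - exists H0, 0, c. destruct be_x_flat as [Cw [Cw0 Hbe]]. split; [|split; [|split; [|split]]].
    + intros s th Hs. eapply derive_eq; [apply derive_plus; [now apply HV|apply derive_opp, derive_mult; [now apply be_der|apply psi_s, Hs]]|].
      unfold Vs. change (F0 s th) with (F0 s 0). destruct (key s Hs) as [[-> ->]|E]; [|rewrite E]; unfold x, y, n; ring.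
    + intros s th Hs. eapply derive_eq; [apply derive_plus; [apply derive_cst|apply derive_opp, derive_scal, psi_t, Hs]|].
      unfold Vt. destruct (key s Hs) as [[-> _]|E]; [|rewrite E]; unfold xt; ring.
    + apply jc_mul; auto. apply Wn_jc, Kle; [lia|]. apply f0_nice.
    + exists (B + Cw). split; [lra|]. intros s th Hs. destruct (HB s Hs) as [B1 B2]. destruct (Hbe s th Hs) as [E1 E2].
      rewrite !Rmult_plus_distr_r. split.
      * rewrite Rminus_0_r. triang. rewrite Rabs_Ropp. lra.
      * replace (H0 s + - (be s * x s th) - c) with ((H0 s - c) + - (be s * x s th)) by ring. triang. rewrite Rabs_Ropp. lra.
    + intros s th th' Hs H1 H2. f_equal. f_equal. f_equal. now apply (proj2 (nice_bdd _ _ _ (psi_nice _ _ _ Sl 0%nat))).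
Qed.

(** * The velocity field and its properties *)

Definition U1 := FF 0 0 (Wn 0 nU1).
Definition U2 := FF 0 0 (Wn 0 nU2).
Definition v2f : R -> R -> R := fun x1 x2 => - U1 x1 x2.

Lemma v2f_eq : v2f = FF 0 0 (Wn 0 (fun s th => - nU1 s th)).
Proof.
  extensionality a. extensionality b. unfold v2f, U1. rewrite <- (FF_op (fun u _ => - u) (Wn 0 nU1) (Wn 0 nU1)) by ring.
  apply FF_ext. intros s th Hs. unfold Wn. ring.
Qed.
Lemma U_Ck k : (k + 2 <= K)%nat -> (k + 2 <= N)%nat -> Ck k U1 /\ Ck k U2 /\ Ck k v2f.
Proof.
  intros HK HN. destruct (nU_nice (S (S k))) as [A B]. apply (Kle (S (S k))) in A, B; try lia.
  split; [|split]; [|clear A|rewrite v2f_eq; apply nice_opp in A]; apply CkW; auto.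
Qed.

Lemma stream_ex : exists u : R -> R -> R, forall x1 x2, is_derive (fun t => u t x2) x1 (U1 x1 x2) /\ is_derive (fun t => u x1 t) x2 (U2 x1 x2).
Proof.
  destruct V_good as [v0 [cm [cp GV]]].
  exists (FF cm cp (fun s th => v0 s + be s * psi _ _ _ Sl s th)). intros x1 x2.
  destruct (FF_partials _ _ _ _ _ GV x1 x2) as [A B]. split.
  - derive. apply FF_ext. intros s th Hs. now apply g_V.
  - derive. apply FF_ext. intros s th Hs. now apply g_V.
Qed.

(** Symmetry of the second derivatives of the stream function, whose gradient is of class C^1. *)
Lemma divergence_free x1 x2 : Derive (fun t => U2 t x2) x1 = Derive (fun t => U1 x1 t) x2.
Proof.
  destruct stream_ex as [u Hu]. destruct (U_Ck 1) as [[_ [E1 [_ C1]]] [[_ [E2 [C2 _]]] _]]; try lia.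
  assert (X1 : forall a b, Derive (fun t => u t b) a = U1 a b) by (intros a b; exact (is_derive_unique _ _ _ (proj1 (Hu a b)))).
  assert (X2 : forall a b, Derive (fun t => u a t) b = U2 a b) by (intros a b; exact (is_derive_unique _ _ _ (proj2 (Hu a b)))).
  assert (Y1 : forall a b, Derive (fun z => Derive (fun t => u t z) a) b = d2 U1 a b) by (intros; apply Derive_ext; intros; apply X1).
  assert (Y2 : forall a b, Derive (fun z => Derive (fun t => u z t) b) a = d1 U2 a b) by (intros; apply Derive_ext; intros; apply X2).
  transitivity (d1 U2 x1 x2); [reflexivity|]. transitivity (d2 U1 x1 x2); [|reflexivity]. rewrite <- Y1, <- Y2.
  apply Schwarz.
  - apply locally_2d_forall. intros a b. split; [exists (U1 a b); exact (proj1 (Hu a b))|]. split; [exists (U2 a b); exact (proj2 (Hu a b))|]. split.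
    + apply (ex_derive_ext (fun z => U2 z b)); [intros; symmetry; apply X2|]. exact (proj1 (E2 a b)).
    + apply (ex_derive_ext (fun z => U1 a z)); [intros; symmetry; apply X1|]. exact (proj2 (E1 a b)).
  - apply continuity_2d_pt_filterlim. rewrite Y2. eapply filterlim_ext; [|exact (C2 x1 x2)]. intros [a b]. simpl. symmetry. apply Y2.
  - apply continuity_2d_pt_filterlim. rewrite Y1. eapply filterlim_ext; [|exact (C1 x1 x2)]. intros [a b]. simpl. symmetry. apply Y1.
Qed.

Lemma pressure_part : exists H, cont2 H /\ forall x1 x2, is_derive (fun t => H t x2) x1 ((d1 U1 x1 x2 + d2 U2 x1 x2) * U1 x1 x2) /\
  is_derive (fun t => H x1 t) x2 ((d1 U1 x1 x2 + d2 U2 x1 x2) * U2 x1 x2).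
Proof.
  destruct H_good as [H0 [cm [cp GH]]].
  assert (LF : forall x1 x2, d1 U1 x1 x2 + d2 U2 x1 x2 = FF 0 0 (F0) x1 x2).
  { intros x1 x2. destruct (lap x1 x2) as [l1 [l2 [A [B C]]]]. rewrite <- C. f_equal; now apply is_derive_unique. }
  assert (HP : forall x1 x2, is_derive (fun t => FF cm cp (fun s th => H0 s + - (be s * psi _ _ _ Sl s th)) t x2) x1 (FF 0 0 (F0) x1 x2 * U1 x1 x2) /\
    is_derive (fun t => FF cm cp (fun s th => H0 s + - (be s * psi _ _ _ Sl s th)) x1 t) x2 (FF 0 0 (F0) x1 x2 * U2 x1 x2)).
  { intros x1 x2. destruct (FF_partials _ _ _ _ _ GH x1 x2) as [A B]. unfold U1, U2.
    rewrite <- (FF_op Rmult (F0) (Wn 0 nU1)), <- (FF_op Rmult (F0) (Wn 0 nU2)) by ring. split.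
    - derive. apply FF_ext. intros s th Hs. rewrite <- (proj1 (g_V s th Hs)). unfold g1. ring.
    - derive. apply FF_ext. intros s th Hs. rewrite <- (proj2 (g_V s th Hs)). unfold g2. ring. }
  exists (FF cm cp (fun s th => H0 s + - (be s * psi _ _ _ Sl s th))). split; [|intros x1 x2; rewrite LF; exact (HP x1 x2)].
  destruct F0_bound as [C0 [C00 HC0]]. destruct (nU_nice 0) as [A B].
  destruct (Wn_bound 0 nU1 (nice_bdd _ _ _ A)) as [C1 [C10 HC1]]; [lia|]. destruct (Wn_bound 0 nU2 (nice_bdd _ _ _ B)) as [C2 [C20 HC2]]; [lia|].
  assert (Dp : forall s, In1 s -> 0 <= D s ^ (N - 0) <= 1).
  { intros s Hs. pose proof (D_pos s Hs). pose proof (D_le s). split; [apply pow_le; lra|]. rewrite <- (pow1 (N - 0)). apply pow_incr. lra. }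
  eapply (cont2_of_bounded _ _ _ (C0 * (C1 + C2))); [intros x1 x2; exact (proj1 (HP x1 x2))|intros x1 x2; exact (proj2 (HP x1 x2))|]. intros x1 x2. cbv beta. rewrite !Rabs_mult.
  assert (Q0 : Rabs (FF 0 0 (F0) x1 x2) <= C0) by (apply FF_bound; auto).
  assert (Q1 : Rabs (U1 x1 x2) <= C1 + C2) by (apply FF_bound; [lra|]; intros s th Hs; eapply Rle_trans; [now apply HC1|]; specialize (Dp s Hs); nra).
  assert (Q2 : Rabs (U2 x1 x2) <= C1 + C2) by (apply FF_bound; [lra|]; intros s th Hs; eapply Rle_trans; [now apply HC2|]; specialize (Dp s Hs); nra).
  split; apply Rmult_le_compat; auto using Rabs_pos.
Qed.

(** For [v = (u_y, - u_x)] one has [v . grad v = grad (|v|^2 / 2) - (u_xx + u_yy) grad u], and the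
    last product is the gradient of [H]. *)
Lemma euler : stationary_euler U2 v2f.
Proof.
  destruct (U_Ck 1) as [[c1 [E1 [C11 C12]]] [[c2 [E2 [C21 C22]]] _]]; try lia.
  assert (F11 : forall x1 x2, is_derive (fun t => U1 t x2) x1 (d1 U1 x1 x2)) by (intros x1 x2; exact (Derive_correct _ _ (proj1 (E1 x1 x2)))).
  assert (F12 : forall x1 x2, is_derive (fun t => U1 x1 t) x2 (d2 U1 x1 x2)) by (intros x1 x2; exact (Derive_correct _ _ (proj2 (E1 x1 x2)))).
  assert (F21 : forall x1 x2, is_derive (fun t => U2 t x2) x1 (d1 U2 x1 x2)) by (intros x1 x2; exact (Derive_correct _ _ (proj1 (E2 x1 x2)))).
  assert (F22 : forall x1 x2, is_derive (fun t => U2 x1 t) x2 (d2 U2 x1 x2)) by (intros x1 x2; exact (Derive_correct _ _ (proj2 (E2 x1 x2)))).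
  assert (G1 : forall x1 x2, d1 v2f x1 x2 = - d1 U1 x1 x2) by (intros; apply is_derive_unique, derive_opp, F11).
  assert (G2 : forall x1 x2, d2 v2f x1 x2 = - d2 U1 x1 x2) by (intros; apply is_derive_unique, derive_opp, F12).
  split.
  - intros x1 x2. rewrite G2. assert (X := divergence_free x1 x2). unfold d1, d2. lra.
  - destruct pressure_part as [H [HC HD]].
    set (p := fun x1 x2 => - (1/2) * (U2 x1 x2 * U2 x1 x2 + U1 x1 x2 * U1 x1 x2) + H x1 x2).
    assert (P1 : forall x1 x2, is_derive (fun t => p t x2) x1 (- (U2 x1 x2 * d1 U2 x1 x2 + U1 x1 x2 * d1 U1 x1 x2) + (d1 U1 x1 x2 + d2 U2 x1 x2) * U1 x1 x2)).
    { intros x1 x2. eapply derive_eq; [apply derive_plus; [apply derive_scal, derive_plus; apply derive_mult; auto|exact (proj1 (HD x1 x2))]|]. cbv beta. field. }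
    assert (P2 : forall x1 x2, is_derive (fun t => p x1 t) x2 (- (U2 x1 x2 * d2 U2 x1 x2 + U1 x1 x2 * d2 U1 x1 x2) + (d1 U1 x1 x2 + d2 U2 x1 x2) * U2 x1 x2)).
    { intros x1 x2. eapply derive_eq; [apply derive_plus; [apply derive_scal, derive_plus; apply derive_mult; auto|exact (proj2 (HD x1 x2))]|]. cbv beta. field. }
    assert (D1 : d1 p = fun x1 x2 => -1 * (U2 x1 x2 * d1 U2 x1 x2 + U1 x1 x2 * d1 U1 x1 x2) + (d1 U1 x1 x2 + d2 U2 x1 x2) * U1 x1 x2).
    { extensionality x1. extensionality x2. rewrite (is_derive_unique _ _ _ (P1 x1 x2) : d1 p x1 x2 = _). ring. }
    assert (D2 : d2 p = fun x1 x2 => -1 * (U2 x1 x2 * d2 U2 x1 x2 + U1 x1 x2 * d2 U1 x1 x2) + (d1 U1 x1 x2 + d2 U2 x1 x2) * U2 x1 x2).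
    { extensionality x1. extensionality x2. rewrite (is_derive_unique _ _ _ (P2 x1 x2) : d2 p x1 x2 = _). ring. }
    exists p. split.
    + split; [|split; [|split]].
      * unfold p. apply cont2_plus; auto. apply cont2_mult; [apply cont2_const|]. apply cont2_plus; apply cont2_mult; auto.
      * intros x1 x2. split; eexists; [apply P1|apply P2].
      * rewrite D1. simpl. apply cont2_plus; [apply cont2_mult; [apply cont2_const|]; apply cont2_plus; apply cont2_mult; auto|].
        apply cont2_mult; auto. apply cont2_plus; auto.
      * rewrite D2. simpl. apply cont2_plus; [apply cont2_mult; [apply cont2_const|]; apply cont2_plus; apply cont2_mult; auto|].
        apply cont2_mult; auto. apply cont2_plus; auto.
    + intros x1 x2. rewrite G1, G2, D1, D2. unfold v2f. split; ring.
Qed.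

Lemma compact_support : compactly_supported U2 v2f.
Proof.
  destruct far_away as [M [M0 HM]]. exists (M + 1). intros x1 x2 H. assert (M < x1 ^ 2 + x2 ^ 2) by nra.
  unfold v2f, U1, U2. rewrite !HM by auto. split; ring.
Qed.

Lemma nonradial : ~ locally_radial U2 v2f.
Proof.
  intros [f [Hf [used [isd [A [B [r [Rad [_ [Hdisj [Hcov Hrad]]]]]]]]]]].
  set (s0 := -(9/20)). assert (Hs : In1 s0) by (unfold In1, s0; lra).
  set (X := fun th => exp (T s0 th) * cos th). set (Z := fun th => exp (T s0 th) * sin th).
  destruct (nU_nice 0) as [nA nB]. pose proof (pl_pos s0) as Pp.
  assert (V1 : forall th, U1 (X th) (Z th) = pl s0 * Ex s0 th * (cos th * na s0 th - sin th * nb s0 th)).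
  { intros th. unfold U1, X, Z. rewrite FF_at; auto; [unfold Wn, nU1; ring|]. apply Wn_per. now apply (nice_bdd K 0). }
  assert (V2 : forall th, U2 (X th) (Z th) = pl s0 * Ex s0 th * (sin th * na s0 th + cos th * nb s0 th)).
  { intros th. unfold U2, X, Z. rewrite FF_at; auto; [unfold Wn, nU2; ring|]. apply Wn_per. now apply (nice_bdd K 0). }
  assert (Pe : forall th, 0 < pl s0 * Ex s0 th) by (intros; apply Rmult_lt_0_compat; auto; apply exp_pos).
  destruct (p_ident4 _ _ P s0) as [I1 [I2 I3]]; [unfold s0; lra|]. fold al ald gh ghd in I1, I2, I3.
  (* At [s0] both [be] and its derivative vanish, so the velocity is tangent to the curve [s = s0]
     and has no zero on it. *)
  assert (Vid : forall th, nb s0 th + na s0 th * Tt s0 th = 0 /\ na s0 th <> 0).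
  { intros th. destruct (V_ident s0 th Hs) as [W1 W2]. assert (Eb : be s0 = 0) by (unfold be; rewrite I1; ring).
    assert (Ebd : bed s0 = 0).
    { unfold bed. rewrite (mu_eq s0 Hs). replace (hl s0 - al s0 * (hl s0 * gh s0 + ghd s0) - ald s0 * gh s0)
       with (hl s0 * (1 - al s0 * gh s0) - (ald s0 * gh s0 + al s0 * ghd s0)) by ring.
      rewrite I1, I2. ring. }
    unfold Vt in W1. unfold Vs in W2. rewrite Eb in W1, W2. rewrite Ebd in W2. split.
    - apply (Rmult_eq_reg_l (pl s0)); lra.
    - intros E. rewrite E in W2. assert (gh s0 * pl s0 = 0) by lra.
      apply Rmult_integral in H. destruct H; [auto|lra]. }
  assert (sq : forall th, sin th * sin th + cos th * cos th = 1) by (intros th; apply (sin2_cos2 th)).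
  assert (Cov : forall th, exists i, used i /\ region (isd i) (A i) (B i) (r i) (Rad i) (X th) (Z th)).
  { intros th. apply Hcov. destruct (Vid th) as [_ Nz]. specialize (Pe th).
    destruct (Req_dec (U2 (X th) (Z th)) 0) as [e|e]; auto. right. intros e2. unfold v2f in e2. apply Nz.
    rewrite V2 in e. rewrite V1 in e2. apply Rmult_integral in e. destruct e as [e|e]; [lra|].
    assert (e3 : pl s0 * Ex s0 th * (cos th * na s0 th - sin th * nb s0 th) = 0) by lra. apply Rmult_integral in e3. destruct e3 as [e3|e3]; [lra|].
    replace (na s0 th) with ((sin th * sin th + cos th * cos th) * na s0 th) by (rewrite sq; ring).
    transitivity (sin th * (sin th * na s0 th + cos th * nb s0 th) + cos th * (cos th * na s0 th - sin th * nb s0 th)); [ring|]. rewrite e, e3. ring. }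
  set (idx := fun th => proj1_sig (constructive_indefinite_description _ (Cov th))).
  assert (Hidx : forall th, used (idx th) /\ region (isd (idx th)) (A (idx th)) (B (idx th)) (r (idx th)) (Rad (idx th)) (X th) (Z th)).
  { intros th. unfold idx. now destruct (constructive_indefinite_description _ (Cov th)). }
  clearbody idx. assert (cX : forall th, continuous X th /\ continuous Z th).
  { intros th. assert (cT : continuous (fun th => exp (T s0 th)) th).
    { eapply cont_of_derive. apply (derive_comp exp (T s0)); [apply derive_exp|]. apply (T_t s0 th Hs). }
    split; apply continuous_Rmult; auto; [eapply cont_of_derive, is_derive_cos|eapply cont_of_derive, is_derive_sin]. }
  (* The regions are open and disjoint, so the index of the region met by the curve is locally
     constant along it. *)
  assert (Lc : forall th, idx th = idx 0).
  { apply locally_constant. intros th. destruct (Hidx th) as [Hu Hreg]. set (i := idx th) in *.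
    assert (cd : continuous (fun t => dist2 (A i) (B i) (X t) (Z t)) th).
    { unfold dist2. destruct (cX th) as [cx cz]. apply (continuous_comp (fun t => (X t - A i) ^ 2 + (Z t - B i) ^ 2) sqrt); [|apply continuous_sqrt].
      simpl. apply continuous_Rplus; (apply continuous_Rmult; [|apply continuous_Rmult; [|apply continuous_const]]);
        apply continuous_Rminus; auto; apply continuous_const. }
    assert (Lr : locally th (fun t => region (isd i) (A i) (B i) (r i) (Rad i) (X t) (Z t))).
    { unfold region in *. destruct (isd i).
      - apply (cd (fun q => q < Rad i)). assert (Hp : 0 < Rad i - dist2 (A i) (B i) (X th) (Z th)) by lra. exists (mkposreal _ Hp). intros q Hq.
        change (Rabs (q - dist2 (A i) (B i) (X th) (Z th)) < Rad i - dist2 (A i) (B i) (X th) (Z th)) in Hq. apply Rabs_def2 in Hq. lra.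
      - apply (cd (fun q => r i < q < Rad i)). apply (locally_itv (r i) (Rad i)). exact Hreg. }
    eapply filter_imp; [|exact Lr]. intros t Ht. destruct (Nat.eq_dec (idx t) i) as [e|e]; auto. exfalso.
    destruct (Hidx t) as [Ht1 Ht2]. exact (Hdisj _ _ _ _ Ht1 Hu e Ht2 Ht). }
  set (i := idx 0) in *. destruct (U_Ck 1) as [_ [_ [cv2 _]]]; try lia.
  assert (Tan : forall th, (X th - A i) * U2 (X th) (Z th) + (Z th - B i) * v2f (X th) (Z th) = 0).
  { intros th. destruct (Hidx th) as [Hu Hreg]. rewrite Lc in Hu, Hreg.
    apply (radial_tangent f U2 v2f (isd i) (A i) (B i) (r i) (Rad i)); auto.
    - intros a b. destruct (Hf a b) as [ea [_ [_ eb]]]. eapply derive_eq; [apply Derive_correct, ea|]. rewrite eb. symmetry. apply Ropp_involutive.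
    - intros a b. destruct (Hf a b) as [_ [ea [eb _]]]. eapply derive_eq; [apply Derive_correct, ea|]. rewrite eb. reflexivity.
    - intros a b a' b'. now apply Hrad. }
  assert (nb0 : forall th, psit _ _ _ Sl s0 th = 0 -> nb s0 th = 0).
  { intros th E. destruct (Vid th) as [e _]. unfold Tt, xt in e. rewrite E in e. lra. }
  (* On each axis the velocity is perpendicular to that axis, so tangency puts the centre of the
     region on both axes. *)
  destruct (psit_axes _ _ _ Sl s0) as [ax1 ax2]. assert (HB : B i = 0).
  { assert (E := Tan 0). unfold v2f in E. rewrite V1, V2 in E. unfold Z in E. rewrite (nb0 0 ax1), sin_0, cos_0 in E.
    assert (Q : B i * (pl s0 * Ex s0 0 * na s0 0) = 0) by lra. apply Rmult_integral in Q. destruct Q as [Q|Q]; auto.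
    apply Rmult_integral in Q. specialize (Pe 0). destruct (Vid 0). destruct Q; [lra|easy]. }
  assert (HA : A i = 0).
  { assert (E := Tan (PI/2)). unfold v2f in E. rewrite V1, V2 in E. unfold X in E. rewrite (nb0 (PI/2) ax2), sin_PI2, cos_PI2 in E.
    assert (Q : A i * (pl s0 * Ex s0 (PI/2) * na s0 (PI/2)) = 0) by lra. apply Rmult_integral in Q. destruct Q as [Q|Q]; auto.
    apply Rmult_integral in Q. specialize (Pe (PI/2)). destruct (Vid (PI/2)). destruct Q; [lra|easy]. }
  (* With the centre at the origin the velocity has no radial component: [nb = 0], then [T_th = 0]
     as [na] is nonzero, and finally [psit = 0] as [al] is nonzero at [s0]. *)
  assert (Zt : forall th, psit _ _ _ Sl s0 th = 0).
  { intros th. assert (E := Tan th). unfold v2f in E. rewrite V1, V2, HA, HB in E. unfold X, Z in E.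
    assert (Q0 : exp (T s0 th) * (pl s0 * Ex s0 th) * nb s0 th = 0).
    { replace (nb s0 th) with ((sin th * sin th + cos th * cos th) * nb s0 th) by (rewrite sq; ring). lra. }
    apply Rmult_integral in Q0. specialize (Pe th). pose proof (exp_pos (T s0 th)).
    destruct Q0 as [Q0|Q0]; [apply Rmult_integral in Q0; lra|]. destruct (Vid th) as [e1 e2]. rewrite Q0, Rplus_0_l in e1.
    apply Rmult_integral in e1. destruct e1 as [e1|e1]; [easy|]. unfold Tt in e1. pose proof (Q_ge s0 th Hs) as HQ.
    apply Rmult_integral in e1. destruct e1 as [e1|e1].
    - apply Rmult_integral in e1. destruct e1 as [e1|e1]; auto. rewrite e1 in I1. lra.
    - assert (/ Q s0 th <> 0) by (apply Rinv_neq_0_compat; lra). easy. }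
  apply (psi_nonconst _ _ _ Sl). fold s0. pose proof PI_RGT_0 as Hpi.
  destruct (mvt (psi _ _ _ Sl s0) (fun th => psit _ _ _ Sl s0 th) 0 (PI / 2)) as [c [_ E]]; [lra|intros t _; apply (psi_t _ _ _ Sl s0 t Hs)|].
  rewrite Zt in E. lra.
Qed.
End Flow.

Theorem theorem1p1 : forall k : nat, (1 <= k)%nat ->
  exists v1 v2 : R -> R -> R,
    vCk k v1 v2 /\ compactly_supported v1 v2 /\ stationary_euler v1 v2 /\
    ~ locally_radial v1 v2.
Proof.
  intros k Hk. destruct (solution_exists (k + 3) (k + 3)) as [P [Sl]]; try lia.
  exists (U2 _ _ P Sl), (v2f _ _ P Sl). split; [|split; [|split]].
  - split; apply U_Ck; lia.
  - apply compact_support.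
  - apply euler; lia.
  - apply nonradial; lia.
Qed.
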